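(* Let $k,n\ge1$ be integers, let $B^H$ be a fractional Brownian $(k,n)$-field with Hurst index $0<H<1$ over a probability space $(\Omega,\mathcal{F},\mathbb{P})$, and let $\varphi:[0,1]^k\to\mathbb{R}^n$ be a bounded Borel function. (i) If $\alpha>0$, $n-\frac{k}{H}<\alpha<n$ and $0<\gamma<H$, then there is some $\Omega_1\in\mathcal{F}$ with $\mathbb{P}(\Omega_1)=1$ such that for any $\omega\in\Omega_1$ we have $B^H(\cdot,\omega)\in\mathcal{C}_0^\gamma([0,1]^k,\mathbb{R}^n)$ and $G^\alpha\mu_{B^H(\cdot,\omega)+\varphi}\in C(\mathbb{R}^n)$. For any such $\omega$ the potential $G^\alpha\mu_{B^H(\cdot,\omega)+\varphi}$ is bounded on $\mathbb{R}^n$, and the same is true for $U^\alpha\mu_{B^H(\cdot,\omega)+\varphi}$. (ii) If $n<\frac{k}{H}$ and $0<\gamma<H$, then there is an event $\Omega_1\in\mathcal{F}$ with $\mathbb{P}(\Omega_1)=1$ such that for any $\omega\in\Omega_1$ we have $B^H(\cdot,\omega)\in\mathcal{C}_0^\gamma([0,1]^k,\mathbb{R}^n)$ and the function $B^H(\cdot,\omega)+\varphi$ has local times $L_{B^H(\cdot,\omega)+\varphi}\in C(\mathbb{R}^n)$. In particular, $L_{B^H(\cdot,\omega)+\varphi}$ is locally bounded for any such $\omega$.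
   Context: A fractional Brownian $(k,1)$-field $b^H$ with Hurst index $H\in(0,1)$ is a centered Gaussian random field $b^H:[0,+\infty)^k\times\Omega\to\mathbb{R}$ with $b^H(0)=0$ $\mathbb{P}$-a.s. and $\mathbb{E}|b^H(t)-b^H(s)|^2=|t-s|^{2H}$ for $s,t\in[0,+\infty)^k$. A fractional Brownian $(k,n)$-field is $B^H=(b^H_1,\dots,b^H_n)$ with $b_1^H,\dots,b_n^H$ independent copies of $b^H$; it is taken to be a modification with continuous paths. $\mathcal{C}_0^\gamma([0,1]^k,\mathbb{R}^n)$ is the space of functions $X:[0,1]^k\to\mathbb{R}^n$ with $X(0)=0$ and $\sup_{s\ne t}\frac{|X(t)-X(s)|}{|t-s|^\gamma}<+\infty$; statements about $B^H(\cdot,\omega)$ refer to its restriction to $[0,1]^k$. The occupation measure of a Borel function $X:[0,1]^k\to\mathbb{R}^n$ is $\mu_X(B)=\mathcal{L}^k(\{t\in[0,1]^k:X(t)\in B\})$, $B\subset\mathbb{R}^n$ Borel, where $\mathcal{L}^k$ is $k$-dimensional Lebesgue measure. If $\mu_X$ is absolutely continuous with respect to $\mathcal{L}^n$, its density $L_X=\frac{d\mu_X}{d\mathcal{L}^n}$ is called the local time of $X$. For $0<\alpha<n$ the Riesz potential is $U^\alpha\mu(x)=\int_{\mathbb{R}^n}|x-y|^{\alpha-n}\mu(dy)$. The Bessel kernel $g_\alpha$ of order $\alpha>0$ is determined by $\hat g_\alpha(\xi)=(1+|\xi|^2)^{-\alpha/2}$, with the Fourier transform convention $\hat\mu(\xi)=\int_{\mathbb{R}^n}e^{i\langle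 x,\xi\rangle}\mu(dx)$, and the Bessel potential is $G^\alpha\mu(x)=\int_{\mathbb{R}^n}g_\alpha(x-y)\mu(dy)$. $C(\mathbb{R}^n)$ is the space of continuous functions on $\mathbb{R}^n$. *)

(* Defs.v *)
From HB Require Import structures.
From mathcomp Require Import all_boot all_order all_algebra.
From mathcomp Require Import all_classical all_reals all_analysis.
From mathcomp Require Import measurable_realfun complex.

Set Implicit Arguments.
Unset Strict Implicit.
Unset Printing Implicit Defensive.

Import Order.TTheory GRing.Theory Num.Theory.
Import numFieldNormedType.Exports.

Local Open Scope classical_set_scope.
Local Open Scope ring_scope.

(* Points of R^n are row vectors 'rV[R]_n. The library equips them with the sup
   norm and hence with the usual topology, but with no sigma-algebra: the
   instance below makes them a Borel space. Distances are Euclidean and use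
   [enorm], not the library norm. *)

Section borel_rV.
Context {R : realType} (n : nat).

Let borel_rV : set (set 'rV[R]_n) := <<s (@open 'rV[R]_n) >>.

Let borel_rV0 : borel_rV set0.
Proof. exact: sigma_algebra0. Qed.

Let borel_rVC A : borel_rV A -> borel_rV (~` A).
Proof. exact: sigma_algebraC. Qed.

Let borel_rV_bigcup (F : (set 'rV[R]_n)^nat) :
  (forall i, borel_rV (F i)) -> borel_rV (\bigcup_i (F i)).
Proof. exact: sigma_algebra_bigcup. Qed.

HB.instance Definition _ := @isMeasurable.Build
  (sigma_display (@open 'rV[R]_n)) 'rV[R]_n
  borel_rV borel_rV0 borel_rVC borel_rV_bigcup.

Lemma open_measurable_rV (U : set 'rV[R]_n) : open U -> measurable U.
Proof. by move=> oU; exact: sub_sigma_algebra. Qed.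

Lemma measurable_coord_rV (i : 'I_n) :
  measurable_fun [set: 'rV[R]_n] (fun v : 'rV[R]_n => v ord0 i).
Proof.
apply: (measurability _ (RGenOInfty.measurableE R)).
move=> _ [_ [a ->] <-]; rewrite setTI; apply: open_measurable_rV.
by apply: open_comp; [move=> v _; exact: coord_continuous|exact: interval_open].
Qed.

Lemma measurable_fun_rV d (T : measurableType d) (f : T -> 'rV[R]_n) :
  (forall i, measurable_fun [set: T] (fun t => f t ord0 i)) ->
  measurable_fun [set: T] f.
Proof.
move=> mf; apply: (@measurability _ _ _ _ _ f (@open 'rV[R]_n) erefl) => _ [U oU <-].
rewrite setTI.
pose box (c : 'rV[rat]_n * rat) : set 'rV[R]_n :=
  [set v | forall i, `|ratr (c.1 ord0 i) - v ord0 i| < ratr c.2].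
have -> : f @^-1` U =
    \bigcup_(c in [set c | box c `<=` U]) (f @^-1` box c).
  apply/seteqP; split=> [t Ut|t [c cU ct]]; last exact: cU.
  have /nbhs_ballP[e /= e0 eU] : nbhs (f t) U by exact: open_nbhs_nbhs.
  have [r] := @rat_in_itvoo R 0 (e / 2) ltac:(by rewrite divr_gt0).
  rewrite in_itv/= => /andP[r0 re].
  have qE i : {q : rat | `|ratr q - f t ord0 i| < ratr r :> R}.
    apply: cid.
    have [|q] := @rat_in_itvoo R (f t ord0 i - ratr r) (f t ord0 i + ratr r).
      by rewrite ltrD2l gtrN.
    by rewrite in_itv/= => ?; exists q; rewrite ltr_distl.
  exists (\row_i sval (qE i), r) => [v /= bv|i /=]; last first.
    by rewrite mxE; case: (qE i).
  apply: eU; split=> // i j; rewrite ord1 /ball/=.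
  have := bv j; rewrite mxE; case: (qE j) => q /= qj bj.
  rewrite -(subrK (ratr q) (f t ord0 j)) -addrA (splitr e).
  rewrite (le_lt_trans (ler_normD _ _))// ltrD ?(lt_trans bj)//.
  by rewrite distrC (lt_trans qj).
rewrite bigcup_mkcond; apply: countable_bigcupT_measurable => [|c].
  exact: countableP.
case: ifPn => // _.
rewrite [X in measurable X](_ : _ =
    \bigcap_(i in [set: 'I_n]) ((fun t => f t ord0 i) @^-1`
      [set x | `|ratr (c.1 ord0 i) - x| < ratr c.2])); last first.
  by apply/seteqP; split=> [t bt i _|t bt i]; exact: bt.
apply: fin_bigcap_measurable => // i _.
rewrite -[X in measurable X]setTI; apply: mf => //.
apply: open_measurable; rewrite (_ : mkset _ = ball (ratr (c.1 ord0 i) : R) (ratr c.2))//.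
exact: ball_open.
Qed.

End borel_rV.

Section cons_rV.
Context {R : realType} (n : nat).

Definition cons_rV (xv : R * 'rV[R]_n) : 'rV[R]_n.+1 :=
  row_mx (const_mx xv.1 : 'rV[R]_1) xv.2.

Definition uncons_rV (v : 'rV[R]_n.+1) : R * 'rV[R]_n :=
  (v ord0 ord0, @rsubmx R 1 1 n v).

Lemma cons_rV0 x v : cons_rV (x, v) ord0 ord0 = x.
Proof.
rewrite [LHS](_ : _ = row_mx (const_mx x : 'rV[R]_1) v ord0 (lshift n ord0)).
  by rewrite row_mxEl mxE.
by congr (row_mx _ _ _ _); exact: val_inj.
Qed.

Lemma cons_rVS x v i : cons_rV (x, v) ord0 (lift ord0 i) = v ord0 i.
Proof.
rewrite [LHS](_ : _ = row_mx (const_mx x : 'rV[R]_1) v ord0 (rshift 1 i)).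
  by rewrite row_mxEr.
by congr (row_mx _ _ _ _); exact: val_inj.
Qed.

Lemma cons_rVK : cancel cons_rV uncons_rV.
Proof.
by move=> [x v]; rewrite /uncons_rV cons_rV0 /cons_rV row_mxKr.
Qed.

Lemma measurable_cons_rV : measurable_fun [set: R * 'rV[R]_n] cons_rV.
Proof.
apply: measurable_fun_rV => i; have [j ->|->] := unliftP ord0 i.
- rewrite (_ : (fun _ => _) = (fun v : 'rV[R]_n => v ord0 j) \o snd).
    by apply: measurableT_comp => //; exact: measurable_coord_rV.
  by apply/funext => -[x v]; exact: cons_rVS.
- rewrite (_ : (fun _ => _) = fst)//.
  by apply/funext => -[x v]; exact: cons_rV0.
Qed.

Lemma measurable_uncons_rV : measurable_fun [set: 'rV[R]_n.+1] uncons_rV.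
Proof.
apply: measurable_fun_pair; first exact: measurable_coord_rV.
apply: measurable_fun_rV => i.
rewrite (_ : (fun _ => _) = (fun v : 'rV[R]_n.+1 => v ord0 (rshift 1 i))).
  exact: measurable_coord_rV.
by apply/funext => v; rewrite mxE.
Qed.

End cons_rV.

Section lebesgue_rV_step.
Context {R : realType} (n : nat).
Variable mu : {sigma_finite_measure set 'rV[R]_n -> \bar R}.
Local Open Scope ereal_scope.

Definition lebesgue_cons := pushforward (lebesgue_measure \x mu) (@cons_rV R n).

HB.instance Definition _ := isMeasure.Build _ _ _ lebesgue_cons
  (measure0 (measure_function_pushforward__canonical__measure_function_Measure
     (lebesgue_measure \x mu) (@measurable_cons_rV R n)))
  (measure_ge0 (measure_function_pushforward__canonical__measure_function_Measure
     (lebesgue_measure \x mu) (@measurable_cons_rV R n)))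
  (@measure_semi_sigma_additive _ _ _
    (measure_function_pushforward__canonical__measure_function_Measure
     (lebesgue_measure \x mu) (@measurable_cons_rV R n))).

Let sigma_finite_lebesgue_cons : sigma_finite setT lebesgue_cons.
Proof.
have [F FT Foo] : sigma_finite setT (lebesgue_measure \x mu).
  have /sigma_finiteP[F [TF ndF Foo]] := sigma_finiteT (@lebesgue_measure R).
  have /sigma_finiteP[G [TG ndG Goo]] := sigma_finiteT mu.
  exists (fun k => F k `*` G k) => [|k].
    rewrite -setXTT TF TG; apply/seteqP; split=> -[x y] /=.
      move=> [[i _ Fix] [j _ Gjy]]; exists (maxn i j) => //; split.
        by move: x Fix; exact/subsetPset/ndF/leq_maxl.
      by move: y Gjy; exact/subsetPset/ndG/leq_maxr.
    by move=> [i _ []/= ? ?]; split; exists i.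
  have [? ?] := Foo k; have [? ?] := Goo k.
  split; first exact: measurableX.
  by rewrite product_measure1E// lte_mul_pinfty// ge0_fin_numE.
exists (fun k => @uncons_rV R n @^-1` F k) => [|k].
  by rewrite -preimage_bigcup -FT preimage_setT.
have [mFk Fkoo] := Foo k; split.
  by rewrite -[X in measurable X]setTI; exact: measurable_uncons_rV.
rewrite /lebesgue_cons /pushforward -comp_preimage.
by rewrite (_ : _ \o _ = id) ?preimage_id//; apply/funext; exact: cons_rVK.
Qed.

HB.instance Definition _ := Measure_isSigmaFinite.Build _ _ _ lebesgue_cons
  sigma_finite_lebesgue_cons.

End lebesgue_rV_step.

Section lebesgue_rV.
Context {R : realType}.
Local Open Scope ereal_scope.

(* n-dimensional Lebesgue measure as an iterated product measure (see
   [lebesgue_rV_box]); on the one-point space R^0 it is the unit mass. *)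
Fixpoint lebesgue_rV (n : nat) : {sigma_finite_measure set 'rV[R]_n -> \bar R} :=
  match n with
  | 0%N => \d_(0%R : 'rV[R]_0)
  | m.+1 => lebesgue_cons (lebesgue_rV m)
  end.

Lemma lebesgue_rV_box n (a b : 'I_n -> R) : (forall i, a i <= b i)%R ->
  lebesgue_rV n [set v | forall i, (a i <= v ord0 i <= b i)%R] =
  (\prod_(i < n) (b i - a i))%:E.
Proof.
elim: n a b => [|n IHn] a b ab.
  by rewrite big_ord0 /= diracE mem_set// => -[].
pose box := [set v : 'rV[R]_n |
  forall i : 'I_n, (a (lift ord0 i) <= v ord0 i <= b (lift ord0 i))%R].
have mbox : measurable box.
  rewrite (_ : box = \bigcap_(i in [set: 'I_n]) ((fun v : 'rV[R]_n => v ord0 i)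
      @^-1` `[a (lift ord0 i), b (lift ord0 i)])).
    apply: fin_bigcap_measurable => // i _.
    by rewrite -[X in measurable X]setTI; exact: measurable_coord_rV.
  apply/seteqP; split=> v /= h i; first by move=> _; rewrite /= in_itv/=; exact: h.
  by have := h i I; rewrite /= in_itv.
transitivity ((lebesgue_measure \x lebesgue_rV n) (`[a ord0, b ord0] `*` box)).
  congr (_ \x _); apply/seteqP; split=> -[x v].
    move=> /= h; split=> [|i /=]; last by have := h (lift ord0 i); rewrite cons_rVS.
    by have := h ord0; rewrite cons_rV0 in_itv.
  rewrite /= in_itv/= => -[x01 bv] i; have [j ->|->] := unliftP ord0 i.
    by rewrite cons_rVS; exact: bv.
  by rewrite cons_rV0.
rewrite product_measure1E//.
rewrite [X in X * _](lebesgue_measure_itv `[a ord0, b ord0])/= lte_fin IHn//.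
rewrite big_ord_recl EFinM; congr (_ * _).
by case: ltgtP (ab ord0) => // ->; rewrite subrr.
Qed.

End lebesgue_rV.

Section euclidean.
Context {R : realType}.

Definition dot n (x y : 'rV[R]_n) : R := \sum_(i < n) x ord0 i * y ord0 i.

Definition enorm n (x : 'rV[R]_n) : R := Num.sqrt (dot x x).

Definition orthant k : set 'rV[R]_k := [set t | forall i, 0 <= t ord0 i].

Definition cube k : set 'rV[R]_k := [set t | forall i, 0 <= t ord0 i <= 1].

(* X \in C_0^gamma([0,1]^k, R^n); only the values of X on the cube matter. *)
Definition holder0 k n (gamma : R) (X : 'rV[R]_k -> 'rV[R]_n) : Prop :=
  X 0 = 0 /\
  (ereal_sup [set r | exists s t, [/\ cube s, cube t, s != t &
     r = (enorm (X t - X s) / enorm (t - s) `^ gamma)%:E]] < +oo)%E.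

Definition bounded_borel k n (phi : 'rV[R]_k -> 'rV[R]_n) : Prop :=
  measurable_fun (@cube k) phi /\
  exists M : R, forall t, cube t -> enorm (phi t) <= M.

End euclidean.

Section fractional_brownian_field.
Context d (T : measurableType d) {R : realType} (P : probability T R).

(* Gaussian laws may be degenerate. The case s = 0 is separate because
   [normal_prob m 0] is the uniform law on [0, 1]. *)
Definition gaussian_law (m s : R) : set R -> \bar R :=
  if s == 0 then \d_m else normal_prob m s.

Definition gaussian_rv (X : T -> R) : Prop :=
  measurable_fun [set: T] X /\
  exists m s : R, forall A : set R, measurable A ->
    P (X @^-1` A) = gaussian_law m s A.

Definition centered_gaussian_field k (D : set 'rV[R]_k)
    (b : 'rV[R]_k -> T -> R) : Prop :=
  [/\ forall t, D t -> measurable_fun [set: T] (b t),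
      forall m (t : 'I_m -> 'rV[R]_k) (a : 'I_m -> R), (forall j, D (t j)) ->
        gaussian_rv (fun w => \sum_(j < m) a j * b (t j) w) &
      forall t, D t -> ('E_P[b t] = 0)%E].

(* Fractional Brownian (k,1)-field; b is indexed by all of R^k but is only
   constrained on [0, +oo[^k. *)
Definition fbm_field1 k (H : R) (b : 'rV[R]_k -> T -> R) : Prop :=
  [/\ centered_gaussian_field (@orthant R k) b,
      {ae P, forall w, b 0 w = 0} &
      forall s t, orthant s -> orthant t ->
        ('E_P[fun w => (`|b t w - b s w| ^+ 2)%R] =
          (enorm (t - s) `^ (2 * H))%:E)%E].

Definition field_sigma k (D : set 'rV[R]_k) (b : 'rV[R]_k -> T -> R) :
    set (set T) :=
  <<s \bigcup_(t in D) preimage_set_system [set: T] (b t) measurable >>.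

(* Subfamilies are covered by taking E i = setT for the missing indices. *)
Definition independent_fields k n (D : set 'rV[R]_k)
    (b : 'I_n -> 'rV[R]_k -> T -> R) : Prop :=
  forall E : 'I_n -> set T, (forall i, field_sigma D (b i) (E i)) ->
    (P (\bigcap_(i in [set: 'I_n]) E i) = \prod_(i < n) P (E i))%E.

(* The components have the same law since the law of a fractional Brownian
   (k,1)-field is determined by H. *)
Definition fbm_field k n (H : R) (B : 'rV[R]_k -> T -> 'rV[R]_n) : Prop :=
  [/\ forall i : 'I_n, fbm_field1 H (fun t w => B t w ord0 i),
      independent_fields (@orthant R k) (fun i t w => B t w ord0 i) &
      forall w, {within @orthant R k, continuous (B ^~ w)}].

End fractional_brownian_field.

Section occupation.
Context {R : realType}.
Local Open Scope ereal_scope.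

Definition occupation_measure k n (X : 'rV[R]_k -> 'rV[R]_n)
    (A : set 'rV[R]_n) : \bar R :=
  lebesgue_rV k (@cube R k `&` X @^-1` A).

(* L is a version of the density d mu_X / d L^n. *)
Definition is_local_time k n (X : 'rV[R]_k -> 'rV[R]_n)
    (L : 'rV[R]_n -> R) : Prop :=
  [/\ occupation_measure X `<< lebesgue_rV n,
      measurable_fun [set: 'rV[R]_n] L,
      forall x, (0 <= L x)%R &
      forall A, measurable A ->
        occupation_measure X A = \int[lebesgue_rV n]_(x in A) (L x)%:E].

(* The Fourier transform of g, with kernel exp(i <x, xi>). *)
Definition fourier n (g : 'rV[R]_n -> \bar R) (xi : 'rV[R]_n) : R[i] :=
  Complex (fine (\int[lebesgue_rV n]_x ((cos (dot x xi))%:E * g x)))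
          (fine (\int[lebesgue_rV n]_x ((sin (dot x xi))%:E * g x))).

(* The Fourier transform determines g almost everywhere; continuity into
   \bar R then singles out the usual pointwise representative, which takes the
   value +oo at 0 when alpha <= n. *)
Definition is_bessel_kernel n (alpha : R) (g : 'rV[R]_n -> \bar R) : Prop :=
  [/\ (lebesgue_rV n).-integrable [set: 'rV[R]_n] g,
      continuous g &
      forall xi, fourier g xi =
        Complex ((1 + enorm xi ^+ 2) `^ (- (alpha / 2)))%R 0%R].

(* |z|^(alpha - n) for 0 < alpha < n, hence +oo at z = 0 (whereas
   [powR 0 (alpha - n)] is 0). *)
Definition riesz_kernel n (alpha : R) (z : 'rV[R]_n) : \bar R :=
  if z == 0%R then +oo else (enorm z `^ (alpha - n%:R))%:E.

(* U^alpha mu for the Riesz kernel, G^alpha mu for the Bessel kernel. *)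
Definition potential n (g : 'rV[R]_n -> \bar R) (mu : set 'rV[R]_n -> \bar R)
    (x : 'rV[R]_n) : \bar R :=
  \int[mu]_y g (x - y)%R.

(* F \in C(R^n): F is finite everywhere and continuous. *)
Definition finite_continuous n (F : 'rV[R]_n -> \bar R) : Prop :=
  (forall x, F x \is a fin_num) /\ continuous (fun x => fine (F x)).

Definition bounded_everywhere n (F : 'rV[R]_n -> \bar R) : Prop :=
  exists M : R, forall x, `|F x| <= M%:E.

End occupation.

(* Main.v *)
(* Idea. Writing the variance of a linear combination Z_v of values b(t_j) of the
   field as K^-1 times the integral over x of e^(-2Hx) times the square norm of
   sum_j v_j (f(. + e^x t_j) - f), where f is a tent function, one sees that
   scales x near -log r_j contribute at least c r_j^(2H) v_j^2 when r_j is the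
   distance of t_j to the origin and to the later points. Representing Gaussian
   bumps exp(-y^2/2) as averages of cosines, this bounds
   E prod_j bump((B(t_j) - c_j) / eta) by prod_j C (eta / r_j^H)^n, and gains a
   factor eta^(2-2H) per isolated point if each bump is replaced by its
   difference with its rescaled version. Integrating over the points bounds all
   moments of the occupation integrals of bumps; Borel-Cantelli along polynomially
   fine grids then gives, almost surely, mu(ball(x, r)) <= C r^b for every
   b < min(n, k/H), and, if n < k/H, summable increments for the Gaussian
   smoothings of mu. The former bounds the Riesz potentials, and the Bessel kernel
   is dominated by a Riesz kernel of slightly larger exponent; the latter makes
   the smoothings converge locally uniformly to a density of mu. *)

Require Import Defs.
From HB Require Import structures.
From mathcomp Require Import all_boot all_order all_algebra.
From mathcomp Require Import all_classical all_reals all_analysis.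
From mathcomp Require Import measurable_realfun complex ring lra.

Set Implicit Arguments.
Unset Strict Implicit.
Unset Printing Implicit Defensive.

Import Order.TTheory GRing.Theory Num.Theory.
Import numFieldNormedType.Exports.

Local Open Scope classical_set_scope.
Local Open Scope ring_scope.

(** * Bounded functions and Gaussian integrals *)

Section bounded_finite.
Context d (T : measurableType d) (R : realType).
Variable mu : {finite_measure set T -> \bar R}.
Implicit Types f g : T -> R.

Lemma bounded_integrable f M : measurable_fun [set: T] f ->
  (forall x, `|f x| <= M) -> mu.-integrable [set: T] (EFin \o f).
Proof.
move=> mf fM; apply: measurable_bounded_integrable => //.
  by rewrite ltey_eq fin_num_measure.
exists M; split; first exact: num_real.
by move=> y My x _ /=; rewrite (le_trans (fM x))// ltW.
Qed.

Lemma integral_EFin_Rintegral f M : measurable_fun [set: T] f ->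
  (forall x, `|f x| <= M) ->
  (\int[mu]_x (f x)%:E = (\int[mu]_x f x)%:E)%E.
Proof.
move=> mf fM; rewrite fineK//; apply: integrable_fin_num => //.
exact: bounded_integrable mf fM.
Qed.

Lemma normr_Rintegral_le f M : measurable_fun [set: T] f ->
  (forall x, `|f x| <= M) -> `|\int[mu]_x f x| <= M * fine (mu setT).
Proof.
move=> mf fM.
apply: (le_trans (le_normr_Rintegral measurableT (bounded_integrable mf fM))).
rewrite -Rintegral_cst//; apply: le_Rintegral => //.
- apply: (@bounded_integrable _ M); first exact: measurableT_comp.
  by move=> x; rewrite normr_id.
- apply: (@bounded_integrable _ `|M|); first exact: measurable_cst.
  by move=> x.
Qed.

End bounded_finite.

Section bounded_fubini.
Context d1 d2 (T1 : measurableType d1) (T2 : measurableType d2) (R : realType).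
Variable mu : {finite_measure set T1 -> \bar R}.
Variable nu : {finite_measure set T2 -> \bar R}.
Variable f : T1 * T2 -> R.
Variable M : R.
Hypothesis mf : measurable_fun [set: T1 * T2] f.
Hypothesis fM : forall z, `|f z| <= M.

Let f1 x : measurable_fun [set: T2] (fun y => f (x, y)).
Proof. by apply: measurableT_comp => //; exact: pair1_measurable. Qed.

Let f2 y : measurable_fun [set: T1] (fun x => f (x, y)).
Proof. by apply: measurableT_comp => //; exact: pair2_measurable. Qed.

Let int12 : (mu \x nu)%E.-integrable [set: T1 * T2] (EFin \o f).
Proof.
apply/integrable12ltyP; first exact/measurable_EFinP.
have [M0 nM0] : exists M0 : R, forall z, `|f z| <= `|M0|.
  by exists M => z; rewrite (le_trans (fM z))// ler_norm.
apply: (@le_lt_trans _ _ (\int[mu]_x \int[nu]_y (`|M0|%:E))%E).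
  apply: ge0_le_integral => //.
  - by move=> x _; exact: integral_ge0.
  - apply: (@measurable_fun_fubini_tonelli_F _ _ _ _ _ nu (fun z => `|(f z)%:E|%E)) => //.
    by apply: measurableT_comp => //; exact/measurable_EFinP.
  - move=> x _; apply: ge0_le_integral => //.
      by apply: measurableT_comp => //; exact/measurable_EFinP.
    by move=> y _; rewrite /= lee_fin.
under eq_integral do rewrite integral_cst//.
by rewrite integral_cst// ltey_eq !fin_numM// fin_num_measure.
Qed.

Lemma measurable_Rintegral2 : measurable_fun [set: T1] (fun x => \int[nu]_y f (x, y)).
Proof.
apply/measurable_EFinP; rewrite (_ : EFin \o _ = (fun x => \int[nu]_y (f (x, y))%:E)%E).
  exact: (measurable_fubini_F int12).
apply/funext => x /=.
by rewrite (integral_EFin_Rintegral nu (f1 x) (fun y => fM (x, y))).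
Qed.

Lemma measurable_Rintegral1 : measurable_fun [set: T2] (fun y => \int[mu]_x f (x, y)).
Proof.
apply/measurable_EFinP; rewrite (_ : EFin \o _ = (fun y => \int[mu]_x (f (x, y))%:E)%E).
  exact: (measurable_fubini_G int12).
apply/funext => y /=.
by rewrite (integral_EFin_Rintegral mu (f2 y) (fun x => fM (x, y))).
Qed.

Lemma bounded_Fubini :
  \int[mu]_x \int[nu]_y f (x, y) = \int[nu]_y \int[mu]_x f (x, y).
Proof.
have := Fubini int12 => /=.
under eq_integral => x _ do
  rewrite (integral_EFin_Rintegral nu (f1 x) (fun y => fM (x, y))).
under [in RHS]eq_integral => y _ do
  rewrite (integral_EFin_Rintegral mu (f2 y) (fun x => fM (x, y))).
by rewrite /Rintegral => ->.
Qed.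

End bounded_fubini.

Section gauss.
Variable R : realType.
Notation mu := (@lebesgue_measure R).

Definition gauss (a x : R) : R := expR (- (a * x ^+ 2)).

Lemma gauss_gt0 a x : 0 < gauss a x.
Proof. exact: expR_gt0. Qed.

Lemma gauss_ge0 a x : 0 <= gauss a x.
Proof. exact: expR_ge0. Qed.

Lemma is_derive_gauss (a x : R) : is_derive x 1 (gauss a) (- (2 * a * x) * gauss a x).
Proof.
rewrite /gauss; apply: is_derive_eq; rewrite /gauss.
rewrite /GRing.scale/=; ring.
Qed.

Lemma is_derive_continuous (f f' : R -> R) :
  (forall x : R, is_derive x 1 f (f' x)) -> continuous f.
Proof.
by move=> df x; have [/derivable1_diffP/differentiable_continuous] := df x.
Qed.

Lemma continuous_gauss a : continuous (gauss a).
Proof. exact: (is_derive_continuous (fun x => is_derive_gauss a x)). Qed.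

Lemma measurable_gauss a : measurable_fun [set: R] (gauss a).
Proof. by apply: continuous_measurable_fun; exact: continuous_gauss. Qed.

Lemma normal_pdf_gauss s x : 0 < s ->
  normal_pdf 0 s x = (Num.sqrt (2 * pi) * s)^-1 * gauss ((2 * s ^+ 2)^-1) x.
Proof.
move=> s0; rewrite /normal_pdf gt_eqF// /normal_peak /normal_fun /gauss.
rewrite subr0; congr (_ * expR _).
  rewrite -mulr_natr -[_ * 2]mulrA [in LHS]mulrC sqrtrM ?mulr_ge0 ?pi_ge0//.
  by rewrite sqrtr_sqr gtr0_norm// (mulrC pi).
by rewrite mulNr mulrC -mulr_natr (mulrC 2).
Qed.

Section fixed_a.
Variable a : R.
Hypothesis a0 : 0 < a.

Let s := Num.sqrt (2 * a)^-1.
Let s0 : 0 < s. Proof. by rewrite sqrtr_gt0 invr_gt0 mulr_gt0. Qed.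
Let sa : (2 * s ^+ 2)^-1 = a.
Proof.
rewrite sqr_sqrtr ?invr_ge0 ?mulr_ge0 ?ltW// invfM invrK mulrA mulVf ?mul1r//.
Qed.

Let gaussE x : gauss a x = Num.sqrt (2 * pi) * s * normal_pdf 0 s x.
Proof.
rewrite normal_pdf_gauss// sa mulrA divff ?mul1r// mulf_neq0 ?gt_eqF//.
by rewrite sqrtr_gt0 mulr_gt0// pi_gt0.
Qed.

Lemma integrable_gauss : mu.-integrable [set: R] (EFin \o gauss a).
Proof.
rewrite (_ : EFin \o _ = (fun x => (Num.sqrt (2 * pi) * s)%:E * (normal_pdf 0 s x)%:E)%E).
  by apply: integrableZl => //; exact: integrable_normal_pdf.
by apply/funext => x /=; rewrite gaussE EFinM.
Qed.

Lemma Rintegral_gauss : \int[mu]_x gauss a x = Num.sqrt (pi / a).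
Proof.
under eq_Rintegral do rewrite gaussE.
rewrite RintegralZl//; last exact: integrable_normal_pdf.
rewrite [X in _ * X]/Rintegral integral_normal_pdf/= mulr1 /s -sqrtrM ?mulr_ge0 ?pi_ge0//.
by congr Num.sqrt; rewrite invfM mulrACA divff// mul1r.
Qed.

End fixed_a.

Section fixed_a2.
Variable a : R.
Hypothesis a0 : 0 < a.

Lemma gauss_dom x : (1 + x ^+ 2) * gauss a x <= (1 + 2 / a) * gauss (a / 2) x.
Proof.
have -> : gauss a x = gauss (a / 2) x * gauss (a / 2) x.
  by rewrite /gauss -expRD; congr expR; field.
rewrite mulrA ler_pM2r ?gauss_gt0//.
have h : a / 2 * x ^+ 2 <= expR (a / 2 * x ^+ 2).
  by rewrite (le_trans _ (expR_ge1Dx _))// lerDr.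
have h1 : 1 <= expR (a / 2 * x ^+ 2).
  by rewrite -expR0 ler_expR mulr_ge0 ?sqr_ge0// divr_ge0// ltW.
rewrite /gauss expRN ler_pdivrMr ?expR_gt0// mulrDl mul1r lerD//.
rewrite -ler_pdivrMl ?divr_gt0//.
by rewrite invf_div.
Qed.

Lemma integrable_mul_gauss (h : R -> R) C : measurable_fun [set: R] h ->
  (forall x, `|h x| <= C * (1 + x ^+ 2)) ->
  mu.-integrable [set: R] (fun x => (h x * gauss a x)%:E).
Proof.
move=> mh hC.
have a20 : 0 < a / 2 by rewrite divr_gt0.
have C0 : 0 <= C.
  have := hC 0; rewrite expr0n addr0 mulr1; exact: le_trans.
apply: (@le_integrable _ _ _ mu setT measurableT _
    (fun x => (C * (1 + 2 / a))%:E * (gauss (a / 2) x)%:E)%E) => //.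
- by apply/measurable_EFinP/measurable_funM => //; exact: measurable_gauss.
- move=> x _.
  have H : `|h x * gauss a x| <= `|C * (1 + 2 / a) * gauss (a / 2) x|.
    apply: le_trans (ler_norm _); rewrite normrM (ger0_norm (gauss_ge0 _ _)).
    apply: (@le_trans _ _ (C * (1 + x ^+ 2) * gauss a x)).
      by rewrite ler_wpM2r ?gauss_ge0.
    by rewrite -!mulrA ler_wpM2l// gauss_dom.
  by rewrite -EFinM lee_fin.
by apply: integrableZl => //; exact: integrable_gauss.
Qed.

Lemma gauss_ibp (h h' : R -> R) C :
  (forall x : R, is_derive x 1 h (h' x)) -> continuous h' ->
  (forall x, `|h x| <= C * (1 + x ^+ 2)) ->
  (forall x, `|h' x - 2 * a * x * h x| <= C * (1 + x ^+ 2)) ->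
  \int[mu]_x ((h' x - 2 * a * x * h x) * gauss a x) = 0.
Proof.
move=> dh ch' hC hC'.
have ch : continuous h.
  exact: is_derive_continuous dh.
pose k x := h' x - 2 * a * x * h x.
have ck : continuous k.
  move=> x; apply: cvgB; first exact: ch'.
  apply: cvgM; last exact: ch.
  by apply: cvgM; [exact: cvg_cst|exact: cvg_id].
pose f x := k x * gauss a x.
have cf : continuous f by move=> x; apply: cvgM; [exact: ck|exact: continuous_gauss].
have intf : mu.-integrable [set: R] (EFin \o f).
  by apply: integrable_mul_gauss hC'; exact: continuous_measurable_fun.
pose F x := h x * gauss a x.
have C0 : 0 <= C by have := hC 0; rewrite expr0n addr0 mulr1; exact: le_trans.
have Fle x : 0 < `|x| -> `|F x| <= C * (1 + 2 / a) * (2 / a) / x ^+ 2.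
  move=> x0; rewrite /F normrM (ger0_norm (gauss_ge0 _ _)).
  apply: (@le_trans _ _ (C * ((1 + x ^+ 2) * gauss a x))).
    by rewrite mulrA ler_wpM2r ?gauss_ge0.
  rewrite -!mulrA ler_wpM2l//; apply: le_trans (gauss_dom x) _.
  rewrite ler_wpM2l//; first by rewrite addr_ge0// divr_ge0// ltW.
  have -> : 2 * (a^-1 / x ^+ 2) = (a / 2 * x ^+ 2)^-1.
    by rewrite !invfM invrK mulrA (mulrC 2).
  rewrite /gauss expRN lef_pV2 ?posrE ?expR_gt0//; last first.
    by rewrite mulr_gt0 ?divr_gt0// -real_normK ?num_real// exprn_gt0.
  by rewrite (le_trans _ (expR_ge1Dx _))// lerDr.
have dF (x : R) : is_derive x 1 F (f x).
  have H1 := dh x; have H2 := is_derive_gauss a x.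
  rewrite /F; apply: is_derive_eq; rewrite /f /k /GRing.scale/=; ring.
have cF : continuous F by move=> x; apply: cvgM; [exact: ch|exact: continuous_gauss].
have IN (N : nat) : (\int[mu]_(x in `[(- N.+1%:R)%R, N.+1%:R]) (f x)%:E =
    (F N.+1%:R - F (- N.+1%:R))%:E)%E.
  rewrite (@continuous_FTC2 _ _ F)//.
  - by rewrite gtrN.
  - exact: continuous_subspaceT.
  - split.
    + by move=> x _; have [] := dF x.
    + exact/cvg_at_right_filter/cF.
    + exact/cvg_at_left_filter/cF.
  - by move=> x _; rewrite derive1E; have [_ ->] := dF x.
pose A (N : nat) := `[(- N.+1%:R)%R, N.+1%:R]%classic : set R.
have lim1 : (F N.+1%:R - F (- N.+1%:R))%:E @[N --> \oo] --> (\int[mu]_x (f x)%:E)%E.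
  rewrite (_ : (fun _ => _) = (fun N : nat => \int[mu]_x ((f \_ (A N)) x)%:E)%E); last first.
    by apply/funext => N; rewrite -IN integral_mkcond restrict_EFin.
  apply: (@dominated_cvg _ _ _ mu _ _ (fun N x => ((f \_ (A N)) x)%:E) (EFin \o f)
      (fun x => `|f x|%:E)) => //.
  - move=> N; apply/measurable_EFinP; apply/(measurable_restrictT _ _).1.
      exact: measurable_itv.
    by apply/measurable_funTS; exact: continuous_measurable_fun.
  - move=> x _; apply: cvg_EFin; first exact: nearW.
    apply: cvg_near_cst; near=> N; rewrite /= patchE mem_set// /A /= in_itv/=.
    rewrite -ler_norml.
    apply: (@le_trans _ _ N%:R); last by rewrite ler_nat.
    by near: N; exact: nbhs_infty_ger.
  - by have := integrable_norm intf.
  - move=> N x _; rewrite /= lee_fin patchE; case: ifPn => // _.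
    by rewrite normr0.
have lim0 : (F N.+1%:R - F (- N.+1%:R))%:E @[N --> \oo] --> (0 : R)%:E.
  apply: cvg_EFin; first exact: nearW.
  pose K := 2 * (C * (1 + 2 / a) * (2 / a)).
  apply: norm_cvg0; apply: (@squeeze_cvgr _ _ _ _ (cst 0) (fun N => K * N.+1%:R^-1)).
  - near=> N; rewrite normr_ge0/=.
    have N1 : 0 < `|N.+1%:R : R| by rewrite normr_gt0 pnatr_eq0.
    have N2 : 0 < `|- N.+1%:R : R| by rewrite normrN.
    apply: (le_trans (ler_normB _ _)).
    apply: (le_trans (lerD (Fle _ N1) (Fle _ N2))).
    rewrite sqrrN /K; set c := C * _ * _.
    have c0 : 0 <= c by rewrite !mulr_ge0 ?addr_ge0 ?mulr_ge0 ?invr_ge0// ltW.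
    have : c / N.+1%:R ^+ 2 <= c / N.+1%:R.
      rewrite ler_wpM2l// lef_pV2 ?posrE ?exprn_gt0 ?ltr0n//.
      by rewrite expr2 ler_pMl ?ltr0n// ler1n.
    by rewrite -mulrA mulr_natl mulr2n => cc; exact: lerD.
  - exact: cvg_cst.
  - have := cvgM (@cvg_cst _ K _ \oo _) (@cvg_harmonic R).
    by rewrite mulr0; apply.
have := cvg_unique (@ereal_hausdorff R) lim1 lim0.
by rewrite /Rintegral /f /k => ->.
Unshelve. all: end_near. Qed.

Let affine_cos_measurable (y c : R) :
  measurable_fun [set: R] (fun u => cos (y * u + c)).
Proof.
apply: measurableT_comp; first by apply: continuous_measurable_fun; exact: continuous_cos.
by apply: measurable_funD => //; exact: measurable_funM.
Qed.

Let norm_le_sqr (u : R) : `|u| <= 1 + u ^+ 2.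
Proof.
have [u1|u1] := leP `|u| 1; first by rewrite (le_trans u1)// lerDl sqr_ge0.
by rewrite -real_normK ?num_real// ler_wpDl// expr2 ler_peMr// ltW.
Qed.

Lemma Rintegral_cos_gauss (x c : R) :
  \int[mu]_u (cos (x * u + c) * gauss a u) =
  cos c * Num.sqrt (pi / a) * expR (- (x ^+ 2 / (4 * a))).
Proof.
pose f y u := cos (y * u + c) * gauss a u.
pose F y := \int[mu]_u f y u.
have one_le (u : R) : 1 <= 1 + u ^+ 2 by rewrite lerDl sqr_ge0.
have intf y : mu.-integrable [set: R] (EFin \o f y).
  apply: (integrable_mul_gauss (C := 1)); first exact: affine_cos_measurable.
  by move=> u; rewrite mul1r (le_trans (cos_max _)).
have df y u : is_derive y (1 : R) (f ^~ u) (- (u * sin (y * u + c)) * gauss a u).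
  rewrite /f; apply: is_derive_eq; rewrite /GRing.scale/=; ring.
pose G u := (1 + u ^+ 2) * gauss a u.
have G0 u : 0 <= G u by rewrite mulr_ge0 ?gauss_ge0// (le_trans _ (one_le u)).
have intG : mu.-integrable [set: R] (EFin \o G).
  apply: (integrable_mul_gauss (C := 1)).
    by apply: measurable_funD => //; exact: measurable_funX.
  by move=> u; rewrite mul1r ger0_norm// (le_trans _ (one_le u)).
have d1f y u : partial1of2 f y u = - (u * sin (y * u + c)) * gauss a u.
  by rewrite partial1of2E; have [_ ->] := df y u.
have I (y : R) : `]y - 1, y + 1[%classic y by rewrite /= in_itv/= ltrBlDr ltrDl ltr01.
have dGb y u : `|partial1of2 f y u| <= G u.
  rewrite d1f normrM (ger0_norm (gauss_ge0 _ _)) ler_wpM2r ?gauss_ge0//.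
  by rewrite normrN normrM (le_trans _ (norm_le_sqr u))// ler_piMr// sin_max.
have dF y : is_derive y (1 : R) F (- (y / (2 * a)) * F y).
  have dy z u : derivable (f ^~ u) z 1 by have [] := df z u.
  apply: DeriveDef.
    exact: (@derivable_under_integral _ _ _ mu f setT measurableT y (y - 1) (y + 1)
      (I y) (fun z _ => intf z) (fun z u _ _ => dy z u) G G0 intG (fun z u _ _ => dGb z u)).
  rewrite -derive1E (@differentiation_under_integral _ _ _ mu f setT measurableT y
      (y - 1) (y + 1) (I y) (fun z _ => intf z) (fun z u _ _ => dy z u) G G0 intG (fun z u _ _ => dGb z u)).
  under eq_Rintegral do rewrite d1f.
  have dsin (u : R) : is_derive u (1 : R) (fun u => sin (y * u + c)) (y * cos (y * u + c)).
    by apply: is_derive_eq; rewrite /GRing.scale/=; ring.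
  have ycos : continuous (fun u => y * cos (y * u + c)).
    apply: (@is_derive_continuous _ (fun u => - (y * y * sin (y * u + c)))) => u.
    by apply: is_derive_eq; rewrite /GRing.scale/=; ring.
  have bcos u : `|y * cos (y * u + c)| <= `|y|.
    by rewrite normrM ler_piMr// cos_max.
  have busin u : `|2 * a * u * sin (y * u + c)| <= 2 * a * (1 + u ^+ 2).
    have a20 : 0 <= 2 * a by rewrite mulr_ge0// ltW.
    rewrite normrM (le_trans (ler_piMr _ (sin_max _)))// normrM ger0_norm//.
    by rewrite ler_wpM2l.
  have a20 : 0 < 2 * a by rewrite mulr_gt0.
  have Csin u : `|sin (y * u + c)| <= (1 + `|y| + 2 * a) * (1 + u ^+ 2).
    rewrite (le_trans (sin_max _))// (le_trans (one_le u))// ler_peMl//.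
      by rewrite (le_trans _ (one_le u)).
    by rewrite -addrA lerDl addr_ge0// ltW.
  have Cibp u : `|y * cos (y * u + c) - 2 * a * u * sin (y * u + c)| <=
      (1 + `|y| + 2 * a) * (1 + u ^+ 2).
    apply: (le_trans (ler_normB _ _)); apply: (le_trans (lerD (bcos u) (busin u))).
    have h1 : 0 <= `|y| * u ^+ 2 by rewrite mulr_ge0// sqr_ge0.
    have h2 : 0 <= u ^+ 2 by rewrite sqr_ge0.
    lra.
  have csin : continuous (fun u => sin (y * u + c)) := is_derive_continuous dsin.
  have mibp : measurable_fun [set: R]
      (fun u => y * cos (y * u + c) - 2 * a * u * sin (y * u + c)).
    apply: measurable_funB; first exact: continuous_measurable_fun.
    by apply: measurable_funM; [exact: measurable_funM|exact: continuous_measurable_fun].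
  have ibp := gauss_ibp dsin ycos Csin Cibp.
  transitivity (\int[mu]_u ((2 * a)^-1 * ((y * cos (y * u + c) -
      2 * a * u * sin (y * u + c)) * gauss a u) - y / (2 * a) * f y u)).
    apply: eq_Rintegral => u _; rewrite /f; field.
    by rewrite gt_eqF.
  have iint := integrable_mul_gauss mibp Cibp.
  have /= I1 := integrableZl measurableT (2 * a)^-1 iint.
  have /= I2 := integrableZl measurableT (y / (2 * a)) (intf y).
  rewrite RintegralB//.
  have /= -> := @RintegralZl _ _ _ mu setT _ (2 * a)^-1 measurableT iint.
  have /= -> := @RintegralZl _ _ _ mu setT _ (y / (2 * a)) measurableT (intf y).
  by rewrite ibp mulr0 sub0r mulNr.
have FE z : F z = F 0 * expR (- (z ^+ 2 / (4 * a))).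
  have dcst (y : R) : is_derive y (1 : R) (fun y => F y * expR (y ^+ 2 / (4 * a))) 0.
    have H := dF y.
    apply: is_derive_eq; rewrite /GRing.scale/=; field; rewrite gt_eqF//.
  have := is_derive_0_is_cst z 0 dcst.
  rewrite expr0n mul0r expR0 mulr1 => <-.
  by rewrite -mulrA -expRD subrr expR0 mulr1.
rewrite -/(F x) FE; congr (_ * _).
rewrite /F /f; under eq_Rintegral do rewrite mul0r add0r.
by rewrite RintegralZl ?Rintegral_gauss//; exact: integrable_gauss.
Qed.

End fixed_a2.
End gauss.

(** * Euclidean norm and Lebesgue measure on row vectors *)

Section translation_R.
Variable R : realType.
Notation mu := (@lebesgue_measure R).

Lemma lebesgue_measure_shift (a : R) (A : set R) : measurable A ->
  pushforward mu (fun x : measurableTypeR R => (x + a : measurableTypeR R)) A = mu A.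
Proof.
move=> mA.
have ms : measurable_fun [set: measurableTypeR R]
    (fun x : measurableTypeR R => (x + a : measurableTypeR R)).
  exact: measurable_funD.
apply/esym/(@lebesgue_measure_unique _ (pushforward mu _)) => //= _ [[x y]] _ <-.
rewrite /pushforward /= (_ : _ @^-1` _ = `](x - a), (y - a)]%classic); last first.
  by apply/seteqP; split=> z /=; rewrite !in_itv/= ltrBlDr lerBrDr.
rewrite !lebesgue_measure_itv/= !lte_fin ltrD2r; case: ifPn => // _.
by rewrite -!EFinB; congr EFin; ring.
Qed.

Lemma ge0_integral_shift (a : R) (f : R -> \bar R) :
  measurable_fun [set: R] f -> (forall x, 0 <= f x)%E ->
  (\int[mu]_x f (x + a)%R = \int[mu]_x f x)%E.
Proof.
move=> mf f0.
have ms : measurable_fun [set: measurableTypeR R]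
    (fun x : measurableTypeR R => (x + a : measurableTypeR R)).
  exact: measurable_funD.
rewrite -(preimage_setT (fun x : measurableTypeR R => (x + a : measurableTypeR R))).
rewrite -(ge0_integral_pushforward ms)//=.
by apply: eq_measure_integral => //= A mA AS; exact: lebesgue_measure_shift.
Qed.

End translation_R.

Section measurable_rV.
Context {R : realType}.

Lemma continuous_measurable_rV n (f : 'rV[R]_n -> R) :
  continuous f -> measurable_fun [set: 'rV[R]_n] f.
Proof.
move=> cf; apply: (measurability _ (RGenOInfty.measurableE R)).
move=> _ [_ [a ->] <-]; rewrite setTI; apply: open_measurable_rV.
by apply: open_comp; [move=> v _; exact: cf|exact: interval_open].
Qed.

Context d (T : measurableType d) (n : nat).
Implicit Types f g : T -> 'rV[R]_n.

Lemma measurable_coord_comp f i : measurable_fun [set: T] f ->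
  measurable_fun [set: T] (fun t => f t ord0 i).
Proof. by move=> mf; exact: (measurableT_comp (measurable_coord_rV i) mf). Qed.

Lemma measurable_rVD f g : measurable_fun [set: T] f -> measurable_fun [set: T] g ->
  measurable_fun [set: T] (fun t => f t + g t).
Proof.
move=> mf mg; apply: measurable_fun_rV => i; under eq_fun do rewrite mxE.
by apply: measurable_funD; exact: measurable_coord_comp.
Qed.

Lemma measurable_rVN f : measurable_fun [set: T] f ->
  measurable_fun [set: T] (fun t => - f t).
Proof.
move=> mf; apply: measurable_fun_rV => i; under eq_fun do rewrite mxE.
by apply: measurableT_comp => //; exact: measurable_coord_comp.
Qed.

Lemma measurable_rVB f g : measurable_fun [set: T] f -> measurable_fun [set: T] g ->
  measurable_fun [set: T] (fun t => f t - g t).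
Proof. by move=> mf mg; apply: measurable_rVD => //; exact: measurable_rVN. Qed.

Lemma measurable_rVZ (c : T -> R) f : measurable_fun [set: T] c ->
  measurable_fun [set: T] f -> measurable_fun [set: T] (fun t => c t *: f t).
Proof.
move=> mc mf; apply: measurable_fun_rV => i; under eq_fun do rewrite mxE.
by apply: measurable_funM => //; exact: measurable_coord_comp.
Qed.

Lemma measurable_dot f g : measurable_fun [set: T] f -> measurable_fun [set: T] g ->
  measurable_fun [set: T] (fun t => dot (f t) (g t)).
Proof.
move=> mf mg; rewrite /dot; apply: measurable_sum => i.
by apply: measurable_funM; exact: measurable_coord_comp.
Qed.

Lemma measurable_enorm f : measurable_fun [set: T] f ->
  measurable_fun [set: T] (fun t => enorm (f t)).
Proof.
move=> mf; rewrite /enorm; apply: measurableT_comp; last exact: measurable_dot.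
by apply: continuous_measurable_fun; exact: sqrt_continuous.
Qed.

End measurable_rV.

Lemma cvg_sum_seq (R : realType) (I T : Type) (r : seq I) (F : set_system T)
    {FF : Filter F} (f : I -> T -> R) (a : I -> R) :
  (forall i, f i x @[x --> F] --> a i) ->
  \sum_(i <- r) f i x @[x --> F] --> \sum_(i <- r) a i.
Proof.
move=> fa; elim: r => [|i r IH].
  by rewrite big_nil; under eq_fun do rewrite big_nil; exact: cvg_cst.
by rewrite big_cons; under eq_fun do rewrite big_cons; exact: cvgD.
Qed.

Section euclid.
Context {R : realType} {n : nat}.
Implicit Types x y z : 'rV[R]_n.

Lemma dotC x y : dot x y = dot y x.
Proof. by apply: eq_bigr => i _; rewrite mulrC. Qed.

Lemma dotDl x y z : dot (x + y) z = dot x z + dot y z.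
Proof. by rewrite /dot -big_split; apply: eq_bigr => i _; rewrite mxE mulrDl. Qed.

Lemma dotZl (a : R) x y : dot (a *: x) y = a * dot x y.
Proof. by rewrite /dot mulr_sumr; apply: eq_bigr => i _; rewrite mxE mulrA. Qed.

Lemma dotDr x y z : dot z (x + y) = dot z x + dot z y.
Proof. by rewrite dotC dotDl !(dotC z). Qed.

Lemma dotZr (a : R) x y : dot y (a *: x) = a * dot y x.
Proof. by rewrite dotC dotZl dotC. Qed.

Lemma dotNl x y : dot (- x) y = - dot x y.
Proof. by rewrite -scaleN1r dotZl mulN1r. Qed.

Lemma dotNr x y : dot y (- x) = - dot y x.
Proof. by rewrite dotC dotNl dotC. Qed.

Lemma dot_ge0 x : 0 <= dot x x.
Proof. by apply: sumr_ge0 => i _; rewrite -expr2 sqr_ge0. Qed.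

Lemma dot_eq0 x : (dot x x == 0) = (x == 0).
Proof.
apply/idP/eqP => [|->]; last by rewrite /dot big1// => i _; rewrite mxE mul0r.
rewrite psumr_eq0; last by move=> i _; rewrite -expr2 sqr_ge0.
move=> /allP h; apply/rowP => i; rewrite mxE; apply/eqP.
by have := h i (mem_index_enum i); rewrite -expr2 sqrf_eq0.
Qed.

Lemma enorm_ge0 x : 0 <= enorm x. Proof. exact: sqrtr_ge0. Qed.

Lemma enorm_sqr x : enorm x ^+ 2 = dot x x.
Proof. by rewrite sqr_sqrtr ?dot_ge0. Qed.

Lemma enorm_eq0 x : (enorm x == 0) = (x == 0).
Proof. by rewrite -sqrf_eq0 enorm_sqr dot_eq0. Qed.

Lemma enorm0 : enorm (0 : 'rV[R]_n) = 0.
Proof. by apply/eqP; rewrite enorm_eq0. Qed.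

Lemma enorm_gt0 x : (0 < enorm x) = (x != 0).
Proof. by rewrite lt0r enorm_eq0 enorm_ge0 andbT. Qed.

Lemma enormN x : enorm (- x) = enorm x.
Proof. by rewrite /enorm dotNl dotNr opprK. Qed.

Lemma enormB x y : enorm (x - y) = enorm (y - x).
Proof. by rewrite -enormN opprB. Qed.

Lemma enormZ (a : R) x : enorm (a *: x) = `|a| * enorm x.
Proof. by rewrite /enorm dotZl dotZr mulrA sqrtrM -?expr2 ?sqr_ge0// sqrtr_sqr. Qed.

Lemma dot_le_enorm x y : dot x y <= enorm x * enorm y.
Proof.
have [->|y0] := eqVneq y 0.
  by rewrite enorm0 mulr0 /dot big1// => i _; rewrite mxE mulr0.
have [xy0|xy0] := leP (dot x y) 0.
  by rewrite (le_trans xy0)// mulr_ge0// enorm_ge0.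
rewrite -(@ler_pXn2r _ 2)// ?nnegrE ?mulr_ge0 ?enorm_ge0 ?(ltW xy0)//.
rewrite exprMn !enorm_sqr.
have yy : 0 < dot y y by rewrite lt0r dot_eq0 y0 dot_ge0.
have := dot_ge0 (dot y y *: x - dot x y *: y).
rewrite dotDl !dotDr !dotNl !dotNr !dotZl !dotZr !(dotC y x) => h.
have : 0 <= dot y y * (dot x x * dot y y - dot x y ^+ 2) by lra.
by rewrite pmulr_rge0// subr_ge0.
Qed.

Lemma enormD x y : enorm (x + y) <= enorm x + enorm y.
Proof.
rewrite -(@ler_pXn2r _ 2)// ?nnegrE ?addr_ge0 ?enorm_ge0//.
rewrite sqrrD !enorm_sqr dotDl !dotDr (dotC y x).
have := dot_le_enorm x y; lra.
Qed.

Lemma enorm_dist x y : `|enorm x - enorm y| <= enorm (x - y).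
Proof.
rewrite ler_norml; apply/andP; split.
  by rewrite lerNl opprB lerBlDr enormB -{1}(subrK x y) enormD.
by rewrite lerBlDr -{1}(subrK y x) enormD.
Qed.

Lemma coord_le_enorm x i : `|x ord0 i| <= enorm x.
Proof.
rewrite -(@ler_pXn2r _ 2)// ?nnegrE ?enorm_ge0// enorm_sqr real_normK ?num_real//.
rewrite /dot (bigD1 i)//= expr2 lerDl sumr_ge0// => j _; rewrite -expr2 sqr_ge0//.
Qed.

End euclid.

Lemma enorm_le_coord (R : realType) n (x : 'rV[R]_n) (e : R) : (forall i, `|x ord0 i| <= e) ->
  enorm x <= n%:R * e.
Proof.
move=> xe; case: n x xe => [|m] x xe.
  by rewrite /enorm /dot big_ord0 sqrtr0 mul0r.
have e0 : 0 <= e by apply: le_trans (xe ord0).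
rewrite -(@ler_pXn2r _ 2)// ?nnegrE ?mulr_ge0 ?enorm_ge0// enorm_sqr exprMn.
apply: (@le_trans _ _ (\sum_(i < m.+1) e ^+ 2)).
  apply: ler_sum => i _; rewrite -expr2 -real_normK ?num_real//.
  by rewrite ler_pXn2r ?nnegrE.
rewrite sumr_const card_ord -[leLHS]mulr_natl ler_wpM2r ?sqr_ge0//.
by rewrite expr2 ler_peMr// ler1n.
Qed.

Section euclid_norm.
Context {R : realType} {n : nat}.
Implicit Types x y z : 'rV[R]_n.

Lemma norm_le_enorm x : `|x| <= enorm x.
Proof.
rewrite /Num.Def.normr/= mx_normrE; apply: bigmax_le; first exact: enorm_ge0.
by move=> [i j] _ /=; rewrite ord1 coord_le_enorm.
Qed.

Lemma coord_le_norm x i : `|x ord0 i| <= `|x|.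
Proof.
rewrite [leRHS]/Num.Def.normr/= mx_normrE.
exact: (le_bigmax _ (fun ij : 'I_1 * 'I_n => `|x ij.1 ij.2|) (ord0, i)).
Qed.

Lemma continuous_enorm : continuous (@enorm R n).
Proof.
move=> x; rewrite /enorm.
apply: (@continuous_comp _ _ _ (fun x : 'rV[R]_n => dot x x) (@Num.sqrt R)).
  apply: (@cvg_sum_seq R _ 'rV[R]_n _ (nbhs x) (nbhs_filter x)
    (fun i (y : 'rV[R]_n) => y ord0 i * y ord0 i)) => i.
  by apply: cvgM; exact: coord_continuous.
move=> /=; exact: sqrt_continuous.
Qed.

End euclid_norm.

Section lebesgue_rV_theory.
Context {R : realType}.
Local Open Scope ereal_scope.

Lemma ge0_integral_lebesgue_rVS n (f : 'rV[R]_n.+1 -> \bar R) :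
  measurable_fun [set: 'rV[R]_n.+1] f -> (forall x, 0 <= f x) ->
  \int[lebesgue_rV n.+1]_x f x =
  \int[lebesgue_measure]_x \int[lebesgue_rV n]_v f (cons_rV (x, v)).
Proof.
move=> mf f0.
transitivity (\int[pushforward (lebesgue_measure \x lebesgue_rV n) (@cons_rV R n)]_x f x) => //.
rewrite ge0_integral_pushforward//; last exact: measurable_cons_rV.
rewrite preimage_setT.
rewrite (@fubini_tonelli1 _ _ _ _ R (@lebesgue_measure R) (lebesgue_rV n) (f \o @cons_rV R n))//=.
by apply: measurableT_comp => //; exact: measurable_cons_rV.
Qed.

Lemma measurable_cons_rV2 n (x : R) : measurable_fun [set: 'rV[R]_n] (fun v => cons_rV (x, v)).
Proof. by apply: measurableT_comp (pair1_measurable x); exact: measurable_cons_rV. Qed.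

Lemma ge0_integral_rV_shift n (a : 'rV[R]_n) (f : 'rV[R]_n -> \bar R) :
  measurable_fun [set: 'rV[R]_n] f -> (forall x, 0 <= f x) ->
  \int[lebesgue_rV n]_x f (x + a)%R = \int[lebesgue_rV n]_x f x.
Proof.
elim: n a f => [|n IHn] a f mf f0.
  by apply: eq_integral => x _; rewrite !(flatmx0, thinmx0).
have ma : measurable_fun [set: 'rV[R]_n.+1] (fun x => x + a)%R.
  by apply: measurable_rVD.
rewrite !ge0_integral_lebesgue_rVS//; last first.
  by apply: measurableT_comp => //.
pose a' := (uncons_rV a).2.
have consD (x : R) v : (cons_rV (x, v) + a = cons_rV (x + a ord0 ord0, v + a'))%R.
  apply/rowP => i; rewrite mxE; have [j ->|->] := unliftP ord0 i.
    rewrite !cons_rVS mxE /a' mxE; congr (_ + a _ _)%R.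
    exact: val_inj.
  by rewrite !cons_rV0.
pose F x := \int[lebesgue_rV n]_v f (cons_rV (x, v)).
transitivity (\int[lebesgue_measure]_x F (x + a ord0 ord0)%R).
  apply: eq_integral => x _; rewrite /F.
  rewrite -(IHn a' (fun v => f (cons_rV ((x + a ord0 ord0)%R, v))))//.
    by apply: eq_integral => v _; rewrite consD.
  by apply: measurableT_comp (measurable_cons_rV2 _) => //.
rewrite ge0_integral_shift//; last by move=> x; exact: integral_ge0.
apply: (measurable_fun_fubini_tonelli_F (m2 := lebesgue_rV n) (f \o @cons_rV R n)) => //=.
by apply: measurableT_comp => //; exact: measurable_cons_rV.
Qed.

Section reflection.
Variable n : nat.
Local Notation la := (@lebesgue_rV R n).

Definition reflect_rV (v x : 'rV[R]_n) : 'rV[R]_n :=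
  (x - (2 * dot x v / dot v v) *: v)%R.

Lemma reflect_rVD v x y :
  (reflect_rV v (x + y) = reflect_rV v x + reflect_rV v y)%R.
Proof. by rewrite /reflect_rV dotDl mulrDr mulrDl scalerDl opprD addrACA. Qed.

Lemma dot_reflect_rV v x y :
  dot (reflect_rV v x) (reflect_rV v y) = dot x y.
Proof.
rewrite /reflect_rV !(dotDl, dotDr, dotNl, dotNr, dotZl, dotZr) (dotC v y).
have [->|v0] := eqVneq (dot v v) 0%R; first by rewrite !invr0; ring.
by field.
Qed.

Lemma reflect_rVK v : involutive (reflect_rV v).
Proof.
move=> x; rewrite {1}/reflect_rV {2}/reflect_rV dotDl dotNl dotZl /reflect_rV.
have [v0|v0] := eqVneq (dot v v) 0%R; first by rewrite v0 !invr0 !mulr0 !scale0r !subr0.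
rewrite -addrA -opprD -scalerDl.
have -> : (2 * dot x v / dot v v + 2 * (dot x v - 2 * dot x v / dot v v * dot v v) / dot v v = 0)%R.
  by field.
by rewrite scale0r subr0.
Qed.

Lemma reflect_rV_swap x y : enorm x = enorm y -> reflect_rV (x - y) x = y.
Proof.
move=> xy; have dxy : dot x x = dot y y by rewrite -!enorm_sqr xy.
rewrite /reflect_rV; have [xye|xye] := eqVneq (x - y)%R 0%R.
  by rewrite xye scaler0 subr0; apply/eqP; rewrite -subr_eq0 xye.
have E : (2 * dot x (x - y) / dot (x - y) (x - y) = 1)%R.
  have : (dot (x - y) (x - y) != 0)%R by rewrite dot_eq0.
  rewrite !(dotDl, dotDr, dotNl, dotNr) (dotC y x) dxy => h.
  by apply: (canLR (mulfK h)); ring.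
by rewrite E scale1r opprB addrCA subrr addr0.
Qed.

Lemma enorm_reflect_rV v x : enorm (reflect_rV v x) = enorm x.
Proof. by rewrite /enorm dot_reflect_rV. Qed.

Lemma measurable_reflect_rV v : measurable_fun [set: 'rV[R]_n] (reflect_rV v).
Proof.
apply: measurable_rVB => //; apply: measurable_rVZ => //.
apply: measurable_funM => //; apply: measurable_funM => //.
exact: measurable_dot.
Qed.

Definition eball (r : R) : set 'rV[R]_n := [set x | (enorm x <= r)%R].

Lemma measurable_eball r : measurable (eball r).
Proof.
rewrite (_ : eball r = @enorm R n @^-1` `]-oo, r]); last first.
  by apply/seteqP; split=> x /=; rewrite in_itv.
rewrite -[X in measurable X]setTI; apply: measurable_enorm => //.
Qed.

Lemma measurable_box (a b : 'I_n -> R) :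
  measurable [set v : 'rV[R]_n | forall i, (a i <= v ord0 i <= b i)%R].
Proof.
rewrite (_ : mkset _ = \bigcap_(i in [set: 'I_n]) ((fun v : 'rV[R]_n => v ord0 i)
    @^-1` `[a i, b i])).
  apply: fin_bigcap_measurable => // i _.
  by rewrite -[X in measurable X]setTI; exact: measurable_coord_rV.
by apply/seteqP; split=> v /= h i; [move=> _|]; have := h i; rewrite /= in_itv/=; apply.
Qed.

Lemma lebesgue_eball_fin r : la (eball r) < +oo.
Proof.
have [r0|r0] := ltP r 0%R.
  rewrite (_ : eball r = set0) ?measure0//; apply/seteqP; split=> x //=.
  by move=> xr; have := le_lt_trans xr r0; rewrite ltNge enorm_ge0.
apply: (@le_lt_trans _ _ (la [set v : 'rV[R]_n | forall i, ((fun=> - r) i <= v ord0 i <= (fun=> r) i)%R])).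
  apply: le_measure; rewrite ?inE; [exact: measurable_eball|exact: measurable_box|].
  move=> x /= xr i; rewrite -ler_norml; exact: le_trans (coord_le_enorm _ _) xr.
rewrite lebesgue_rV_box ?ltry// => i.
by rewrite (@le_trans _ _ 0%R)// oppr_le0.
Qed.

Lemma lebesgue_eball_gt0 r : (0 < r)%R -> 0 < la (eball r).
Proof.
move=> r0; pose e := (r / n.+1%:R)%R.
have e0 : (0 < e)%R by rewrite divr_gt0.
apply: (@lt_le_trans _ _ (la [set v : 'rV[R]_n | forall i, ((fun=> - e) i <= v ord0 i <= (fun=> e) i)%R])).
  rewrite lebesgue_rV_box => [|i]; last by rewrite ge0_cp// ltW.
  by rewrite lte_fin prodr_gt0// => i _; rewrite opprK addr_gt0.
apply: le_measure; rewrite ?inE; [exact: measurable_box|exact: measurable_eball|].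
move=> x /= xe; rewrite /eball/=.
apply: (@le_trans _ _ (n%:R * e)%R).
  by apply: enorm_le_coord => i; rewrite ler_norml xe.
apply: (@le_trans _ _ (n.+1%:R * e)%R); first by rewrite ler_wpM2r ?ler_nat// ltW.
by rewrite /e mulrC divfK// pnatr_eq0.
Qed.

(* Uniqueness of Haar measure, by computing the integral of g(x) f(Tx + y)
   in two ways, with g the indicator function of a T-invariant ball. *)
Lemma ge0_integral_reflect_rV v (f : 'rV[R]_n -> \bar R) :
  measurable_fun [set: 'rV[R]_n] f -> (forall x, 0 <= f x) ->
  \int[la]_x f (reflect_rV v x) = \int[la]_x f x.
Proof.
move=> mf f0; pose T := reflect_rV v.
have mT : measurable_fun [set: 'rV[R]_n] T := measurable_reflect_rV v.
pose B := eball 1.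
pose g x : \bar R := (\1_B x)%:E.
have mg : measurable_fun [set: 'rV[R]_n] g.
  by apply/measurable_EFinP/measurable_indic; exact: measurable_eball.
have g0 x : 0 <= g x by rewrite lee_fin.
have gT x : g (- T x)%R = g x.
  congr EFin; rewrite !indicE; congr ((nat_of_bool _)%:R).
  by apply/idP/idP => /set_mem h; apply/mem_set; move: h;
    rewrite /B /eball/= enormN enorm_reflect_rV.
have intg : \int[la]_x g x = la B.
  by rewrite integral_indic ?setIT//; exact: measurable_eball.
have Bfin : la B \is a fin_num.
  by rewrite ge0_fin_numE ?measure_ge0//; exact: lebesgue_eball_fin.
have B0 : la B != 0 by rewrite gt_eqF//; exact: lebesgue_eball_gt0.
have m2 (h1 h2 : 'rV[R]_n * 'rV[R]_n -> 'rV[R]_n) :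
    measurable_fun [set: 'rV[R]_n * 'rV[R]_n] h1 -> measurable_fun [set: 'rV[R]_n * 'rV[R]_n] h2 ->
    measurable_fun [set: 'rV[R]_n * 'rV[R]_n] (fun z => g (h1 z) * f (h2 z)).
  by move=> mh1 mh2; apply: emeasurable_funM; apply: measurableT_comp.
suff : (\int[la]_x f (T x)) * la B = (\int[la]_x f x) * la B.
  by move/(congr1 (fun z => z * (fine (la B))^-1%:E)); rewrite -!muleA -{1 3}(fineK Bfin)
     -EFinM divff ?mule1//; apply: contra_neq B0 => b0; rewrite -(fineK Bfin) b0.
rewrite -intg -ge0_integralZl//; last first.
- exact: integral_ge0.
transitivity (\int[la]_x \int[la]_y (g x * f (T y + x)%R)).
  apply: eq_integral => x _; rewrite muleC ge0_integralZl//; last first.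
    by apply: measurableT_comp => //; apply: measurable_rVD.
  congr (_ * _).
  rewrite -[LHS](ge0_integral_rV_shift (T x))//; last by apply: measurableT_comp.
  by apply: eq_integral => y _; rewrite /T reflect_rVD reflect_rVK.
rewrite (@fubini_tonelli _ _ _ _ R la la (fun z => g z.1 * f (T z.2 + z.1)%R))//; last 2 first.
- apply: m2 => //; apply: measurable_rVD => //; apply: measurableT_comp => //.
- by move=> z; rewrite mule_ge0.
transitivity (\int[la]_y \int[la]_x (g (x - T y)%R * f x)).
  apply: eq_integral => y _.
  rewrite -[RHS](ge0_integral_rV_shift (T y))/=.
  - by apply: eq_integral => x _; rewrite addrK addrC.
  - by apply: emeasurable_funM => //; apply: measurableT_comp => //; apply: measurable_rVB.
  - by move=> x; rewrite mule_ge0.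
rewrite (@fubini_tonelli _ _ _ _ R la la (fun z => g (z.2 - T z.1)%R * f z.2))//; last 2 first.
- by apply: m2 => //; apply: measurable_rVB => //; apply: measurableT_comp.
- by move=> z; rewrite mule_ge0.
transitivity (\int[la]_x (f x * la B)); last first.
  by rewrite ge0_integralZr// intg.
apply: eq_integral => x _.
under eq_integral do rewrite muleC /=.
rewrite ge0_integralZl//; last first.
  by apply: measurableT_comp => //; apply: measurable_rVB.
congr (_ * _); rewrite -intg.
rewrite -[LHS](ge0_integral_rV_shift (T x))//; last first.
  by apply: measurableT_comp => //; apply: measurable_rVB.
apply: eq_integral => y _; rewrite /T reflect_rVD reflect_rVK opprD addrCA subrr addr0.
exact: gT.
Qed.

End reflection.
End lebesgue_rV_theory.

(** * Lower bounds for the variance of the field *)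

Section tent.
Context {R : realType} {k : nat}.
Local Notation la := (@lebesgue_rV R k).
Implicit Types y z : 'rV[R]_k.

Definition tent z : R := Num.max 0 (1 - enorm z).

Lemma tent_ge0 z : 0 <= tent z. Proof. by rewrite le_max lexx. Qed.

Lemma tent_le1 z : tent z <= 1.
Proof. by rewrite ge_max ler01 gerBl enorm_ge0. Qed.

Lemma tent_eq0 z : 1 <= enorm z -> tent z = 0.
Proof. by move=> z1; apply/max_idPl; rewrite subr_le0. Qed.

Lemma tent_lip y z : `|tent y - tent z| <= enorm (y - z).
Proof.
have h (a b : R) : `|Num.max 0 (1 - a) - Num.max 0 (1 - b)| <= `|a - b|.
  have h1 : a - b <= `|a - b| by exact: ler_norm.
  have h2 : b - a <= `|a - b| by rewrite distrC ler_norm.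
  by rewrite /Num.max; case: ltP => ?; case: ltP => ?; rewrite ler_norml; apply/andP; split; lra.
exact: le_trans (h _ _) (enorm_dist _ _).
Qed.

Lemma measurable_tent_comp d (T : measurableType d) (f : T -> 'rV[R]_k) :
  measurable_fun [set: T] f -> measurable_fun [set: T] (fun t => tent (f t)).
Proof.
move=> mf; apply: measurable_maxr => //; apply: measurable_funB => //.
exact: measurable_enorm.
Qed.

Lemma integrable_eball (h : 'rV[R]_k -> R) (C r : R) :
  measurable_fun [set: 'rV[R]_k] h -> (forall z, `|h z| <= C) ->
  (forall z, r < enorm z -> h z = 0) -> la.-integrable [set: 'rV[R]_k] (EFin \o h).
Proof.
move=> mh hC h0.
apply: (@le_integrable _ _ _ la setT measurableT _ (fun z => (C * \1_(eball r) z)%:E)).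
- exact/measurable_EFinP.
- move=> z _; rewrite /= lee_fin indicE; have [zr|zr] := boolP (z \in _).
    by rewrite mulr1 (le_trans (hC z))// ler_norm.
  rewrite h0 ?normr0// ltNge; apply: contra zr => zr; exact/mem_set.
have : la.-integrable [set: 'rV[R]_k] (fun z => (C%:E * (\1_(@eball R k r) z)%:E)%E).
  apply: integrableZl => //; apply/integrableP; split.
    by apply/measurable_EFinP/measurable_indic; exact: measurable_eball.
  under eq_integral do rewrite gee0_abs ?lee_fin//.
  by rewrite integral_indic ?setIT//; [exact: lebesgue_eball_fin|exact: measurable_eball].
by apply: eq_integrable => // z _.
Qed.

Definition tent_var y : R := \int[la]_z ((tent (z + y) - tent z) ^+ 2).

Lemma tent_out z y : 1 + enorm y < enorm z -> tent (z + y) = 0.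
Proof.
move=> zy; apply: tent_eq0; have := enormD (z + y) (- y).
by rewrite addrK enormN; lra.
Qed.

Lemma tentD_lt1 y z : `|tent y - tent z| <= 1.
Proof.
have := tent_ge0 y; have := tent_le1 y; have := tent_ge0 z; have := tent_le1 z.
by rewrite ler_norml => ? ? ? ?; apply/andP; split; lra.
Qed.

Lemma measurable_shift_rV y : measurable_fun [set: 'rV[R]_k] (fun z => z + y).
Proof. exact: measurable_rVD. Qed.

Lemma integrable_tent_var y1 y2 : la.-integrable [set: 'rV[R]_k]
  (EFin \o (fun z => (tent (z + y1) - tent (z + y2)) ^+ 2)).
Proof.
apply: (@integrable_eball _ 1 (1 + (enorm y1 + enorm y2))).
- apply: measurable_funX; apply: measurable_funB;
    by apply: measurable_tent_comp; exact: measurable_shift_rV.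
- by move=> z; rewrite normrX expr_le1// tentD_lt1.
- move=> z yz; rewrite !tent_out ?subrr ?expr0n//;
  by have := enorm_ge0 y1; have := enorm_ge0 y2; lra.
Qed.

Lemma tent_var_ge0 y : 0 <= tent_var y.
Proof. by apply: Rintegral_ge0 => z _; rewrite sqr_ge0. Qed.

Lemma tent_var0 : tent_var 0 = 0.
Proof.
rewrite /tent_var; under eq_Rintegral do rewrite addr0 subrr expr0n.
by rewrite /Rintegral integral0.
Qed.

Lemma tent_var_shift y1 y2 :
  \int[la]_z ((tent (z + y1) - tent (z + y2)) ^+ 2) = tent_var (y1 - y2).
Proof.
rewrite /tent_var /Rintegral; congr fine.
rewrite -[RHS](ge0_integral_rV_shift y2)//.
- by apply: eq_integral => z _; rewrite addrAC -addrA addrNK.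
- apply/measurable_EFinP; apply: measurable_funX; apply: measurable_funB;
    by apply: measurable_tent_comp => //; exact: measurable_shift_rV.
- by move=> z; rewrite lee_fin sqr_ge0.
Qed.

Lemma tent_var_enorm y1 y2 : enorm y1 = enorm y2 -> tent_var y1 = tent_var y2.
Proof.
move=> y12; rewrite -(reflect_rV_swap y12); set v := y1 - y2.
rewrite /tent_var /Rintegral; congr fine.
rewrite -[RHS](ge0_integral_reflect_rV v)//.
- apply: eq_integral => z _; rewrite -reflect_rVD /tent !enorm_reflect_rV//.
- apply/measurable_EFinP; apply: measurable_funX; apply: measurable_funB;
    by apply: measurable_tent_comp => //; exact: measurable_shift_rV.
- by move=> z; rewrite lee_fin sqr_ge0.
Qed.

Lemma tent_var_ub : exists V : R, forall y, tent_var y <= V * Num.min 1 (enorm y ^+ 2).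
Proof.
exists (2 * fine (la (eball 1))) => y.
pose h z : R := (\1_(@eball R k 1) z + \1_(@eball R k 1) (z + y)) * Num.min 1 (enorm y ^+ 2).
have mB : measurable (@eball R k 1) := @measurable_eball R k 1.
have min0 : 0 <= Num.min 1 (enorm y ^+ 2) by rewrite le_min ler01 sqr_ge0.
have le_h z : (tent (z + y) - tent z) ^+ 2 <= h z.
  have hsq : (tent (z + y) - tent z) ^+ 2 <= Num.min 1 (enorm y ^+ 2).
    rewrite le_min -real_normK ?num_real// expr_le1// tentD_lt1/=.
    rewrite ler_pXn2r ?nnegrE ?enorm_ge0//.
    by apply: (le_trans (tent_lip _ _)); rewrite addrAC subrr add0r.
  rewrite /h; have [z1|z1] := leP (enorm z) 1.
    rewrite indicE mem_set// mulrDl mul1r ler_wpDr// mulr_ge0//.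
  have [zy1|zy1] := leP (enorm (z + y)) 1.
    rewrite [\1__ (z + y)]indicE [_ \in _]mem_set// mulrDl mul1r ler_wpDl// mulr_ge0//.
  by rewrite (tent_eq0 (ltW z1)) (tent_eq0 (ltW zy1)) subrr expr0n/= mulr_ge0// addr_ge0.
have indE f : measurable_fun [set: 'rV[R]_k] f -> (forall z, f z = (\1_(@eball R k 1) z : R)%:E) ->
   (\int[la]_z f z = la (eball 1))%E.
  by move=> _ fE; under eq_integral do rewrite fE; rewrite integral_indic ?setIT.
have mi : measurable_fun [set: 'rV[R]_k] (fun z => (\1_(@eball R k 1) z : R)%:E).
  exact/measurable_EFinP/measurable_indic.
have mis : measurable_fun [set: 'rV[R]_k] (fun z => (\1_(@eball R k 1) (z + y) : R)%:E).
  by apply: (measurableT_comp mi); exact: measurable_shift_rV.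
have Bfin : (la (eball 1) \is a fin_num)%E.
  by rewrite ge0_fin_numE ?measure_ge0//; exact: lebesgue_eball_fin.
have Ih : (\int[la]_z (h z)%:E = ((2 * fine (la (eball 1)) * Num.min 1 (enorm y ^+ 2)))%:E)%E.
  under eq_integral do rewrite EFinM EFinD.
  rewrite ge0_integralZr//; last 2 first.
  - exact: emeasurable_funD.
  - by move=> z _; rewrite adde_ge0.
  rewrite ge0_integralD// (ge0_integral_rV_shift y (f := fun z => (\1_(@eball R k 1) z : R)%:E))//.
  by rewrite (indE _ mi)// -[in LHS](fineK Bfin) -EFinD -EFinM -mulr2n mulr_natl.
rewrite -lee_fin -Ih /tent_var /Rintegral fineK; last first.
  apply: integrable_fin_num => //.
  have := integrable_tent_var y 0; apply: eq_integrable => // z _ /=.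
  by rewrite addr0.
apply: ge0_le_integral => //.
- by move=> z _; rewrite lee_fin sqr_ge0.
- apply/measurable_EFinP; apply: measurable_funX; apply: measurable_funB;
    by apply: measurable_tent_comp => //; exact: measurable_shift_rV.
- apply/measurable_EFinP; apply: measurable_funM => //; apply: measurable_funD.
    exact: measurable_indic.
  exact/measurable_EFinP.
- by move=> z _; rewrite lee_fin.
Qed.

Lemma Rintegral_tent_gt0 y : 0 < \int[la]_z (tent (z + y) ^+ 2) /\
  \int[la]_z (tent (z + y) ^+ 2) = \int[la]_z (tent z ^+ 2).
Proof.
have mt : measurable_fun [set: 'rV[R]_k] (fun z => (tent z ^+ 2)%:E).
  apply/measurable_EFinP; apply: measurable_funX; exact: measurable_tent_comp.
have E : \int[la]_z (tent (z + y) ^+ 2) = \int[la]_z (tent z ^+ 2).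
  rewrite /Rintegral; congr fine.
  by rewrite (ge0_integral_rV_shift y (f := fun z => (tent z ^+ 2)%:E))// => z; rewrite lee_fin sqr_ge0.
split => //; rewrite E.
have it : la.-integrable [set: 'rV[R]_k] (EFin \o (fun z => tent z ^+ 2)).
  apply: (@integrable_eball _ 1 1) => [|z|z z1]; first exact/measurable_EFinP.
    by rewrite ger0_norm ?sqr_ge0// expr_le1 ?tent_ge0 ?tent_le1.
  by rewrite tent_eq0 ?expr0n// ltW.
rewrite -lte_fin /Rintegral fineK; last exact: integrable_fin_num.
apply: (@lt_le_trans _ _ (4^-1%:E * la (eball 2^-1))%E).
  by rewrite mule_gt0 ?lte_fin// lebesgue_eball_gt0.
have -> : (4^-1%:E * la (eball 2^-1) = \int[la]_z (4^-1%:E * (\1_(@eball R k 2^-1) z : R)%:E))%E.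
  rewrite ge0_integralZl//; last first.
    by apply/measurable_EFinP/measurable_indic; exact: measurable_eball.
  by rewrite integral_indic ?setIT//; exact: measurable_eball.
apply: ge0_le_integral => //.
- apply: measurable_funeM; apply/measurable_EFinP/measurable_indic; exact: measurable_eball.
- move=> z _; rewrite -EFinM lee_fin indicE; have [zr|zr] := boolP (z \in _); last first.
    by rewrite mulr0 sqr_ge0.
  have {}zr : enorm z <= 2^-1 by exact: set_mem zr.
  have zt : 2^-1 <= tent z by rewrite le_max; apply/orP; right; lra.
  by rewrite mulr1 (_ : 4^-1 = 2^-1 ^+ 2); [rewrite ler_pXn2r ?nnegrE ?tent_ge0//|rewrite exprVn; congr _^-1; ring].
Qed.

End tent.

Section Rintegral_sums.
Context d (T : measurableType d) (R : realType) (mu : {measure set T -> \bar R}).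

Lemma integrable_sum_seq (I : Type) (r : seq I) (f : I -> T -> R) :
  (forall i, mu.-integrable [set: T] (EFin \o f i)) ->
  mu.-integrable [set: T] (EFin \o (fun x => \sum_(i <- r) f i x)).
Proof.
move=> intf; elim: r => [|i r IH].
  by apply: eq_integrable (integrable0 _ _) => // x _ /=; rewrite big_nil.
apply: eq_integrable (integrableD measurableT (intf i) IH) => // x _ /=.
by rewrite big_cons EFinD.
Qed.

Lemma Rintegral_sum_seq (I : Type) (r : seq I) (f : I -> T -> R) :
  (forall i, mu.-integrable [set: T] (EFin \o f i)) ->
  \int[mu]_x (\sum_(i <- r) f i x) = \sum_(i <- r) \int[mu]_x f i x.
Proof.
move=> intf; elim: r => [|i r IH].
  by rewrite big_nil; under eq_Rintegral do rewrite big_nil; rewrite /Rintegral integral0.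
rewrite big_cons -IH; under eq_Rintegral do rewrite big_cons.
by rewrite RintegralD//; exact: integrable_sum_seq.
Qed.

Context (m : nat) (F : 'I_m -> T -> R) (v : 'I_m -> R).
Hypothesis intF : forall i, mu.-integrable [set: T] (EFin \o (fun x => F i x ^+ 2)).
Hypothesis intFB : forall i j,
  mu.-integrable [set: T] (EFin \o (fun x => (F i x - F j x) ^+ 2)).

Let f (ij : 'I_m * 'I_m) x := v ij.1 * v ij.2 / 2 *
  (F ij.1 x ^+ 2 + F ij.2 x ^+ 2 - (F ij.1 x - F ij.2 x) ^+ 2).

Let int3 ij : mu.-integrable [set: T] (EFin \o
  (fun x => F ij.1 x ^+ 2 + F ij.2 x ^+ 2 - (F ij.1 x - F ij.2 x) ^+ 2)).
Proof.
have := integrableB measurableT (integrableD measurableT (intF ij.1) (intF ij.2)) (intFB ij.1 ij.2).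
by apply: eq_integrable => // x _ /=; rewrite EFinB EFinD.
Qed.

Let intf ij : mu.-integrable [set: T] (EFin \o f ij).
Proof.
have := integrableZl measurableT (v ij.1 * v ij.2 / 2) (int3 ij).
by apply: eq_integrable => // x _ /=; rewrite EFinM.
Qed.

Let sqr_sumE x : (\sum_i v i * F i x) ^+ 2 = \sum_ij f ij x.
Proof.
rewrite expr2 mulr_suml -(pair_bigA _ (fun i j => f (i, j) x))/=.
apply: eq_bigr => i _; rewrite mulr_sumr; apply: eq_bigr => j _.
by rewrite /f /=; field.
Qed.

Lemma integrable_sqr_sum :
  mu.-integrable [set: T] (EFin \o (fun x => (\sum_i v i * F i x) ^+ 2)).
Proof.
apply: eq_integrable (integrable_sum_seq (index_enum _) intf) => // x _ /=.
by rewrite sqr_sumE.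
Qed.

Lemma Rintegral_sqr_sum : \int[mu]_x ((\sum_i v i * F i x) ^+ 2) =
  \sum_i \sum_j v i * v j / 2 * (\int[mu]_x (F i x ^+ 2) + \int[mu]_x (F j x ^+ 2) -
    \int[mu]_x ((F i x - F j x) ^+ 2)).
Proof.
under eq_Rintegral do rewrite sqr_sumE.
rewrite Rintegral_sum_seq// -(pair_bigA _ (fun i j => \int[mu]_x f (i, j) x))/=.
apply: eq_bigr => i _; apply: eq_bigr => j _.
have -> : \int[mu]_x f (i, j) x = v i * v j / 2 *
    \int[mu]_x (F i x ^+ 2 + F j x ^+ 2 - (F i x - F j x) ^+ 2).
  exact: (@RintegralZl _ _ _ mu setT _ (v i * v j / 2) measurableT (int3 (i, j))).
congr (_ * _).
rewrite RintegralB//; first by rewrite RintegralD.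
have := integrableD measurableT (intF i) (intF j).
by apply: eq_integrable => // x _ /=; rewrite EFinD.
Qed.

End Rintegral_sums.

Section exp_abs.
Context {R : realType}.
Notation mu := (@lebesgue_measure R).

Lemma integrable_expR_abs (e : R) : 0 < e ->
  mu.-integrable [set: R] (fun x => (expR (- (e * `|x|)))%:E).
Proof.
move=> e0.
have ch : continuous (fun x : R => expR (- (e * `|x|))).
  move=> x; apply: continuous_comp; last exact: continuous_expR.
  apply: cvgN; apply: cvgM; first exact: cvg_cst.
  exact: norm_continuous.
apply/integrableP; split.
  by apply/measurable_EFinP; exact: continuous_measurable_fun.
under eq_integral do rewrite gee0_abs ?lee_fin ?expR_ge0//.
rewrite ge0_symfun_integralT//; last by move=> x /=; rewrite normrN.
apply: lte_mul_pinfty => //.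
apply: (@le_lt_trans _ _ (\int[mu]_x (e^-1%:E * (exponential_pdf e x)%:E))%E); last first.
  rewrite ge0_integralZl//; last 3 first.
  - by apply/measurable_EFinP; exact: measurable_exponential_pdf.
  - by move=> x _; rewrite lee_fin exponential_pdf_ge0// ltW.
  - by rewrite lee_fin invr_ge0 ltW.
  by rewrite integral_exponential_pdf// mule1 ltry.
apply: (@le_trans _ _ (\int[mu]_(x in [set x : R | (0 <= x)%R]) (e^-1%:E * (exponential_pdf e x)%:E))%E).
  rewrite le_eqVlt; apply/orP; left; apply/eqP; apply: eq_integral => x; rewrite inE/= => x0.
  by rewrite exponential_pdfE// -EFinM mulrA mulVf ?gt_eqF// mul1r ger0_norm// mulNr.
have m0 : measurable [set x : R | 0 <= x] by rewrite -set_itvcy.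
apply: ge0_subset_integral => //.
- by apply: measurable_funeM; apply/measurable_EFinP; exact: measurable_exponential_pdf.
- by move=> x _; rewrite mule_ge0// lee_fin ?invr_ge0 ?exponential_pdf_ge0// ltW.
Qed.

End exp_abs.

Section fractional_form.
Context {R : realType} {k : nat} (H : R).
Hypothesis H01 : 0 < H < 1.
Local Notation la := (@lebesgue_rV R k).
Local Notation mu := (@lebesgue_measure R).

Let tv_fun (y : 'rV[R]_k) (x : R) := expR (- (2 * H * x)) * tent_var (expR x *: y).

Let measurable_tv_fun y : measurable_fun [set: R] (tv_fun y).
Proof.
apply: measurable_funM.
  by apply: measurableT_comp => //; apply: measurableT_comp => //.
apply/measurable_EFinP.
have m2 : measurable_fun [set: R * 'rV[R]_k]
    (fun z => ((tent (z.2 + expR z.1 *: y) - tent z.2) ^+ 2)%:E).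
  apply/measurable_EFinP; apply: measurable_funX; apply: measurable_funB.
    apply: measurable_tent_comp; apply: measurable_rVD => //; apply: measurable_rVZ => //.
    by apply: measurableT_comp.
  exact: measurable_tent_comp.
have z0 z : (0 <= (fun z : R * 'rV[R]_k => ((tent (z.2 + expR z.1 *: y) - tent z.2) ^+ 2)%:E) z)%E.
  by rewrite lee_fin sqr_ge0.
have := @measurable_fun_fubini_tonelli_F _ _ R _ R la _ m2 z0.
apply: eq_measurable_fun => x _; rewrite /fubini_F /= /tent_var /Rintegral fineK//.
apply: integrable_fin_num => //.
have := integrable_tent_var (expR x *: y) 0; apply: eq_integrable => // z _ /=.
by rewrite addr0.
Qed.

Let tv_fun_ge0 y x : 0 <= tv_fun y x.
Proof. by rewrite mulr_ge0 ?expR_ge0 ?tent_var_ge0. Qed.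

Let integrable_tv_fun y : mu.-integrable [set: R] (EFin \o tv_fun y).
Proof.
have [H0 H1] := andP H01.
have [V hV] := @tent_var_ub R k.
pose e := Num.min (2 * H) (2 - 2 * H).
have e0 : 0 < e by rewrite lt_min; apply/andP; split; lra.
pose C := `|V| * Num.max 1 (enorm y ^+ 2).
apply: (@le_integrable _ _ _ mu setT measurableT _ (fun x => (C%:E * (expR (- (e * `|x|)))%:E)%E)).
- by apply/measurable_EFinP; exact: measurable_tv_fun.
- move=> x _; rewrite -EFinM /= lee_fin ger0_norm//; apply: le_trans (ler_norm _).
  have C1 : tent_var (expR x *: y) <= C * Num.min 1 (expR x ^+ 2).
    apply: (le_trans (hV _)); rewrite enormZ exprMn (ger0_norm (expR_ge0 _)).
    have m0 : 0 <= Num.min 1 (expR x ^+ 2 * enorm y ^+ 2).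
      by rewrite le_min ler01 mulr_ge0 ?sqr_ge0.
    apply: (le_trans (ler_wpM2r m0 (ler_norm V))).
    rewrite /C -mulrA ler_wpM2l//.
    have M1 : 1 <= Num.max 1 (enorm y ^+ 2) by rewrite le_max lexx.
    have M2 : enorm y ^+ 2 <= Num.max 1 (enorm y ^+ 2) by rewrite le_max lexx orbT.
    have x2 : 0 <= expR x ^+ 2 by rewrite sqr_ge0.
    rewrite {2}/Num.min; case: ifPn => _.
      by rewrite mulr1 ge_min; apply/orP; left.
    by rewrite ge_min; apply/orP; right; rewrite mulrC ler_wpM2r.
  have C0 : 0 <= C by rewrite mulr_ge0// le_max ler01.
  rewrite /tv_fun; apply: (le_trans (ler_wpM2l (expR_ge0 _) C1)).
  have -> : expR x ^+ 2 = expR (2 * x) by rewrite expr2 -expRD; congr expR; ring.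
  rewrite mulrCA ler_wpM2l//.
  have [x0|x0] := leP x 0.
    apply: (@le_trans _ _ (expR (- (2 * H * x)) * expR (2 * x))).
      by rewrite ler_wpM2l ?expR_ge0// ge_min lexx orbT.
    rewrite -expRD ler_expR ler0_norm//.
    have : e <= 2 - 2 * H by rewrite ge_min lexx orbT.
    nra.
  apply: (@le_trans _ _ (expR (- (2 * H * x)) * 1)).
    by rewrite ler_wpM2l ?expR_ge0// ge_min lexx.
  rewrite mulr1 ler_expR gtr0_norm//.
  have : e <= 2 * H by rewrite ge_min lexx.
  nra.
- by apply: integrableZl => //; exact: integrable_expR_abs.
Qed.

Definition frac_const (e : 'rV[R]_k) : R := \int[mu]_x tv_fun e x.

Lemma Rintegral_tent_var (e y : 'rV[R]_k) : enorm e = 1 ->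
  \int[mu]_x tv_fun y x = frac_const e * enorm y `^ (2 * H).
Proof.
move=> e1; have [H0 H1] := andP H01.
have [->|y0] := eqVneq y 0.
  rewrite enorm0 powR0 ?mulf_neq0 ?gt_eqF// mulr0 /tv_fun.
  under eq_Rintegral do rewrite scaler0 tent_var0 mulr0.
  by rewrite /Rintegral integral0.
have y1 : 0 < enorm y by rewrite enorm_gt0.
pose L := ln (enorm y).
transitivity (\int[mu]_x (expR (2 * H * L) * tv_fun e (x + L))).
  apply: eq_Rintegral => x _; rewrite /tv_fun mulrA -expRD; congr (_ * _).
    by congr expR; ring.
  apply: tent_var_enorm; rewrite !enormZ e1 mulr1 !(ger0_norm (expR_ge0 _)).
  by rewrite expRD /L lnK.
have mshift : measurable_fun [set: R] (fun x => (tv_fun e (x + L))%:E).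
  apply/measurable_EFinP; apply: (measurableT_comp (measurable_tv_fun e)).
  exact: measurable_funD.
rewrite /Rintegral; under eq_integral do rewrite EFinM.
rewrite ge0_integralZl//; last first.
  by move=> x _; rewrite lee_fin; exact: tv_fun_ge0.
rewrite (ge0_integral_shift L (f := fun x => (tv_fun e x)%:E)); last 2 first.
- by apply/measurable_EFinP; exact: measurable_tv_fun.
- by move=> x; rewrite lee_fin; exact: tv_fun_ge0.
rewrite fineM//; last exact: integrable_fin_num (integrable_tv_fun e).
rewrite mulrC /= /frac_const /Rintegral; congr (_ * _).
by rewrite /powR gt_eqF// /L.
Qed.

Definition frac_cov (s t : 'rV[R]_k) : R :=
  (enorm s `^ (2 * H) + enorm t `^ (2 * H) - enorm (s - t) `^ (2 * H)) / 2.

Definition frac_form m (t : 'I_m -> 'rV[R]_k) (v : 'I_m -> R) : R :=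
  \sum_i \sum_j v i * v j * frac_cov (t i) (t j).

Let feature m (t : 'I_m -> 'rV[R]_k) (x : R) i z := tent (z + expR x *: t i) - tent z.

Let int_feature m (t : 'I_m -> 'rV[R]_k) (x : R) i :
  la.-integrable [set: 'rV[R]_k] (EFin \o (fun z => feature t x i z ^+ 2)).
Proof.
have := integrable_tent_var (expR x *: t i) 0; apply: eq_integrable => // z _ /=.
by rewrite addr0.
Qed.

Let int_featureB m (t : 'I_m -> 'rV[R]_k) (x : R) i j : la.-integrable [set: 'rV[R]_k]
  (EFin \o (fun z => (feature t x i z - feature t x j z) ^+ 2)).
Proof.
have := integrable_tent_var (expR x *: t i) (expR x *: t j); apply: eq_integrable => // z _ /=.
by rewrite /feature opprB addrA addrNK.
Qed.

Let features m (t : 'I_m -> 'rV[R]_k) v x :=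
  \int[la]_z ((\sum_i v i * feature t x i z) ^+ 2).

Let featuresE m (t : 'I_m -> 'rV[R]_k) v x : expR (- (2 * H * x)) * features t v x =
  \sum_ij (v ij.1 * v ij.2 / 2 * (tv_fun (t ij.1) x + tv_fun (t ij.2) x
    - tv_fun (t ij.1 - t ij.2) x)).
Proof.
rewrite /features Rintegral_sqr_sum// mulr_sumr.
rewrite -(pair_bigA _ (fun i j => v i * v j / 2 * (tv_fun (t i) x + tv_fun (t j) x
    - tv_fun (t i - t j) x)))/=.
apply: eq_bigr => i _; rewrite mulr_sumr; apply: eq_bigr => j _.
have E : \int[la]_z ((feature t x i z - feature t x j z) ^+ 2) = tent_var (expR x *: (t i - t j)).
  rewrite scalerBr -tent_var_shift; apply: eq_Rintegral => z _.
  by rewrite /feature opprB addrA addrNK.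
have E1 i' : \int[la]_z (feature t x i' z ^+ 2) = tent_var (expR x *: t i') by [].
rewrite E !E1 /tv_fun.
move: (tent_var (expR x *: t i)) (tent_var (expR x *: t j)) => a b.
move: (tent_var (expR x *: (t i - t j))) (expR (- (2 * H * x))) => c w.
by ring.
Qed.

Let Kint y := \int[mu]_x tv_fun y x.

Let KintE (e y : 'rV[R]_k) : enorm e = 1 -> Kint y = frac_const e * enorm y `^ (2 * H).
Proof. by move=> e1; exact: Rintegral_tent_var. Qed.

Let KintB (y1 y2 y3 : 'rV[R]_k) :
  \int[mu]_x (tv_fun y1 x + tv_fun y2 x - tv_fun y3 x) = Kint y1 + Kint y2 - Kint y3.
Proof.
have intD : mu.-integrable [set: R] (EFin \o (fun x => tv_fun y1 x + tv_fun y2 x)).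
  have := integrableD measurableT (integrable_tv_fun y1) (integrable_tv_fun y2).
  by apply: eq_integrable => // x _ /=; rewrite EFinD.
rewrite (RintegralB measurableT intD (integrable_tv_fun y3)).
by rewrite (RintegralD measurableT (integrable_tv_fun y1) (integrable_tv_fun y2)).
Qed.

Lemma frac_formE (e : 'rV[R]_k) m (t : 'I_m -> 'rV[R]_k) v : enorm e = 1 ->
  frac_const e * frac_form t v = \int[mu]_x (expR (- (2 * H * x)) * features t v x) /\
  mu.-integrable [set: R] (EFin \o (fun x => expR (- (2 * H * x)) * features t v x)).
Proof.
move=> e1.
have int3 (ij : 'I_m * 'I_m) : mu.-integrable [set: R] (EFin \o
    (fun x => tv_fun (t ij.1) x + tv_fun (t ij.2) x - tv_fun (t ij.1 - t ij.2) x)).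
  have := integrableB measurableT (integrableD measurableT (integrable_tv_fun (t ij.1))
    (integrable_tv_fun (t ij.2))) (integrable_tv_fun (t ij.1 - t ij.2)).
  by apply: eq_integrable => // x _ /=; rewrite EFinB EFinD.
have intv (ij : 'I_m * 'I_m) : mu.-integrable [set: R] (EFin \o (fun x =>
    v ij.1 * v ij.2 / 2 * (tv_fun (t ij.1) x + tv_fun (t ij.2) x - tv_fun (t ij.1 - t ij.2) x))).
  have := integrableZl measurableT (v ij.1 * v ij.2 / 2) (int3 ij).
  by apply: eq_integrable => // x _ /=; rewrite EFinM.
split; last first.
  apply: eq_integrable (integrable_sum_seq (index_enum _) intv) => // x _ /=.
  by rewrite featuresE.
under eq_Rintegral do rewrite featuresE.
rewrite Rintegral_sum_seq// -(pair_bigA _ (fun i j => \int[mu]_x (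
    v i * v j / 2 * (tv_fun (t i) x + tv_fun (t j) x - tv_fun (t i - t j) x))))/=.
rewrite /frac_form mulr_sumr; apply: eq_bigr => i _; rewrite mulr_sumr; apply: eq_bigr => j _.
have -> := @RintegralZl _ _ _ mu setT _ (v i * v j / 2) measurableT (int3 (i, j)).
rewrite /= KintB (KintE (t i) e1) (KintE (t j) e1) (KintE (t i - t j) e1) /frac_cov.
move: (frac_const e) (enorm (t i) `^ (2 * H)) => w a.
move: (enorm (t j) `^ (2 * H)) (enorm (t i - t j) `^ (2 * H)) => b c.
by field.
Qed.

Let features_ge0 m (t : 'I_m -> 'rV[R]_k) v x : 0 <= features t v x.
Proof. by apply: Rintegral_ge0 => z _; rewrite sqr_ge0. Qed.

Let W := \int[la]_z (tent (z : 'rV[R]_k) ^+ 2).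

Let features_lower m (t : 'I_m -> 'rV[R]_k) (v : 'I_m -> R) (rho x : R) (J : pred 'I_m) :
  (forall j, J j -> rho <= enorm (t j) /\
    forall i, i != j -> v i = 0 \/ rho <= enorm (t i - t j)) ->
  2 <= expR x * rho -> W * \sum_(j | J j) v j ^+ 2 <= features t v x.
Proof.
move=> Jt xrho; have far (y : 'rV[R]_k) : rho <= enorm y -> 2 <= enorm (expR x *: y).
  move=> ry; rewrite enormZ (ger0_norm (expR_ge0 _)).
  by apply: (le_trans xrho); rewrite ler_wpM2l ?expR_ge0.
have int_t (y : 'rV[R]_k) : la.-integrable [set: 'rV[R]_k] (EFin \o (fun z => tent (z + y) ^+ 2)).
  apply: (@integrable_eball _ _ _ 1 (1 + enorm y)).
  - by apply: measurable_funX; apply: measurable_tent_comp; exact: measurable_shift_rV.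
  - by move=> z; rewrite ger0_norm ?sqr_ge0// expr_le1 ?tent_ge0 ?tent_le1.
  - by move=> z yz; rewrite tent_out// expr0n.
have int_vt j : la.-integrable [set: 'rV[R]_k]
    (EFin \o (fun z => if J j then v j ^+ 2 * tent (z + expR x *: t j) ^+ 2 else 0)).
  case: (J j); last exact: integrable0.
  have := integrableZl measurableT (v j ^+ 2) (int_t (expR x *: t j)).
  by apply: eq_integrable => // z _ /=; rewrite EFinM.
have -> : W * \sum_(j | J j) v j ^+ 2 =
    \int[la]_z (\sum_j (if J j then v j ^+ 2 * tent (z + expR x *: t j) ^+ 2 else 0)).
  rewrite Rintegral_sum_seq// mulr_sumr big_mkcond; apply: eq_bigr => j _.
  case: (J j); last by rewrite /Rintegral integral0.
  have -> := @RintegralZl _ _ _ la setT _ (v j ^+ 2) measurableT (int_t (expR x *: t j)).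
  by have [_ ->] := Rintegral_tent_gt0 (expR x *: t j); rewrite mulrC.
apply: le_Rintegral => //; first exact: integrable_sum_seq.
  exact: integrable_sqr_sum.
move=> z _; have [[j /and3P[Jj vj0 tj]]|nex] := pselect (exists j,
    [&& J j, v j != 0 & enorm (z + expR x *: t j) < 1]).
  have [tj2 tij] := Jt j Jj.
  have z0 : tent z = 0.
    apply: tent_eq0; have := far _ tj2.
    have := enormD (z + expR x *: t j) (- z); rewrite addrAC subrr add0r enormN; lra.
  have i0 i : i != j -> v i = 0 \/ tent (z + expR x *: t i) = 0.
    move=> ij; have [->|tij2] := tij _ ij; [by left|right].
    apply: tent_eq0; have := far _ tij2.
    have := enormD (z + expR x *: t i) (- (z + expR x *: t j)).
    have -> : z + expR x *: t i - (z + expR x *: t j) = expR x *: (t i - t j).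
      by rewrite opprD addrACA subrr add0r -scalerBr.
    by rewrite enormN; lra.
  rewrite [leLHS](bigD1 j)//= Jj big1 ?addr0; last first.
    move=> i ij; case: ifP => // _.
    by have [->|->] := i0 _ ij; rewrite expr0n ?mul0r ?mulr0.
  rewrite [in leRHS](bigD1 j)//= [X in (_ + X) ^+ 2]big1 ?addr0; last first.
    move=> i ij; rewrite /feature z0 subr0.
    by have [->|->] := i0 _ ij; rewrite ?mul0r ?mulr0.
  by rewrite /feature z0 subr0 exprMn.
rewrite big1 ?sqr_ge0// => j _; case: ifP => // Jj.
have [->|vj] := eqVneq (v j) 0; first by rewrite expr0n mul0r.
rewrite tent_eq0 ?expr0n ?mulr0// leNgt; apply/negP => tj; apply: nex.
by exists j; rewrite Jj vj.
Qed.

(* The fields on small balls around the points t_j with j in J are independent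
   pieces of the moving average representation of the process. *)
Lemma frac_form_lower : (0 < k)%N -> exists2 K, 0 < K &
  forall m (t : 'I_m -> 'rV[R]_k) (v : 'I_m -> R) (rho : R) (J : pred 'I_m), 0 < rho ->
  (forall j, J j -> rho <= enorm (t j) /\
    forall i, i != j -> v i = 0 \/ rho <= enorm (t i - t j)) ->
  rho `^ (2 * H) * \sum_(j | J j) v j ^+ 2 <= K * frac_form t v.
Proof.
move=> k0; have [H0 H1] := andP H01.
pose e : 'rV[R]_k := delta_mx ord0 (Ordinal k0).
have e1 : enorm e = 1.
  rewrite /enorm /dot (bigD1 (Ordinal k0))//= big1; last first.
    by move=> i i0; rewrite mxE (negbTE i0) andbF mul0r.
  by rewrite mxE !eqxx mulr1 addr0 sqrtr1.
have W0 : 0 < W.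
  by have [] := @Rintegral_tent_gt0 R k 0; under eq_Rintegral do rewrite addr0.
pose c := expR (- (2 * H * (ln 2 + 1))) * W.
have c0 : 0 < c by rewrite mulr_gt0 ?expR_gt0.
have key m (t : 'I_m -> 'rV[R]_k) (v : 'I_m -> R) (rho : R) (J : pred 'I_m) : 0 < rho ->
  (forall j, J j -> rho <= enorm (t j) /\
    forall i, i != j -> v i = 0 \/ rho <= enorm (t i - t j)) ->
  c * (rho `^ (2 * H) * \sum_(j | J j) v j ^+ 2) <= frac_const e * frac_form t v.
  move=> rho0 Jt; have [-> intf] := frac_formE t v e1.
  pose L := ln 2 - ln rho.
  set S := \sum_(j | J j) _.
  have S0 : 0 <= S by apply: sumr_ge0 => j _; rewrite sqr_ge0.
  have -> : c * (rho `^ (2 * H) * S) =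
      \int[mu]_x (\1_`[L, (L + 1)%R] x * (expR (- (2 * H * (L + 1))) * (W * S))).
    rewrite /Rintegral; under eq_integral do rewrite EFinM.
    rewrite ge0_integralZr//; last 2 first.
    - by apply/measurable_EFinP/measurable_indic.
    - by rewrite lee_fin !mulr_ge0 ?expR_ge0// ltW.
    have muL : mu `[L, (L + 1)%R]%classic = 1%E.
      rewrite lebesgue_measure_itv/= lte_fin ltrDl ltr01 -EFinB.
      by congr EFin; ring.
    have muI : (\int[mu]_x (\1_`[L, (L + 1)%R] x : R)%:E = 1)%E.
      by rewrite integral_indic// setIT; exact: muL.
    rewrite muI mul1e /=.
    rewrite /c /powR gt_eqF// !mulrA; congr (_ * _).
    rewrite mulrAC -expRD; congr (expR _ * _); rewrite /L; lra.
  apply: le_Rintegral => //.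
  - have := integrableZl measurableT (expR (- (2 * H * (L + 1))) * (W * S))
      (@integrable_indic_itv _ L (L + 1) true false).
    by apply: eq_integrable => // x _ /=; rewrite -EFinM mulrC.
  - move=> x _; rewrite indicE; have [xL|xL] := boolP (x \in _); last first.
      by rewrite mul0r mulr_ge0 ?expR_ge0.
    have {xL} : x \in `[L, (L + 1)%R] by move/set_mem: xL.
    rewrite in_itv/= => /andP[xL xL1]; rewrite mul1r.
    apply: ler_pM; rewrite ?expR_ge0// ?mulr_ge0 ?(ltW W0)//.
      by rewrite ler_expR lerN2 ler_wpM2l// mulr_ge0// ltW.
    apply: (@features_lower _ _ _ rho) => //.
    rewrite -[X in _ * X]lnK ?posrE// -expRD -[leLHS]lnK ?posrE// ler_expR.
    by move: xL; rewrite /L; lra.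
have K0 : 0 < frac_const e.
  have := key 1%N (fun=> e) (fun=> 1) 1 predT ltr01.
  rewrite powR1 mul1r big_ord1 expr1n mulr1 /frac_form !big_ord1 /frac_cov subrr enorm0 e1.
  rewrite powR1 powR0 ?mulf_neq0 ?gt_eqF// !mul1r subr0 -[1 + 1]/(2%:R) divff ?pnatr_eq0// mulr1.
  move=> h; apply: lt_le_trans c0 (h _) => j _; split=> // i.
  by rewrite (ord1 i) (ord1 j) eqxx.
exists (frac_const e / c); first by rewrite divr_gt0.
move=> m t v rho J rho0 Jt.
by rewrite mulrAC ler_pdivlMr// mulrC; exact: key.
Qed.

End fractional_form.

(** * Gaussian random variables *)

Section density.
Context d (T : measurableType d) (R : realType).
Local Open Scope ereal_scope.
Import HBNNSimple.

Lemma integral_pushforward_all d' (Y : measurableType d') (mu : {measure set T -> \bar R})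
    (h : T -> Y) (f : Y -> \bar R) :
  measurable_fun [set: T] h -> measurable_fun [set: Y] f ->
  \int[pushforward mu h]_y f y = \int[mu]_x f (h x).
Proof.
move=> mh mf; rewrite [LHS]integralE [RHS]integralE.
have H (k : Y -> \bar R) : measurable_fun [set: Y] k -> (forall y, 0 <= k y) ->
    \int[pushforward mu h]_y k y = \int[mu]_x k (h x).
  move=> mk k0.
  have := @ge0_integral_pushforward _ _ _ _ _ _ mh mu setT k measurableT mk.
  by rewrite preimage_setT => -> // y _.
congr (_ - _).
  transitivity (\int[mu]_x f^\+ (h x)).
    by apply: H => //; exact: measurable_funepos.
  by apply: eq_integral => x _; rewrite !funeposE.
transitivity (\int[mu]_x f^\- (h x)).
  by apply: H => //; exact: measurable_funeneg.
by apply: eq_integral => x _; rewrite !funenegE.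
Qed.

Variables (mu nu : {measure set T -> \bar R}) (g : T -> R).
Hypothesis mg : measurable_fun [set: T] g.
Hypothesis g0 : forall x, (0 <= g x)%R.
Hypothesis nuE : forall A, measurable A -> nu A = \int[mu]_(x in A) (g x)%:E.

Let mge : measurable_fun [set: T] (fun x => (g x)%:E).
Proof. exact/measurable_EFinP. Qed.

Let nnsfun_density (h : {nnsfun T >-> R}) :
  \int[nu]_x (h x)%:E = \int[mu]_x ((h x)%:E * (g x)%:E).
Proof.
rewrite integralT_nnsfun sintegralE.
transitivity (\int[mu]_x (\sum_(r \in range h) ((r * \1_(h @^-1` [set r]) x)%:E * (g x)%:E))); last first.
  apply: eq_integral => x _; rewrite [in RHS]fimfunE -fsumEFin// ge0_mule_fsuml//.
  by move=> r; exact: nnfun_muleindic_ge0.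
rewrite ge0_integral_fsum//; last 2 first.
- move=> r; apply: emeasurable_funM => //.
  by apply/measurable_EFinP; apply: measurable_funM => //; exact: measurable_indic.
- by move=> r x _; rewrite mule_ge0 ?lee_fin//; exact: nnfun_muleindic_ge0.
apply: eq_fsbigr => r _.
have [r0|r0] := ltP r 0%R.
  rewrite preimage_nnfun0// measure0 mule0.
  by apply/esym/integral0_eq => x _; rewrite indic0 mulr0 mul0e.
rewrite nuE// -ge0_integralZl//.
- rewrite integral_mkcond; apply: eq_integral => x _.
  rewrite patchE EFinM indicE; case: ifPn => _; first by rewrite mule1.
  by rewrite mule0 mul0e.
- exact: measurable_funTS.
- by move=> x _; rewrite lee_fin.
Qed.

Lemma ge0_integral_density (f : T -> \bar R) : measurable_fun [set: T] f ->
  (forall x, 0 <= f x) -> \int[nu]_x f x = \int[mu]_x (f x * (g x)%:E).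
Proof.
move=> mf f0; pose h := nnsfun_approx measurableT mf.
have hf x : EFin \o h ^~ x @ \oo --> f x by exact: cvg_nnsfun_approx.
have nd x : nondecreasing_seq (fun n => (h n x)%:E).
  by move=> a b ab; rewrite lee_fin; have /lefP := nd_nnsfun_approx measurableT mf ab; exact.
transitivity (limn (fun n => \int[nu]_x (h n x)%:E)).
  rewrite -monotone_convergence//.
  - by apply: eq_integral => x _; apply/esym/cvg_lim => //; exact: hf.
  - by move=> n; exact/measurable_EFinP.
  - by move=> n x _; rewrite lee_fin.
under eq_fun do rewrite nnsfun_density.
rewrite -monotone_convergence//.
- apply: eq_integral => x _; apply/cvg_lim => //; apply: cvgeMr => //.
  exact: hf.
- by move=> n; apply: emeasurable_funM => //; exact/measurable_EFinP.
- by move=> n x _; rewrite mule_ge0 ?lee_fin.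
- by move=> x _ a b ab; rewrite lee_wpmul2r ?lee_fin//; have := nd x a b ab; rewrite lee_fin.
Qed.

Lemma integral_density (f : T -> \bar R) : measurable_fun [set: T] f ->
  \int[nu]_x f x = \int[mu]_x (f x * (g x)%:E).
Proof.
move=> mf; rewrite [LHS]integralE [RHS]integralE; congr (_ - _).
  rewrite ge0_integral_density//; last exact: measurable_funepos.
  by apply: eq_integral => x _; rewrite !funeposE maxe_pMl ?lee_fin ?mul0e//.
rewrite ge0_integral_density//; last exact: measurable_funeneg.
by apply: eq_integral => x _; rewrite !funenegE maxe_pMl ?lee_fin ?mul0e ?mulNe//.
Qed.

End density.

Section gaussian.
Context d (T : measurableType d) (R : realType) (P : probability T R).
Notation mu := (@lebesgue_measure R).

Lemma integral_shift (a : R) (f : R -> \bar R) : measurable_fun [set: R] f ->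
  (\int[mu]_x f (x + a)%R = \int[mu]_x f x)%E.
Proof.
move=> mf; rewrite [LHS]integralE [RHS]integralE; congr (_ - _)%E.
  rewrite -(ge0_integral_shift a (f := f^\+%E))//.
    by apply: eq_integral => x _; rewrite !funeposE.
  exact: measurable_funepos.
rewrite -(ge0_integral_shift a (f := f^\-%E))//.
  by apply: eq_integral => x _; rewrite !funenegE.
exact: measurable_funeneg.
Qed.

Definition gauss_norm (a : R) : R := (Num.sqrt (pi / a))^-1.

Lemma gauss_norm_gt0 a : 0 < a -> 0 < gauss_norm a.
Proof. by move=> a0; rewrite invr_gt0 sqrtr_gt0 divr_gt0// pi_gt0. Qed.

Lemma normal_pdf_shift m s x : s != 0 -> normal_pdf m s (x + m) =
  gauss_norm (2 * s ^+ 2)^-1 * gauss (2 * s ^+ 2)^-1 x.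
Proof.
move=> s0; rewrite /normal_pdf (negbTE s0) /normal_peak /normal_fun addrK.
rewrite /gauss_norm invrK /gauss; congr (_^-1 * expR _).
  by congr Num.sqrt; rewrite -mulr_natr; ring.
by rewrite mulNr mulrC -mulr_natr (mulrC 2).
Qed.

Section law.
Variables (X : T -> R) (m s : R).
Hypothesis mX : measurable_fun [set: T] X.
Hypothesis XE : forall A : set R, measurable A -> P (X @^-1` A) = gaussian_law m s A.

Lemma integral_normal_law (f : R -> \bar R) : s != 0 -> measurable_fun [set: R] f ->
  (\int[P]_w f (X w) = \int[mu]_x (f (x + m)%R *
    (gauss_norm (2 * s ^+ 2)^-1 * gauss (2 * s ^+ 2)^-1 x)%:E))%E.
Proof.
move=> s0 mf; have mX' : measurable_fun [set: T] (X : T -> measurableTypeR R) := mX.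
rewrite -(integral_pushforward_all P mX' mf).
rewrite (@integral_density _ _ R mu
  (measure_function_pushforward__canonical__measure_function_Measure P mX')
  (normal_pdf m s))//.
- rewrite -[LHS](integral_shift m); last first.
    by apply: emeasurable_funM => //; apply/measurable_EFinP; exact: measurable_normal_pdf.
  by apply: eq_integral => x _; rewrite normal_pdf_shift.
- exact: measurable_normal_pdf.
- by move=> x; exact: normal_pdf_ge0.
- by move=> A mA; have := XE mA; rewrite /gaussian_law (negbTE s0); exact.
Qed.

Lemma integral_dirac_law (f : R -> \bar R) : s = 0 -> measurable_fun [set: R] f ->
  (\int[P]_w f (X w) = f m)%E.
Proof.
move=> s0 mf; rewrite -(integral_pushforward_all P mX mf).
rewrite (eq_measure_integral (\d_ m)); first by rewrite integral_dirac// diracT mul1e.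
by move=> A mA _; rewrite /= /pushforward XE// /gaussian_law s0 eqxx.
Qed.

End law.

Section moments.
Variable a : R.
Hypothesis a0 : 0 < a.

Lemma integrable_poly_gauss (c0 c1 c2 : R) : mu.-integrable [set: R]
  (fun x => ((c0 + c1 * x + c2 * x ^+ 2) * gauss a x)%:E).
Proof.
apply: (integrable_mul_gauss a0 (C := `|c0| + `|c1| + `|c2|)).
  apply: measurable_funD; first by apply: measurable_funD => //; exact: measurable_funM.
  by apply: measurable_funM => //; exact: measurable_funX.
move=> x.
have x1 : `|x| <= 1 + x ^+ 2.
  have [u1|u1] := leP `|x| 1; first by rewrite (le_trans u1)// lerDl sqr_ge0.
  by rewrite -real_normK ?num_real// ler_wpDl// expr2 ler_peMr// ltW.
have x2 : 0 <= x ^+ 2 := sqr_ge0 x.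
apply: (le_trans (ler_normD _ _)); rewrite !mulrDl lerD//; last first.
  by rewrite normrM (ger0_norm x2) ler_wpM2l// lerDr.
apply: (le_trans (ler_normD _ _)); rewrite lerD//.
  by rewrite ler_peMr// lerDl.
by rewrite normrM ler_wpM2l.
Qed.

Lemma Rintegral_poly_gauss (c0 c1 c2 : R) :
  \int[mu]_x ((c0 + c1 * x + c2 * x ^+ 2) * gauss a x) =
  (c0 + c2 / (2 * a)) * Num.sqrt (pi / a).
Proof.
have a20 : 0 < 2 * a by rewrite mulr_gt0.
pose h (x : R) : R := - (c1 / (2 * a)) + - (c2 / (2 * a)) * x.
have dh (x : R) : is_derive x (1 : R) h (- (c2 / (2 * a))).
  by apply: is_derive_eq; rewrite /GRing.scale/=; ring.
have hE (x : R) : - (c2 / (2 * a)) - 2 * a * x * h x = - (c2 / (2 * a)) + c1 * x + c2 * x ^+ 2.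
  by rewrite /h; field; rewrite gt_eqF.
have bnd (b0 b1 b2 x : R) : `|b0 + b1 * x + b2 * x ^+ 2| <= (`|b0| + `|b1| + `|b2|) * (1 + x ^+ 2).
  have x1 : `|x| <= 1 + x ^+ 2.
    have [u1|u1] := leP `|x| 1; first by rewrite (le_trans u1)// lerDl sqr_ge0.
    by rewrite -real_normK ?num_real// ler_wpDl// expr2 ler_peMr// ltW.
  have x2 : 0 <= x ^+ 2 := sqr_ge0 x.
  apply: (le_trans (ler_normD _ _)); rewrite !mulrDl lerD//; last first.
    by rewrite normrM (ger0_norm x2) ler_wpM2l// lerDr.
  apply: (le_trans (ler_normD _ _)); rewrite lerD//.
    by rewrite ler_peMr// lerDl.
  by rewrite normrM ler_wpM2l.
pose K := (`|c1 / (2 * a)| + `|c2 / (2 * a)|) + (`|c2 / (2 * a)| + `|c1| + `|c2|).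
have := @gauss_ibp R a a0 h (fun=> - (c2 / (2 * a))) K dh.
have -> : (\int[mu]_x ((- (c2 / (2 * a)) - 2 * a * x * h x) * gauss a x)) =
   \int[mu]_x ((c0 + c1 * x + c2 * x ^+ 2) * gauss a x) - (c0 + c2 / (2 * a)) * Num.sqrt (pi / a).
  rewrite -Rintegral_gauss//.
  have -> : (c0 + c2 / (2 * a)) * \int[mu]_x gauss a x =
      \int[mu]_x ((c0 + c2 / (2 * a)) * gauss a x).
    by rewrite RintegralZl//; exact: integrable_gauss.
  rewrite -RintegralB//.
  - by apply: eq_Rintegral => x _; rewrite hE; ring.
  - exact: integrable_poly_gauss.
  - have := integrable_poly_gauss (c0 + c2 / (2 * a)) 0 0.
    by apply: eq_integrable => // x _ /=; rewrite !mul0r !addr0.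
move=> ibp; apply/eqP; rewrite -subr_eq0; apply/eqP; apply: ibp.
- by move=> x; exact: cvg_cst.
- move=> x; have := bnd (- (c1 / (2 * a))) (- (c2 / (2 * a))) 0 x.
  rewrite mul0r addr0 normr0 addr0 !normrN => /le_trans; apply.
  by rewrite ler_wpM2r ?addr_ge0 ?sqr_ge0// lerDl !addr_ge0.
- move=> x; rewrite hE; apply: (le_trans (bnd _ _ _ _)).
  by rewrite normrN ler_wpM2r ?addr_ge0 ?sqr_ge0// lerDr addr_ge0.
Qed.

End moments.

Section gaussian_rv.
Variable X : T -> R.
Hypothesis gX : gaussian_rv P X.
Hypothesis X0 : (\int[P]_w (X w)%:E = 0)%E.

Let main : exists2 s2 : R, 0 <= s2 & [/\
  P.-integrable [set: T] (EFin \o (fun w => X w ^+ 2)),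
  \int[P]_w (X w ^+ 2) = s2,
  forall c, \int[P]_w cos (X w + c) = cos c * expR (- (s2 / 2)) &
  forall v, s2 <= v -> 0 < v -> (\int[P]_w (expR (X w ^+ 2 / (4 * v)))%:E <= 2%:E)%E].
Proof.
have [mX [m [s XE]]] := gX.
have mX2 : measurable_fun [set: R] (fun x : R => (x ^+ 2)%:E).
  by apply/measurable_EFinP; exact: measurable_funX.
have mcos c : measurable_fun [set: R] (fun x : R => (cos (x + c))%:E).
  apply/measurable_EFinP; apply: measurableT_comp; last exact: measurable_funD.
  by apply: continuous_measurable_fun; exact: continuous_cos.
have mexp v : measurable_fun [set: R] (fun x : R => (expR (x ^+ 2 / (4 * v)))%:E).
  apply/measurable_EFinP; apply: measurableT_comp => //.
  by apply: measurable_funM => //; exact: measurable_funX.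
have mid : measurable_fun [set: R] (fun x : R => x%:E) by exact/measurable_EFinP.
have mPX2 : measurable_fun [set: T] (EFin \o (fun w => X w ^+ 2)).
  by apply/measurable_EFinP; exact: measurable_funX.
exists (s ^+ 2); first exact: sqr_ge0.
have [s0|s0] := eqVneq s 0.
  have E := integral_dirac_law mX XE s0.
  have m0 : m = 0 by have := E _ mid; rewrite X0 => -[].
  have E2 := E _ mX2; rewrite m0 expr0n/= in E2.
  rewrite s0 expr0n /=; split.
  - apply/integrableP; split => //.
    under eq_integral do rewrite /= ger0_norm ?sqr_ge0//.
    by rewrite E2 ltry.
  - by rewrite /Rintegral E2.
  - by move=> c; rewrite /Rintegral (E _ (mcos c)) m0 add0r mul0r oppr0 expR0 mulr1.
  - by move=> v _ v0; rewrite (E _ (mexp v)) m0 expr0n mul0r expR0 lee_fin ler1n.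
pose a := (2 * s ^+ 2)^-1.
have s20 : 0 < s ^+ 2 by rewrite exprn_even_gt0.
have a0 : 0 < a by rewrite invr_gt0 mulr_gt0.
have q0 : 0 < gauss_norm a := gauss_norm_gt0 a0.
have q1 : gauss_norm a * Num.sqrt (pi / a) = 1.
  by rewrite /gauss_norm mulVf// gt_eqF// sqrtr_gt0 divr_gt0// pi_gt0.
have E (f : R -> \bar R) : measurable_fun [set: R] f ->
    (\int[P]_w f (X w) = \int[mu]_x (f (x + m)%R * (gauss_norm a * gauss a x)%:E))%E.
  by move=> mf; rewrite (integral_normal_law mX XE).
have poly c0 c1 c2 : (\int[mu]_x ((c0 + c1 * x + c2 * x ^+ 2) * (gauss_norm a * gauss a x))%:E =
    (c0 + c2 * s ^+ 2)%:E)%E.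
  transitivity (\int[mu]_x ((gauss_norm a)%:E *
      ((c0 + c1 * x + c2 * x ^+ 2) * gauss a x)%:E))%E.
    by apply: eq_integral => x _; rewrite -EFinM; congr EFin; ring.
  have ip := integrable_poly_gauss a0 c0 c1 c2.
  rewrite integralZl// -[X in (_ * X)%E]fineK; last exact: integrable_fin_num ip.
  have := Rintegral_poly_gauss a0 c0 c1 c2; rewrite /Rintegral => ->.
  rewrite -EFinM mulrCA q1 mulr1; congr (_ + _ * _)%:E.
  by rewrite /a [(2 * s ^+ 2)^-1]invfM mulrA divff// mul1r invrK.
have m0 : m = 0.
  have := E _ mid; rewrite X0; under eq_integral do rewrite -EFinM.
  have := poly m 1 0; rewrite mul0r addr0 => pm.
  have -> : (\int[mu]_x ((x + m) * (gauss_norm a * gauss a x))%:E = m%:E)%E.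
    by rewrite -pm; apply: eq_integral => x _; congr EFin; ring.
  by case=> <-.
have {}E (f : R -> \bar R) : measurable_fun [set: R] f ->
    (\int[P]_w f (X w) = \int[mu]_x (f x * (gauss_norm a * gauss a x)%:E))%E.
  by move=> mf; rewrite E//; apply: eq_integral => x _; rewrite m0 addr0.
have E2 : (\int[P]_w (X w ^+ 2)%:E = (s ^+ 2)%:E)%E.
  rewrite (E _ mX2); have := poly 0 0 1; rewrite mul1r add0r => <-.
  by apply: eq_integral => x _; rewrite -EFinM; congr EFin; ring.
split.
- apply/integrableP; split => //.
  under eq_integral do rewrite /= ger0_norm ?sqr_ge0//.
  by rewrite E2 ltry.
- by rewrite /Rintegral E2.
- move=> c; rewrite /Rintegral (E _ (mcos c)).
  transitivity (\int[mu]_x (gauss_norm a * (cos (1 * x + c) * gauss a x))).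
    by rewrite /Rintegral; congr fine; apply: eq_integral => x _; rewrite -EFinM mul1r mulrCA.
  rewrite RintegralZl//; last first.
    apply: (integrable_mul_gauss a0 (C := 1)).
      apply: measurableT_comp; first by apply: continuous_measurable_fun; exact: continuous_cos.
      by apply: measurable_funD => //; exact: measurable_funM.
    by move=> x; rewrite [1 * (1 + _)]mul1r (le_trans (cos_max _))// lerDl sqr_ge0.
  rewrite Rintegral_cos_gauss// [cos c * _]mulrC !mulrA q1 mul1r expr1n; congr (_ * expR (- _)).
  by rewrite /a; field.
- move=> v sv v0; rewrite (E _ (mexp v)).
  apply: (@le_trans _ _ (\int[mu]_x ((gauss_norm a)%:E * (gauss (a / 2) x)%:E))%E).
    apply: ge0_le_integral => //.
    + by move=> x _; rewrite -EFinM lee_fin !mulr_ge0 ?expR_ge0// ltW.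
    + apply: emeasurable_funM; first exact: mexp.
      apply/measurable_EFinP; apply: measurable_funM => //.
      exact: measurable_gauss.
    + by apply: measurable_funeM; apply/measurable_EFinP; exact: measurable_gauss.
    move=> x _; rewrite -!EFinM lee_fin mulrCA ler_wpM2l ?(ltW q0)//.
    rewrite /gauss -expRD ler_expR.
    have h : x ^+ 2 / (4 * v) <= a / 2 * x ^+ 2.
      have p1 : 0 < 2 * s ^+ 2 * 2 by lra.
      have p2 : 0 < 4 * v by lra.
      rewrite mulrC ler_wpM2r ?sqr_ge0// /a -invfM lef_pV2 ?posrE//.
      by lra.
    by lra.
  rewrite integralZl//; last by apply: integrable_gauss; rewrite divr_gt0.
  rewrite -[X in (_ * X)%E]fineK; last first.
    by apply: integrable_fin_num => //; apply: integrable_gauss; rewrite divr_gt0.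
  have := @Rintegral_gauss _ (a / 2); rewrite /Rintegral => ->; last by rewrite divr_gt0.
  rewrite -EFinM lee_fin /gauss_norm ler_pdivrMl ?sqrtr_gt0 ?divr_gt0 ?pi_gt0//.
  have -> : 2 = Num.sqrt (2 ^+ 2) :> R by rewrite sqrtr_sqr ger0_norm.
  rewrite -sqrtrM ?divr_ge0 ?pi_ge0 ?(ltW a0)// ler_wsqrtr//.
  have -> : pi / (a / Num.sqrt (2 ^+ 2)) = pi / a * 2.
    by rewrite sqrtr_sqr ger0_norm//; field; rewrite gt_eqF.
  by rewrite ler_wpM2l ?divr_ge0 ?pi_ge0 ?(ltW a0)// expr2 ler_peMr// ler1n.
Qed.

Lemma centered_gaussian_sqr_integrable :
  P.-integrable [set: T] (EFin \o (fun w => X w ^+ 2)).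
Proof. by have [s2 _ []] := main. Qed.

Lemma centered_gaussian_cos c : \int[P]_w cos (X w + c) =
  cos c * expR (- (\int[P]_w (X w ^+ 2) / 2)).
Proof. by have [s2 _ [_ <- -> _]] := main. Qed.

Lemma centered_gaussian_tail v (r : R) : \int[P]_w (X w ^+ 2) <= v -> 0 < v ->
  0 < r -> (P [set w | (r <= `|X w|)%R] <= (2 * expR (- (r ^+ 2 / (4 * v))))%:E)%E.
Proof.
have [s2 _ [_ -> _ tail]] := main; move=> sv v0 r0.
have [mX _] := gX.
pose A := [set w | (r <= `|X w|)%R].
have mA : measurable A.
  rewrite (_ : A = (fun w => `|X w|) @^-1` `[r, +oo[); last first.
    by apply/seteqP; split=> w /=; rewrite in_itv/= andbT.
  by rewrite -[X in measurable X]setTI; apply: measurableT_comp mX _ _ _.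
have e0 : 0 < expR (r ^+ 2 / (4 * v)) by exact: expR_gt0.
set e := expR _ in e0.
suff K : (e%:E * P A <= 2%:E)%E.
  have E1 : (P A = e^-1%:E * (e%:E * P A))%E.
    by rewrite muleA -EFinM mulVf ?gt_eqF// mul1e.
  rewrite -/A expRN -/e mulrC EFinM [leLHS]E1.
  by rewrite lee_wpmul2l// lee_fin invr_ge0 ltW.
apply: le_trans (tail v sv v0).
rewrite -[X in P X](setIT A) -(integral_indic P measurableT mA).
rewrite -ge0_integralZl//; last 2 first.
- exact/measurable_EFinP/measurable_indic.
- by rewrite lee_fin ltW.
apply: ge0_le_integral => //.
- by move=> w _; rewrite -EFinM lee_fin mulr_ge0// expR_ge0.
- by apply: measurable_funeM; apply/measurable_EFinP; exact: measurable_indic.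
- apply/measurable_EFinP; apply: measurableT_comp => //.
  by apply: measurable_funM => //; exact: measurable_funX.
move=> w _; rewrite -EFinM lee_fin indicE; have [wA|wA] := boolP (w \in _); last first.
  by rewrite mulr0 expR_ge0.
move/set_mem: wA => /= wA; rewrite mulr1 /e ler_expR ler_wpM2r//.
  by rewrite invr_ge0 mulr_ge0// ltW.
by rewrite -[X in _ <= X]real_normK ?num_real// ler_pXn2r ?nnegrE// ltW.
Qed.

End gaussian_rv.
End gaussian.

Section fbm_moments.
Context d (T : measurableType d) (R : realType) (P : probability T R).
Context (k : nat) (H : R) (b : 'rV[R]_k -> T -> R).
Hypothesis fb : fbm_field1 P H b.

Lemma fbm_measurable t : orthant t -> measurable_fun [set: T] (b t).
Proof. by case: fb => -[+ _ _] _ _; exact. Qed.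

Lemma fbm_gaussian t : orthant t -> gaussian_rv P (b t).
Proof.
move=> ot; case: fb => -[_ + _] _ _ => /(_ 1%N (fun=> t) (fun=> 1) (fun=> ot)).
by under eq_fun do rewrite big_ord1 mul1r.
Qed.

Lemma fbm_mean t : orthant t -> (\int[P]_w (b t w)%:E = 0)%E.
Proof. by case: fb => -[_ _ +] _ _ => /[apply]; rewrite unlock. Qed.

Lemma fbm_integrable t : orthant t -> P.-integrable [set: T] (EFin \o b t).
Proof.
move=> ot.
have i2 := centered_gaussian_sqr_integrable (fbm_gaussian ot) (fbm_mean ot).
have i1 : P.-integrable [set: T] (EFin \o cst 1).
  by apply: (@bounded_integrable _ _ _ P _ 1) => // x; rewrite normr1.
have := integrableD measurableT i1 i2; apply: le_integrable => //.
  by apply/measurable_EFinP; exact: fbm_measurable.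
move=> w _; rewrite /= lee_fin; apply: le_trans (ler_norm _).
have [u1|u1] := leP `|b t w| 1; first by rewrite (le_trans u1)// lerDl sqr_ge0.
by rewrite -real_normK ?num_real// ler_wpDl// expr2 ler_peMr// ltW.
Qed.

Lemma fbm_increment s t : orthant s -> orthant t ->
  \int[P]_w ((b t w - b s w) ^+ 2) = enorm (t - s) `^ (2 * H).
Proof.
move=> os ot; case: fb => _ _ /(_ s t os ot); rewrite unlock => E.
rewrite -[RHS]/(fine (_ %:E)) -E /Rintegral; congr fine; apply: eq_integral => w _.
by rewrite real_normK ?num_real.
Qed.

Lemma fbm_comb_gaussian m (t : 'I_m -> 'rV[R]_k) (v : 'I_m -> R) :
  (forall j, orthant (t j)) -> gaussian_rv P (fun w => \sum_j v j * b (t j) w).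
Proof. by move=> ot; case: fb => -[_ + _] _ _; apply. Qed.

Lemma fbm_increment_gaussian s t : orthant s -> orthant t ->
  gaussian_rv P (fun w => b t w - b s w) /\ (\int[P]_w (b t w - b s w)%:E = 0)%E.
Proof.
move=> os ot; split.
  have o2 (j : 'I_2) : orthant (if j == ord0 then t else s) by case: ifP.
  have := fbm_comb_gaussian (fun j : 'I_2 => if j == ord0 then 1 else -1) o2.
  by under eq_fun do rewrite !big_ord_recl big_ord0 /= mul1r mulN1r addr0.
under eq_integral do rewrite EFinB.
rewrite integralB//; [|exact: fbm_integrable|exact: fbm_integrable].
by rewrite !fbm_mean// sube0.
Qed.

Lemma orthant0 : orthant (0 : 'rV[R]_k).
Proof. by move=> i; rewrite mxE. Qed.

Lemma fbm_variance t : orthant t -> \int[P]_w (b t w ^+ 2) = enorm t `^ (2 * H).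
Proof.
move=> ot; rewrite -[t in RHS]subr0 -(fbm_increment orthant0 ot) /Rintegral; congr fine.
apply: ae_eq_integral => //.
- by apply/measurable_EFinP; apply: measurable_funX; exact: fbm_measurable.
- apply/measurable_EFinP; apply: measurable_funX; apply: measurable_funB;
    apply: fbm_measurable => //; exact: orthant0.
- case: fb => _ b0 _; apply: filterS b0 => w -> _.
  by rewrite subr0.
Qed.

Section combination.
Context (m : nat) (t : 'I_m -> 'rV[R]_k).
Hypothesis ot : forall j, orthant (t j).

Lemma fbm_comb_mean (v : 'I_m -> R) : (\int[P]_w (\sum_j v j * b (t j) w)%:E = 0)%E.
Proof.
have iv j : P.-integrable [set: T] (EFin \o (fun w => v j * b (t j) w)).
  have := integrableZl measurableT (v j) (fbm_integrable (ot j)).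
  by apply: eq_integrable => // w _ /=; rewrite EFinM.
rewrite -[LHS]fineK; last first.
  by apply: integrable_fin_num => //; exact: (integrable_sum_seq (index_enum _) iv).
have -> : fine (\int[P]_w (\sum_j v j * b (t j) w)%:E)%E = \int[P]_w (\sum_j v j * b (t j) w) by [].
rewrite Rintegral_sum_seq// big1// => j _.
by rewrite RintegralZl//; [rewrite /Rintegral fbm_mean ?mulr0|exact: fbm_integrable].
Qed.

Lemma fbm_comb_variance (v : 'I_m -> R) :
  \int[P]_w ((\sum_j v j * b (t j) w) ^+ 2) = frac_form H t v.
Proof.
rewrite Rintegral_sqr_sum.
- apply: eq_bigr => i _; apply: eq_bigr => j _.
  rewrite !fbm_variance// fbm_increment// /frac_cov; by field.
- by move=> i; exact: centered_gaussian_sqr_integrable (fbm_gaussian _) (fbm_mean _).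
- move=> i j; have [g1 g2] := fbm_increment_gaussian (ot j) (ot i).
  exact: centered_gaussian_sqr_integrable g1 g2.
Qed.

Lemma fbm_comb_cos (v : 'I_m -> R) c : \int[P]_w cos (\sum_j v j * b (t j) w + c) =
  cos c * expR (- (frac_form H t v / 2)).
Proof.
rewrite -fbm_comb_variance; apply: centered_gaussian_cos.
  exact: fbm_comb_gaussian.
exact: fbm_comb_mean.
Qed.

End combination.

Lemma fbm_tail s t (r : R) : 0 < H -> orthant s -> orthant t -> s != t -> 0 < r ->
  (P [set w | (r <= `|b t w - b s w|)%R] <=
     (2 * expR (- (r ^+ 2 / (4 * enorm (t - s) `^ (2 * H)))))%:E)%E.
Proof.
move=> H0 os ot st r0; have [g1 g2] := fbm_increment_gaussian os ot.
apply: centered_gaussian_tail => //; first by rewrite fbm_increment.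
by rewrite powR_gt0// enorm_gt0 subr_eq0 eq_sym.
Qed.

End fbm_moments.

Section standard_normal.
Variable R : realType.
Notation mu := (@lebesgue_measure R).
Notation ga := (@normal_prob R 0 1).

Lemma Rintegral_normal (f : R -> R) : measurable_fun [set: R] f ->
  \int[ga]_x f x = \int[mu]_x (f x * (gauss_norm 2^-1 * gauss 2^-1 x)).
Proof.
move=> mf; rewrite /Rintegral; congr fine.
rewrite (@integral_density _ _ R mu ga (normal_pdf 0 1))//.
- apply: eq_integral => x _; rewrite -EFinM -[in LHS](addr0 x) normal_pdf_shift ?oner_eq0//.
  by rewrite expr1n mulr1 addr0.
- exact: measurable_normal_pdf.
- by move=> x; exact: normal_pdf_ge0.
- exact/measurable_EFinP.
Qed.

Lemma ge0_integralN (f : R -> \bar R) : measurable_fun [set: R] f -> (forall x, 0 <= f x)%E ->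
  (\int[mu]_x f (- x)%R = \int[mu]_x f x)%E.
Proof.
move=> mf f0.
have mN : measurable_fun [set: measurableTypeR R] (-%R : _ -> measurableTypeR R).
  exact: measurable_funN.
rewrite -(preimage_setT (-%R : measurableTypeR R -> measurableTypeR R)).
rewrite -(ge0_integral_pushforward mN)//=.
by apply: eq_measure_integral => //= A mA AS; exact: lebesgue_measureN.
Qed.

Lemma integral_opp (f : R -> \bar R) : measurable_fun [set: R] f ->
  (\int[mu]_x f (- x)%R = \int[mu]_x f x)%E.
Proof.
move=> mf; rewrite [LHS]integralE [RHS]integralE; congr (_ - _)%E.
  rewrite -(ge0_integralN (f := f^\+%E))//.
    by apply: eq_integral => x _; rewrite !funeposE.
  exact: measurable_funepos.
rewrite -(ge0_integralN (f := f^\-%E))//.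
  by apply: eq_integral => x _; rewrite !funenegE.
exact: measurable_funeneg.
Qed.

Lemma Rintegral_normal_odd (f : R -> R) (M : R) : measurable_fun [set: R] f ->
  (forall x, `|f x| <= M) -> (forall x, f (- x) = - f x) -> \int[ga]_x f x = 0.
Proof.
move=> mf fM fodd.
have : \int[ga]_x f x = - \int[ga]_x f x.
  rewrite [LHS]Rintegral_normal// /Rintegral -integral_opp; last first.
    apply/measurable_EFinP; apply: measurable_funM => //.
    by apply: measurable_funM => //; exact: measurable_gauss.
  have -> : - fine (\int[ga]_x (f x)%:E)%E = \int[ga]_x (- f x).
    have := @RintegralZl _ _ _ ga setT f (-1) measurableT (bounded_integrable ga mf fM).
    by rewrite mulN1r => <-; apply: eq_Rintegral => x _; rewrite mulN1r.
  rewrite Rintegral_normal; last exact: measurableT_comp.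
  rewrite /Rintegral; congr fine; apply: eq_integral => x _; congr EFin.
  by rewrite fodd /gauss sqrrN.
by move/eqP; rewrite -subr_eq0 opprK -mulr2n mulrn_eq0/= => /eqP.
Qed.

Lemma Rintegral_normal_gauss (s2 l : R) : 0 < s2 ->
  \int[ga]_u expR (- (s2 * (u + l) ^+ 2 / 2)) <= (Num.max 1 (Num.sqrt s2))^-1.
Proof.
move=> s20.
have m1 : measurable_fun [set: R] (fun u : R => expR (- (s2 * (u + l) ^+ 2 / 2))).
  apply: measurableT_comp => //; apply: measurableT_comp => //.
  apply: measurable_funM => //; apply: measurable_funM => //.
  by apply: measurable_funX; exact: measurable_funD.
have b1 u : `|expR (- (s2 * (u + l) ^+ 2 / 2))| <= 1.
  rewrite ger0_norm ?expR_ge0// -expR0 ler_expR oppr_le0 divr_ge0// mulr_ge0 ?sqr_ge0//.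
  exact: ltW.
have [s1|s1] := leP (Num.sqrt s2) 1.
  rewrite invr1; apply: (le_trans (ler_norm _)).
  apply: (le_trans (normr_Rintegral_le ga m1 b1)).
  by rewrite mul1r (_ : fine _ = fine 1%E)//; congr fine; exact: probability_setT.
rewrite Rintegral_normal//.
have i0 : mu.-integrable [set: R] (EFin \o gauss (s2 / 2)).
  by apply: integrable_gauss; rewrite divr_gt0.
have E : \int[mu]_u (gauss_norm 2^-1 * gauss (s2 / 2) u) = (Num.sqrt s2)^-1.
  rewrite RintegralZl//.
  rewrite Rintegral_gauss ?divr_gt0// /gauss_norm invrK.
  rewrite -sqrtrV ?mulr_ge0 ?pi_ge0// -sqrtrM ?invr_ge0 ?mulr_ge0 ?pi_ge0//.
  rewrite -sqrtrV ?ltW//; congr Num.sqrt.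
  move: (@pi R) (pi_gt0 R) => q q0; field.
  by rewrite !gt_eqF.
have mg : measurable_fun [set: R] (fun u => (gauss_norm 2^-1 * gauss (s2 / 2) u)%:E).
  by apply/measurable_EFinP; apply: measurable_funM => //; exact: measurable_gauss.
have E2 : \int[mu]_u (gauss_norm 2^-1 * gauss (s2 / 2) (u + l)) = (Num.sqrt s2)^-1.
  by rewrite -E /Rintegral; congr fine; rewrite -(integral_shift l mg).
have n0 : 0 < gauss_norm (2^-1 : R) by apply: gauss_norm_gt0.
rewrite -E2; apply: le_Rintegral => //.
- apply: (@le_integrable _ _ _ mu setT measurableT _ (fun u => (gauss_norm 2^-1)%:E * (gauss 2^-1 u)%:E)%E).
  + apply/measurable_EFinP; apply: measurable_funM => //; apply: measurable_funM => //.
    exact: measurable_gauss.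
  + move=> u _; rewrite -EFinM /= lee_fin normrM ler_piMl//.
  + by apply: integrableZl => //; apply: integrable_gauss.
- have i1 : mu.-integrable [set: R] (fun u => (gauss_norm 2^-1 * gauss (s2 / 2) u)%:E).
    have := integrableZl measurableT (gauss_norm 2^-1) i0.
    by apply: eq_integrable => // u _ /=; rewrite EFinM.
  apply/integrableP; split.
    by apply: (measurableT_comp mg); exact: measurable_funD.
  have /integrableP[_] := i1.
  rewrite -(integral_shift l)//.
  by apply: measurableT_comp => //; exact: mg.
move=> u _; rewrite mulrCA ler_wpM2l ?(ltW n0)//.
rewrite /gauss; have -> : s2 * (u + l) ^+ 2 / 2 = s2 / 2 * (u + l) ^+ 2 by rewrite mulrAC.
rewrite ler_piMr ?expR_ge0// -expR0 ler_expR oppr_le0.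
by rewrite mulr_ge0 ?sqr_ge0.
Qed.

End standard_normal.

(** * Gaussian bumps of the field *)

Lemma normr_Rintegral_prob_le d (T : measurableType d) (R : realType) (P : probability T R)
    (f : T -> R) (M : R) : measurable_fun [set: T] f -> (forall x, `|f x| <= M) ->
  `|\int[P]_x f x| <= M.
Proof.
move=> mf fM; have := normr_Rintegral_le P mf fM.
by rewrite (_ : fine _ = fine 1%E) ?mulr1//; congr fine; exact: probability_setT.
Qed.

Section quadratic_form.
Variables (R : realType) (m : nat).
Implicit Types (N : 'I_m -> 'I_m -> R) (v : 'I_m -> R).

Definition qform N v := \sum_i \sum_j v i * v j * N i j.

Definition bump v j x : 'I_m -> R := fun i => v i + x * (i == j)%:R.

Lemma sum_delta j (f : 'I_m -> R) : \sum_i (i == j)%:R * f i = f j.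
Proof.
rewrite (bigD1 j)//= eqxx mul1r big1 ?addr0// => i /negbTE ->.
by rewrite mul0r.
Qed.

Lemma qform_delta N j : qform N (bump (fun=> 0) j 1) = N j j.
Proof.
rewrite -[RHS](sum_delta j (fun i => N i j)); apply: eq_bigr => i _.
rewrite -(sum_delta j (fun i' => N i i')) mulr_sumr; apply: eq_bigr => i' _.
by rewrite /bump !add0r !mul1r mulrA.
Qed.

Lemma qform_bump N j v x : (forall i i', N i i' = N i' i) ->
  qform N (bump v j x) = qform N v + 2 * x * (\sum_i v i * N i j) + x ^+ 2 * N j j.
Proof.
move=> Nsym.
have -> : qform N (bump v j x) =
   qform N v + \sum_i v i * (x * \sum_i' (i' == j)%:R * N i i')
   + \sum_i (i == j)%:R * (x * \sum_i' v i' * N i i')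
   + \sum_i (i == j)%:R * (x ^+ 2 * \sum_i' (i' == j)%:R * N i i').
  rewrite -!big_split/=; apply: eq_bigr => i _.
  rewrite !mulr_sumr -!big_split/=; apply: eq_bigr => i' _.
  rewrite /bump; by ring.
rewrite !sum_delta.
under eq_bigr do rewrite sum_delta mulrCA.
rewrite [X in x * X](eq_bigr (fun i => v i * N i j)) => [|i _]; last by rewrite Nsym.
rewrite -mulr_sumr; move: (qform _ _) (\sum_i _) => a b; by ring.
Qed.

(* Schur complement: the residual form left by the j-th variable. *)
Lemma qform_complete N j : (forall i i', N i i' = N i' i) -> 0 < N j j ->
  exists2 N', (forall i i', N' i i' = N' i' i) & exists l : ('I_m -> R) -> R,
    forall v x, qform N (bump v j x) = qform N' v + N j j * (x + l v) ^+ 2.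
Proof.
move=> Nsym N0; exists (fun i i' => N i i' - N i j * N i' j / N j j).
  by move=> i i'; rewrite Nsym [N i j * _]mulrC.
exists (fun v => (\sum_i v i * N i j) / N j j) => v x; rewrite qform_bump//.
have -> : qform (fun i i' => N i i' - N i j * N i' j / N j j) v =
    qform N v - (\sum_i v i * N i j) ^+ 2 / N j j.
  rewrite expr2 -mulrA mulr_suml -sumrB; apply: eq_bigr => i _.
  rewrite mulr_suml mulr_sumr -sumrB; apply: eq_bigr => i' _.
  by field; rewrite gt_eqF.
move: (qform _ _) (\sum_i _) => a b; by field; rewrite gt_eqF.
Qed.

End quadratic_form.

Section charw.
Variable R : realType.
Notation ga := (@normal_prob R 0 1).
Variable w : R -> R.
Hypothesis mw : measurable_fun [set: R] w.
Hypothesis w1 : forall u, `|w u| <= 1.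
Hypothesis weven : forall u, w (- u) = w u.

Definition charw (x : R) := \int[ga]_u (w u * cos (u * x)).

Let mcos d (T : measurableType d) (f : T -> R) : measurable_fun [set: T] f ->
  measurable_fun [set: T] (fun x => cos (f x)).
Proof. by apply: measurableT_comp; apply: continuous_measurable_fun; exact: continuous_cos. Qed.

Let msin d (T : measurableType d) (f : T -> R) : measurable_fun [set: T] f ->
  measurable_fun [set: T] (fun x => sin (f x)).
Proof. by apply: measurableT_comp; apply: continuous_measurable_fun; exact: continuous_sin. Qed.

Lemma measurable_charw : measurable_fun [set: R] charw.
Proof.
apply: (@measurable_Rintegral1 _ _ _ _ _ ga ga (fun z => w z.1 * cos (z.1 * z.2)) 1).
  apply: measurable_funM; first exact: (measurableT_comp mw).
  by apply: mcos; apply: measurable_funM.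
by move=> z; rewrite normrM mulr_ile1// cos_max.
Qed.

Lemma charw_le1 x : `|charw x| <= 1.
Proof.
apply: (@normr_Rintegral_prob_le _ _ _ ga); first by apply: measurable_funM => //; apply: mcos; exact: measurable_funM.
by move=> z; rewrite normrM mulr_ile1// cos_max.
Qed.

Lemma cos_charw A x : cos A * charw x = \int[ga]_u (w u * cos (A + u * x)).
Proof.
have i1 : ga.-integrable [set: R] (EFin \o (fun u => w u * cos (u * x))).
  apply: (@bounded_integrable _ _ _ ga _ 1).
    by apply: measurable_funM => //; apply: mcos; exact: measurable_funM.
  by move=> z; rewrite normrM mulr_ile1// cos_max.
have m2 : measurable_fun [set: R] (fun u => w u * sin (u * x)).
  by apply: measurable_funM => //; apply: msin; exact: measurable_funM.
have b2 u : `|w u * sin (u * x)| <= 1 by rewrite normrM mulr_ile1// sin_max.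
have i2 := bounded_integrable ga m2 b2.
have E := @RintegralB _ _ _ ga setT (fun u => cos A * (w u * cos (u * x)))
  (fun u => sin A * (w u * sin (u * x))) measurableT.
have -> : \int[ga]_u (w u * cos (A + u * x)) =
  \int[ga]_u (cos A * (w u * cos (u * x)) - sin A * (w u * sin (u * x))).
  by apply: eq_Rintegral => u _; rewrite cosD; ring.
rewrite E; last 2 first.
- have := integrableZl measurableT (cos A) i1.
  by apply: eq_integrable => // u _ /=; rewrite EFinM.
- have := integrableZl measurableT (sin A) i2.
  by apply: eq_integrable => // u _ /=; rewrite EFinM.
rewrite (@RintegralZl _ _ _ ga setT (fun u => w u * cos (u * x)) (cos A) measurableT i1).
rewrite (@RintegralZl _ _ _ ga setT (fun u => w u * sin (u * x)) (sin A) measurableT i2).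
rewrite (Rintegral_normal_odd m2 b2) ?mulr0 ?subr0//.
by move=> u; rewrite weven mulNr sinN mulrN.
Qed.

Section recursion.
Context d (T : measurableType d) (P : probability T R) (m : nat).
Variables (Z : 'I_m -> T -> R) (c tau g : 'I_m -> R) (a : 'I_m -> R -> R) (eta : R).
Variable N : 'I_m -> 'I_m -> R.
Hypothesis mZ : forall i, measurable_fun [set: T] (Z i).
Hypothesis eta0 : 0 < eta.
Hypothesis Nsym : forall i j, N i j = N j i.
Hypothesis a_ge0 : forall i x, 0 <= a i x.
Hypothesis ag : forall i u, `|w u| * a i (u / eta) <= g i.
Hypothesis base : forall v kappa,
  `|\int[P]_t cos (\sum_i v i * Z i t + kappa)| <= \prod_i a i (v i) * expR (- (qform N v / 2)).
Hypothesis tau0 : forall j, 0 < tau j.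
Hypothesis tauP : forall j (v : 'I_m -> R), v j = 1 -> (forall i : 'I_m, (i < j)%N -> v i = 0) ->
  tau j ^+ 2 <= qform N v.

Let Th (s : seq 'I_m) t := \prod_(j <- s) charw ((Z j t - c j) / eta).

Let mTh s : measurable_fun [set: T] (Th s).
Proof.
apply: measurable_prod => j _; apply: (measurableT_comp measurable_charw).
by apply: measurable_funM => //; apply: measurable_funB.
Qed.

Let Th_le1 s t : `|Th s t| <= 1.
Proof.
rewrite /Th; elim: s => [|j s IH]; first by rewrite big_nil normr1.
by rewrite big_cons normrM mulr_ile1// charw_le1.
Qed.

Let msum v kappa : measurable_fun [set: T] (fun t => \sum_i v i * Z i t + kappa).
Proof. by apply: measurable_funD => //; apply: measurable_sum => i; exact: measurable_funM. Qed.

Let step_Fubini j s v kappa :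
  \int[P]_t (cos (\sum_i v i * Z i t + kappa) * Th (j :: s) t) =
  \int[ga]_u (w u * \int[P]_t (cos (\sum_i bump v j (u / eta) i * Z i t + (kappa - u / eta * c j)) * Th s t)).
Proof.
pose F (z : T * R) := w z.2 * cos (\sum_i v i * Z i z.1 + kappa + z.2 * ((Z j z.1 - c j) / eta)) * Th s z.1.
have mF : measurable_fun [set: T * R] F.
  apply: measurable_funM; last exact: (measurableT_comp (mTh s)).
  apply: measurable_funM; first exact: (measurableT_comp mw).
  apply: mcos; apply: measurable_funD; first exact: (measurableT_comp (msum v kappa)).
  apply: measurable_funM => //; apply: measurable_funM => //.
  by apply: measurable_funB => //; exact: (measurableT_comp (mZ j)).
have bF z : `|F z| <= 1.
  by rewrite /F !normrM mulr_ile1 ?mulr_ge0// mulr_ile1// cos_max.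
transitivity (\int[P]_t \int[ga]_u F (t, u)).
  apply: eq_Rintegral => t _; rewrite /Th big_cons mulrA cos_charw.
  rewrite mulrC -RintegralZl//.
    by apply: eq_Rintegral => u _; rewrite /F /= mulrC.
  apply: (@bounded_integrable _ _ _ ga _ 1).
    by apply: measurable_funM => //; apply: mcos; apply: measurable_funD => //; exact: measurable_funM.
  by move=> u; rewrite normrM mulr_ile1// cos_max.
rewrite (bounded_Fubini P ga mF bF); apply: eq_Rintegral => u _.
rewrite -RintegralZl//.
  apply: eq_Rintegral => t _; rewrite /F /= -mulrA; congr (_ * (cos _ * _)).
  have -> : \sum_i bump v j (u / eta) i * Z i t = \sum_i v i * Z i t + u / eta * Z j t.
    rewrite -(sum_delta j (Z^~ t)) mulr_sumr -big_split/=; apply: eq_bigr => i _.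
    by rewrite /bump mulrDl mulrA.
  move: (\sum_i _) (Z j t) => q z; by field; rewrite gt_eqF.
apply: (@bounded_integrable _ _ _ P _ 1).
  by apply: measurable_funM => //; apply: mcos; exact: msum.
by move=> t; rewrite normrM mulr_ile1// cos_max.
Qed.

Let claim (s : seq 'I_m) : sorted (fun i j : 'I_m => i < j)%N s ->
  exists N', [/\ (forall i j, N' i j = N' j i),
    (forall v, exists2 v', (forall i, i \notin s -> v' i = v i) & qform N' v = qform N v') &
    forall v kappa, (forall i, i \in s -> v i = 0) ->
    `|\int[P]_t (cos (\sum_i v i * Z i t + kappa) * Th s t)| <=
    \prod_(i | i \notin s) a i (v i) * \prod_(j <- s) (g j / Num.max 1 (tau j / eta)) *
    expR (- (qform N' v / 2))].
Proof.
elim: s => [_|j s IH js].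
  exists N; split=> //; first by move=> v; exists v.
  move=> v kappa _; rewrite big_nil mulr1; apply: le_trans (base v kappa).
  rewrite /Th le_eqVlt; apply/orP; left; apply/eqP; congr `|_|.
  by apply: eq_Rintegral => t _; rewrite big_nil mulr1.
have {IH} [N1 [N1sym N1att N1b]] := IH (path_sorted js).
have jlt i : i \in s -> (j < i)%N.
  move=> si; have /allP := order_path_min (fun x y z : 'I_m => @ltn_trans x y z) js.
  exact.
have jns : j \notin s by apply/negP => /jlt; rewrite ltnn.
have tN : tau j ^+ 2 <= N1 j j.
  rewrite -qform_delta; have [v' v'E ->] := N1att (bump (fun=> 0) j 1).
  apply: tauP; first by rewrite v'E// /bump add0r mul1r eqxx.
  move=> i ij; rewrite v'E; last by apply/negP => /jlt; rewrite ltnNge ltnW.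
  by rewrite /bump add0r mul1r -val_eqE/= ltn_eqF.
have N1jj : 0 < N1 j j by apply: lt_le_trans tN; rewrite exprn_gt0.
have [N2 N2sym [l N2E]] := qform_complete N1sym N1jj.
exists N2; split=> // [v|v kappa v0].
  have [v' v'E E] := N1att (bump v j (- l v)).
  exists v'; last by rewrite -E N2E addNr expr0n mulr0 addr0.
  move=> i; rewrite inE negb_or => /andP[ij si]; rewrite v'E// /bump.
  by rewrite (negbTE ij) mulr0 addr0.
rewrite step_Fubini.
pose C := \prod_(i | i \notin j :: s) a i (v i) * \prod_(j <- s) (g j / Num.max 1 (tau j / eta)).
pose s2 := N1 j j / eta ^+ 2.
have s20 : 0 < s2 by rewrite divr_gt0// exprn_gt0.
have g0 i : 0 <= g i by apply: le_trans (ag i 0); rewrite mulr_ge0.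
have max0 x : 0 < Num.max 1 x :> R by rewrite lt_max ltr01.
have C0 : 0 <= C.
  apply: mulr_ge0; first by apply: prodr_ge0 => i _.
  by apply: prodr_ge0 => i _; rewrite divr_ge0// ltW.
have bnd u : `|w u * \int[P]_t (cos (\sum_i bump v j (u / eta) i * Z i t + (kappa - u / eta * c j)) * Th s t)|
   <= C * g j * expR (- (qform N2 v / 2)) * expR (- (s2 * (u + l v * eta) ^+ 2 / 2)).
  rewrite normrM.
  have /N1b {}N1b : forall i, i \in s -> bump v j (u / eta) i = 0.
    move=> i si; rewrite /bump v0 ?inE ?si ?orbT// (_ : (i == j) = false) ?mulr0 ?addr0//.
    by apply/negbTE; apply: contraNneq jns => <-.
  apply: (le_trans (ler_wpM2l (normr_ge0 _) (N1b _))).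
  rewrite N2E; have -> : \prod_(i | i \notin s) a i (bump v j (u / eta) i) =
     a j (u / eta) * \prod_(i | i \notin j :: s) a i (v i).
    rewrite (bigD1 j)//= {1}/bump eqxx v0 ?mem_head// add0r mulr1; congr (_ * _).
    apply: eq_big => [i|i /andP[_ /negbTE ij]]; first by rewrite inE negb_or andbC.
    by rewrite /bump ij mulr0 addr0.
  have -> : - ((qform N2 v + N1 j j * (u / eta + l v) ^+ 2) / 2) =
     - (qform N2 v / 2) + - (s2 * (u + l v * eta) ^+ 2 / 2).
    rewrite /s2; move: (qform _ _) (l v) => q r; by field; rewrite gt_eqF.
  rewrite expRD.
  move: C0 (ag j u); rewrite /C; move: (\prod_(i | _) _) (\prod_(i <- s) _) => p q pq0 agju.
  have -> : `|w u| * (a j (u / eta) * p * q * (expR (- (qform N2 v / 2)) *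
      expR (- (s2 * (u + l v * eta) ^+ 2 / 2)))) = (`|w u| * a j (u / eta)) *
      (p * q * expR (- (qform N2 v / 2)) * expR (- (s2 * (u + l v * eta) ^+ 2 / 2))).
    move: (expR _) (expR _) `|w u| => e1 e2 e3; by ring.
  rewrite [p * q * g j]mulrC -!(mulrA (g j)).
  by apply: ler_wpM2r => //; rewrite mulr_ge0 ?expR_ge0// mulr_ge0 ?expR_ge0//.
have Isq : \int[ga]_u expR (- (s2 * (u + l v * eta) ^+ 2 / 2)) <= (Num.max 1 (tau j / eta))^-1.
  apply: (le_trans (Rintegral_normal_gauss _ s20)).
  rewrite lef_pV2 ?posrE//; rewrite ge_max !le_max lexx/=; apply/orP; right; rewrite -(@ler_pXn2r _ 2)// ?nnegrE ?sqrtr_ge0//; last first.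
    by rewrite divr_ge0// ltW.
  rewrite sqr_sqrtr ?(ltW s20)// /s2 expr_div_n ler_pM2r ?invr_gt0 ?exprn_gt0//.
have mI : measurable_fun [set: R] (fun u => w u *
    \int[P]_t (cos (\sum_i bump v j (u / eta) i * Z i t + (kappa - u / eta * c j)) * Th s t)).
  apply: measurable_funM => //.
  apply: (@measurable_Rintegral1 _ _ _ _ _ P ga (fun z => cos (\sum_i bump v j (z.2 / eta) i * Z i z.1
     + (kappa - z.2 / eta * c j)) * Th s z.1) 1).
    apply: measurable_funM; last exact: (measurableT_comp (mTh s)).
    apply: mcos; apply: measurable_funD.
      apply: measurable_sum => i; apply: measurable_funM; last exact: (measurableT_comp (mZ i)).
      by apply: measurable_funD => //; apply: measurable_funM => //; exact: measurable_funM.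
    by apply: measurable_funB => //; apply: measurable_funM => //; exact: measurable_funM.
  by move=> z; rewrite normrM mulr_ile1// cos_max.
have bI u : `|w u * \int[P]_t (cos (\sum_i bump v j (u / eta) i * Z i t + (kappa - u / eta * c j)) * Th s t)| <= 1.
  rewrite normrM mulr_ile1//.
  apply: normr_Rintegral_prob_le.
    by apply: measurable_funM => //; apply: mcos; exact: msum.
  by move=> t; rewrite normrM mulr_ile1// cos_max.
have mG : measurable_fun [set: R] (fun u : R => expR (- (s2 * (u + l v * eta) ^+ 2 / 2))).
  apply: measurableT_comp => //; apply: measurableT_comp => //.
  apply: measurable_funM => //; apply: measurable_funM => //.
  by apply: measurable_funX; exact: measurable_funD.
have bG u : `|expR (- (s2 * (u + l v * eta) ^+ 2 / 2))| <= 1.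
  rewrite ger0_norm ?expR_ge0// -expR0 ler_expR oppr_le0 divr_ge0// mulr_ge0 ?sqr_ge0//.
  exact: ltW.
apply: (le_trans (le_normr_Rintegral measurableT (bounded_integrable ga mI bI))).
have iG := bounded_integrable ga mG bG.
apply: (@le_trans _ _ (\int[ga]_u (C * g j * expR (- (qform N2 v / 2)) *
    expR (- (s2 * (u + l v * eta) ^+ 2 / 2))))).
  apply: le_Rintegral => //.
- apply: (@bounded_integrable _ _ _ ga _ 1); first exact: measurableT_comp.
  by move=> u; rewrite normr_id.
- have := integrableZl measurableT (C * g j * expR (- (qform N2 v / 2))) iG.
  by apply: eq_integrable => // u _ /=; rewrite EFinM.
rewrite (@RintegralZl _ _ _ ga setT (fun u : R => expR (- (s2 * (u + l v * eta) ^+ 2 / 2))) _ measurableT iG).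
apply: (le_trans (ler_wpM2l _ Isq)); first by rewrite mulr_ge0 ?expR_ge0// mulr_ge0 ?expR_ge0//.
rewrite big_cons /C le_eqVlt; apply/orP; left; apply/eqP.
move: (\prod_(i | i \notin j :: s) a i (v i)) (\prod_(j0 <- s) (g j0 / Num.max 1 (tau j0 / eta))).
move=> p q; move: (expR (- (qform N2 v / 2))) => r; by ring.
Qed.

Lemma recursion_bound : `|\int[P]_t \prod_j charw ((Z j t - c j) / eta)| <=
  \prod_j (g j / Num.max 1 (tau j / eta)).
Proof.
have [|N' [_ _ /(_ (fun=> 0) 0)]] := @claim (index_enum 'I_m).
  have := iota_ltn_sorted 0 m; rewrite -val_enum_ord sorted_map.
  by rewrite /index_enum -enumT.
rewrite big_pred0 => [+|i]; last by rewrite mem_index_enum.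
move=> /(_ (fun _ _ => erefl)); rewrite mul1r.
have -> : qform N' (fun=> 0) = 0.
  by rewrite /qform big1// => i _; rewrite big1// => j _; rewrite !mul0r.
rewrite mul0r oppr0 expR0 mulr1; apply: le_trans.
rewrite le_eqVlt; apply/orP; left; apply/eqP; congr `|_|.
apply: eq_Rintegral => t _; have -> : \sum_i 0 * Z i t = 0.
  by apply: big1 => i _; rewrite mul0r.
by rewrite addr0 cos0 mul1r.
Qed.

End recursion.
End charw.

Section gaussian_bump.
Variable R : realType.

Definition psi (x : R) := expR (- (x ^+ 2 / 2)).

Lemma psi_ge0 x : 0 <= psi x. Proof. exact: expR_ge0. Qed.

Lemma psi_le1 x : psi x <= 1.
Proof. by rewrite -expR0 ler_expR oppr_le0 divr_ge0// sqr_ge0. Qed.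

Lemma measurable_psi : measurable_fun [set: R] psi.
Proof.
apply: measurableT_comp => //; apply: measurableT_comp => //.
by apply: measurable_funM => //; exact: measurable_funX.
Qed.

Definition dpsi (x : R) := psi x - 2^-1 * psi (x / 2).

Definition wdpsi (u : R) := 1 - gauss (3 / 2) u.

Lemma charw_gauss (a : R) x : 0 <= a ->
  charw (gauss a) x = (Num.sqrt (1 + 2 * a))^-1 * psi (x / Num.sqrt (1 + 2 * a)).
Proof.
move=> a0; have s0 : 0 < 1 + 2 * a by rewrite ltr_wpDr// mulr_ge0.
rewrite /charw Rintegral_normal; last first.
  apply: measurable_funM; first exact: measurable_gauss.
  apply: measurableT_comp; last exact: measurable_funM.
  by apply: continuous_measurable_fun; exact: continuous_cos.
have -> : \int[lebesgue_measure]_u (gauss a u * cos (u * x) * (gauss_norm 2^-1 * gauss 2^-1 u)) =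
   \int[lebesgue_measure]_u (gauss_norm 2^-1 * (cos (x * u + 0) * gauss (a + 2^-1) u)).
  apply: eq_Rintegral => u _; rewrite addr0 (mulrC u) [gauss a u * _]mulrC.
  have -> : gauss (a + 2^-1) u = gauss a u * gauss 2^-1 u.
    by rewrite /gauss -expRD mulrDl opprD.
  move: (cos _) (gauss _ _) (gauss _ _) (gauss_norm _) => p q r s; by ring.
have a2 : 0 < a + 2^-1 by rewrite ltr_wpDl.
rewrite RintegralZl//; last first.
  apply: (@le_integrable _ _ _ (@lebesgue_measure R) setT measurableT _ (EFin \o gauss (a + 2^-1))).
  - apply/measurable_EFinP; apply: measurable_funM; last exact: measurable_gauss.
    apply: measurableT_comp; first by apply: continuous_measurable_fun; exact: continuous_cos.
    by apply: measurable_funD => //; exact: measurable_funM.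
  - by move=> u _ /=; rewrite lee_fin normrM ler_piMl// cos_max.
  - exact: integrable_gauss.
rewrite Rintegral_cos_gauss// cos0 mul1r mulrA; congr (_ * _).
  rewrite /gauss_norm -!sqrtrV ?ltW ?divr_gt0 ?pi_gt0//.
  rewrite -sqrtrM ?invr_ge0 ?divr_ge0 ?pi_ge0//; congr Num.sqrt.
  move: (@pi R) (pi_gt0 R) => q q0; field.
  by rewrite !gt_eqF//= (_ : a * 2 + 1 = 1 + 2 * a)//; ring.
rewrite /psi; congr expR; congr (- _).
rewrite expr_div_n sqr_sqrtr ?ltW//; field; rewrite !gt_eqF//.
Qed.


Lemma measurable_wdpsi : measurable_fun [set: R] wdpsi.
Proof. by apply: measurable_funB => //; exact: measurable_gauss. Qed.

Lemma wdpsi_ge0 u : 0 <= wdpsi u.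
Proof. by rewrite subr_ge0 /gauss -expR0 ler_expR oppr_le0 mulr_ge0// sqr_ge0. Qed.

Lemma wdpsi_le1 u : `|wdpsi u| <= 1.
Proof. by rewrite ger0_norm ?wdpsi_ge0// gerBl gauss_ge0. Qed.

Lemma wdpsi_le u : wdpsi u <= 3 / 2 * u ^+ 2.
Proof. by rewrite lerBlDr -lerBlDl /gauss expR_ge1Dx. Qed.

Let charw_integrable (f : R -> R) x : measurable_fun [set: R] f -> (forall u, `|f u| <= 1) ->
  (@normal_prob R 0 1).-integrable [set: R] (EFin \o (fun u => f u * cos (u * x))).
Proof.
move=> mf f1; apply: (@bounded_integrable _ _ _ (@normal_prob R 0 1) _ 1).
  apply: measurable_funM => //; apply: measurableT_comp; last exact: measurable_funM.
  by apply: continuous_measurable_fun; exact: continuous_cos.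
by move=> u; rewrite normrM mulr_ile1// cos_max.
Qed.

Lemma charw1 x : charw (fun=> 1) x = psi x.
Proof.
have := charw_gauss x (lexx 0); rewrite mulr0 addr0 sqrtr1 divr1 invr1 mul1r => <-.
by apply: eq_Rintegral => u _; rewrite /gauss mul0r oppr0 expR0.
Qed.

Lemma charw_wdpsi x : charw wdpsi x = dpsi x.
Proof.
transitivity (charw (fun=> 1) x - charw (gauss (3 / 2)) x).
  rewrite /charw -RintegralB//.
  - by apply: eq_Rintegral => u _; rewrite -mulrBl.
  - by apply: charw_integrable => // u; rewrite normr1.
  - apply: charw_integrable => [|u]; first exact: measurable_gauss.
    by rewrite ger0_norm ?gauss_ge0// -subr_ge0 wdpsi_ge0.
rewrite charw1 charw_gauss ?divr_ge0// /dpsi.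
have -> : 1 + 2 * (3 / 2) = 2 ^+ 2 :> R by field.
by rewrite sqrtr_sqr ger0_norm.
Qed.

End gaussian_bump.

Section fbm_recursion.
Context (k : nat) (R : realType) (H : R).
Hypothesis H01 : 0 < H < 1.

Lemma fbm_charw : (0 < k)%N -> exists2 C, 0 < C &
  forall d (T : measurableType d) (P : probability T R) (b : 'rV[R]_k -> T -> R) (w : R -> R)
    m (t : 'I_m -> 'rV[R]_k) (c r g : 'I_m -> R) (iso : pred 'I_m) eta,
  fbm_field1 P H b ->
  measurable_fun [set: R] w -> (forall u, `|w u| <= 1) -> (forall u, w (- u) = w u) ->
  0 < eta -> (forall j, orthant (t j)) ->
  (forall j, [/\ 0 < r j, r j <= enorm (t j) &
     forall i : 'I_m, (j < i)%N -> r j <= enorm (t i - t j)]) ->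
  (forall j, iso j -> eta <= enorm (t j) /\ forall i, i != j -> eta <= enorm (t i - t j)) ->
  (forall j, if iso j then forall u,
     `|w u| * expR (- (eta `^ (2 * H) * (u / eta) ^+ 2 / (2 * C ^+ 2))) <= g j else 1 <= g j) ->
  `|\int[P]_x \prod_j charw w ((b (t j) x - c j) / eta)| <=
  \prod_j (g j / Num.max 1 (r j `^ H / C / eta)).
Proof.
move=> k0; have [K K0 HK] := frac_form_lower H01 k0.
exists (Num.sqrt (2 * K)); first by rewrite sqrtr_gt0 mulr_gt0.
move=> d T P b w m t c r g iso eta fb mw w1 weven eta0 ot rP isoP gP.
have K2 : 0 < 2 * K by rewrite mulr_gt0.
pose N i j := frac_cov H (t i) (t j) / 2.
have NE v : qform N v = frac_form H t v / 2.
  rewrite /qform /frac_form mulr_suml; apply: eq_bigr => i _.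
  by rewrite mulr_suml; apply: eq_bigr => j _; rewrite mulrA.
pose a j x := if iso j then expR (- (eta `^ (2 * H) * x ^+ 2 / (2 * Num.sqrt (2 * K) ^+ 2))) else 1.
have sq : Num.sqrt (2 * K) ^+ 2 = 2 * K by rewrite sqr_sqrtr// ltW.
have RB := @recursion_bound R w mw w1 weven d T P m (fun i => b (t i)) c
  (fun j => r j `^ H / Num.sqrt (2 * K)) g a eta N.
apply: RB.
- by move=> i; exact: (fbm_measurable fb).
- exact: eta0.
- move=> i j; rewrite /N /frac_cov -(enormB (t j) (t i)).
  by rewrite (addrC (enorm (t j) `^ _)).
- by move=> i x; rewrite /a; case: ifP => // _; exact: expR_ge0.
- move=> i u; have := gP i; rewrite /a; case: (iso i) => [|g1]; first exact.
  rewrite mulr1; exact: le_trans g1.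
- move=> v kappa; rewrite (fbm_comb_cos fb)// normrM (ger0_norm (expR_ge0 _)).
  apply: (le_trans (ler_piMl _ (cos_max _))); first exact: expR_ge0.
  rewrite NE -[X in X <= _](_ : expR (- (frac_form H t v / 4)) * expR (- (frac_form H t v / 2 / 2)) = _); last first.
    by rewrite -expRD; congr expR; field.
  rewrite ler_wpM2r ?expR_ge0//.
  rewrite /a -big_mkcond/= -expR_sum ler_expR sumrN lerN2.
  have {}HK : eta `^ (2 * H) * (\sum_(j | iso j) v j ^+ 2) <= K * frac_form H t v.
    apply: HK => // j /isoP[e1 e2]; split=> // i ij; right; exact: e2.
  have -> : \sum_(i | iso i) eta `^ (2 * H) * v i ^+ 2 / (2 * Num.sqrt (2 * K) ^+ 2) =
      eta `^ (2 * H) * (\sum_(j | iso j) v j ^+ 2) / (4 * K).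
    by rewrite mulr_sumr mulr_suml; apply: eq_bigr => i _; rewrite sq; congr (_ / _); ring.
  rewrite ler_pdivrMr ?mulr_gt0//.
  by move: HK; move: (frac_form H t v) (_ * \sum_(j | _) _) => p q; lra.
- by move=> j; have [r0 _ _] := rP j; rewrite divr_gt0 ?powR_gt0// sqrtr_gt0.
- move=> j v vj v0; have [r0 rt rd] := rP j.
  have {}HK : r j `^ (2 * H) * (\sum_(i | pred1 j i) v i ^+ 2) <= K * frac_form H t v.
    apply: HK => // i /eqP ->; split=> // i' ij.
    by have [/v0 ->|ji] := ltnP i' j; [left|right; apply: rd; rewrite ltn_neqAle eq_sym ij].
  move: HK; rewrite big_pred1_eq vj expr1n mulr1 NE expr_div_n sq.
  rewrite [2 * H]mulrC powRrM powR_mulrn ?powR_ge0// ler_pdivrMr//.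
  move: (frac_form H t v) (_ ^+ 2) => p q; lra.
Qed.

End fbm_recursion.

Section independence.
Context d (T : measurableType d) (R : realType) (P : probability T R).

Lemma count_lt (z : R) m : 0 <= z -> 
  Num.min m%:R z <= \sum_(q < m) (q%:R < z)%R%:R <= Num.min m%:R (z + 1).
Proof.
move=> z0; elim: m => [|m /andP[IH1 IH2]].
  by rewrite big_ord0 ge_min le_min lexx/= addr_ge0.
rewrite big_ord_recr/= le_min; move: IH1 IH2; rewrite le_min => IH1 /andP[IH2 IH3].
rewrite ge_min -natr1; case: ltP => mz /=; rewrite ?addr0 ?mulr1n.
  move: IH1; rewrite (min_idPl (ltW mz)) => IH1.
  by rewrite !lerD2r IH1 IH2/= (le_trans IH2)//= ltW.
move: IH1; rewrite (min_idPr mz) => IH1.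
by rewrite IH1 orbT IH3 (le_trans IH2) ?lerDl.
Qed.

Let approx (y : R) m : (0 < m)%N -> `|y| <= 1 ->
  `|y - (2 / m%:R * (\sum_(q < m) (q%:R < m%:R * (y + 1) / 2)%R%:R) - 1)| <= 2 / m%:R.
Proof.
move=> m0; rewrite ler_norml => /andP[y1 y2].
have mr : 0 < m%:R :> R by rewrite ltr0n.
have z0 : 0 <= m%:R * (y + 1) / 2.
  by rewrite divr_ge0// mulr_ge0// -lerBlDr sub0r.
have /andP[] := count_lt m z0.
rewrite le_min ge_min => c1 /andP[_ c2].
have {}c1 : m%:R * (y + 1) / 2 <= \sum_(q < m) (q%:R < m%:R * (y + 1) / 2)%R%:R.
  case/orP: c1 => //; apply: le_trans; rewrite -mulrA ler_piMr//.
  by rewrite ler_pdivrMr// mul1r -lerBrDr (le_trans y2)// ; lra.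
set S := \sum_(q < m) _ in c1 c2 *.
have -> : y - (2 / m%:R * S - 1) = 2 / m%:R * (m%:R * (y + 1) / 2 - S).
  by field; rewrite gt_eqF.
rewrite normrM ger0_norm ?divr_ge0// ler_piMr ?divr_ge0// ler_norml; apply/andP; split; lra.
Qed.

Lemma independent_factor (V Y : T -> R) (c : R) :
  measurable_fun [set: T] V -> measurable_fun [set: T] Y ->
  (forall w, `|V w| <= 1) -> (forall w, `|Y w| <= 1) ->
  (forall y, \int[P]_w ((y < Y w)%R%:R * V w) = \int[P]_w ((y < Y w)%R%:R) * c) ->
  \int[P]_w V w = c ->
  \int[P]_w (Y w * V w) = \int[P]_w (Y w) * c.
Proof.
move=> mV mY V1 Y1 Ec E1.
have mI y : measurable_fun [set: T] (fun w => (y < Y w)%R%:R : R).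
  rewrite (_ : (fun _ => _) = \1_[set w | y < Y w]).
    apply: measurable_indic; rewrite -[X in measurable X]setTI.
    have -> : [set w | y < Y w] = Y @^-1` `]y, +oo[.
      by apply/seteqP; split=> w /=; rewrite in_itv/= andbT.
    exact: mY.
  apply/funext => w; rewrite indicE; case: (boolP (w \in _)) => [/set_mem/= -> //|/negP h].
  by case: ltP => // yw; case: h; exact/mem_set.
have bI y w : `|(y < Y w)%R%:R : R| <= 1 by case: (_ < _); rewrite ?normr1 ?normr0.
pose S m w : R := 2 / m%:R * (\sum_(q < m) (2 * q%:R / m%:R - 1 < Y w)%R%:R) - 1.
have YS m w : (0 < m)%N -> `|Y w - S m w| <= 2 / m%:R.
  move=> m0; have mr : 0 < m%:R :> R by rewrite ltr0n.
  apply: le_trans (approx m0 (Y1 w)); rewrite /S le_eqVlt; apply/orP; left; apply/eqP.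
  congr `|_ - (_ * _ - _)|; apply: eq_bigr => q _; congr (nat_of_bool _)%:R.
  rewrite ltrBlDr ltr_pdivrMr// ltr_pdivlMr// [2 * _]mulrC.
  by rewrite [m%:R * _]mulrC.
have mS m : measurable_fun [set: T] (S m).
  by apply: measurable_funB => //; apply: measurable_funM => //; exact: measurable_sum.
have iU (U : T -> R) : measurable_fun [set: T] U -> (forall w, `|U w| <= 1) ->
  P.-integrable [set: T] (EFin \o U) by exact: bounded_integrable.
have bYS m (U : T -> R) w : (0 < m)%N -> `|U w| <= 1 -> `|(Y w - S m w) * U w| <= 2 / m%:R.
  by move=> m0 U1; rewrite normrM -[leRHS]mulr1 ler_pM// YS.
have iS m (U : T -> R) : (0 < m)%N -> measurable_fun [set: T] U -> (forall w, `|U w| <= 1) ->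
  P.-integrable [set: T] (EFin \o (fun w => S m w * U w)).
  move=> m0 mU U1; apply: (@bounded_integrable _ _ _ P _ (1 + 2 / m%:R)).
    exact: measurable_funM.
  move=> w; have -> : S m w * U w = Y w * U w - (Y w - S m w) * U w by ring.
  apply: (le_trans (ler_normB _ _)); apply: lerD; last exact: bYS.
  by rewrite normrM mulr_ile1.
have ES m (U : T -> R) : (0 < m)%N -> measurable_fun [set: T] U -> (forall w, `|U w| <= 1) ->
   \int[P]_w (S m w * U w) = 2 / m%:R * (\sum_(q < m) \int[P]_w ((2 * q%:R / m%:R - 1 < Y w)%R%:R * U w)) - \int[P]_w U w.
  move=> m0 mU U1.
  have iq (q : 'I_m) : P.-integrable [set: T] (EFin \o (fun w => (2 * q%:R / m%:R - 1 < Y w)%R%:R * U w)).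
    by apply: iU; [exact: measurable_funM|move=> w; rewrite normrM mulr_ile1].
  rewrite -(Rintegral_sum_seq _ iq) -RintegralZl//; last exact: integrable_sum_seq.
  rewrite -RintegralB//; last 2 first.
  - have := integrableZl measurableT (2 / m%:R) (integrable_sum_seq (index_enum 'I_m) iq).
    by apply: eq_integrable => // w _ /=; rewrite EFinM.
  - exact: iU.
  apply: eq_Rintegral => w _; by rewrite /S mulrBl mul1r -mulr_suml mulrA.
have dYS m (U : T -> R) : (0 < m)%N -> measurable_fun [set: T] U -> (forall w, `|U w| <= 1) ->
   `|\int[P]_w (Y w * U w) - \int[P]_w (S m w * U w)| <= 2 / m%:R.
  move=> m0 mU U1; rewrite -RintegralB//; last 2 first.
  - by apply: iU; [exact: measurable_funM|move=> w; rewrite normrM mulr_ile1].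
  - exact: iS.
  under eq_Rintegral do rewrite -mulrBl.
  apply: normr_Rintegral_prob_le; last by move=> w; exact: bYS.
  by apply: measurable_funM => //; exact: measurable_funB.
have c1 : `|c| <= 1 by rewrite -E1; exact: normr_Rintegral_prob_le.
have D m : (0 < m)%N -> `|\int[P]_w (Y w * V w) - \int[P]_w Y w * c| <= 4 / m%:R.
  move=> m0; have d1 := dYS m V m0 mV V1.
  have d2 : `|\int[P]_w (Y w * 1) - \int[P]_w (S m w * 1)| <= 2 / m%:R.
    by apply: dYS => // w; rewrite normr1.
  have e : \int[P]_w (S m w * V w) = \int[P]_w (S m w * 1) * c.
    rewrite !ES//; last by move=> w; rewrite normr1.
    rewrite mulrBl E1; congr (_ - _); last first.
      rewrite Rintegral_cst// (_ : fine _ = fine 1%E) ?mulr1 ?mul1r//.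
      by congr fine; exact: probability_setT.
    rewrite -[RHS]mulrA mulr_suml; congr (_ * _); apply: eq_bigr => q _; rewrite Ec.
    by under [in RHS]eq_Rintegral do rewrite mulr1.
  have e2 : \int[P]_w Y w = \int[P]_w (Y w * 1) by under [in RHS]eq_Rintegral do rewrite mulr1.
  have -> : \int[P]_w (Y w * V w) - \int[P]_w Y w * c =
     (\int[P]_w (Y w * V w) - \int[P]_w (S m w * V w)) -
     (\int[P]_w (Y w * 1) - \int[P]_w (S m w * 1)) * c.
    by rewrite e -e2; move: (Rintegral _ _ _) (Rintegral _ _ _) => p q; ring.
  apply: (le_trans (ler_normB _ _)); rewrite (_ : 4 / m%:R = 2 / m%:R + 2 / m%:R); last first.
    by rewrite -mulrDl; congr (_ / _); ring.
  apply: lerD => //; rewrite normrM.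
  by rewrite -[leRHS]mulr1 ler_pM.
apply/eqP; rewrite -subr_eq0 -normr_le0; apply/ler_addgt0Pr => e e0; rewrite add0r.
have [m me] : exists m : nat, 4 / e < m%:R.
  exists (Num.bound (4 / e)); apply: archi_boundP; by rewrite divr_ge0// ltW.
have m0 : (0 < m)%N by rewrite -(ltr0n R); apply: le_lt_trans me; rewrite divr_ge0// ltW.
by apply: (le_trans (D m m0)); rewrite ler_pdivrMr ?ltr0n// mulrC -ler_pdivrMr// ltW.
Qed.

Lemma Rintegral_indic (A : set T) : measurable A -> \int[P]_w \1_A w = fine (P A).
Proof. by move=> mA; rewrite /Rintegral integral_indic// setIT. Qed.

Lemma independent_prod (n : nat) (S : 'I_n -> set (set T)) (Y : 'I_n -> T -> R) :
  (forall E : 'I_n -> set T, (forall i, S i (E i)) ->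
    (P (\bigcap_(i in [set: 'I_n]) E i) = \prod_(i < n) P (E i))%E) ->
  (forall i, S i setT) -> (forall i E, S i E -> measurable E) ->
  (forall i, measurable_fun [set: T] (Y i)) -> (forall i w, `|Y i w| <= 1) ->
  (forall i y, S i [set w | y < Y i w]) ->
  \int[P]_w (\prod_i Y i w) = \prod_i \int[P]_w Y i w.
Proof.
move=> ind ST Sm mY Y1 SY.
have claim (s : seq 'I_n) : uniq s -> forall E : 'I_n -> set T, (forall i, S i (E i)) ->
  \int[P]_w ((\prod_(i <- s) Y i w) * \prod_(i | i \notin s) \1_(E i) w) =
  \prod_(i <- s) \int[P]_w Y i w * \prod_(i | i \notin s) fine (P (E i)).
  elim: s => [_ E SE|j s IH /= /andP[js us] E SE].
    rewrite big_nil mul1r.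
    have <- : fine (P (\bigcap_(i in [set: 'I_n]) E i)) = \prod_(i | i \notin [::]) fine (P (E i)).
      rewrite ind// (eq_bigr (fun i => (fine (P (E i)))%:E)).
        by rewrite prodEFin; apply: eq_bigl.
      by move=> i _; rewrite fineK// fin_num_measure//; exact: Sm.
    have mE : measurable (\bigcap_(i in [set: 'I_n]) E i).
      by apply: fin_bigcap_measurable => // i _; exact: Sm.
    rewrite -Rintegral_indic//; apply: eq_Rintegral => w _; rewrite big_nil mul1r.
    rewrite indicE; case: (boolP (w \in _)) => [/set_mem wE|wE].
      by apply: big1 => i _; rewrite indicE mem_set//; exact: wE.
    have [i wi] : exists i, ~ E i w.
      by apply/existsNP => h; move/negP: wE; apply; apply/mem_set => i _.
    by rewrite (bigD1 i)//= indicE memNset// mul0r.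
  pose V w := (\prod_(i <- s) Y i w) * \prod_(i | i \notin j :: s) \1_(E i) w.
  pose c := \prod_(i <- s) \int[P]_w Y i w * \prod_(i | i \notin j :: s) fine (P (E i)).
  have mid w (A : 'I_n -> set T) : (forall i, i != j -> A i = E i) ->
      \prod_(i | i \notin s) \1_(A i) w = \1_(A j) w * \prod_(i | i \notin j :: s) \1_(E i) w :> R.
    move=> AE; rewrite (bigD1 j)//=; congr (_ * _); apply: eq_big => [i|i /andP[_ ij]].
      by rewrite inE negb_or andbC.
    by rewrite AE.
  have key A : S j A -> \int[P]_w (\1_A w * V w) = fine (P A) * c.
    move=> SA; pose E' i := if i == j then A else E i.
    have SE' i : S i (E' i) by rewrite /E'; case: eqP => [->|].
    have := IH us E' SE'.
    have -> : \prod_(i | i \notin s) fine (P (E' i)) = fine (P A) * \prod_(i | i \notin j :: s) fine (P (E i)).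
      rewrite (bigD1 j)//= /E' eqxx; congr (_ * _); apply: eq_big => [i|i /andP[_ /negbTE ->]]//.
      by rewrite inE negb_or andbC.
    rewrite mulrCA => <-; apply: eq_Rintegral => w _.
    rewrite (mid w E'); first by rewrite /E' eqxx /V mulrCA.
    by move=> i /negbTE ij; rewrite /E' ij.
  have PT : fine (P setT) = 1 by rewrite (_ : P setT = 1%E) //; exact: probability_setT.
  have -> : \prod_(i <- j :: s) \int[P]_w Y i w * \prod_(i | i \notin j :: s) fine (P (E i)) =
    \int[P]_w Y j w * c by rewrite big_cons mulrA.
  rewrite -(@independent_factor V (Y j) c)//.
  - by apply: eq_Rintegral => w _; rewrite big_cons /V mulrA.
  - apply: measurable_funM; first exact: measurable_prod.
    under eq_fun do rewrite big_mkcond/=.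
    apply: measurable_prod => i _; case: (i \notin _) => //.
    by apply: measurable_indic; exact: Sm.
  - move=> w; rewrite /V normrM mulr_ile1//.
      by elim: (s) => [|i s' IHs]; rewrite ?big_nil ?normr1// big_cons normrM mulr_ile1.
    rewrite normr_prod; apply: prodr_ile1 => i _; rewrite normr_ge0/= indicE.
    by case: (_ \in _); rewrite ?normr1 ?normr0.
  - move=> y; have <- : \int[P]_w (\1_[set w | y < Y j w] w * V w) = \int[P]_w ((y < Y j w)%R%:R * V w).
      apply: eq_Rintegral => w _; congr (_ * _); rewrite indicE; congr (nat_of_bool _)%:R.
      by apply/idP/idP => [/set_mem|h]//; exact/mem_set.
    rewrite key//; congr (_ * _).
    rewrite -Rintegral_indic; last exact: (Sm j).
    apply: eq_Rintegral => w _.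
    rewrite indicE; congr (nat_of_bool _)%:R.
    by apply/idP/idP => [/set_mem|h]//; exact/mem_set.
  - have := key setT (ST j); rewrite PT mul1r => <-; apply: eq_Rintegral => w _.
    by rewrite indicT mul1r.
have := claim (index_enum 'I_n) (index_enum_uniq _) (fun=> setT) ST.
have none (F : 'I_n -> R) : \prod_(i | i \notin index_enum 'I_n) F i = 1.
  by apply: big_pred0 => i; rewrite mem_index_enum.
rewrite none mulr1 => <-.
by apply: eq_Rintegral => w _; rewrite none mulr1.
Qed.

End independence.

Section fbm_field_product.
Context (R : realType).

(* Replacing the bump (y |-> prod_i psi (y_i / eta)) by its rescaled version
   (y |-> 2^-n prod_i psi (y_i / (2 eta))) one coordinate at a time gives a
   telescoping sum; [theta l] are the factors of its l-th term, and the untouched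
   bump when l is the number of coordinates. *)
Definition theta (l i : nat) (x : R) : R :=
  if (i < l)%N then psi x else if i == l then dpsi x else 2^-1 * psi (x / 2).

Lemma theta_lt l i : (i < l)%N -> theta l i = psi (R := R).
Proof. by move=> il; apply/funext => x; rewrite /theta il. Qed.

Lemma theta_eq l : theta l l = dpsi (R := R).
Proof. by apply/funext => x; rewrite /theta ltnn eqxx. Qed.

Lemma theta_gt l i : (l < i)%N -> theta l i = fun x => 2^-1 * psi (x / 2).
Proof. by move=> li; apply/funext => x; rewrite /theta ltnNge (ltnW li) gtn_eqF. Qed.

Lemma measurable_theta l i : measurable_fun [set: R] (theta l i).
Proof.
have mp := @measurable_psi R.
have mp2 : measurable_fun [set: R] (fun x : R => 2^-1 * psi (x / 2)).
  by apply: measurable_funM => //; apply: (measurableT_comp mp); exact: measurable_funM.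
have [il|li|->] := ltngtP i l; [by rewrite theta_lt|by rewrite theta_gt|rewrite theta_eq].
exact: measurable_funB.
Qed.

Lemma theta_le1 l i x : `|theta l i x| <= 1.
Proof.
have [il|li|->] := ltngtP i l; [rewrite theta_lt//|rewrite theta_gt//|rewrite theta_eq].
- by rewrite ger0_norm ?psi_ge0 ?psi_le1.
- rewrite ger0_norm ?mulr_ge0 ?psi_ge0// mulr_ile1 ?psi_ge0 ?psi_le1//.
  by rewrite invf_le1 ?ler1n.
- by rewrite -charw_wdpsi; apply: charw_le1; [exact: measurable_wdpsi|exact: wdpsi_le1].
Qed.

Lemma wdpsi_gauss_le (A u : R) : 0 < A -> `|wdpsi u| * expR (- (u ^+ 2 / A)) <= 3 / 2 * A.
Proof.
move=> A0; rewrite ger0_norm ?wdpsi_ge0//.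
apply: (le_trans (ler_wpM2r (expR_ge0 _) (wdpsi_le u))).
have := expR_ge1Dx (u ^+ 2 / A).
move=> h; rewrite expRN ler_pdivrMr ?expR_gt0//.
rewrite -[leRHS]mulrA; apply: ler_wpM2l => //.
by rewrite mulrC -ler_pdivrMr// (le_trans _ h)// lerDr.
Qed.

Context (k : nat) (H : R).
Hypothesis H01 : 0 < H < 1.

Lemma fbm_field_product : (0 < k)%N -> exists2 C, 0 < C &
  forall d (T : measurableType d) (P : probability T R) n (B : 'rV[R]_k -> T -> 'rV[R]_n)
    m (t : 'I_m -> 'rV[R]_k) (c : 'I_m -> 'I_n -> R) (r : 'I_m -> R) (iso : pred 'I_m) eta l,
  fbm_field P H B -> 0 < eta -> (forall j, orthant (t j)) ->
  (forall j, [/\ 0 < r j, r j <= enorm (t j) &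
     forall i : 'I_m, (j < i)%N -> r j <= enorm (t i - t j)]) ->
  (forall j, iso j -> eta <= enorm (t j) /\ forall i, i != j -> eta <= enorm (t i - t j)) ->
  `|\int[P]_w \prod_j \prod_(i < n) theta l i ((B (t j) w ord0 i - c j i) / eta)| <=
  \prod_j ((if (l < n)%N && iso j then 3 * C ^+ 2 * (eta ^+ 2 / eta `^ (2 * H)) else 1) /
           Num.max 1 (r j `^ H / C / eta) ^+ n).
Proof.
move=> k0; have [C C0 HC] := fbm_charw H01 k0; exists C => //.
move=> d T P n B m t c r iso eta l [fb ind _] eta0 ot rP isoP.
pose g : R := 3 * C ^+ 2 * (eta ^+ 2 / eta `^ (2 * H)).
pose q j := r j `^ H / C / eta.
have q0 j : 0 < q j by have [r0 _ _] := rP j; rewrite !divr_gt0// powR_gt0.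
have max0 x : 0 < Num.max 1 x :> R by rewrite lt_max ltr01.
have comp (i : 'I_n) : `|\int[P]_w \prod_j theta l i ((B (t j) w ord0 i - c j i) / eta)| <=
    \prod_j ((if (i == l :> nat) && iso j then g else 1) / Num.max 1 (q j)).
  have [il|li|il] := ltngtP i l.
  - rewrite theta_lt//; under eq_Rintegral do under eq_bigr do rewrite -charw1.
    apply: (@HC d T P (fun t w => B t w ord0 i) (fun=> 1) m t (fun j => c j i) r _ pred0 eta) => //.
      by move=> u; rewrite normr1.
    by move=> j /=.
  - rewrite theta_gt//.
    have -> : \int[P]_w \prod_j (2^-1 * psi ((B (t j) w ord0 i - c j i) / eta / 2)) =
        2^-1 ^+ m * \int[P]_w \prod_j charw (fun=> 1) ((B (t j) w ord0 i - c j i) / (2 * eta)).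
      rewrite -RintegralZl//.
        apply: eq_Rintegral => w _; rewrite big_split/= prodr_const card_ord; congr (_ * _).
        apply: eq_bigr => j _; rewrite charw1; congr psi.
        by rewrite invfM -mulrA [2^-1 * _]mulrC.
      apply: (@bounded_integrable _ _ _ P _ 1).
        apply: measurable_prod => j _; under eq_fun do rewrite charw1.
        apply: (measurableT_comp (@measurable_psi R)).
        by apply: measurable_funM => //; apply: measurable_funB => //; apply: (fbm_measurable (fb i)).
      move=> w; elim: (index_enum _) => [|j s IHs]; first by rewrite big_nil normr1.
      by rewrite big_cons normrM mulr_ile1// charw1 ger0_norm ?psi_ge0 ?psi_le1.
    rewrite normrM ger0_norm ?exprn_ge0//.
    have n11 : R -> `|1 : R| <= 1 by rewrite normr1.
    have e2 : 0 < 2 * eta by rewrite mulr_gt0.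
    have {}HC := @HC d T P (fun t w => B t w ord0 i) (fun=> 1) m t (fun j => c j i) r (fun=> 1) pred0 (2 * eta)
      (fb i) (measurable_cst _) n11 (fun=> erefl) e2 ot rP (fun j f => False_ind _ (notF f)) (fun=> lexx 1).
    apply: (le_trans (ler_wpM2l _ HC)); first by rewrite exprn_ge0.
    rewrite -[m in _ ^+ m](card_ord m) -prodr_const -big_split/=.
    apply: ler_prod => j _; rewrite !mul1r -invfM invr_ge0 mulr_ge0 ?(ltW (max0 _))//=.
    rewrite lef_pV2 ?posrE ?mulr_gt0//.
    have -> : r j `^ H / C / (2 * eta) = q j / 2 by rewrite /q invfM [2^-1 * _]mulrC mulrA.
    by rewrite ge_max -ler_pdivrMl// -[_ <= 2 * _]ler_pdivrMl// !le_max [2^-1 * q j]mulrC lexx orbT mulr1 invf_le1 ?ler1n.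
  - rewrite il theta_eq; under eq_Rintegral do under eq_bigr do rewrite -charw_wdpsi.
    apply: (@HC d T P (fun t w => B t w ord0 i) (@wdpsi R) m t (fun j => c j i) r _ iso eta) => //.
    + exact: measurable_wdpsi.
    + exact: wdpsi_le1.
    + by move=> u; rewrite /wdpsi /gauss sqrrN.
    + move=> j; case: (iso j) => // u.
      rewrite (_ : eta `^ (2 * H) * (u / eta) ^+ 2 / (2 * C ^+ 2) = u ^+ 2 / (2 * C ^+ 2 * (eta ^+ 2 / eta `^ (2 * H)))).
        apply: (le_trans (wdpsi_gauss_le _ _)).
          by rewrite !mulr_gt0// ?invr_gt0 ?powR_gt0 ?exprn_gt0.
        rewrite /g le_eqVlt; apply/orP; left; apply/eqP; move: (_ / _ `^ _) => z; by field.
      have e0 : 0 < eta `^ (2 * H) by rewrite powR_gt0.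
      move: (_ `^ _) e0 => z z0; field; by rewrite !gt_eqF.
pose S i := field_sigma (@orthant R k) (fun t w => B t w ord0 i).
have mS i A : S i A -> measurable A.
  have smT : sigma_algebra [set: T] (@measurable d T) by exact: sigma_algebra_measurable.
  apply: smallest_sub => // _ [u ou [C' mC' <-]].
  by apply: (fbm_measurable (fb i)).
have mY (i : 'I_n) : measurable_fun [set: g_sigma_algebraType (\bigcup_(t in @orthant R k)
      preimage_set_system [set: T] (fun w => B t w ord0 i) measurable)]
   (fun w => \prod_j theta l i ((B (t j) w ord0 i - c j i) / eta)).
  apply: measurable_prod => j _; apply: (measurableT_comp (measurable_theta l i)).
  apply: measurable_funM => //; apply: measurable_funB => //.
  move=> _ A mA; apply: sub_sigma_algebra; exists (t j); first exact: ot.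
  by exists A.
have E : \int[P]_w (\prod_(i < n) \prod_j theta l i ((B (t j) w ord0 i - c j i) / eta)) =
   \prod_(i < n) \int[P]_w (\prod_j theta l i ((B (t j) w ord0 i - c j i) / eta)).
  apply: (@independent_prod _ T R P n S).
  - exact: ind.
  - by move=> i; exact: (@measurableT _ (g_sigma_algebraType _)).
  - exact: mS.
  - move=> i; apply: measurable_prod => j _; apply: (measurableT_comp (measurable_theta l i)).
    apply: measurable_funM => //; apply: measurable_funB => //.
    by apply: (fbm_measurable (fb i)).
  - move=> i w; elim: (index_enum _) => [|j s IHs]; first by rewrite big_nil normr1.
    by rewrite big_cons normrM mulr_ile1// theta_le1.
  - move=> i y; have := mY i measurableT `]y, +oo[%classic (measurable_itv _).
    rewrite setTI; congr (S i _).
    by apply/seteqP; split=> w /=; rewrite in_itv/= andbT.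
under eq_Rintegral do rewrite exchange_big.
rewrite E normr_prod.
apply: (@le_trans _ _ (\prod_(i < n) \prod_j ((if (i == l :> nat) && iso j then g else 1) / Num.max 1 (q j)))).
  by apply: ler_prod => i _; rewrite normr_ge0/=.
rewrite exchange_big/=.
rewrite le_eqVlt; apply/orP; left; apply/eqP; apply: eq_bigr => j _.
rewrite big_split/= prodrV; last by move=> i _; rewrite unitfE gt_eqF.
rewrite prodr_const card_ord; congr (_ / _).
have [ln|nl] := ltnP l n => /=.
  rewrite (bigD1 (Ordinal ln))//= eqxx big1 ?mulr1// => i.
  by rewrite -val_eqE/= => /negbTE ->.
by apply: big1 => i _; rewrite ltn_eqF// (leq_trans (ltn_ord i)).
Qed.

End fbm_field_product.

(** * Moments of occupation integrals *)

Section noniso.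
Context (R : realType) (k m : nat) (t : 'I_m -> 'rV[R]_k) (r : 'I_m -> R) (eta : R).
Hypothesis rt : forall j, r j <= enorm (t j).
Hypothesis rd : forall j i : 'I_m, (j < i)%N -> r j <= enorm (t i - t j).

Definition isolated (j : 'I_m) :=
  (eta <= enorm (t j)) && [forall i, (i != j) ==> (eta <= enorm (t i - t j))].

Lemma isolatedP j : isolated j ->
  eta <= enorm (t j) /\ forall i, i != j -> eta <= enorm (t i - t j).
Proof.
by move=> /andP[-> /forallP h]; split=> // i ij; have := h i; rewrite ij.
Qed.

(* A non isolated point j with r j >= 2 eta is eta-close to an earlier point i;
   then r i < eta, and i determines j. *)
Lemma card_non_isolated : 0 < eta ->
  (#|[pred j | ~~ isolated j]| <= 2 * #|[pred j | (r j < 2 * eta)%R]|)%N.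
Proof.
move=> eta0; set S := [pred j | (r j < 2 * eta)%R].
pose E := [pred j | ~~ isolated j && (2 * eta <= r j)].
have near j : j \in E -> exists i : 'I_m, (i < j)%N && (enorm (t j - t i) < eta).
  rewrite inE/= => /andP[+ rj]; rewrite negb_and -ltNge => /orP[tj|].
    by have := rt j; move: rj tj; lra.
  apply: contraPP => /forallNP nE; apply/negP; rewrite negbK; apply/forallP => i.
  apply/implyP => ij; rewrite leNgt; apply/negP => d; apply: (nE i).
  rewrite enormB d andbT; have [//|ji] := ltnP i j.
  have ji' : (j < i)%N by rewrite ltn_neqAle eq_sym ij.
  by have := rd ji'; move: d rj eta0; lra.
have [f fP] : exists f : 'I_m -> 'I_m, forall j, j \in E -> (f j < j)%N && (enorm (t j - t (f j)) < eta).
  have /choice[f fP] : forall j, exists i : 'I_m, j \in E -> (i < j)%N && (enorm (t j - t i) < eta).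
    by move=> j; have [/near[i ?]|jE] := boolP (j \in E); [exists i|exists j].
  by exists f.
have fS : [seq f x | x in E] \subset S.
  apply/fintype.subsetP => y /fintype.imageP[j /fP /andP[fj d] ->]; rewrite inE/=.
  by apply: le_lt_trans (rd fj) _; lra.
have finj : {in E &, injective f}.
  suff lt j j' : j \in E -> j' \in E -> f j = f j' -> ~~ (j < j')%N.
    move=> j j' jE j'E e; apply: val_inj; apply/eqP.
    by rewrite eqn_leq !(leqNgt (val _)) (lt _ _ jE j'E e) (lt _ _ j'E jE (esym e)).
  move=> jE j'E e; apply/negP => jj'.
  have /andP[_ d1] := fP _ jE; have /andP[_ d2] := fP _ j'E.
  have := rd jj'; move: jE; rewrite inE/= => /andP[_ rj].
  have := enormD (t j' - t (f j)) (t (f j) - t j); rewrite addrA subrK.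
  rewrite (enormB (t (f j))); move: d2; rewrite -e; move: d1 rj.
  move: (enorm _) (enorm _) (enorm _) (r j) => x y z u; lra.
apply: (@leq_trans #|[predU E & S]|).
  apply: subset_leq_card; apply/fintype.subsetP => j; rewrite !inE/= => ->/=.
  by case: ltP.
rewrite mul2n -addnn; apply: (@leq_trans (#|E| + #|S|)); first by rewrite -cardUI leq_addr.
by rewrite leq_add2r -(card_in_image finj) subset_leq_card.
Qed.

Lemma prod_isolated (e : R) : 0 < eta -> 0 < e <= 1 ->
  \prod_j (if isolated j then e else 1) <= \prod_j (e * (if r j < 2 * eta then e ^- 2 else 1)).
Proof.
move=> eta0 /andP[e0 e1].
rewrite [leLHS](_ : _ = \prod_j (e * (if isolated j then 1 else e^-1))); last first.
  by apply: eq_bigr => j _; case: ifP; rewrite ?mulr1// divff// gt_eqF.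
rewrite [leLHS]big_split/= [leRHS]big_split/=; apply: ler_wpM2l.
  by apply: prodr_ge0 => j _; exact: ltW.
have -> : \prod_i (if isolated i then 1 else e^-1) = \prod_(i in [pred j | ~~ isolated j]) e^-1.
  by rewrite [RHS]big_mkcond/=; apply: eq_bigr => i _; rewrite inE/=; case: isolated.
have -> : \prod_i (if r i < 2 * eta then e ^- 2 else 1) = \prod_(i in [pred j | (r j < 2 * eta)%R]) e ^- 2.
  by rewrite [RHS]big_mkcond/=; apply: eq_bigr => i _; rewrite inE.
rewrite !prodr_const -exprVn -exprM; apply: ler_weXn2l.
  by rewrite invf_ge1.
exact: card_non_isolated.
Qed.

End noniso.

Section energy.
Context (R : realType) (k : nat).
Local Open Scope ereal_scope.

Definition rker (a : R) (z : 'rV[R]_k) : \bar R :=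
  if z == 0%R then +oo else (enorm z `^ (- a))%:E.

Fixpoint energy (a : R) (s : seq 'rV[R]_k) : \bar R :=
  if s is t :: s' then energy a s' * (rker a t + \sum_(x <- s') rker a (x - t)) else 1.

Definition rmin (t : 'rV[R]_k) s : R := (\big[Num.min/enorm t]_(x <- s) enorm (x - t))%R.

Lemma rker_gt0 a z : 0 < rker a z.
Proof. by rewrite /rker; case: eqP => // /eqP z0; rewrite lte_fin powR_gt0// enorm_gt0. Qed.

Lemma rker_sum_gt0 a t s : 0 < rker a t + \sum_(x <- s) rker a (x - t).
Proof.
apply: (lt_le_trans (rker_gt0 a t)); rewrite leeDl//.
by apply: sume_ge0 => x _; exact/ltW/rker_gt0.
Qed.

Lemma energy_gt0 a s : 0 < energy a s.
Proof.
by elim: s => [//|t s IH] /=; rewrite mule_gt0// rker_sum_gt0.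
Qed.

Lemma rmin_le t s : (rmin t s <= enorm t)%R /\ forall x, x \in s -> (rmin t s <= enorm (x - t))%R.
Proof.
rewrite /rmin; elim: s => [|y s [IH1 IH2]]; first by rewrite big_nil.
rewrite big_cons; split=> [|x]; first by rewrite ge_min IH1 orbT.
by rewrite inE => /orP[/eqP ->|/IH2 h]; rewrite ge_min ?lexx// h orbT.
Qed.

Lemma rmin_ge0 t s : (0 <= rmin t s)%R.
Proof.
rewrite /rmin; elim: s => [|y s IH]; first by rewrite big_nil enorm_ge0.
by rewrite big_cons le_min enorm_ge0.
Qed.

Lemma rker_sum_ge a t s : (if rmin t s == 0%R then +oo else (rmin t s `^ (- a))%:E) <=
  rker a t + \sum_(x <- s) rker a (x - t).
Proof.
rewrite /rmin; elim: s => [|y s IH].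
  by rewrite !big_nil adde0 /rker enorm_eq0.
rewrite !big_cons; set M := \big[_/_]_(j <- s) _ in IH *.
have [->|->] : (Num.min (enorm (y - t)) M = enorm (y - t) \/ Num.min (enorm (y - t)) M = M)%R.
  by rewrite /Num.min; case: ifP; [left|right].
  rewrite enorm_eq0 -/(rker a (y - t)) addeCA leeDl//.
  exact/ltW/rker_sum_gt0.
apply: (le_trans IH); rewrite addeCA leeDr//.
exact/ltW/rker_gt0.
Qed.

Lemma prod_rmin (F : R -> R) t s :
  (\prod_(j < size (t :: s)) F (rmin (nth 0 (t :: s) j) (drop j.+1 (t :: s))) =
  F (rmin t s) * \prod_(j < size s) F (rmin (nth 0 s j) (drop j.+1 s)))%R.
Proof. by rewrite big_ord_recl /= drop0. Qed.

Lemma energy_ge a (s : seq 'rV[R]_k) :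
  ((forall j : 'I_(size s), 0 < rmin (nth 0 s j) (drop j.+1 s))%R /\
   (\prod_(j < size s) rmin (nth 0 s j) (drop j.+1 s) `^ (- a))%:E <= energy a s) \/
  energy a s = +oo.
Proof.
elim: s => [|t s IH]; first by left; split=> [[]//|]; rewrite big_ord0.
have W := rker_sum_ge a t s; have W0 := rker_sum_gt0 a t s; have E0 := energy_gt0 a s.
have [r0|r0] := eqVneq (rmin t s) 0%R.
  right; move: W; rewrite r0 eqxx leye_eq /= => /eqP ->.
  by rewrite gt0_muley.
move: W; rewrite (negbTE r0) => W.
case: IH => [[rs IH]|IH]; last by right; rewrite /= IH gt0_mulye.
left; split=> [j|].
  have [j' ->|->] := unliftP ord0 j; last first.
    by rewrite /= drop0 lt_neqAle eq_sym r0 rmin_ge0.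
  by rewrite /=; exact: rs.
rewrite (prod_rmin (fun x => x `^ (- a))%R) /= EFinM muleC.
apply: lee_pmul => //; first by rewrite lee_fin prodr_ge0// => j _; exact: powR_ge0.
by rewrite lee_fin powR_ge0.
Qed.

Lemma energy_bound a (A : R) (s : seq 'rV[R]_k) (E : R) : (0 < A)%R ->
  ((forall j : 'I_(size s), 0 < rmin (nth 0 s j) (drop j.+1 s))%R ->
   (E <= \prod_(j < size s) (A * rmin (nth 0 s j) (drop j.+1 s) `^ (- a)))%R) ->
  E%:E <= (A ^+ size s)%:E * energy a s.
Proof.
move=> A0 EA; have [[rs Es]|->] := energy_ge a s; last first.
  by rewrite gt0_muley ?leey// lte_fin exprn_gt0.
have As : (0%R <= (A ^+ size s)%:E) by rewrite lee_fin exprn_ge0// ltW.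
apply: le_trans (lee_wpmul2l As Es); rewrite -EFinM lee_fin; apply: (le_trans (EA rs)).
by rewrite big_split/= prodr_const card_ord.
Qed.

Lemma rmin_nth (s : seq 'rV[R]_k) (j i : 'I_(size s)) : (j < i)%N ->
  (rmin (nth 0 s j) (drop j.+1 s) <= enorm (nth 0 s i - nth 0 s j))%R.
Proof.
move=> ji; have [_] := rmin_le (nth 0 s j)%R (drop j.+1 s); apply.
have -> : (nth 0 s i = nth 0 (drop j.+1 s) (i - j.+1))%R by rewrite nth_drop subnKC.
by rewrite mem_nth// size_drop ltn_sub2r// (leq_ltn_trans ji).
Qed.

Lemma cube_orthant (t : 'rV[R]_k) : cube t -> orthant t.
Proof. by move=> ct i; have /andP[] := ct i. Qed.

Lemma cube_enorm (t : 'rV[R]_k) : cube t -> (enorm t <= k%:R)%R.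
Proof.
move=> ct; rewrite -[leRHS]mulr1; apply: enorm_le_coord => i.
by have /andP[? ?] := ct i; rewrite ger0_norm.
Qed.

End energy.

Lemma powRV (R : realType) (x r : R) : 0 < x -> x^-1 `^ r = (x `^ r)^-1.
Proof. by move=> x0; rewrite -powR_inv1 ?(ltW x0)// -powRrM mulN1r powRN. Qed.

Lemma pow1R (R : realType) (r : R) : 1 `^ r = 1.
Proof. by rewrite /powR oner_eq0 ln1 mulr0 expR0. Qed.

Section field_moments.
Context (R : realType) (k : nat) (H : R).
Hypothesis H01 : 0 < H < 1.
Hypothesis k0 : (0 < k)%N.

Definition bumps n (l : nat) (eta : R) (c : 'I_n -> R) (y : 'rV[R]_n) : R :=
  \prod_(i < n) theta l i ((y ord0 i - c i) / eta).

Lemma bumps_moment n (beta : R) : 0 < beta <= n%:R -> exists2 A, 0 < A &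
  forall d (T : measurableType d) (P : probability T R) (B : 'rV[R]_k -> T -> 'rV[R]_n)
    (c : 'rV[R]_k -> 'I_n -> R) eta (s : seq 'rV[R]_k),
  fbm_field P H B -> 0 < eta -> (forall t, t \in s -> cube t) ->
  ((`|\int[P]_w \prod_(t <- s) bumps n eta (c t) (B t w)|)%:E <=
   ((A * eta `^ beta) ^+ size s)%:E * energy (H * beta) s)%E.
Proof.
move=> /andP[b0 bn]; have [C C0 HC] := fbm_field_product H01 k0.
exists (C `^ beta); first exact: powR_gt0.
move=> d T P B c eta s fb eta0 cs.
apply: energy_bound => [|rs]; first by rewrite mulr_gt0// powR_gt0.
pose r (j : 'I_(size s)) := rmin (nth 0 s j) (drop j.+1 s).
have {}rs : forall j, 0 < r j by [].
have rP (j : 'I_(size s)) : [/\ 0 < r j, r j <= enorm (nth 0 s j) &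
     forall i : 'I_(size s), (j < i)%N -> r j <= enorm (nth 0 s i - nth 0 s j)].
  by split=> [//||i ji]; [exact: (rmin_le _ _).1|exact: rmin_nth].
have os (j : 'I_(size s)) : orthant (nth 0 s j) by apply/cube_orthant/cs/mem_nth.
have := HC d T P n B (size s) (fun j => nth 0 s j) (fun j => c (nth 0 s j)) r pred0 eta n
  fb eta0 os rP (fun j f => False_ind _ (notF f)).
rewrite ltnn /=.
under eq_Rintegral do rewrite -(big_mkord xpredT (fun j => bumps n eta (c (nth 0 s j)) (B (nth 0 s j) _))) -(big_nth 0 xpredT (fun t => bumps n eta (c t) (B t _))).
move=> h; apply: (le_trans h); apply: ler_prod => j _.
have q0 : 0 < r j `^ H / C / eta by rewrite !divr_gt0// powR_gt0.
have m1 : 1 <= Num.max 1 (r j `^ H / C / eta) by rewrite le_max lexx.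
have m0 : 0 < Num.max 1 (r j `^ H / C / eta) by exact: lt_le_trans m1.
rewrite divr_ge0 ?exprn_ge0 ?(ltW m0)//= mul1r.
rewrite powRN -powR_mulrn ?(ltW m0)//.
have -> : C `^ beta * eta `^ beta / rmin (nth 0 s j) (drop j.+1 s) `^ (H * beta) = ((r j `^ H / C / eta) `^ beta)^-1.
  rewrite powRrM -!mulrA !powRM ?invr_ge0 ?powR_ge0 ?mulr_ge0 ?invr_ge0 ?(ltW C0) ?(ltW eta0)//.
  rewrite !powRV// !invfM !invrK mulrCA [RHS]mulrC -mulrA.
  by rewrite mulrCA.
rewrite lef_pV2 ?posrE ?powR_gt0//.
apply: (@le_trans _ _ (Num.max 1 (r j `^ H / C / eta) `^ beta)); last exact: ler_powR.
by apply: ge0_ler_powR; rewrite ?nnegrE ?(ltW b0) ?(ltW q0) ?(ltW m0)// le_max lexx orbT.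
Qed.

Lemma bumps_increment_moment n (delta : R) : 0 < delta <= 2 - 2 * H -> exists2 A, 0 < A &
  forall d (T : measurableType d) (P : probability T R) (B : 'rV[R]_k -> T -> 'rV[R]_n)
    (c : 'rV[R]_k -> 'I_n -> R) l eta (s : seq 'rV[R]_k),
  fbm_field P H B -> (l < n)%N -> 0 < eta <= 1 -> (forall t, t \in s -> cube t) ->
  ((`|\int[P]_w \prod_(t <- s) bumps l eta (c t) (B t w)|)%:E <=
   ((A * eta `^ (n%:R + delta)) ^+ size s)%:E * energy (H * n%:R + 2 * delta) s)%E.
Proof.
move=> /andP[d0 d1]; have [C C0 HC] := fbm_field_product H01 k0.
pose G := 1 + 3 * C ^+ 2; pose D : R := k%:R + 2.
have G1 : 1 <= G by rewrite lerDl mulr_ge0// sqr_ge0.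
have G0 : 0 < G by exact: lt_le_trans G1.
have D0 : 0 < D by rewrite ltr_wpDl.
exists (G * D `^ (2 * delta) * C ^+ n); first by rewrite !mulr_gt0 ?powR_gt0 ?exprn_gt0.
move=> d T P B c l eta s fb ln /andP[eta0 eta1] cs.
apply: energy_bound => [|rs].
  by rewrite !mulr_gt0 ?powR_gt0 ?exprn_gt0.
pose r (j : 'I_(size s)) := rmin (nth 0 s j) (drop j.+1 s).
have {}rs : forall j, 0 < r j by [].
have rP (j : 'I_(size s)) : [/\ 0 < r j, r j <= enorm (nth 0 s j) &
     forall i : 'I_(size s), (j < i)%N -> r j <= enorm (nth 0 s i - nth 0 s j)].
  by split=> [//||i ji]; [exact: (rmin_le _ _).1|exact: rmin_nth].
have os (j : 'I_(size s)) : orthant (nth 0 s j) by apply/cube_orthant/cs/mem_nth.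
pose t (j : 'I_(size s)) := nth 0 s j.
have := HC d T P n B (size s) t (fun j => c (nth 0 s j)) r (isolated t eta) eta l
  fb eta0 os rP (@isolatedP _ _ _ t eta).
rewrite ln /=.
under eq_Rintegral do rewrite -(big_mkord xpredT (fun j => bumps l eta (c (nth 0 s j)) (B (nth 0 s j) _))) -(big_nth 0 xpredT (fun t => bumps l eta (c t) (B t _))).
move=> h; apply: (le_trans h).
pose e := eta `^ delta.
have e0 : 0 < e by exact: powR_gt0.
have e1 : e <= 1 by rewrite -(pow1R delta); apply: ge0_ler_powR; rewrite ?nnegrE// ltW.
pose q j := r j `^ H / C / eta.
have q0 j : 0 < q j by rewrite !divr_gt0// powR_gt0.
have m1 j : 1 <= Num.max 1 (q j) by rewrite le_max lexx.
have m0 j : 0 < Num.max 1 (q j) by exact: lt_le_trans (m1 j).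
rewrite big_split/= !prodrV; last first.
  by move=> j _; rewrite unitfE gt_eqF// exprn_gt0//; exact: m0.
apply: (@le_trans _ _ ((\prod_(j < size s) (G * (e * (if r j < 2 * eta then e ^- 2 else 1)))) /
   \prod_(j < size s) (q j ^+ n))).
  apply: ler_pM.
  - by apply: prodr_ge0 => j _; case: ifP => // _; rewrite !mulr_ge0// ?invr_ge0 ?exprn_ge0 ?powR_ge0// ltW.
  - by rewrite invr_ge0; apply: prodr_ge0 => j _; rewrite exprn_ge0//; exact: ltW (m0 j).
  - rewrite [leRHS]big_split/=; apply: (@le_trans _ _ ((\prod_(j < size s) G) * \prod_(j < size s) (if isolated t eta j then e else 1))).
      rewrite -big_split/=; apply: ler_prod => j _; case: ifP => _; last by rewrite ler01 mulr1.
      rewrite mulr_ge0 ?divr_ge0 ?mulr_ge0 ?exprn_ge0 ?powR_ge0 ?(ltW eta0) ?(ltW C0)//=.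
      apply: ler_pM; rewrite ?divr_ge0 ?mulr_ge0 ?exprn_ge0 ?powR_ge0 ?(ltW eta0) ?(ltW C0) ?lerDr//.
      rewrite ler_pdivrMr ?powR_gt0// -powR_mulrn ?(ltW eta0)// -powRD; last by rewrite (gt_eqF eta0) implybT.
      apply: ger_powR; first by rewrite eta0.
      by move: d1; lra.
    apply: ler_wpM2l; first by apply: prodr_ge0 => j _; exact: ltW.
    apply: prod_isolated => //; last by rewrite e0.
      by move=> j; have [] := rP j.
    by move=> j; have [] := rP j.
  - rewrite lef_pV2 ?posrE ?prodr_gt0// => [|j _|j _]; [|by rewrite exprn_gt0//; exact: m0|by rewrite exprn_gt0].
    apply: ler_prod => j _; rewrite exprn_ge0 ?(ltW (q0 j))//=.
    by apply: lerXn2r; rewrite ?nnegrE ?(ltW (q0 j)) ?(ltW (m0 j))// le_max lexx orbT.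
rewrite -prodrV; last by move=> j _; rewrite unitfE gt_eqF// exprn_gt0.
rewrite -big_split/=; apply: ler_prod => j _; apply/andP; split.
  rewrite divr_ge0 ?exprn_ge0 ?(ltW (q0 j))// !mulr_ge0 ?(ltW G0) ?(ltW e0)//.
  by case: ifP; rewrite ?invr_ge0 ?exprn_ge0// ltW.
rewrite -/(r j); have r0 := rs j.
have rD : r j <= D.
  have [_ h1 _] := rP j; apply: (le_trans h1); apply: (le_trans (cube_enorm (cs _ _))); first exact: mem_nth.
  by rewrite lerDl.
have key : (if r j < 2 * eta then e ^- 2 else 1) <= (D / r j) `^ (2 * delta).
  have Dr0 : 0 < D / r j by rewrite divr_gt0.
  case: ifP => reta.
    rewrite -exprVn -powR_mulrn ?invr_ge0 ?(ltW e0)// /e -powRN -powRrM.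
    have -> : eta `^ (- delta * 2) = eta^-1 `^ (2 * delta).
      by rewrite mulNr powRN powRV// mulrC.
    apply: ge0_ler_powR; rewrite ?nnegrE ?invr_ge0 ?(ltW eta0) ?(ltW Dr0) ?mulr_ge0 ?(ltW d0)//.
    rewrite ler_pdivlMr// mulrC ler_pdivrMr// (le_trans (ltW reta))// ler_wpM2r ?(ltW eta0)//.
    by rewrite lerDr.
  rewrite -[leLHS](pow1R (2 * delta)); apply: ge0_ler_powR; rewrite ?nnegrE ?(ltW Dr0) ?mulr_ge0 ?(ltW d0)//.
  by rewrite ler_pdivlMr// mul1r.
have -> : G * D `^ (2 * delta) * C ^+ n * eta `^ (n%:R + delta) * r j `^ (- (H * n%:R + 2 * delta)) =
   G * (e * (D / r j) `^ (2 * delta)) / q j ^+ n.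
  rewrite opprD powRD; last by rewrite (gt_eqF eta0) implybT.
  rewrite powRD; last by rewrite (gt_eqF r0) implybT.
  rewrite !powRN (powRrM _ H) !powR_mulrn ?powR_ge0 ?(ltW eta0)// powRM ?invr_ge0 ?(ltW D0) ?(ltW r0)//.
  rewrite powRV// /q !expr_div_n -/e.
  have := powR_gt0 (2 * delta) r0; have := powR_gt0 H r0; have := powR_gt0 (2 * delta) D0.
  move: (r j `^ _) (r j `^ _) (D `^ _) => x y z x0 y0 z0.
  by field; rewrite ?expf_neq0 ?gt_eqF.
rewrite ler_pM2r ?invr_gt0 ?exprn_gt0//; apply: ler_wpM2l; first exact: ltW.
by apply: ler_wpM2l => //; exact: ltW.
Qed.

End field_moments.

Section shells.
Context (R : realType) (n : nat).
Local Notation dy j := (2^-1 ^+ j : R).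

Definition cball (x : 'rV[R]_n) (r : R) := [set y : 'rV[R]_n | enorm (x - y) <= r].

Lemma measurable_enorm_sub (x : 'rV[R]_n) : measurable_fun [set: 'rV[R]_n] (fun y => enorm (x - y)).
Proof. by apply: measurable_enorm; apply: measurable_rVB. Qed.

Lemma measurable_cball x r : measurable (cball x r).
Proof.
rewrite -[X in measurable X]setTI (_ : cball x r = (fun y => enorm (x - y)) @^-1` `]-oo, r]).
  exact: measurable_enorm_sub.
by apply/seteqP; split=> y /=; rewrite in_itv.
Qed.

Lemma dy_gt0 j : 0 < dy j. Proof. by rewrite exprn_gt0. Qed.

Lemma dy_le1 j : dy j <= 1. Proof. by rewrite exprn_ile1// invf_le1 ?ler1n. Qed.

Lemma dy_powR j c : dy j `^ c = (2^-1 `^ c) ^+ j.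
Proof.
elim: j => [|j IH]; first by rewrite !expr0 pow1R.
by rewrite !exprS powRM ?exprn_ge0 ?invr_ge0// IH.
Qed.

Lemma measurable_rker_sub a (x : 'rV[R]_n) : measurable_fun [set: 'rV[R]_n] (fun y => rker a (x - y)).
Proof.
apply: measurable_fun_ifT => //.
  under eq_fun do rewrite -enorm_eq0.
  apply: measurable_fun_eqr => //; exact: measurable_enorm_sub.
apply/measurable_EFinP; apply: (measurableT_comp (measurable_powR _)).
exact: measurable_enorm_sub.
Qed.

Lemma rker_ge0 a (z : 'rV[R]_n) : (0 <= rker a z)%E.
Proof. exact/ltW/rker_gt0. Qed.

Lemma rker_shell a J (z : 'rV[R]_n) : 0 <= a ->
  ((\1_[set z | enorm z <= dy J] z)%:E * rker a z <=
   \big[+%E/0%E]_(0 <= j <oo) ((dy (J + j).+1 `^ (- a))%:E * (\1_[set z | enorm z <= dy (J + j)] z)%:E))%E.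
Proof.
move=> a0.
have u0 j : (0 <= (dy (J + j).+1 `^ (- a))%:E * (\1_[set z | (enorm z <= dy (J + j))%R] z)%:E)%E.
  by rewrite mule_ge0// lee_fin ?powR_ge0.
rewrite indicE; case: (boolP (z \in _)) => [|_]; last by rewrite mul0e; exact: nneseries_ge0.
rewrite inE/= mul1e => zJ.
have big1' j : 1 <= dy j `^ (- a).
  rewrite powRN invf_ge1 ?powR_gt0 ?dy_gt0// -[leRHS](pow1R a).
  by apply: ge0_ler_powR; rewrite ?nnegrE ?dy_le1// ltW// dy_gt0.
have [z0|z0] := eqVneq z 0.
  rewrite [leRHS](_ : _ = +oo%E) ?leey//; apply/eqyP => A A0.
  apply: le_trans (nneseries_lim_ge (Num.bound A) (fun j _ _ => u0 j)).
  apply: (@le_trans _ _ (\sum_(0 <= i < Num.bound A) 1%:E)%E).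
    by rewrite sumEFin lee_fin sumr_const_nat subn0 ltW// archi_boundP// ltW.
  apply: lee_sum => j _; rewrite indicE mem_set ?mule1 ?lee_fin//.
  by rewrite /= z0 enorm0 ltW// dy_gt0.
rewrite /rker (negbTE z0).
have zp : 0 < enorm z by rewrite enorm_gt0.
have [m0 m0z] : exists m, dy m < enorm z.
  have [m Hm] : exists m : nat, (enorm z)^-1 < m%:R.
    by exists (Num.bound (enorm z)^-1); apply: archi_boundP; rewrite invr_ge0 enorm_ge0.
  exists m; rewrite exprVn -[ltRHS]invrK ltf_pV2 ?posrE ?exprn_gt0 ?invr_gt0//.
  by apply: lt_le_trans Hm _; rewrite -natrX ler_nat ltnW// ltn_expl.
case: (@ex_minnP (fun m => dy (J + m) < enorm z)) => [|m mz mmin].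
  exists m0; apply: le_lt_trans m0z; apply: ler_wiXn2l; rewrite ?invr_ge0//.
    by rewrite invf_le1 ?ler1n.
  exact: leq_addl.
case: m mz mmin => [|m] mz mmin; first by move: mz; rewrite addn0 ltNge zJ.
have zm : enorm z <= dy (J + m).
  by rewrite leNgt; apply/negP => /mmin; rewrite ltnn.
apply: le_trans (nneseries_lim_ge m.+1 (fun j _ _ => u0 j)).
rewrite big_nat_recr//= indicE mem_set// mule1.
apply: (@le_trans _ _ (dy (J + m).+1 `^ (- a))%:E); last by rewrite leeDr// sume_ge0.
rewrite lee_fin !powRN lef_pV2 ?posrE ?powR_gt0 ?dy_gt0//.
apply: ge0_ler_powR; rewrite ?nnegrE ?enorm_ge0 ?(ltW (dy_gt0 _))//.
by rewrite -addnS ltW.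
Qed.

Variable mu : {measure set 'rV[R]_n -> \bar R}.

Lemma shell_integral a b C J (x : 'rV[R]_n) : 0 <= a -> a < b -> 0 <= C ->
  (forall j, (mu (cball x (dy j)) <= (C * dy j `^ b)%:E)%E) ->
  (\int[mu]_y ((\1_(cball x (dy J)) y)%:E * rker a (x - y)) <=
   (C * 2^-1 `^ (- a) * (2^-1 `^ (b - a)) ^+ J / (1 - 2^-1 `^ (b - a)))%:E)%E.
Proof.
move=> a0 ab C0 muC; set rho := 2^-1 `^ (b - a).
have rho0 : 0 < rho by rewrite powR_gt0.
have rho1 : rho < 1.
  rewrite -(pow1R (b - a)); apply: gt0_ltr_powR; rewrite ?nnegrE ?subr_gt0//.
  by rewrite invf_lt1 ?ltr1n.
pose u j y := ((dy (J + j).+1 `^ (- a))%:E * (\1_(cball x (dy (J + j))) y)%:E)%E.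
have mu1 j : measurable_fun [set: 'rV[R]_n] (u j).
  apply: emeasurable_funM => //; apply/measurable_EFinP.
  apply: measurable_indic; exact: measurable_cball.
have u0 j y : (0 <= u j y)%E by rewrite mule_ge0// lee_fin ?powR_ge0.
apply: (@le_trans _ _ (\int[mu]_y \big[+%E/0%E]_(0 <= j <oo) u j y)%E).
  apply: ge0_le_integral => //.
  - by move=> y _; rewrite mule_ge0// ?rker_ge0// lee_fin.
  - apply: emeasurable_funM; last exact: measurable_rker_sub.
    by apply/measurable_EFinP; apply: measurable_indic; exact: measurable_cball.
  - by apply: ge0_emeasurable_sum => // j y _ _; exact: u0.
  - move=> y _; have := @rker_shell a J (x - y) a0.
    by rewrite !indicE !mem_setE.
rewrite integral_nneseries//.
have intu j : (\int[mu]_y u j y <= (C * 2^-1 `^ (- a) * rho ^+ J * rho ^+ j)%:E)%E.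
  rewrite ge0_integralZl ?lee_fin ?powR_ge0//; last first.
    by apply/measurable_EFinP; apply: measurable_indic; exact: measurable_cball.
  rewrite integral_indic//; last exact: measurable_cball.
  rewrite setIT; apply: (le_trans (lee_wpmul2l _ (muC _))); first by rewrite lee_fin powR_ge0.
  rewrite -EFinM lee_fin le_eqVlt; apply/orP; left; apply/eqP.
  rewrite exprS powRM ?invr_ge0 ?exprn_ge0// !dy_powR -!(mulrA C) mulrCA; congr (_ * _).
  rewrite -!mulrA; congr (_ * _); rewrite -exprD mulrC -exprMn -powRD; last first.
    by rewrite invr_eq0 pnatr_eq0 implybT.
  by [].
apply: lime_le; first by apply: is_cvg_nneseries => j _ _; exact: integral_ge0.
apply: nearW => N; apply: (le_trans (lee_sum _ (fun j _ => intu j))).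
rewrite sumEFin lee_fin.
have := @geometric_le_lim _ N (C * 2^-1 `^ (- a) * rho ^+ J) rho _ rho0 _.
apply; last by rewrite ger0_norm// ltW.
by rewrite !mulr_ge0 ?powR_ge0 ?exprn_ge0 ?(ltW rho0).
Qed.

End shells.

Section cube_measure.
Context (R : realType) (k : nat).

Lemma measurable_cube : measurable (@cube R k).
Proof. exact: (@measurable_box R k (fun=> 0) (fun=> 1)). Qed.

Lemma lebesgue_cube : lebesgue_rV k (@cube R k) = 1%E.
Proof.
have := @lebesgue_rV_box R k (fun=> 0) (fun=> 1) (fun=> @ler01 R).
by rewrite big1 => [->//|i _]; rewrite subr0.
Qed.

Lemma lebesgue_cube_fin : (lebesgue_rV k (@cube R k) < +oo)%E.
Proof. by rewrite lebesgue_cube ltry. Qed.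

End cube_measure.

Notation cubeM R k := (mfrestr (@measurable_cube R k) (@lebesgue_cube_fin R k)).

Section cube_measure_theory.
Context (R : realType) (k : nat).

Lemma cubeME A : cubeM R k A = lebesgue_rV k (@cube R k `&` A).
Proof. by rewrite /mfrestr /mrestr setIC. Qed.

Lemma cubeMT : cubeM R k setT = 1%E.
Proof. by rewrite cubeME setIT lebesgue_cube. Qed.

Lemma cubeM_cball x j : (cubeM R k (cball x (2^-1 ^+ j)) <= ((2 ^+ k) * (2^-1 ^+ j) `^ k%:R)%:E)%E.
Proof.
set r : R := 2^-1 ^+ j; have r0 : 0 <= r by rewrite exprn_ge0.
pose a (i : 'I_k) := x ord0 i - r; pose b (i : 'I_k) := x ord0 i + r.
have -> : 2 ^+ k * r `^ k%:R = \prod_(i < k) (b i - a i).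
  rewrite powR_mulrn// -exprMn -[k in _ ^+ k](card_ord k) -prodr_const; apply: eq_bigr => i _.
  by rewrite /a /b; ring.
rewrite -lebesgue_rV_box => [|i]; last by rewrite /a /b; lra.
rewrite cubeME; apply: le_measure; rewrite ?inE.
- by apply: measurableI; [exact: measurable_cube|exact: measurable_cball].
- exact: measurable_box.
- move=> y [_]; rewrite /cball/= => yx i.
  have := coord_le_enorm (x - y) i; rewrite !mxE => h.
  by have := le_trans h yx; rewrite ler_norml /a /b => /andP[h1 h2]; apply/andP; split; lra.
Qed.

End cube_measure_theory.

Section rker_total.
Context (R : realType) (n : nat) (mu : {measure set 'rV[R]_n -> \bar R}).

Lemma rker_total a b C M (x : 'rV[R]_n) : 0 <= a -> a < b -> 0 <= C ->
  (mu setT <= M%:E)%E ->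
  (forall j, (mu (cball x (2^-1 ^+ j)) <= (C * (2^-1 ^+ j) `^ b)%:E)%E) ->
  (\int[mu]_y rker a (x - y) <=
   (M + C * 2^-1 `^ (- a) / (1 - 2^-1 `^ (b - a)))%:E)%E.
Proof.
move=> a0 ab C0 muM muC.
have H := shell_integral 0 a0 ab C0 muC; rewrite expr0 mulr1 in H.
rewrite EFinD; apply: (@le_trans _ _ (\int[mu]_y (1 + (\1_(cball x (2^-1 ^+ 0)) y)%:E * rker a (x - y)))%E).
  have m1 := @measurable_rker_sub R n a x.
  have m2 : measurable_fun [set: 'rV[R]_n] (fun y => ((\1_(cball x (2^-1 ^+ 0)) y)%:E * rker a (x - y))%E).
    apply: emeasurable_funM => //; apply/measurable_EFinP.
    by apply: measurable_indic; exact: measurable_cball.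
  apply: ge0_le_integral => //.
  - by move=> y _; exact: rker_ge0.
  - exact: emeasurable_funD.
  - move=> y _; rewrite indicE /cball expr0; case: (boolP (y \in _)) => [_|].
      by rewrite mul1e leeDr.
    move=> /negP; rewrite inE/= => /negP; rewrite -ltNge => yx.
    rewrite mul0e adde0 /rker; case: eqP => [e|_].
      by move: yx; rewrite e enorm0 ltNge ler01.
    rewrite lee_fin powRN invf_le1 ?powR_gt0 ?(lt_trans _ yx)//.
    rewrite -(pow1R a); apply: ge0_ler_powR; rewrite ?nnegrE ?enorm_ge0//; exact: ltW.
rewrite ge0_integralD//; last 2 first.
- by move=> y _; rewrite mule_ge0 ?lee_fin// rker_ge0.
- apply: emeasurable_funM; last exact: measurable_rker_sub.
  by apply/measurable_EFinP; apply: measurable_indic; exact: measurable_cball.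
by apply: leeD => //; rewrite integral_cst// mul1e.
Qed.

End rker_total.

Section integral_moments.
Context (R : realType) (k : nat) (nu : {finite_measure set 'rV[R]_k -> \bar R}) (C0 a : R).
Hypothesis C00 : 0 <= C0.
Hypothesis nuC : forall x, (\int[nu]_t rker a (x - t) <= C0%:E)%E.

Fixpoint moment_cst (p N : nat) : R :=
  if p is p'.+1 then moment_cst p' N.+1 * (N.+1%:R * C0) else 1.

Lemma moment_cst_ge0 p N : 0 <= moment_cst p N.
Proof. by elim: p N => [//|p IH] N /=; rewrite mulr_ge0// mulr_ge0. Qed.

Context d (T : measurableType d) (P : probability T R) (h : 'rV[R]_k * T -> R) (A M : R).
Hypothesis mh : measurable_fun [set: 'rV[R]_k * T] h.
Hypothesis hM : forall z, `|h z| <= M.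
Hypothesis A0 : 0 <= A.
Hypothesis hA : forall s : seq 'rV[R]_k,
  ((`|\int[P]_w \prod_(t <- s) h (t, w)|)%:E <= (A ^+ size s)%:E * energy a s)%E.

Let I w := \int[nu]_t h (t, w).

Let mI : measurable_fun [set: T] I.
Proof. exact: (measurable_Rintegral1 nu P mh hM). Qed.

Let bI w : `|I w| <= M * fine (nu setT).
Proof. by apply: normr_Rintegral_le => [|t]; [exact: measurableT_comp mh _|exact: hM]. Qed.

Let M0 : 0 <= M. Proof. exact: le_trans (hM point). Qed.

Let step_integral s :
  (\int[nu]_t (rker a t + \sum_(x <- s) rker a (x - t)) <= ((size s).+1%:R * C0)%:E)%E.
Proof.
have m0 : measurable_fun [set: 'rV[R]_k] (rker a).
  have := @measurable_rker_sub R k a 0; apply: eq_measurable_fun => t _.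
  by rewrite /rker sub0r oppr_eq0 enormN.
have e0 : (\int[nu]_t rker a t = \int[nu]_t rker a (0 - t))%E.
  by apply: eq_integral => t _; rewrite /rker sub0r oppr_eq0 enormN.
have ms : measurable_fun [set: 'rV[R]_k] (fun t => \sum_(x <- s) rker a (x - t))%E.
  by apply: emeasurable_sum => x; exact: measurable_rker_sub.
have s0 t : (0 <= \sum_(x <- s) rker a (x - t))%E by apply: sume_ge0 => x _; exact: rker_ge0.
rewrite (@ge0_integralD _ _ _ nu setT measurableT (rker a) _ (fun t _ => rker_ge0 a t) m0 (fun t _ => s0 t) ms).
have -> : (size s).+1%:R * C0 = C0 + C0 *+ size s by rewrite mulr_natl mulrS.
rewrite EFinD e0; apply: leeD; first exact: nuC.
have mx x : measurable_fun [set: 'rV[R]_k] (fun t => rker a (x - t)) by exact: measurable_rker_sub.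
rewrite (@ge0_integral_sum _ _ _ nu setT measurableT _ (fun x t => rker a (x - t)) mx (fun x t _ => rker_ge0 a (x - t))).
rewrite (_ : C0 *+ size s = \sum_(x <- s) C0); last by rewrite big_const_seq count_predT iter_addr_0.
by rewrite -sumEFin; apply: lee_sum => x _.
Qed.

Lemma integral_moment p s :
  ((`|\int[P]_w ((\prod_(t <- s) h (t, w)) * I w ^+ p)|)%:E <=
   (A ^+ (size s + p) * moment_cst p (size s))%:E * energy a s)%E.
Proof.
elim: p s => [|p IH] s.
  rewrite addn0 mulr1; apply: le_trans (hA s); rewrite lee_fin le_eqVlt; apply/orP; left.
  by apply/eqP; congr `|_|; apply: eq_Rintegral => w _; rewrite mulr1.
pose G (z : T * 'rV[R]_k) := (\prod_(t <- s) h (t, z.1)) * I z.1 ^+ p * h (z.2, z.1).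
have mprod (s' : seq 'rV[R]_k) : measurable_fun [set: T] (fun w => \prod_(t <- s') h (t, w)).
  by apply: measurable_prod => t _; apply: measurableT_comp mh _.
have bprod (s' : seq 'rV[R]_k) w : `|\prod_(t <- s') h (t, w)| <= M ^+ size s'.
  elim: s' => [|t s' IHs]; first by rewrite big_nil normr1.
  by rewrite big_cons normrM exprS ler_pM.
have bp (s' : seq 'rV[R]_k) w : `|(\prod_(t <- s') h (t, w)) * I w ^+ p| <= M ^+ size s' * (M * fine (nu setT)) ^+ p.
  rewrite normrM ler_pM// normrX lerXn2r ?nnegrE//.
  by rewrite mulr_ge0// fine_ge0.
have mG : measurable_fun [set: T * 'rV[R]_k] G.
  apply: measurable_funM; last by apply: (measurableT_comp mh); exact: measurable_swap.
  apply: measurable_funM; first exact: (measurableT_comp (mprod s)).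
  by apply: measurable_funX; exact: (measurableT_comp mI).
have bG z : `|G z| <= M ^+ size s * (M * fine (nu setT)) ^+ p * M.
  by rewrite normrM ler_pM.
have -> : \int[P]_w ((\prod_(t <- s) h (t, w)) * I w ^+ p.+1) = \int[P]_w \int[nu]_t G (w, t).
  apply: eq_Rintegral => w _; rewrite exprSr mulrA /I -RintegralZl//.
  apply: (@bounded_integrable _ _ _ nu _ M) => [|t]; last exact: hM.
  exact: measurableT_comp mh _.
rewrite (bounded_Fubini P nu mG bG).
have mF := measurable_Rintegral1 P nu mG bG.
have bF t : `|\int[P]_w G (w, t)| <= M ^+ size s * (M * fine (nu setT)) ^+ p * M.
  apply: normr_Rintegral_prob_le => [|w]; last exact: bG.
  by apply: (measurableT_comp mG); exact: measurable_pair2.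
have iF := bounded_integrable nu mF bF.
apply: (@le_trans _ _ (\int[nu]_t (`|\int[P]_w G (w, t)|)%:E)%E).
  apply: (@le_trans _ _ (\int[nu]_t `|\int[P]_w G (w, t)|)%:E).
    by rewrite lee_fin; exact: le_normr_Rintegral.
  rewrite le_eqVlt; apply/orP; left; apply/eqP.
  rewrite /Rintegral fineK//; apply: integrable_fin_num => //.
  by have := integrable_abse iF; apply: eq_integrable.
pose c := A ^+ (size s + p.+1) * moment_cst p (size s).+1.
have c0 : (0 <= c%:E)%E by rewrite lee_fin mulr_ge0 ?exprn_ge0 ?moment_cst_ge0.
have e0 := energy_gt0 a s.
have m1 : measurable_fun [set: 'rV[R]_k] (fun t => (rker a t + \sum_(x <- s) rker a (x - t))%E).
  apply: emeasurable_funD; last by apply: emeasurable_sum => x; exact: measurable_rker_sub.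
  have := @measurable_rker_sub R k a 0; apply: eq_measurable_fun => t _.
  by rewrite /rker sub0r oppr_eq0 enormN.
have st0 t : (0 <= rker a t + \sum_(x <- s) rker a (x - t))%E by exact/ltW/rker_sum_gt0.
apply: (@le_trans _ _ (\int[nu]_t ((c%:E * energy a s) * (rker a t + \sum_(x <- s) rker a (x - t))))%E).
  apply: ge0_le_integral => //.
  - by apply/measurable_EFinP; exact: measurableT_comp.
  - exact: emeasurable_funM.
  - move=> t _; have := IH (t :: s); rewrite /= addSnnS -/c muleA; apply: le_trans.
    rewrite lee_fin le_eqVlt; apply/orP; left; apply/eqP; congr `|_|; apply: eq_Rintegral => w _.
    by rewrite /G big_cons /=; ring.
rewrite ge0_integralZl//; last by rewrite mule_ge0// ltW.
apply: (le_trans (lee_wpmul2l _ (step_integral s))); first by rewrite mule_ge0// ltW.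
by rewrite -muleA (muleC (energy a s)) muleA -EFinM /c /= !mulrA.
Qed.

Lemma integral_tail q (lambda : R) : 0 < lambda ->
  (P [set w | (lambda <= `|I w|)%R] <= (moment_cst q.*2 0 * (A / lambda) ^+ q.*2)%:E)%E.
Proof.
move=> l0; set S := [set w | _].
have mS : measurable S.
  rewrite -[X in measurable X]setTI (_ : S = (fun w => `|I w|) @^-1` `[lambda, +oo[).
    by apply: measurableT_comp mI _ _ _ => //.
  by apply/seteqP; split=> w; rewrite /S /= in_itv/= andbT.
have := integral_moment q.*2 [::].
rewrite /= mule1 lee_fin add0n => Hm.
have m2 : measurable_fun [set: T] (fun w => I w ^+ q.*2) by exact: measurable_funX.
have b2 w : `|I w ^+ q.*2| <= (M * fine (nu setT)) ^+ q.*2.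
  by rewrite normrX lerXn2r ?nnegrE// mulr_ge0// fine_ge0.
have i2 := bounded_integrable P m2 b2.
have i1 : P.-integrable [set: T] (EFin \o (\1_S : T -> R)).
  apply: (@bounded_integrable _ _ _ P _ 1); first exact: measurable_indic.
  by move=> w; rewrite indicE; case: (_ \in _); rewrite ?normr1 ?normr0.
have key : lambda ^+ q.*2 * fine (P S) <= \int[P]_w (I w ^+ q.*2).
  rewrite -(setIT S) -[P _](integral_indic P measurableT mS).
  have -> : fine (\int[P]_w (\1_S w)%:E)%E = \int[P]_w (\1_S w) by [].
  rewrite -RintegralZl//; apply: le_Rintegral => //.
    have := integrableZl measurableT (lambda ^+ q.*2) i1.
    by apply: eq_integrable => // w _ /=; rewrite EFinM.
  move=> w _; rewrite indicE; case: (boolP (w \in S)) => [|_]; last first.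
    by rewrite mulr0 -muln2 exprM sqr_ge0.
  rewrite inE /S/= mulr1 => lw.
  rewrite -[leRHS]ger0_norm; last by rewrite -muln2 exprM sqr_ge0.
  by rewrite normrX lerXn2r// nnegrE// ltW.
rewrite -[P S]fineK; last by rewrite fin_num_measure.
rewrite lee_fin expr_div_n mulrA ler_pdivlMr ?exprn_gt0// mulrC.
apply: (le_trans key); apply: (le_trans (ler_norm _)).
rewrite mulrC; apply: le_trans Hm; rewrite le_eqVlt; apply/orP; left; apply/eqP.
by congr `|_|; apply: eq_Rintegral => w _; rewrite big_nil mul1r.
Qed.

End integral_moments.

(** * Almost sure bounds on grids *)

Section dyadic_approximation.
Context (R : realType) (k : nat).

Definition clip (t : 'rV[R]_k) : 'rV[R]_k := \row_i Num.min 1 (Num.max 0 (t ord0 i)).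

Lemma cube_clip t : cube (clip t).
Proof.
by move=> i; rewrite mxE le_min ler01 le_max lexx/= ge_min lexx.
Qed.

Lemma clip_cube t : cube t -> clip t = t.
Proof.
move=> ct; apply/rowP => i; have /andP[t0 t1] := ct i.
by rewrite mxE (max_idPr t0) (min_idPr t1).
Qed.

Definition ceilg m (t : 'rV[R]_k) (i : 'I_k) : nat := \sum_(q < 2 ^ m) (q%:R < 2 ^+ m * t ord0 i)%R.

Definition gridpt m (g : 'I_k -> nat) : 'rV[R]_k := \row_i ((g i)%:R / 2 ^+ m).

Definition dyceil m t := gridpt m (ceilg m t).

Lemma ceilg_le m t i : (ceilg m t i <= 2 ^ m)%N.
Proof.
rewrite /ceilg; apply: (@leq_trans (\sum_(q < 2 ^ m) 1)).
  by apply: leq_sum => q _; case: (_ < _).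
by rewrite sum1_card card_ord.
Qed.

Lemma gridpt_cube m g : (forall i, (g i <= 2 ^ m)%N) -> cube (gridpt m g).
Proof.
move=> gm i; rewrite mxE divr_ge0 ?exprn_ge0//= ler_pdivrMr ?exprn_gt0// mul1r.
by rewrite -natrX ler_nat.
Qed.

Lemma dyceil_cube m t : cube (dyceil m t).
Proof. by apply: gridpt_cube => i; exact: ceilg_le. Qed.

Lemma dyceil_bounds m t i :
  clip t ord0 i <= dyceil m t ord0 i <= clip t ord0 i + 2^-1 ^+ m.
Proof.
have p0 : 0 < 2 ^+ m :> R by rewrite exprn_gt0.
set z := Num.max 0 (2 ^+ m * t ord0 i).
have z0 : 0 <= z by rewrite le_max lexx.
have cE : (ceilg m t i)%:R = \sum_(q < 2 ^ m) (q%:R < z)%R%:R :> R.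
  rewrite natr_sum; apply: eq_bigr => q _; congr (nat_of_bool _)%:R.
  by rewrite /z lt_max [_ < 0]ltNge ler0n.
have zE : z = 2 ^+ m * Num.max 0 (t ord0 i) by rewrite maxr_pMr ?(ltW p0)// mulr0.
have /andP[c1 c2] := count_lt (2 ^ m) z0.
rewrite !mxE cE; apply/andP; split.
  rewrite ler_pdivlMr//; apply: le_trans c1; rewrite natrX zE.
  by rewrite minr_pMl ?(ltW p0)// mul1r mulrC.
rewrite ler_pdivrMr//; apply: (le_trans c2); rewrite natrX zE.
rewrite mulrDl -exprMn mulVf// expr1n minr_pMl ?(ltW p0)// mul1r [_ * 2 ^+ m]mulrC.
have [h|h] := leP (2 ^+ m) (2 ^+ m * Num.max 0 (t ord0 i)).
  by rewrite ge_min lerDl ler01.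
by rewrite ge_min lexx orbT.
Qed.

Lemma dyceil_dist m t i : `|dyceil m t ord0 i - clip t ord0 i| <= 2^-1 ^+ m.
Proof.
have /andP[h1 h2] := dyceil_bounds m t i.
by rewrite ger0_norm ?subr_ge0// lerBlDl.
Qed.

Lemma dyceil_cvg t : dyceil m t @[m --> \oo] --> clip t.
Proof.
apply/cvgrPdist_le => e e0.
have h : (k%:R * (2^-1 : R) ^+ m) @[m --> \oo] --> (0 : R).
  rewrite -[X in _ --> X](mulr0 (k%:R : R)); apply: cvgM; first exact: cvg_cst.
  by apply: cvg_expr; rewrite ger0_norm ?invf_lt1 ?ltr1n.
near=> m.
apply: (le_trans (norm_le_enorm _)); rewrite enormB.
apply: (@le_trans _ _ (k%:R * 2^-1 ^+ m)).
  by apply: enorm_le_coord => i; rewrite !mxE; have := dyceil_dist m t i; rewrite !mxE.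
rewrite -[leLHS]ger0_norm; last by rewrite mulr_ge0 ?exprn_ge0.
rewrite -[X in `|X|]subr0 distrC.
near: m; exact: (cvgrPdist_le _ _).1 h e e0.
Unshelve. all: by end_near. Qed.

Lemma measurable_joint_clip d (T : measurableType d) (b : 'rV[R]_k -> T -> R) :
  (forall t, orthant t -> measurable_fun [set: T] (b t)) ->
  (forall w, {within @orthant R k, continuous (b ^~ w)}) ->
  measurable_fun [set: 'rV[R]_k * T] (fun z => b (clip z.1) z.2).
Proof.
move=> mb cb.
apply: (@measurable_fun_cvg _ _ R _ (fun m z => b (dyceil m z.1) z.2)) => [m|[t w] _]; last first.
  have /subspace_continuousP/(_ (clip t)) := cb w.
  have oc s : cube s -> @orthant R k s by move=> cs i; have /andP[] := cs i.
  move=> /(_ (oc _ (cube_clip t))) h U HU.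
  have hU : nbhs (clip t) [set x | orthant x -> U (b x w)] by exact: h U HU.
  have [N _ HN] := @dyceil_cvg t _ hU.
  by exists N => // m /HN; apply; exact/oc/dyceil_cube.
pose ind (g : {ffun 'I_k -> 'I_(2 ^ m).+1}) (t : 'rV[R]_k) : R :=
  \prod_i (if (ceilg m t i)%:R == (g i)%:R :> R then 1 else 0).
rewrite (_ : (fun _ => _) = (fun z : 'rV[R]_k * T =>
   \sum_(g : {ffun 'I_k -> 'I_(2 ^ m).+1}) ind g z.1 * b (gridpt m (fun i => g i : nat)) z.2)); last first.
  apply/funext => -[t w] /=.
  have gP i : (ceilg m t i < (2 ^ m).+1)%N by rewrite ltnS ceilg_le.
  pose g0 : {ffun 'I_k -> 'I_(2 ^ m).+1} := [ffun i => Ordinal (gP i)].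
  rewrite (bigD1 g0)//= big1 ?addr0.
    rewrite /ind big1 ?mul1r; last by move=> i _; rewrite ffunE eqxx.
    by congr b; apply/rowP => i; rewrite !mxE ffunE.
  move=> g /eqP gg0; rewrite /ind.
  have [i gi] : exists i, g i != g0 i.
    by apply: contrapT => /forallNP h; apply: gg0; apply/ffunP => i; apply/eqP; have /negP := h i; rewrite negbK.
  rewrite (bigD1 i)//= eqr_nat ifF ?mul0r//; apply/negbTE; apply: contra gi => /eqP e.
  by apply/eqP/val_inj; rewrite ffunE.
apply: measurable_sum => g; apply: measurable_funM; last first.
  apply: (measurableT_comp (mb _ _)) => //.
  by move=> i; rewrite mxE divr_ge0 ?exprn_ge0.
suff mi : measurable_fun [set: 'rV[R]_k] (ind g) by exact: (measurableT_comp mi measurable_fst).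
apply: measurable_prod => i _; apply: measurable_fun_ifT => //.
apply: measurable_fun_eqr => //.
rewrite (_ : (fun _ => _) = (fun t : 'rV[R]_k => \sum_(q < 2 ^ m) (if q%:R < 2 ^+ m * t ord0 i then 1 else 0 : R))); last first.
  by apply/funext => t; rewrite natr_sum; apply: eq_bigr => q _; case: (_ < _).
apply: measurable_sum => q; apply: measurable_fun_ifT => //.
by apply: measurable_fun_ltr => //; apply: measurable_funM => //; exact: measurable_coord_rV.
Qed.

End dyadic_approximation.

Section borel_cantelli.
Context d (T : measurableType d) (R : realType) (P : probability T R).

Lemma as_eventually (F : nat -> set T) (C rho : R) : (forall j, measurable (F j)) ->
  0 <= C -> 0 < rho < 1 -> (forall j, (P (F j) <= (C * rho ^+ j)%:E)%E) ->
  exists Om : set T, [/\ measurable Om, P Om = 1%E &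
    forall w, Om w -> exists J, forall j, (J <= j)%N -> ~ F j w].
Proof.
move=> mF C0 /andP[r0 r1] PF.
have mL : measurable (lim_sup_set F).
  by apply: bigcapT_measurable => j; apply: bigcup_measurable.
have L0 : P (lim_sup_set F) = 0%E.
  apply: lim_sup_set_cvg0 => //; apply: (@le_lt_trans _ _ (C / (1 - rho))%:E); last exact: ltry.
  apply: lime_le; first by apply: is_cvg_nneseries => j _ _; exact: measure_ge0.
  apply: nearW => N; apply: (le_trans (lee_sum _ (fun j _ => PF j))).
  rewrite sumEFin lee_fin.
  by apply: (@geometric_le_lim _ N C rho C0 r0); rewrite ger0_norm// ltW.
exists (~` lim_sup_set F); split; first exact: measurableC.
  by rewrite probability_setC// L0 sube0.
move=> w Lw; apply: contrapT => /forallNP h; apply: Lw => J _.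
by have /existsNP[j /not_implyP[Jj /contrapT Fj]] := h J; exists j.
Qed.

Lemma union_bound (G : eqType) (s : seq G) (E : G -> set T) (c : R) :
  (forall g, measurable (E g)) -> (forall g, (P (E g) <= c%:E)%E) ->
  measurable [set w | exists2 g, g \in s & E g w] /\
  (P [set w | exists2 g, g \in s & E g w] <= ((size s)%:R * c)%:E)%E.
Proof.
move=> mE PE; elim: s => [|g s [IH1 IH2]].
  rewrite (_ : [set w | _] = set0); first by rewrite measure0 mul0r; split.
  by apply/seteqP; split=> w //= -[].
rewrite (_ : [set w | _] = E g `|` [set w | exists2 g, g \in s & E g w]).
  split; first exact: measurableU.
  apply: (le_trans (measureU2 _ _ _)) => //.
  by rewrite /= -natr1 mulrDl mul1r (addrC _ c) EFinD; apply: leeD; [exact: PE|exact: IH2].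
apply/seteqP; split=> w /=.
  by move=> [g']; rewrite inE => /orP[/eqP ->|gs]; [left|right; exists g'].
by move=> [gw|[g' gs gw]]; [exists g; rewrite ?mem_head|exists g'; rewrite // inE gs orbT].
Qed.

Lemma as_eventually_all (G : nat -> finType) (E : forall j, G j -> set T) (C D N sigma : R) :
  (forall j g, measurable (E j g)) -> 0 <= C -> 0 <= D -> 0 < N -> 0 < sigma -> N * sigma < 1 ->
  (forall j, #|G j|%:R <= D * N ^+ j) -> (forall j g, (P (E j g) <= (C * sigma ^+ j)%:E)%E) ->
  exists Om : set T, [/\ measurable Om, P Om = 1%E &
    forall w, Om w -> exists J, forall j, (J <= j)%N -> forall g, ~ E j g w].
Proof.
move=> mE C0 D0 N0 s0 Ns GD PE.
pose F j := [set w | exists2 g, g \in enum (G j) & E j g w].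
have UB j := union_bound (enum (G j)) (mE j) (PE j).
have [|||j|Om [mO PO HO]] := @as_eventually F (D * C) (N * sigma).
- by move=> j; exact: (UB j).1.
- exact: mulr_ge0.
- by rewrite Ns mulr_gt0.
- apply: (le_trans (UB j).2); rewrite lee_fin -cardE.
  apply: (le_trans (ler_wpM2r _ (GD j))); first by rewrite mulr_ge0// exprn_ge0// ltW.
  by rewrite exprMn mulrACA.
exists Om; split=> // w /HO[J HJ]; exists J => j /HJ h g Eg; apply: h.
by exists g => //; rewrite mem_enum.
Qed.

Lemma small_power (N tau : R) : 0 < tau < 1 -> exists q : nat, N * tau ^+ q < 1.
Proof.
move=> /andP[t0 t1].
have h : (N * tau ^+ q) @[q --> \oo] --> (0 : R).
  rewrite -[X in _ --> X](mulr0 N); apply: cvgM; first exact: cvg_cst.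
  by apply: cvg_expr; rewrite ger0_norm ?ltW.
have [q _ Hq] := (cvgrPdist_lt _ _).1 h 1 ltr01.
exists q; have := Hq q (leqnn q); rewrite /= sub0r normrN; apply: le_lt_trans; exact: ler_norm.
Qed.

(* Moments of all orders beat the exponential growth of the number of events. *)
Lemma tails_eventually (G : nat -> finType) (I : forall j, G j -> T -> R) (A D N e eps : R) :
  (forall j g, measurable_fun [set: T] (I j g)) -> 0 <= A -> 0 <= D -> 0 < N -> 0 < eps ->
  (forall j, #|G j|%:R <= D * N ^+ j) ->
  (forall q, exists2 K, 0 <= K & forall j g lambda, 0 < lambda ->
    (P [set w | (lambda <= `|I j g w|)%R] <=
      (K * (A * (2^-1 ^+ j) `^ e / lambda) ^+ q.*2)%:E)%E) ->
  exists Om : set T, [/\ measurable Om, P Om = 1%E &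
    forall w, Om w -> exists J, forall j, (J <= j)%N -> forall g, `|I j g w| < (2^-1 ^+ j) `^ (e - eps)].
Proof.
move=> mI A0 D0 N0 eps0 GD tail.
have tau01 : 0 < (2^-1 : R) `^ eps < 1.
  rewrite powR_gt0 ?invr_gt0//= -[ltRHS](pow1R eps); apply: gt0_ltr_powR; rewrite ?nnegrE//.
  by rewrite invf_lt1 ?ltr1n.
have [t0 t1] := andP tau01.
have tau201 : 0 < ((2^-1 : R) `^ eps) ^+ 2 < 1 by rewrite exprn_gt0//= exprn_ilt1// ltW.
have [q Hq] := small_power N tau201.
have [K K0 HK] := tail q.
pose E j g := [set w | ((2^-1 ^+ j) `^ (e - eps) <= `|I j g w|)%R].
have [|||j g|Om [mO PO HO]] := @as_eventually_all G E (K * A ^+ q.*2) D N ((((2^-1 : R) `^ eps) ^+ 2) ^+ q) _ _ D0 N0 _ Hq GD.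
- move=> j g; rewrite -[X in measurable X]setTI.
  rewrite (_ : E j g = (fun w => `|I j g w|) @^-1` `[(2^-1 ^+ j) `^ (e - eps), +oo[).
    by apply: measurableT_comp (mI j g) _ _ _.
  by apply/seteqP; split=> w; rewrite /E /= in_itv/= andbT.
- by rewrite mulr_ge0// exprn_ge0.
- by rewrite exprn_gt0// exprn_gt0.
- have p0 : 0 < (2^-1 ^+ j : R) by rewrite exprn_gt0.
  apply: (le_trans (HK j g _ (powR_gt0 _ p0))); rewrite lee_fin le_eqVlt; apply/orP; left; apply/eqP.
  rewrite -!mulrA; congr (_ * _); rewrite exprMn; congr (_ * _).
  rewrite -powRN -powRD; last by rewrite (gt_eqF p0) implybT.
  rewrite opprB addrCA subrr addr0 dy_powR -!exprM; congr (_ ^+ _).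
  by rewrite -mul2n mulnCA (mulnC j).
exists Om; split=> // w /HO[J HJ]; exists J => j /HJ h g.
by rewrite ltNge; apply/negP => /h.
Qed.

End borel_cantelli.

Section space_grid.
Context (R : realType) (n p : nat).

Definition sgrid j : finType := {ffun 'I_n -> 'I_(2 ^ (j * p + j).+1).+1}.

Definition sgridpt j (g : sgrid j) : 'rV[R]_n := \row_i ((g i)%:R / 2 ^+ (j * p) - 2 ^+ j).

Lemma card_sgrid j : #|sgrid j|%:R <= 4 ^+ n * (2 ^+ (p.+1 * n)) ^+ j :> R.
Proof.
rewrite card_ffun !card_ord natrX -(exprM 2) -[4]/((2 * 2)%:R : R) natrM -expr2 -exprM -exprD.
rewrite (_ : (2 * n + p.+1 * n * j = (j * p + j).+2 * n)%N); last by rewrite -addn2 -addn1; ring.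
rewrite [leRHS]exprM; apply: lerXn2r; rewrite ?nnegrE ?exprn_ge0//.
by rewrite -natrX ler_nat [leqRHS]expnS mul2n -addnn -[leqLHS]addn1 leq_add2l expn_gt0.
Qed.

Lemma sgrid_near j (y : 'rV[R]_n) : (forall i, `|y ord0 i| <= 2 ^+ j) ->
  exists g : sgrid j, forall i, `|sgridpt g ord0 i - y ord0 i| <= 2^-1 ^+ (j * p).
Proof.
move=> yj; have p0 : 0 < 2 ^+ (j * p) :> R by rewrite exprn_gt0.
pose z i := (y ord0 i + 2 ^+ j) * 2 ^+ (j * p).
have z0 i : 0 <= z i.
  rewrite mulr_ge0 ?exprn_ge0// -lerBlDr sub0r.
  by have := yj i; rewrite ler_norml => /andP[].
have zb i : (Num.trunc (z i) < (2 ^ (j * p + j).+1).+1)%N.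
  rewrite ltnS -(ler_nat R); have /andP[h _] := truncn_itv (z0 i).
  apply: (le_trans h); rewrite natrX exprS exprD [2 ^+ (j * p) * _]mulrC mulrA ler_pM2r//.
  rewrite mulr_natl mulr2n lerD2r.
  by have := yj i; rewrite ler_norml => /andP[].
exists [ffun i => Ordinal (zb i)] => i; rewrite mxE ffunE /=.
have /andP[h1 h2] := truncn_itv (z0 i).
have -> : (Num.trunc (z i))%:R / 2 ^+ (j * p) - 2 ^+ j - y ord0 i = ((Num.trunc (z i))%:R - z i) / 2 ^+ (j * p).
  by rewrite /z; field; rewrite gt_eqF.
rewrite normrM [X in _ * X]ger0_norm ?invr_ge0 ?exprn_ge0// exprVn ler_piMl ?invr_ge0 ?exprn_ge0//.
rewrite distrC ger0_norm ?subr_ge0//; move: h1 h2; rewrite -natr1.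
by move: (Num.trunc _)%:R => u; lra.
Qed.

End space_grid.

Section perturbed_field.
Context d (T : measurableType d) (R : realType) (P : probability T R) (k n : nat) (H : R).
Context (B : 'rV[R]_k -> T -> 'rV[R]_n) (phi : 'rV[R]_k -> 'rV[R]_n).
Hypothesis k0 : (0 < k)%N.
Hypothesis H01 : 0 < H < 1.
Hypothesis fB : fbm_field P H B.
Hypothesis bphi : bounded_borel phi.

(* Jointly measurable version of B + phi, equal to it on the cube. *)
Definition pfield (z : 'rV[R]_k * T) : 'rV[R]_n := B (clip z.1) z.2 + (phi \_ (@cube R k)) z.1.

Lemma pfield_cube t w : cube t -> pfield (t, w) = B t w + phi t.
Proof. by move=> ct; rewrite /pfield /= clip_cube// patchE mem_set. Qed.

Lemma measurable_pfield : measurable_fun [set: 'rV[R]_k * T] pfield.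
Proof.
apply: measurable_rVD; last first.
  have mp : measurable_fun [set: 'rV[R]_k] (phi \_ (@cube R k)).
    case: bphi => mphi _.
    exact: (measurable_restrictT _ (@measurable_cube R k)).1 mphi.
  exact: (measurableT_comp mp measurable_fst).
apply: measurable_fun_rV => i; case: fB => fb _ cB.
apply: (@measurable_joint_clip R k d T (fun t w => B t w ord0 i)) => [t ot|w].
  exact: (fbm_measurable (fb i)).
apply/subspace_continuousP => t ot; have /subspace_continuousP/(_ t ot) h := cB w.
exact: (@cvg_comp _ _ _ (B ^~ w) (fun v : 'rV[R]_n => v ord0 i) _ _ _ h (@coord_continuous R 1 n ord0 i (B t w))).
Qed.

Lemma measurable_pfield1 w : measurable_fun [set: 'rV[R]_k] (fun t => pfield (t, w)).
Proof. by apply: (measurableT_comp measurable_pfield); exact: measurable_pair2. Qed.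

Lemma occupation_pfield w : occupation_measure (fun t => B t w + phi t) =
  pushforward (cubeM R k) (fun t => pfield (t, w)).
Proof.
apply/funext => A; rewrite /occupation_measure /pushforward cubeME; congr (lebesgue_rV k _).
by apply/seteqP; split=> t /= [ct]; rewrite pfield_cube.
Qed.

Definition bump_at l eta (x : 'rV[R]_n) (z : 'rV[R]_k * T) : R :=
  \1_(@cube R k) z.1 * bumps l eta (fun i => x ord0 i) (pfield z).

Lemma bumps_le1 l eta (c : 'I_n -> R) (y : 'rV[R]_n) : `|bumps l eta c y| <= 1.
Proof. by rewrite normr_prod; apply: prodr_ile1 => i _; rewrite normr_ge0 theta_le1. Qed.

Lemma measurable_bumps l eta (c : 'I_n -> R) : measurable_fun [set: 'rV[R]_n] (bumps l eta c).
Proof.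
rewrite /bumps; apply: measurable_prod => i _.
apply: (measurableT_comp (@measurable_theta R l i)).
by apply: measurable_funM => //; apply: measurable_funB => //; exact: measurable_coord_rV.
Qed.

Lemma measurable_bump_at l eta x : measurable_fun [set: 'rV[R]_k * T] (bump_at l eta x).
Proof.
apply: measurable_funM; last exact: (measurableT_comp (measurable_bumps _ _ _) measurable_pfield).
by apply: (measurableT_comp _ measurable_fst); apply: measurable_indic; exact: measurable_cube.
Qed.

Lemma bump_at_le1 l eta x z : `|bump_at l eta x z| <= 1.
Proof.
rewrite normrM mulr_ile1// ?bumps_le1// indicE.
by case: (_ \in _); rewrite ?normr1 ?normr0.
Qed.

Lemma bump_at_moment l eta a A x : 0 <= A ->
  (forall (c : 'rV[R]_k -> 'I_n -> R) s, (forall t, t \in s -> cube t) ->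
    ((`|\int[P]_w \prod_(t <- s) bumps l eta (c t) (B t w)|)%:E <= (A ^+ size s)%:E * energy a s)%E) ->
  forall s, ((`|\int[P]_w \prod_(t <- s) bump_at l eta x (t, w)|)%:E <= (A ^+ size s)%:E * energy a s)%E.
Proof.
move=> A0 HA s; have [cs|/existsNP[t /not_implyP[ts nt]]] := pselect (forall t, t \in s -> cube t).
  apply: le_trans (HA (fun t i => x ord0 i - phi t ord0 i) s cs).
  rewrite lee_fin le_eqVlt; apply/orP; left; apply/eqP; congr `|_|; apply: eq_Rintegral => w _.
  apply: eq_big_seq => t ts; rewrite /bump_at /= indicE mem_set ?mul1r; last exact: cs.
  rewrite pfield_cube; last exact: cs.
  rewrite /bumps; apply: eq_bigr => i _; congr (theta l i (_ / eta)).
  by rewrite mxE opprB addrA.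
have -> : \int[P]_w \prod_(t <- s) bump_at l eta x (t, w) = 0.
  under eq_Rintegral => w _.
    rewrite (_ : \prod_(t <- s) _ = 0); first over.
    by rewrite (big_rem t)//= /bump_at /= indicE memNset// !mul0r.
  by rewrite Rintegral_cst// mul0r.
by rewrite normr0 mule_ge0 ?lee_fin ?exprn_ge0// ltW// energy_gt0.
Qed.

Lemma cube_rker_total a : 0 <= a < k%:R -> exists2 C0, 0 <= C0 &
  forall x : 'rV[R]_k, (\int[cubeM R k]_t rker a (x - t) <= C0%:E)%E.
Proof.
move=> /andP[a0 ak]; exists (1 + 2 ^+ k * 2^-1 `^ (- a) / (1 - 2^-1 `^ (k%:R - a))).
  rewrite addr_ge0// divr_ge0 ?mulr_ge0 ?exprn_ge0 ?powR_ge0// subr_ge0.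
  rewrite -[leRHS](pow1R (k%:R - a)); apply: ge0_ler_powR; rewrite ?nnegrE ?subr_ge0 ?(ltW ak)//.
  by rewrite invf_le1 ?ler1n.
move=> x; apply: rker_total; [exact: a0|exact: ak|exact: exprn_ge0| |].
  by rewrite le_eqVlt; apply/orP; left; apply/eqP; exact: cubeMT.
by move=> j; exact: cubeM_cball.
Qed.

Lemma bump_at_eventually (m p : nat) (L : 'I_m -> nat) (a e eps A : R) : 0 <= a < k%:R -> 0 <= A -> 0 < eps ->
  (forall i j (c : 'rV[R]_k -> 'I_n -> R) s, (forall t, t \in s -> cube t) ->
    ((`|\int[P]_w \prod_(t <- s) bumps (L i) (2^-1 ^+ j) (c t) (B t w)|)%:E <=
      ((A * (2^-1 ^+ j) `^ e) ^+ size s)%:E * energy a s)%E) ->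
  exists Om : set T, [/\ measurable Om, P Om = 1%E &
    forall w, Om w -> exists J, forall j, (J <= j)%N -> forall i (g : sgrid n p j),
      `|\int[cubeM R k]_t bump_at (L i) (2^-1 ^+ j) (sgridpt R g) (t, w)| < (2^-1 ^+ j) `^ (e - eps)].
Proof.
move=> ak A0 eps0 HA; have [C0 C00 HC] := cube_rker_total ak.
pose G j : finType := ('I_m * sgrid n p j)%type.
pose I j (g : G j) w := \int[cubeM R k]_t bump_at (L g.1) (2^-1 ^+ j) (sgridpt R g.2) (t, w).
have [||||q|Om [mO PO HO]] := @tails_eventually d T R P G I A (m%:R * 4 ^+ n) (2 ^+ (p.+1 * n)) e eps _ A0 _ _ eps0.
- move=> j g; apply: (@measurable_Rintegral1 _ _ _ _ _ (cubeM R k) P (bump_at (L g.1) (2^-1 ^+ j) (sgridpt R g.2)) 1).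
    exact: measurable_bump_at.
  exact: bump_at_le1.
- by rewrite mulr_ge0// exprn_ge0.
- by rewrite exprn_gt0.
- by move=> j; rewrite card_prod card_ord natrM -mulrA ler_wpM2l// card_sgrid.
- exists (moment_cst C0 q.*2 0); first exact: moment_cst_ge0.
  move=> j g lambda l0.
  have A'0 : 0 <= A * (2^-1 ^+ j) `^ e by rewrite mulr_ge0// powR_ge0.
  apply: (integral_tail C00 HC (@measurable_bump_at _ _ _) (@bump_at_le1 _ _ _) A'0 _ q l0).
  by apply: bump_at_moment => // c s; exact: HA.
exists Om; split=> // w /HO[J HJ]; exists J => j Jj i g.
exact: (HJ j Jj (i, g)).
Qed.

Lemma as_frostman (beta : R) : 0 < beta <= n%:R -> H * beta < k%:R -> forall eps, 0 < eps ->
  exists Om : set T, [/\ measurable Om, P Om = 1%E &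
    forall w, Om w -> exists J, forall j, (J <= j)%N -> forall (g : sgrid n 1 j),
      `|\int[cubeM R k]_t bump_at n (2^-1 ^+ j) (sgridpt R g) (t, w)| < (2^-1 ^+ j) `^ (beta - eps)].
Proof.
move=> bn Hb eps eps0; have [A A0 HA] := bumps_moment H01 k0 bn.
have [||i j c s cs|Om [mO PO HO]] := @bump_at_eventually 1 1 (fun=> n) (H * beta) beta eps A _ _ eps0.
- by rewrite Hb mulr_ge0// ltW//; [case/andP: H01|case/andP: bn].
- exact: ltW.
- by apply: HA => //; rewrite exprn_gt0.
exists Om; split=> // w /HO[J HJ]; exists J => j Jj g; exact: (HJ j Jj ord0 g).
Qed.

Lemma as_increment : H * n%:R < k%:R -> exists2 eps, 0 < eps &
  exists Om : set T, [/\ measurable Om, P Om = 1%E &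
    forall w, Om w -> exists J, forall j, (J <= j)%N -> forall (l : 'I_n) (g : sgrid n n.+2 j),
      `|\int[cubeM R k]_t bump_at l (2^-1 ^+ j) (sgridpt R g) (t, w)| < (2^-1 ^+ j) `^ (n%:R + eps)].
Proof.
move=> Hnk; have [H0 H1] := andP H01.
pose delta := Num.min (2 - 2 * H) ((k%:R - H * n%:R) / 4).
have d0 : 0 < delta.
  by rewrite lt_min divr_gt0 ?subr_gt0// andbT -[ltRHS]mulr1 ltr_pM2l.
have d1 : delta <= 2 - 2 * H by rewrite ge_min lexx.
have d2 : delta <= (k%:R - H * n%:R) / 4 by rewrite ge_min lexx orbT.
move: delta d0 d1 d2 => delta d0 d1 d2.
have [|A A0 HA] := @bumps_increment_moment R k H H01 k0 n delta; first by rewrite d0.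
exists (delta / 2); first by rewrite divr_gt0.
have d20 : 0 < delta / 2 by rewrite divr_gt0.
have [||i j c s cs|Om [mO PO HO]] := @bump_at_eventually n n.+2 val (H * n%:R + 2 * delta) (n%:R + delta) (delta / 2) A _ _ d20.
- apply/andP; split; first by rewrite addr_ge0 ?mulr_ge0// ltW.
  by move: d0 d2 Hnk; move: (H * n%:R) (k%:R) => u v; lra.
- exact: ltW.
- apply: HA; [exact: fB|exact: ltn_ord| |exact: cs].
  by rewrite dy_gt0 dy_le1.
exists Om; split=> // w /HO[J HJ]; exists J => j Jj l g.
have := HJ j Jj l g; rewrite (_ : n%:R + delta - delta / 2 = n%:R + delta / 2)//.
by field.
Qed.

End perturbed_field.

(** * Holder continuity *)

Section almost_sure.
Context d (T : measurableType d) (R : realType) (P : probability T R).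

Definition almost (Q : T -> Prop) := exists Om : set T,
  [/\ measurable Om, P Om = 1%E & forall w, Om w -> Q w].

Lemma almost_all (n : nat) (Q : 'I_n -> T -> Prop) :
  (forall i, almost (Q i)) -> almost (fun w => forall i, Q i w).
Proof.
move=> /choice[Om HOm].
have mC i : measurable (~` Om i) by apply: measurableC; have [] := HOm i.
have PC i : (P (~` Om i) <= 0%:E)%E.
  by have [m1 P1 _] := HOm i; rewrite probability_setC// P1 subee.
have [mU PU] := union_bound (enum 'I_n) mC PC.
set U := [set w | _] in mU PU.
exists (~` U); split; first exact: measurableC.
  rewrite probability_setC//; have -> : P U = 0%E; last by rewrite sube0.
  by apply/eqP; rewrite eq_le measure_ge0 andbT (le_trans PU)// mulr0.
move=> w Uw i; have [_ _] := HOm i; apply.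
by apply: contrapT => nO; apply: Uw; exists i => //; rewrite mem_enum.
Qed.

Lemma almost_and (Q1 Q2 : T -> Prop) : almost Q1 -> almost Q2 -> almost (fun w => Q1 w /\ Q2 w).
Proof.
move=> h1 h2; have [|Om [mO PO HO]] := @almost_all 2 (fun i => if i == ord0 then Q1 else Q2).
  by move=> i; case: ifP.
exists Om; split=> // w /HO h; split; first by have := h ord0.
by have := h ord_max.
Qed.

Lemma ae_almost (Q : T -> Prop) : {ae P, forall w, Q w} -> almost Q.
Proof.
move=> [A [mA PA HA]]; exists (~` A); split; first exact: measurableC.
  by rewrite probability_setC// PA sube0.
by move=> w Aw; apply: contrapT => nQ; apply: Aw; exact: HA.
Qed.

End almost_sure.

Lemma expR_neg_le (R : realType) (y : R) q : 0 < y -> expR (- y) <= (q%:R / y) ^+ q.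
Proof.
move=> y0; case: q => [|q]; first by rewrite expr0 -expR0 ler_expR oppr_le0 ltW.
have z0 : 0 < y / q.+1%:R by rewrite divr_gt0.
have -> : expR (- y) = (expR (y / q.+1%:R))^-1 ^+ q.+1.
  by rewrite exprVn -expRM_natl -expRN; rewrite mulrC divfK ?pnatr_eq0.
apply: lerXn2r; rewrite ?nnegrE ?invr_ge0 ?expR_ge0 ?divr_ge0 ?(ltW y0)//.
rewrite -[leRHS]invf_div lef_pV2 ?posrE ?expR_gt0//.
by apply: le_trans (expR_ge1Dx _); rewrite lerDr.
Qed.

Section dyadic_scale.
Variable R : realType.

Lemma dy_between J (x : R) : 0 < x <= 2^-1 ^+ J ->
  exists2 m, (J <= m)%N & (2^-1 : R) ^+ m.+1 < x <= 2^-1 ^+ m.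
Proof.
move=> /andP[x0 xJ].
have [m0 m0x] : exists m, (2^-1 : R) ^+ m < x.
  have t01 : 0 < (2^-1 : R) < 1 by rewrite invr_gt0 invf_lt1 ?ltr1n// ltr0n.
  have [q] := small_power x^-1 t01; rewrite mulrC ltr_pdivrMr// mul1r => h; by exists q.
case: (@ex_minnP (fun m => (2^-1 : R) ^+ (J + m) < x)) => [|m mx mmin].
  exists m0; apply: le_lt_trans m0x; apply: ler_wiXn2l; rewrite ?invr_ge0//.
    by rewrite invf_le1 ?ler1n.
  exact: leq_addl.
case: m mx mmin => [|m] mx mmin; first by move: mx; rewrite addn0 ltNge xJ.
exists (J + m)%N; first exact: leq_addr.
rewrite -addnS mx/= leNgt; apply/negP => /mmin; by rewrite ltnn.
Qed.

Lemma count_lt_strict (z : R) m : 0 <= z -> \sum_(q < m) (q%:R < z)%R%:R < z + 1.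
Proof.
move=> z0; elim: m => [|m IH]; first by rewrite big_ord0 ltr_wpDl.
rewrite big_ord_recr/=; case: (ltP (m%:R : R) z) => mz; last by rewrite addr0.
rewrite mulr1n ltrD2r; apply: le_lt_trans mz.
have /andP[_] := count_lt m z0; rewrite le_min => /andP[+ _]; exact.
Qed.

End dyadic_scale.

Section chaining.
Context (R : realType) (k : nat) (f : 'rV[R]_k -> R) (gam : R) (J : nat).
Hypothesis gam0 : 0 < gam.
Local Notation pt := (@gridpt R k).
Local Notation dy j := (2^-1 ^+ j : R).
Let rho : R := 2^-1 `^ gam.
Hypothesis step : forall j (g : 'I_k -> nat) (i : 'I_k), (J <= j)%N -> (forall i, (g i <= 2 ^ j)%N) ->
  (g i < 2 ^ j)%N -> `|f (pt j (fun i' => (g i' + (i' == i))%N)) - f (pt j g)| <= dy j `^ gam.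
Hypothesis cf : {within @orthant R k, continuous f}.

Let rho0 : 0 < rho. Proof. by rewrite powR_gt0. Qed.

Let rho1 : rho < 1.
Proof.
rewrite -(pow1R gam); apply: gt0_ltr_powR; rewrite ?nnegrE//.
by rewrite invf_lt1 ?ltr1n.
Qed.

Let dyE j : dy j `^ gam = rho ^+ j. Proof. exact: dy_powR. Qed.

Let grid_step j (g g' : 'I_k -> nat) : (J <= j)%N ->
  (forall i, (g i <= 2 ^ j)%N) -> (forall i, (g' i <= 2 ^ j)%N) ->
  (forall i, (g i <= (g' i).+1)%N) -> (forall i, (g' i <= (g i).+1)%N) ->
  `|f (pt j g') - f (pt j g)| <= k%:R * rho ^+ j.
Proof.
move=> Jj gj g'j gg' g'g.
pose h l (i : 'I_k) := if (i < l)%N then g' i else g i.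
have hj l i : (h l i <= 2 ^ j)%N by rewrite /h; case: ifP.
have hS l : (l < k)%N -> `|f (pt j (h l.+1)) - f (pt j (h l))| <= rho ^+ j.
  move=> lk; pose i0 := Ordinal lk.
  have off i : i != i0 -> h l.+1 i = h l i.
    by move=> ii0; rewrite /h ltnS leq_eqVlt -[(i == l :> nat)]/(i == i0) (negbTE ii0).
  have h1 : h l.+1 i0 = g' i0 by rewrite /h /= ltnSn.
  have h2 : h l i0 = g i0 by rewrite /h /= ltnn.
  have [e|e|e] := ltngtP (g' i0) (g i0).
  - have -> : h l = fun i' => (h l.+1 i' + (i' == i0))%N.
      apply/funext => i; have [->|ii0] := eqVneq i i0; last by rewrite addn0 off.
      by rewrite h1 h2 addn1; apply/eqP; rewrite eqn_leq gg' e.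
    rewrite distrC -dyE; apply: step => //.
    by rewrite h1 (leq_trans e).
  - have -> : h l.+1 = fun i' => (h l i' + (i' == i0))%N.
      apply/funext => i; have [->|ii0] := eqVneq i i0; last by rewrite addn0 off.
      by rewrite h1 h2 addn1; apply/eqP; rewrite eqn_leq g'g e.
    rewrite -dyE; apply: step => //.
    by rewrite h2 (leq_trans e).
  - have -> : h l.+1 = h l.
      by apply/funext => i; have [->|ii0] := eqVneq i i0; [rewrite h1 h2|rewrite off].
    by rewrite subrr normr0 exprn_ge0// ltW.
have hl l : (l <= k)%N -> `|f (pt j (h l)) - f (pt j (h 0))| <= l%:R * rho ^+ j.
  elim: l => [_|l IH lk]; first by rewrite subrr normr0 mul0r.
  have -> : f (pt j (h l.+1)) - f (pt j (h 0%N)) =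
      (f (pt j (h l.+1)) - f (pt j (h l))) + (f (pt j (h l)) - f (pt j (h 0%N))) by rewrite addrA subrK.
  rewrite -natr1 mulrDl mul1r [leRHS]addrC.
  by apply: (le_trans (ler_normD _ _)); apply: lerD; [exact: hS|exact/IH/ltnW].
have := hl k (leqnn k).
have -> : h k = g' by apply/funext => i; rewrite /h ltn_ord.
by have -> : h 0%N = g by apply/funext => i; rewrite /h.
Qed.

Let ceilg_bounds m (t : 'rV[R]_k) i : cube t ->
  2 ^+ m * t ord0 i <= (ceilg m t i)%:R < 2 ^+ m * t ord0 i + 1.
Proof.
move=> ct; have /andP[t0 t1] := ct i; have p0 : 0 < 2 ^+ m :> R by rewrite exprn_gt0.
have z0 : 0 <= 2 ^+ m * t ord0 i by rewrite mulr_ge0// ltW.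
rewrite /ceilg natr_sum count_lt_strict// andbT.
have /andP[+ _] := count_lt (2 ^ m) z0; apply: le_trans.
by rewrite le_min lexx andbT natrX ler_piMr// ltW.
Qed.

Let dyceil_step m t : (J <= m)%N -> cube t ->
  `|f (dyceil m.+1 t) - f (dyceil m t)| <= k%:R * rho ^+ m.+1.
Proof.
move=> Jm ct.
have -> : dyceil m t = pt m.+1 (fun i => (2 * ceilg m t i)%N).
  by apply/rowP => i; rewrite !mxE exprS natrM invfM; field; rewrite expf_neq0.
have b i := ceilg_bounds m i ct; have b' i := ceilg_bounds m.+1 i ct.
apply: grid_step => //; first exact: leqW.
- by move=> i; rewrite expnS leq_mul2l ceilg_le.
- by move=> i; exact: ceilg_le.
- move=> i; rewrite -ltnS -(ltr_nat R); move: (b i) (b' i); rewrite exprS => /andP[_ h1] /andP[h2 _].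
  by rewrite -!natr1 natrM; move: h1 h2; rewrite -mulrA; move: (2 ^+ m * _) => z; lra.
- move=> i; rewrite -ltnS -(ltr_nat R); move: (b i) (b' i); rewrite exprS => /andP[h1 _] /andP[_ h2].
  by rewrite -!natr1 natrM; move: h1 h2; rewrite -mulrA; move: (2 ^+ m * _) => z; lra.
Qed.

Let dyceil_chain m p t : (J <= m)%N -> cube t ->
  `|f (dyceil (m + p) t) - f (dyceil m t)| <= k%:R * (rho ^+ m - rho ^+ (m + p)) / (1 - rho).
Proof.
move=> Jm ct; have r1 : 0 < 1 - rho by rewrite subr_gt0.
elim: p => [|p IH]; first by rewrite addn0 !subrr normr0 mulr0 mul0r.
rewrite addnS -(subrKA (f (dyceil (m + p) t))).
apply: (le_trans (ler_normD _ _)).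
have := @dyceil_step (m + p) t (leq_trans Jm (leq_addr _ _)) ct => h.
have {}h := le_trans h (_ : _ <= k%:R * rho ^+ (m + p)).
apply: (le_trans (lerD (h _) IH)); first by rewrite ler_wpM2l// exprS ler_piMl ?exprn_ge0// ltW.
rewrite le_eqVlt; apply/orP; left; apply/eqP.
by rewrite !exprS; move: (rho ^+ (m + p)) => u; field; rewrite gt_eqF.
Qed.

Let dyceil_limit m t : (J <= m)%N -> cube t ->
  `|f t - f (dyceil m t)| <= k%:R * rho ^+ m / (1 - rho).
Proof.
move=> Jm ct; have r1 : 0 < 1 - rho by rewrite subr_gt0.
apply/ler_addgt0Pr => e e0.
have oc s : cube s -> @orthant R k s by move=> cs i; have /andP[] := cs i.
have /subspace_continuousP/(_ t (oc _ ct)) cft := cf.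
have /cft hU : nbhs (f t) (ball (f t) e) by exact: nbhsx_ballx.
have [N _ HN] : \forall p \near \oo, orthant (dyceil p t) -> ball (f t) e (f (dyceil p t)).
  have hU' : nbhs t [set x | orthant x -> ball (f t) e (f x)] := hU.
  have tc : dyceil p t @[p --> \oo] --> t by have := @dyceil_cvg R k t; rewrite clip_cube.
  exact: (tc _ hU').
have := HN (m + N)%N (leq_addl _ _) (oc _ (dyceil_cube _ _)); rewrite /ball /= => h1.
have -> : f t - f (dyceil m t) = (f t - f (dyceil (m + N) t)) +
    (f (dyceil (m + N) t) - f (dyceil m t)) by rewrite addrA subrK.
apply: (le_trans (ler_normD _ _)).
rewrite addrC; apply: lerD; last exact: ltW.
apply: (le_trans (dyceil_chain N Jm ct)).
rewrite ler_pM2r ?invr_gt0// ler_wpM2l// gerBl exprn_ge0// ltW//.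
Qed.

Lemma chaining_holder : exists2 C, 0 <= C & forall s t, cube s -> cube t ->
  `|f t - f s| <= C * enorm (t - s) `^ gam.
Proof.
have r1 : 0 < 1 - rho by rewrite subr_gt0.
pose D := \sum_(g : {ffun 'I_k -> 'I_(2 ^ J).+1}) `|f (pt J (fun i => g i : nat))|.
have D0 : 0 <= D by apply: sumr_ge0.
have fD t : `|f (dyceil J t)| <= D.
  have gP i : (ceilg J t i < (2 ^ J).+1)%N by rewrite ltnS ceilg_le.
  pose g0 : {ffun 'I_k -> 'I_(2 ^ J).+1} := [ffun i => Ordinal (gP i)].
  rewrite /D (bigD1 g0)//= (_ : pt J _ = dyceil J t); last by apply/rowP => i; rewrite !mxE ffunE.
  by rewrite lerDl sumr_ge0.
pose K := 2 * (k%:R / (1 - rho)) + k%:R.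
have K0 : 0 <= K by rewrite addr_ge0// mulr_ge0// divr_ge0// ltW.
pose K' := 2 * (k%:R * rho ^+ J / (1 - rho)) + 2 * D.
have K'0 : 0 <= K'.
  apply: addr_ge0; apply: mulr_ge0 => //.
  by rewrite divr_ge0 ?mulr_ge0 ?exprn_ge0 ?(ltW rho0) ?(ltW r1).
have Kr0 : 0 <= K / rho by rewrite divr_ge0 ?(ltW rho0).
have Kr'0 : 0 <= K' / rho ^+ J by rewrite divr_ge0 ?exprn_ge0 ?(ltW rho0).
exists (K / rho + K' / rho ^+ J); first exact: addr_ge0.
move=> s t cs ct; have [->|st] := eqVneq s t.
  by rewrite !subrr normr0 mulr_ge0 ?powR_ge0// addr_ge0.
have x0 : 0 < enorm (t - s) by rewrite enorm_gt0 subr_eq0 eq_sym.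
have tri m : (J <= m)%N -> `|f t - f s| <= 2 * (k%:R * rho ^+ m / (1 - rho)) + `|f (dyceil m t) - f (dyceil m s)|.
  move=> Jm; have h1 := dyceil_limit Jm ct; have h2 := dyceil_limit Jm cs.
  have -> : f t - f s = (f t - f (dyceil m t)) + (f (dyceil m t) - f (dyceil m s)) - (f s - f (dyceil m s)) by ring.
  apply: (le_trans (ler_normB _ _)); apply: (le_trans (lerD (ler_normD _ _) (lexx _))).
  by move: h1 h2; lra.
have [xJ|xJ] := leP (enorm (t - s)) (dy J).
  have [|m Jm /andP[m1 m2]] := @dy_between R J (enorm (t - s)); first by rewrite x0.
  apply: (@le_trans _ _ (K / rho * enorm (t - s) `^ gam)); last first.
    by rewrite ler_wpM2r ?powR_ge0// lerDl.
  have gs : `|f (dyceil m t) - f (dyceil m s)| <= k%:R * rho ^+ m.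
    have bt i := ceilg_bounds m i ct; have bs i := ceilg_bounds m i cs.
    have d i : `|2 ^+ m * t ord0 i - 2 ^+ m * s ord0 i| <= 1.
      rewrite -mulrBr normrM ger0_norm ?exprn_ge0// mulrC -ler_pdivlMr ?exprn_gt0// mul1r -exprVn.
      by apply: le_trans m2; have := coord_le_enorm (t - s) i; rewrite !mxE.
    apply: grid_step => //; try by move=> i; exact: ceilg_le.
    - move=> i; rewrite -ltnS -(ltr_nat R) -!natr1; move: (bt i) (bs i) (d i) => /andP[h1 h2] /andP[h3 h4].
      by rewrite ler_norml => /andP[h5 h6]; lra.
    - move=> i; rewrite -ltnS -(ltr_nat R) -!natr1; move: (bt i) (bs i) (d i) => /andP[h1 h2] /andP[h3 h4].
      by rewrite ler_norml => /andP[h5 h6]; lra.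
  have rm : rho ^+ m <= enorm (t - s) `^ gam / rho.
    rewrite ler_pdivlMr// -exprSr -dyE; apply: ge0_ler_powR; rewrite ?nnegrE ?(ltW gam0) ?exprn_ge0 ?(ltW x0)//.
    exact: ltW.
  apply: (le_trans (tri m Jm)); apply: (le_trans (lerD (lexx _) gs)).
  rewrite (_ : _ + _ = K * rho ^+ m); last by rewrite /K; ring.
  by rewrite -mulrA [rho^-1 * _]mulrC ler_wpM2l.
apply: (@le_trans _ _ (K' / rho ^+ J * enorm (t - s) `^ gam)); last first.
  by rewrite ler_wpM2r ?powR_ge0// lerDr.
apply: (@le_trans _ _ K'); last first.
  rewrite -mulrA ler_peMr// mulrC ler_pdivlMr ?exprn_gt0// mul1r -dyE.
  by apply: ge0_ler_powR; rewrite ?nnegrE ?(ltW gam0) ?exprn_ge0 ?(ltW x0)// ltW.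
apply: (le_trans (tri J (leqnn J))); rewrite lerD2l; apply: (le_trans (ler_normB _ _)).
by have := fD t; have := fD s; lra.
Qed.

End chaining.

Section fbm_holder.
Context d (T : measurableType d) (R : realType) (P : probability T R) (k : nat) (H : R).
Hypothesis H01 : 0 < H < 1.

Lemma enorm_delta (i : 'I_k) (a : R) : enorm (\row_i' (a * (i' == i)%:R)) = `|a|.
Proof.
rewrite /enorm /dot (bigD1 i)//= big1 ?addr0; last first.
  by move=> i' /negbTE ii'; rewrite mxE ii' !mulr0.
by rewrite mxE eqxx mulr1 -expr2 sqrtr_sqr.
Qed.

Lemma gridpt_next j (g : 'I_k -> nat) (i : 'I_k) :
  gridpt R j (fun i' => (g i' + (i' == i))%N) - gridpt R j g = \row_i' (2^-1 ^+ j * (i' == i)%:R).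
Proof.
apply/rowP => i'; rewrite !mxE natrD mulrDl addrAC subrr add0r mulrC exprVn.
by case: (i' == i).
Qed.

Lemma fbm_grid_increment (b : 'rV[R]_k -> T -> R) (gam : R) : fbm_field1 P H b -> gam < H ->
  almost P (fun w => exists J, forall j (g : 'I_k -> nat) (i : 'I_k), (J <= j)%N ->
    (forall i, (g i <= 2 ^ j)%N) -> (g i < 2 ^ j)%N ->
    `|b (gridpt R j (fun i' => (g i' + (i' == i))%N)) w - b (gridpt R j g) w| <= (2^-1 ^+ j) `^ gam).
Proof.
move=> fb gH; have [H0 H1] := andP H01.
pose G j : finType := ({ffun 'I_k -> 'I_(2 ^ j).+1} * 'I_k)%type.
pose nxt j (g : G j) : 'rV[R]_k := if (g.1 g.2 < 2 ^ j)%N then gridpt R j (fun i' => (g.1 i' + (i' == g.2))%N)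
  else gridpt R j (fun i' => g.1 i' : nat).
pose I j (g : G j) w := b (nxt j g) w - b (gridpt R j (fun i' => g.1 i' : nat)) w.
have o1 j (g : G j) : orthant (gridpt R j (fun i' => g.1 i' : nat)).
  by move=> i; rewrite mxE divr_ge0 ?exprn_ge0.
have o2 j (g : G j) : orthant (nxt j g).
  by rewrite /nxt; case: ifP => _ i; rewrite mxE divr_ge0 ?exprn_ge0.
have eps0 : 0 < H - gam by rewrite subr_gt0.
have [|||j|q|Om [mO PO HO]] := @tails_eventually d T R P G I 1 (k%:R * 2 ^+ k) (2 ^+ k) H (H - gam) _ ler01 _ _ eps0.
- by move=> j g; apply: measurable_funB; apply: (fbm_measurable fb).
- by rewrite mulr_ge0// exprn_ge0.
- by rewrite exprn_gt0.
- rewrite card_prod card_ffun !card_ord natrM mulrC -mulrA ler_wpM2l// natrX -exprM mulnC exprM -exprMn.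
  rewrite lerXn2r ?nnegrE ?mulr_ge0 ?exprn_ge0// -natrX -natrM ler_nat.
  by rewrite mul2n -addnn -addn1 leq_add2l expn_gt0.
- exists (2 * (4 * q%:R) ^+ q); first by rewrite mulr_ge0// exprn_ge0// mulr_ge0.
  move=> j g lambda l0; rewrite /I.
  have p0 : 0 < (2^-1 : R) ^+ j by rewrite exprn_gt0.
  have B0 : (0 <= (2 * (4 * q%:R) ^+ q * (1 * (2^-1 ^+ j) `^ H / lambda) ^+ q.*2)%:E)%E.
    by rewrite lee_fin !mulr_ge0// exprn_ge0// ?mul1r ?mulr_ge0// ?powR_ge0// invr_ge0 ltW.
  have [gl|gl] := ltnP (g.1 g.2) (2 ^ j); last first.
    rewrite (_ : [set w | _] = set0) ?measure0//; apply/seteqP; split=> w //=.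
    by rewrite /nxt ltnNge gl /= subrr normr0 leNgt l0.
  have ee : enorm (nxt j g - gridpt R j (fun i' => g.1 i' : nat)) = 2^-1 ^+ j.
    by rewrite /nxt gl gridpt_next enorm_delta ger0_norm// ltW.
  have ne : gridpt R j (fun i' => g.1 i' : nat) != nxt j g.
    by rewrite eq_sym -subr_eq0 -enorm_eq0 ee gt_eqF.
  apply: (le_trans (fbm_tail fb H0 (o1 j g) (o2 j g) ne l0)); rewrite lee_fin ee.
  rewrite -[leRHS]mulrA; apply: ler_wpM2l => //.
  have y0 : 0 < lambda ^+ 2 / (4 * (2^-1 ^+ j) `^ (2 * H)).
    by rewrite divr_gt0 ?exprn_gt0// mulr_gt0// powR_gt0.
  apply: (le_trans (expR_neg_le q y0)); rewrite le_eqVlt; apply/orP; left; apply/eqP.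
  rewrite -mul2n exprM -exprMn; congr (_ ^+ _).
  rewrite [2 * H]mulrC powRrM powR_mulrn ?powR_ge0// mul1r.
  have := powR_gt0 H p0; move: (_ `^ _) => u u0; field.
  by rewrite !gt_eqF.
exists Om; split=> // w /HO[J HJ]; exists J => j g i Jj gj gij.
pose g' : {ffun 'I_k -> 'I_(2 ^ j).+1} := [ffun i => inord (g i)].
have g'E i' : g' i' = g i' :> nat by rewrite ffunE inordK// ltnS.
have := HJ j Jj (g', i); rewrite /I /nxt /= g'E gij subKr.
have -> : gridpt R j (fun i' => g' i' : nat) = gridpt R j g by apply/rowP => i'; rewrite !mxE g'E.
have -> : gridpt R j (fun i' => (g' i' + (i' == i))%N) = gridpt R j (fun i' => (g i' + (i' == i))%N).
  by apply/rowP => i'; rewrite !mxE g'E.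
exact: ltW.
Qed.

Lemma field_holder n (B : 'rV[R]_k -> T -> 'rV[R]_n) (gam : R) : fbm_field P H B ->
  0 < gam < H -> almost P (fun w => holder0 gam (B ^~ w)).
Proof.
move=> [fb _ cB] /andP[g0 gH].
have a1 : almost P (fun w => forall i, B 0 w ord0 i = 0).
  by apply: almost_all => i; apply: ae_almost; case: (fb i).
have a2 := almost_all (fun i => fbm_grid_increment (fb i) gH).
have [Om [mO PO HO]] := almost_and a1 a2.
exists Om; split=> // w /HO[B0 Binc].
split; first by apply/rowP => i; rewrite B0 mxE.
have /choice[C HC] : forall i : 'I_n, exists C : R, 0 <= C /\ forall s t, cube s -> cube t ->
    `|B t w ord0 i - B s w ord0 i| <= C * enorm (t - s) `^ gam.
  move=> i; have [J HJ] := Binc i.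
  have [|C C0 HC] := @chaining_holder R k (fun t => B t w ord0 i) gam J g0 (fun j g i' Jj gj gij => HJ j g i' Jj gj gij).
    apply/subspace_continuousP => t ot; have /subspace_continuousP/(_ t ot) h := cB w.
    exact: (@cvg_comp _ _ _ (B ^~ w) (fun v : 'rV[R]_n => v ord0 i) _ _ _ h (@coord_continuous R 1 n ord0 i (B t w))).
  by exists C.
apply: (@le_lt_trans _ _ (n%:R * \sum_i C i)%:E); last exact: ltry.
apply: ge_ereal_sup => _ [s [t [cs ct st ->]]].
have x0 : 0 < enorm (t - s) `^ gam by rewrite powR_gt0// enorm_gt0 subr_eq0 eq_sym.
rewrite lee_fin ler_pdivrMr// -mulrA; apply: enorm_le_coord => i.
have [Ci0 HCi] := HC i; rewrite !mxE; apply: (le_trans (HCi s t cs ct)).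
rewrite ler_wpM2r ?(ltW x0)// (bigD1 i)//= lerDl sumr_ge0// => i' _.
by have [] := HC i'.
Qed.

End fbm_holder.

(** * Potentials of image measures *)

Section dominated_continuity.
Context d (T : measurableType d) (R : realType) (nu : {finite_measure set T -> \bar R}) (n : nat).
Variable Y : T -> 'rV[R]_n.
Hypothesis mY : measurable_fun [set: T] Y.

Lemma measurable_shifted (f : 'rV[R]_n -> R) x : measurable_fun [set: 'rV[R]_n] f ->
  measurable_fun [set: T] (fun t => f (x - Y t)).
Proof. by move=> mf; apply: (measurableT_comp mf); exact: measurable_rVB. Qed.

Lemma continuous_Rintegral (f : 'rV[R]_n -> R) (M : R) : continuous f -> (forall z, `|f z| <= M) ->
  continuous (fun x : 'rV[R]_n => \int[nu]_t f (x - Y t)).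
Proof.
move=> cf fM x; apply/(@cvgrPdist_le _ _ _ _ (nbhs_filter x)) => e e0.
apply: contrapT => nF.
have /choice[y Hy] : forall m : nat, exists y : 'rV[R]_n, `|x - y| <= 2^-1 ^+ m /\
    e < `|\int[nu]_t f (x - Y t) - \int[nu]_t f (y - Y t)|.
  move=> m; apply: contrapT => /forallNP h; apply: nF.
  have hB : \forall y \near x, `|x - y| <= 2^-1 ^+ m.
    exact: (@cvgrPdist_le _ _ _ _ (nbhs_filter x) id x).1 (fun A hA => hA) _ (dy_gt0 R m).
  apply: filterS hB => y xy; rewrite leNgt; apply/negP => ey; exact: (h y).
have yx : y m @[m --> \oo] --> x.
  apply/cvgrPdist_le => r r0.
  have t01 : 0 < (2^-1 : R) < 1 by rewrite invr_gt0 invf_lt1 ?ltr1n// ltr0n.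
  have [q] := small_power r^-1 t01; rewrite mulrC ltr_pdivrMr// mul1r => h.
  exists q => // m /= qm; apply: (le_trans (Hy m).1); apply/ltW/(le_lt_trans _ h).
  by apply: ler_wiXn2l; rewrite ?invr_ge0// invf_le1 ?ler1n.
have mf := continuous_measurable_rV cf.
have M0 : 0 <= M by exact: le_trans (fM 0).
have lim : (\int[nu]_t (f (y m - Y t))%:E)%E @[m --> \oo] --> (\int[nu]_t (f (x - Y t))%:E)%E.
  apply: (@dominated_cvg _ _ _ nu setT measurableT (fun m t => (f (y m - Y t))%:E) _ (cst M%:E)).
  - by move=> m; apply/measurable_EFinP; exact: measurable_shifted.
  - move=> t _; apply: cvg_EFin; first exact: nearW.
    apply: (@cvg_comp _ _ _ (fun m => y m - Y t) f); last exact: cf.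
    by apply: cvgB => //; exact: cvg_cst.
  - by [].
  - by apply: (@bounded_integrable _ _ _ nu (cst M) M) => // t; rewrite /= ger0_norm.
  - by move=> m t _; rewrite /= lee_fin.
have {}lim : (\int[nu]_t f (y m - Y t)) @[m --> \oo] --> (\int[nu]_t f (x - Y t)).
  apply: fine_cvg; rewrite -(integral_EFin_Rintegral nu (measurable_shifted x mf) (fun t => fM _)).
  exact: lim.
have [N _ HN] := (cvgrPdist_le _ _).1 lim e e0.
by have := HN N (leqnn N); rewrite /= leNgt (Hy N).2.
Qed.

End dominated_continuity.

Section image_potential.
Context d (T : measurableType d) (R : realType) (nu : {finite_measure set T -> \bar R}) (n : nat).
Variable Y : T -> 'rV[R]_n.
Hypothesis mY : measurable_fun [set: T] Y.
Variables (b C M : R).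
Hypothesis C0 : 0 <= C.
Hypothesis nuM : (nu setT <= M%:E)%E.
Hypothesis nuC : forall (x : 'rV[R]_n) j, (nu [set t | (enorm (x - Y t) <= 2^-1 ^+ j)%R] <= (C * (2^-1 ^+ j) `^ b)%:E)%E.

Let mu : {measure set 'rV[R]_n -> \bar R} :=
  measure_function_pushforward__canonical__measure_function_Measure nu mY.

Let muC x j : (mu (cball x (2^-1 ^+ j)) <= (C * (2^-1 ^+ j) `^ b)%:E)%E.
Proof. exact: nuC. Qed.

Let m1 a x : measurable_fun [set: T] (fun t => rker a (x - Y t)).
Proof. exact: (measurableT_comp (measurable_rker_sub a x) mY). Qed.

Lemma rker_pot_bound a : 0 <= a -> a < b -> exists2 K, 0 <= K & forall x,
  (\int[nu]_t rker a (x - Y t) <= K%:E)%E.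
Proof.
move=> a0 ab; exists (Num.max 0 (M + C * 2^-1 `^ (- a) / (1 - 2^-1 `^ (b - a)))).
  by rewrite le_max lexx.
move=> x; apply: (@le_trans _ _ (M + C * 2^-1 `^ (- a) / (1 - 2^-1 `^ (b - a)))%:E); last first.
  by rewrite lee_fin le_max lexx orbT.
have := @rker_total R n mu a b C M x a0 ab C0 nuM (muC x); apply: le_trans.
rewrite le_eqVlt; apply/orP; left; apply/eqP.
by rewrite (@integral_pushforward_all _ _ _ _ _ nu Y (fun y => rker a (x - y)))//; exact: measurable_rker_sub.
Qed.

Lemma rker_pot_small a e : 0 <= a -> a < b -> 0 < e -> exists J, forall x,
  (\int[nu]_t ((\1_(cball x (2^-1 ^+ J)) (Y t))%:E * rker a (x - Y t)) <= e%:E)%E.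
Proof.
move=> a0 ab e0; set rho := 2^-1 `^ (b - a) : R.
have rho01 : 0 < rho < 1.
  rewrite powR_gt0//= -(pow1R (b - a)); apply: gt0_ltr_powR; rewrite ?nnegrE ?subr_gt0//.
  by rewrite invf_lt1 ?ltr1n.
have [q Hq] := small_power (C * 2^-1 `^ (- a) / (1 - rho) / e) rho01.
exists q => x; have := @shell_integral R n mu a b C q x a0 ab C0 (muC x) => h.
have mf : measurable_fun [set: 'rV[R]_n] (fun y => ((\1_(cball x (2^-1 ^+ q)) y)%:E * rker a (x - y))%E).
  apply: emeasurable_funM; last exact: measurable_rker_sub.
  by apply/measurable_EFinP; apply: measurable_indic; exact: measurable_cball.
rewrite (@integral_pushforward_all _ _ _ _ _ nu Y _ mY mf) in h.
apply: (le_trans h); rewrite lee_fin; apply: ltW; move: Hq.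
by rewrite -/rho mulrAC ltr_pdivrMr// mul1r; congr (_ < _); rewrite mulrAC.
Qed.

Section bounded_by_rker.
Variables (g : 'rV[R]_n -> \bar R) (a K : R).
Hypothesis a0 : 0 <= a.
Hypothesis ab : a < b.
Hypothesis K0 : 0 <= K.
Hypothesis cg : continuous g.
Hypothesis gK : forall z, (`|g z| <= K%:E * rker a z)%E.

Let gfin z : z != 0 -> g z \is a fin_num.
Proof.
move=> z0; rewrite -abse_fin_num ge0_fin_numE//; apply: (le_lt_trans (gK z)).
by rewrite /rker (negbTE z0) -EFinM ltry.
Qed.

Let chi J (z : 'rV[R]_n) : R := Num.max 0 (Num.min 1 (2 ^+ J.+1 * enorm z - 1)).

Let chi01 J z : 0 <= chi J z <= 1.
Proof. by rewrite /chi le_max lexx/= ge_max ler01/= ge_min lexx. Qed.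

Let chi0 J z : enorm z <= 2^-1 ^+ J.+1 -> chi J z = 0.
Proof.
move=> zJ; rewrite /chi; apply/max_idPl; rewrite ge_min subr_le0.
by rewrite mulrC -ler_pdivlMr ?exprn_gt0// mul1r -exprVn zJ orbT.
Qed.

Let chi1 J z : 2^-1 ^+ J <= enorm z -> chi J z = 1.
Proof.
move=> zJ; rewrite /chi; have -> : Num.min 1 (2 ^+ J.+1 * enorm z - 1) = 1.
  apply/min_idPl; rewrite lerBrDr -[1 + 1]/(2 : R).
  rewrite exprS -mulrA ler_peMr// mulrC -ler_pdivrMr ?exprn_gt0// mul1r -exprVn//.
by apply/max_idPr; exact: ler01.
Qed.

Let continuous_chi J : continuous (chi J).
Proof.
move=> z; apply: (@continuous_max R _ (cst 0 : 'rV[R]_n -> R^o) (fun z => Num.min 1 (2 ^+ J.+1 * enorm z - 1)) z); first exact: cst_continuous.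
apply: (@continuous_min R _ (cst 1 : 'rV[R]_n -> R^o) (fun z => 2 ^+ J.+1 * enorm z - 1) z); first exact: cst_continuous.
have h : (2 ^+ J.+1 * enorm y - 1) @[y --> z] --> (2 ^+ J.+1 * enorm z - 1 : R).
  apply: (@cvgB R R^o _ (nbhs z) (nbhs_filter z)); last exact: (@cvg_cst _ _ _ _ (nbhs_filter z)).
  apply: (@cvgM R _ (nbhs z) (nbhs_filter z)); first exact: (@cvg_cst _ _ _ _ (nbhs_filter z)).
  exact: continuous_enorm.
exact: h.
Qed.

Let trunc J z : R := fine (g z) * chi J z.

Let continuous_trunc J : continuous (trunc J).
Proof.
move=> z; have [->|z0] := eqVneq z 0.
  have e0 : trunc J 0 = 0 by rewrite /trunc chi0 ?mulr0// enorm0 exprn_ge0.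
  rewrite /continuous_at e0; apply: (@cvg_near_cst _ _ _ _ _ (nbhs_filter (0 : 'rV[R]_n))).
  have h : \forall y \near (0 : 'rV[R]_n), enorm y < 2^-1 ^+ J.+1.
    have h0 : enorm y @[y --> (0 : 'rV[R]_n)] --> (0 : R).
      by have := @continuous_enorm R n 0; rewrite /continuous_at enorm0.
    by apply: (cvgr_lt _ h0); exact: dy_gt0.
  by apply: filterS h => y /ltW yJ; rewrite /trunc chi0 ?mulr0.
have gz : g y @[y --> z] --> (fine (g z))%:E by rewrite fineK ?gfin//; exact: cg.
have h := @fine_cvg R _ (nbhs z) (nbhs_filter z) g (fine (g z)) gz.
exact: (@cvgM R _ (nbhs z) (nbhs_filter z) (fun y => fine (g y)) (chi J) _ _ h (@continuous_chi J z)).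
Qed.

Let fineg_le z : z != 0 -> `|fine (g z)| <= K * enorm z `^ (- a).
Proof.
move=> z0; rewrite -lee_fin EFinM; have := gK z; rewrite /rker (negbTE z0).
by rewrite -[g z in X in X -> _]fineK ?gfin.
Qed.

Let trunc_le J z : `|trunc J z| <= K * (2^-1 ^+ J.+1) `^ (- a).
Proof.
have p0 : 0 < (2^-1 : R) ^+ J.+1 by rewrite exprn_gt0.
have /andP[c0 c1] := chi01 J z.
have [zJ|zJ] := leP (enorm z) (2^-1 ^+ J.+1).
  by rewrite /trunc chi0// mulr0 normr0 mulr_ge0// powR_ge0.
have z0 : z != 0 by rewrite -enorm_eq0 gt_eqF// (lt_trans _ zJ).
rewrite normrM (ger0_norm c0); apply: (le_trans (ler_piMr (normr_ge0 _) c1)).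
apply: (le_trans (fineg_le z0)); rewrite ler_wpM2l// !powRN lef_pV2 ?posrE ?powR_gt0 ?enorm_gt0//.
by apply: ge0_ler_powR; rewrite ?nnegrE ?enorm_ge0 ?(ltW p0) ?(ltW zJ).
Qed.

Let g_trunc J z : (`|g z - (trunc J z)%:E| <= K%:E * ((\1_[set z | (enorm z <= 2^-1 ^+ J)%R] z)%:E * rker a z))%E.
Proof.
rewrite indicE; case: (boolP (z \in _)) => [|/negP]; rewrite inE/=.
  move=> zJ; rewrite mul1e; have [z0|z0] := eqVneq z 0.
    rewrite /trunc chi0; last by rewrite z0 enorm0 exprn_ge0.
    by rewrite mulr0 sube0.
  apply: le_trans (gK z); rewrite -[g z]fineK ?gfin// -EFinB !abse_EFin lee_fin.
  have /andP[c0 c1] := chi01 J z.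
  rewrite /trunc -{1}[fine (g z)]mulr1 -mulrBr normrM ler_piMr// ger0_norm ?subr_ge0//.
  by rewrite gerBl.
move=> /negP; rewrite -ltNge => zJ; rewrite mul0e mule0.
have z0 : z != 0 by rewrite -enorm_eq0 gt_eqF// (lt_trans _ zJ)// dy_gt0.
by rewrite /trunc chi1 ?(ltW zJ)// mulr1 EFinN fineK ?gfin// subee ?gfin// abse0.
Qed.

Lemma measurable_rker_bounded : measurable_fun [set: 'rV[R]_n] g.
Proof.
pose G z : R := if z == 0 then 0 else fine (g z).
have mG : measurable_fun [set: 'rV[R]_n] G.
  apply: (@measurable_fun_cvg _ _ R _ trunc) => [J|z _].
    by apply: continuous_measurable_rV; exact: continuous_trunc.
  rewrite /G; have [->|z0] := eqVneq z 0.
    apply: cvg_near_cst; apply: nearW => J.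
    by rewrite /trunc chi0 ?mulr0// enorm0 exprn_ge0.
  apply: cvg_near_cst.
  have t01 : 0 < (2^-1 : R) < 1 by rewrite invr_gt0 invf_lt1 ?ltr1n// ltr0n.
  have zp : 0 < enorm z by rewrite enorm_gt0.
  have [q] := small_power (enorm z)^-1 t01; rewrite mulrC ltr_pdivrMr// mul1r => h.
  exists q => // J /= qJ; rewrite /trunc chi1 ?mulr1//; apply/ltW/(le_lt_trans _ h).
  by apply: ler_wiXn2l; rewrite ?invr_ge0// invf_le1 ?ler1n.
rewrite (_ : g = fun z => if z == 0 then g 0 else (G z)%:E); last first.
  by apply/funext => z; rewrite /G; have [->//|z0] := eqVneq z 0; rewrite fineK ?gfin.
apply: measurable_fun_ifT => //; last exact/measurable_EFinP.
under eq_fun do rewrite -enorm_eq0.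
by apply: measurable_fun_eqr => //; exact: measurable_enorm.
Qed.

Let mg x : measurable_fun [set: T] (fun t => g (x - Y t)).
Proof. by apply: (measurableT_comp measurable_rker_bounded); exact: measurable_rVB. Qed.

Let ig x : nu.-integrable [set: T] (fun t => g (x - Y t)).
Proof.
apply/integrableP; split; first exact: mg.
have [L L0 HL] := rker_pot_bound a0 ab.
apply: (@le_lt_trans _ _ (\int[nu]_t (K%:E * rker a (x - Y t)))%E).
  apply: ge0_le_integral => //.
  - by apply: (measurableT_comp _ (mg x)); exact: abse_measurable.
  - by apply: emeasurable_funM.
  rewrite ge0_integralZl//; last by move=> t _; exact: rker_ge0.
apply: (@le_lt_trans _ _ (K%:E * L%:E)%E); last by rewrite -EFinM ltry.
by apply: lee_wpmul2l.
Qed.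

Lemma image_potential_bounded : exists L : R, forall x, (`|\int[nu]_t g (x - Y t)| <= L%:E)%E.
Proof.
have [L L0 HL] := rker_pot_bound a0 ab; exists (K * L) => x.
apply: (le_trans (le_abse_integral _ measurableT (mg x))).
apply: (@le_trans _ _ (\int[nu]_t (K%:E * rker a (x - Y t)))%E).
  apply: ge0_le_integral => //.
  - by apply: (measurableT_comp _ (mg x)); exact: abse_measurable.
  - by apply: emeasurable_funM.
rewrite ge0_integralZl//; last by move=> t _; exact: rker_ge0.
by rewrite EFinM; apply: lee_wpmul2l.
Qed.

Lemma image_potential_continuous :
  (forall x : 'rV[R]_n, (\int[nu]_t g (x - Y t))%E \is a fin_num) /\
  continuous (fun x : 'rV[R]_n => fine (\int[nu]_t g (x - Y t))%E).
Proof.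
have fn x : (\int[nu]_t g (x - Y t))%E \is a fin_num by apply: integrable_fin_num.
split=> // x; apply/(@cvgrPdist_le _ _ _ _ (nbhs_filter x)) => e e0.
have [|J HJ] := @rker_pot_small a (e / 3 / (K + 1)) a0 ab; first by rewrite !divr_gt0// ltr_wpDl.
have near_trunc y : `|fine (\int[nu]_t g (y - Y t))%E - \int[nu]_t trunc J (y - Y t)| <= e / 3.
  have mt : measurable_fun [set: T] (fun t => trunc J (y - Y t)).
    by apply: measurable_shifted => //; apply: continuous_measurable_rV; exact: continuous_trunc.
  have it := bounded_integrable nu mt (fun t => trunc_le J _).
  have fi : (\int[nu]_t (trunc J (y - Y t))%:E)%E \is a fin_num by apply: integrable_fin_num.
  rewrite /Rintegral -fineB// -integralB// -lee_fin -abse_EFin fineK; last first.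
    by apply: integrable_fin_num => //; exact: integrableB.
  apply: (le_trans (le_abse_integral _ measurableT _)).
    by apply: emeasurable_funB => //; exact/measurable_EFinP.
  have mr : measurable_fun [set: T] (fun t => ((\1_(cball y (2^-1 ^+ J)) (Y t))%:E * rker a (y - Y t))%E).
    apply: emeasurable_funM => //; apply/measurable_EFinP.
    apply: (measurableT_comp _ mY); apply: measurable_indic; exact: measurable_cball.
  apply: (@le_trans _ _ (\int[nu]_t (K%:E * ((\1_(cball y (2^-1 ^+ J)) (Y t))%:E * rker a (y - Y t))))%E).
    apply: ge0_le_integral => //.
    - apply: (measurableT_comp (@abse_measurable _ _)); apply: emeasurable_funB => //.
      exact/measurable_EFinP.
    - exact: emeasurable_funM.
  rewrite ge0_integralZl//; last by move=> t _; rewrite mule_ge0 ?lee_fin ?rker_ge0.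
  apply: (le_trans (lee_wpmul2l _ (HJ y))); first by rewrite lee_fin.
  have e30 : 0 < e / 3 by rewrite divr_gt0.
  rewrite -EFinM lee_fin mulrA ler_pdivrMr ?ltr_wpDl//.
  by rewrite mulrC ler_wpM2l ?(ltW e30)// lerDl.
have cF := @continuous_Rintegral _ T R nu n Y mY (trunc J) _ (@continuous_trunc J) (trunc_le J) x.
have e3 : 0 < e / 3 by rewrite divr_gt0.
have hF := (@cvgrPdist_le _ _ _ _ (nbhs_filter x) _ _).1 cF (e / 3) e3.
apply: filterS hF => y h3.
have h1 := near_trunc x; have h2 := near_trunc y.
move: h1 h2 h3; move: (fine _) (fine _) (\int[nu]_t _) (\int[nu]_t _) => u v u' v' h1 h2 h3.
have -> : v - u = (v - v') + (v' - u') - (u - u') by ring.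
apply: (le_trans (ler_normB _ _)); apply: (le_trans (lerD (ler_normD _ _) (lexx _))).
by move: h1 h2 h3; lra.
Qed.

End bounded_by_rker.

End image_potential.

(** * The Bessel kernel *)

Section density_measure.
Context d (T : measurableType d) (R : realType) (mu : {measure set T -> \bar R}) (g : T -> R).
Hypothesis g0 : forall x, 0 <= g x.
Hypothesis intg : mu.-integrable [set: T] (EFin \o g).
Local Open Scope ereal_scope.

Definition dens of (forall x, (0 <= g x)%R) & mu.-integrable [set: T] (EFin \o g) :=
  fun A : set T => \int[mu]_(x in A) (g x)%:E.

Let nu := dens g0 intg.

Let nu0 : nu set0 = 0. Proof. by rewrite /nu /dens integral_set0. Qed.

Let nu_ge0 A : 0 <= nu A.
Proof. by apply: integral_ge0 => x _; rewrite lee_fin. Qed.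

Let mg : measurable_fun [set: T] g.
Proof. by apply/measurable_EFinP; exact: measurable_int intg. Qed.

Let nu_semi_sigma_additive : semi_sigma_additive nu.
Proof.
move=> F mF tF mUF; rewrite /nu /dens ge0_integral_bigcup//; last 2 first.
- by apply/measurable_EFinP; exact: measurable_funTS mg.
- by move=> x _; rewrite lee_fin.
by apply: is_cvg_ereal_nneg_natsum_cond => n _ _; apply: nu_ge0.
Qed.

HB.instance Definition _ := isMeasure.Build _ _ _ (dens g0 intg) nu0 nu_ge0 nu_semi_sigma_additive.

Let nu_fin : fin_num_fun nu.
Proof.
move=> A mA; rewrite ge0_fin_numE; last exact: nu_ge0.
have /integrableP[_] := intg; apply: le_lt_trans.
have -> : \int[mu]_x `|(EFin \o g) x| = \int[mu]_x (g x)%:E.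
  by apply: eq_integral => x _ /=; rewrite ger0_norm.
apply: ge0_subset_integral; [exact: mA|exact: measurableT| | |by []].
  by apply/measurable_EFinP; exact: mg.
by move=> x _; rewrite lee_fin.
Qed.

HB.instance Definition _ := @Measure_isFinite.Build _ _ _ (dens g0 intg) nu_fin.

End density_measure.

Section gaussian_mean.
Context (R : realType).
Notation ga := (@normal_prob R 0 1).

Fixpoint gmean n : ('rV[R]_n -> R) -> R :=
  match n return ('rV[R]_n -> R) -> R with
  | 0%N => fun f => f 0
  | m.+1 => fun f => \int[ga]_u gmean (fun v => f (cons_rV (u, v)))
  end.

Lemma eq_gmean n (f h : 'rV[R]_n -> R) : f =1 h -> gmean f = gmean h.
Proof. by move=> /funext ->. Qed.

Lemma measurable_cons2 n d (W : measurableType d) :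
  measurable_fun [set: (W * R) * 'rV[R]_n] (fun z : (W * R) * 'rV[R]_n => (z.1.1, cons_rV (z.1.2, z.2))).
Proof.
apply: measurable_fun_pair; first exact: (measurableT_comp measurable_fst measurable_fst).
apply: (measurableT_comp (@measurable_cons_rV R n)); apply: measurable_fun_pair => //.
exact: (measurableT_comp measurable_snd measurable_fst).
Qed.

Lemma gmean_measurable n d (W : measurableType d) (F : W * 'rV[R]_n -> R) (M : R) :
  measurable_fun [set: W * 'rV[R]_n] F -> (forall z, `|F z| <= M) ->
  measurable_fun [set: W] (fun w => gmean (fun v => F (w, v))) /\
  forall w, `|gmean (fun v => F (w, v))| <= M.
Proof.
elim: n d W F => [|n IH] d W F mF FM /=.
  by split=> //; apply: (measurableT_comp mF); exact: measurable_pair2.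
have [|z|mG GM] := IH _ _ (fun z : (W * R) * 'rV[R]_n => F (z.1.1, cons_rV (z.1.2, z.2))).
- exact: (measurableT_comp mF (@measurable_cons2 n d W)).
- exact: FM.
split.
  exact: (@measurable_Rintegral2 _ _ _ _ R (@dirac _ W point R) ga _ M mG GM).
move=> w; apply: (@normr_Rintegral_prob_le _ _ _ ga) => [|u]; last exact: (GM (w, u)).
exact: (measurableT_comp mG (pair1_measurable w)).
Qed.

Lemma gmean_Fubini n d (W : measurableType d) (nu : {finite_measure set W -> \bar R})
    (F : W * 'rV[R]_n -> R) (M : R) :
  measurable_fun [set: W * 'rV[R]_n] F -> (forall z, `|F z| <= M) ->
  \int[nu]_w gmean (fun v => F (w, v)) = gmean (fun v => \int[nu]_w F (w, v)).
Proof.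
elim: n F => [//|n IH] F mF FM /=.
have mF' := measurableT_comp mF (@measurable_cons2 n d W).
have [mG GM] := gmean_measurable mF' (fun z => FM _).
rewrite (bounded_Fubini nu ga mG GM); apply: eq_Rintegral => u _ /=.
apply: (IH (fun z => F (z.1, cons_rV (u, z.2)))) => //.
apply: (measurableT_comp mF); apply: measurable_fun_pair => //.
by apply: (measurableT_comp (@measurable_cons_rV R n)); apply: measurable_fun_pair.
Qed.

Lemma gmean_sub n (f h : 'rV[R]_n -> R) (M : R) :
  measurable_fun [set: 'rV[R]_n] f -> measurable_fun [set: 'rV[R]_n] h ->
  (forall z, `|f z| <= M) -> (forall z, `|h z| <= M) ->
  gmean (fun v => f v - h v) = gmean f - gmean h.
Proof.
elim: n f h => [//|n IH] f h mf mh fM hM /=.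
have mf' : measurable_fun [set: R * 'rV[R]_n] (f \o @cons_rV R n) by exact: (measurableT_comp mf (@measurable_cons_rV R n)).
have mh' : measurable_fun [set: R * 'rV[R]_n] (h \o @cons_rV R n) by exact: (measurableT_comp mh (@measurable_cons_rV R n)).
have [m1 M1] := gmean_measurable mf' (fun z => fM _).
have [m2 M2] := gmean_measurable mh' (fun z => hM _).
rewrite -RintegralB//; [|exact: (bounded_integrable ga m1 M1)|exact: (bounded_integrable ga m2 M2)].
apply: eq_Rintegral => u _; apply: IH => //.
  by apply: (measurableT_comp mf'); exact: measurable_pair1.
by apply: (measurableT_comp mh'); exact: measurable_pair1.
Qed.

Lemma gmean_scale n (f : 'rV[R]_n -> R) (c M : R) :
  measurable_fun [set: 'rV[R]_n] f -> (forall z, `|f z| <= M) ->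
  gmean (fun v => c * f v) = c * gmean f.
Proof.
elim: n f => [//|n IH] f mf fM /=.
have mf' : measurable_fun [set: R * 'rV[R]_n] (f \o @cons_rV R n) by exact: (measurableT_comp mf (@measurable_cons_rV R n)).
have [m1 M1] := gmean_measurable mf' (fun z => fM _).
rewrite -RintegralZl//; last exact: (bounded_integrable ga m1 M1).
apply: eq_Rintegral => u _; apply: IH => //.
by apply: (measurableT_comp mf'); exact: measurable_pair1.
Qed.

Lemma dot_cons n x (v : 'rV[R]_n) (z : 'rV[R]_n.+1) :
  dot (cons_rV (x, v)) z = x * z ord0 ord0 + dot v (\row_i z ord0 (lift ord0 i)).
Proof.
rewrite /dot big_ord_recl cons_rV0; congr (_ + _); apply: eq_bigr => i _.
by rewrite cons_rVS mxE.
Qed.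

Lemma dot_cons_self n x (v : 'rV[R]_n) : dot (cons_rV (x, v)) (cons_rV (x, v)) = x ^+ 2 + dot v v.
Proof.
rewrite /dot big_ord_recl cons_rV0 expr2; congr (_ + _); apply: eq_bigr => i _.
by rewrite cons_rVS.
Qed.

Lemma gmean_cos n (s tau kappa : R) (z : 'rV[R]_n) : 0 <= s ->
  gmean (fun v => expR (- (s * dot v v)) * cos (tau * dot v z + kappa)) =
  cos kappa * \prod_i ((Num.sqrt (1 + 2 * s))^-1 * psi (tau * z ord0 i / Num.sqrt (1 + 2 * s))).
Proof.
move=> s0; elim: n z kappa => [|n IH] z kappa /=.
  by rewrite big_ord0 mulr1 /dot !big_ord0 !mulr0 oppr0 expR0 mul1r add0r.
have E u : gmean (fun v : 'rV[R]_n => expR (- (s * dot (cons_rV (u, v)) (cons_rV (u, v)))) *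
     cos (tau * dot (cons_rV (u, v)) z + kappa)) =
   gauss s u * cos (kappa + u * (tau * z ord0 ord0)) *
   \prod_i ((Num.sqrt (1 + 2 * s))^-1 * psi (tau * z ord0 (lift ord0 i) / Num.sqrt (1 + 2 * s))).
  have := IH (\row_i z ord0 (lift ord0 i)) (kappa + u * (tau * z ord0 ord0)).
  under [X in _ = _ * X -> _]eq_bigr do rewrite mxE.
  rewrite -mulrA => <-; rewrite -(@gmean_scale _ _ _ 1).
  - apply: eq_gmean => v; rewrite dot_cons_self dot_cons mulrDr opprD expRD -!mulrA; congr (_ * (_ * cos _)).
    by ring.
  - apply: measurable_funM.
      apply: measurableT_comp => //; apply: measurableT_comp => //; apply: measurable_funM => //.
      by apply: measurable_dot.
    apply: measurableT_comp; first by apply: continuous_measurable_fun; exact: continuous_cos.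
    by apply: measurable_funD => //; apply: measurable_funM => //; exact: measurable_dot.
  - move=> v; rewrite normrM mulr_ile1 ?cos_max// ger0_norm ?expR_ge0//.
    by rewrite -expR0 ler_expR oppr_le0 mulr_ge0// dot_ge0.
under eq_Rintegral do rewrite E mulrC.
have mw := @measurable_gauss R s.
have w1 u : `|gauss s u| <= 1.
  by rewrite ger0_norm ?gauss_ge0// /gauss -expR0 ler_expR oppr_le0 mulr_ge0// sqr_ge0.
have we u : gauss s (- u) = gauss s u by rewrite /gauss sqrrN.
rewrite RintegralZl//; last first.
  apply: (@bounded_integrable _ _ _ ga _ 1).
    apply: measurable_funM => //; apply: measurableT_comp.
      by apply: continuous_measurable_fun; exact: continuous_cos.
    by apply: measurable_funD => //; exact: measurable_funM.
  by move=> u; rewrite normrM mulr_ile1// cos_max.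
rewrite -(cos_charw mw w1 we) charw_gauss// big_ord_recl mulrC -!mulrA; congr (_ * _).
Qed.

End gaussian_mean.

Section gamma_density.
Context (R : realType).
Notation mu := (@lebesgue_measure R).

Definition gden (c v : R) := expR (c * v - expR v).

Lemma gden_ge0 c v : 0 <= gden c v. Proof. exact: expR_ge0. Qed.

Lemma measurable_gden c : measurable_fun [set: R] (gden c).
Proof. by apply: measurableT_comp => //; apply: measurable_funB => //; apply: measurable_funM. Qed.

Lemma integrable_gden c : 0 < c -> mu.-integrable [set: R] (EFin \o gden c).
Proof.
move=> c0; pose K := 1 + expR (- (2 * c * (1 - ln (2 * c)))).
have K0 : 0 <= K by rewrite addr_ge0// expR_ge0.
apply: (le_integrable measurableT _ _ (integrableZl measurableT K (integrable_expR_abs c0))).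
  by apply/measurable_EFinP; exact: measurable_gden.
move=> v _; rewrite -EFinM !abse_EFin lee_fin (ger0_norm (gden_ge0 _ _)) (ger0_norm (mulr_ge0 K0 (expR_ge0 _))).
rewrite /gden; have [v0|v0] := leP v 0.
  rewrite ler0_norm// mulrN opprK; apply: (@le_trans _ _ (expR (c * v))).
    by rewrite ler_expR gerBl expR_ge0.
  by rewrite ler_peMl ?expR_ge0// lerDl expR_ge0.
rewrite gtr0_norm//; have c20 : 0 < 2 * c by rewrite mulr_gt0.
have h : (1 + (v - ln (2 * c))) * (2 * c) <= expR v.
  rewrite -ler_pdivlMr//; have := expR_ge1Dx (v - ln (2 * c)).
  by rewrite expRB lnK// posrE.
apply: (@le_trans _ _ (expR (- (2 * c * (1 - ln (2 * c)))) * expR (- (c * v)))).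
  rewrite -expRD ler_expR; move: h; move: (ln _) (expR v) => L E; lra.
by rewrite ler_wpM2r ?expR_ge0// lerDr.
Qed.

Definition gmass c := \int[mu]_v gden c v.

Lemma gmass_EFin c : 0 < c -> (\int[mu]_v (gden c v)%:E)%E = (gmass c)%:E.
Proof. by move=> c0; rewrite /gmass /Rintegral fineK//; apply: integrable_fin_num => //; exact: integrable_gden. Qed.

Lemma gmass_gt0 c : 0 < c -> 0 < gmass c.
Proof.
move=> c0; rewrite -lte_fin -gmass_EFin//; have e0 := expR_gt0 (- expR 1 : R).
have mi : measurable_fun [set: R] (fun v : R => (\1_(`[0, 1]%classic : set R) v : R)%:E).
  by apply/measurable_EFinP; apply: measurable_indic.
apply: (@lt_le_trans _ _ (\int[mu]_v ((expR (- expR 1))%:E * (\1_(`[0, 1]%classic : set R) v : R)%:E))%E).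
  rewrite ge0_integralZl// ?lee_fin ?expR_ge0//.
  rewrite integral_indic// setIT [X in (_ < _ * X)%E](lebesgue_measure_itv `[0, 1])/=.
  by rewrite lte_fin ltr01 oppr0 adde0 mule1 lte_fin.
apply: ge0_le_integral => //.
- by apply: emeasurable_funM.
- by apply/measurable_EFinP; exact: measurable_gden.
move=> v _; rewrite -EFinM lee_fin indicE; case: (boolP (_ \in _)) => [|_]; last by rewrite mulr0 gden_ge0.
rewrite inE/= in_itv/= => /andP[v0 v1]; rewrite mulr1 /gden ler_expR.
by rewrite ler_wpDl ?mulr_ge0 ?(ltW c0)// lerN2 ler_expR.
Qed.

Section measure.
Variables (c : R) (c0 : 0 < c).

Definition gmeas := @dens _ _ R mu (gden c) (gden_ge0 c) (integrable_gden c0).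

HB.instance Definition _ := Measure.on gmeas.
HB.instance Definition _ := FiniteMeasure.on gmeas.

Lemma integral_gmeas (f : R -> \bar R) : measurable_fun [set: R] f ->
  (\int[gmeas]_v f v = \int[mu]_v (f v * (gden c v)%:E))%E.
Proof.
move=> mf; apply: (@integral_density _ _ R mu gmeas (gden c) (measurable_gden c) (gden_ge0 c)) => //.
Qed.

Lemma measurable_expRM (s : R) : measurable_fun [set: R] (fun v => expR (- (expR v * s))).
Proof. by apply: measurableT_comp => //; apply: measurableT_comp => //; apply: measurable_funM. Qed.

Lemma gmeas_laplace s : 0 <= s ->
  \int[gmeas]_v expR (- (expR v * s)) = (1 + s) `^ (- c) * gmass c.
Proof.
move=> s0; have s10 : 0 < 1 + s by rewrite ltr_wpDr.
rewrite /Rintegral integral_gmeas; last by apply/measurable_EFinP; exact: measurable_expRM.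
rewrite -(integral_shift (- ln (1 + s))); last first.
  by apply/measurable_EFinP; apply: measurable_funM; [exact: measurable_expRM|exact: measurable_gden].
rewrite (_ : (fun x : R => _) = (fun x => ((1 + s) `^ (- c))%:E * (gden c x)%:E)%E); last first.
  apply/funext => x; rewrite -!EFinM; congr EFin.
  have -> : expR (x - ln (1 + s)) = expR x / (1 + s) by rewrite expRB lnK.
  rewrite /gden expRB lnK// -expRD /powR (gt_eqF s10) -expRD; congr expR.
  by field; rewrite gt_eqF.
rewrite ge0_integralZl//; last 3 first.
- by apply/measurable_EFinP; exact: measurable_gden.
- by move=> v _; rewrite lee_fin gden_ge0.
- by rewrite lee_fin powR_ge0.
by rewrite gmass_EFin.
Qed.

Lemma gmeas_moment e : 0 < c - e ->
  (\int[gmeas]_v (expR (- (e * v)))%:E = (gmass (c - e))%:E)%E.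
Proof.
move=> e0; rewrite integral_gmeas; last first.
  by apply/measurable_EFinP; apply: measurableT_comp => //; apply: measurableT_comp => //; apply: measurable_funM.
rewrite -gmass_EFin//; apply: eq_integral => v _; rewrite -EFinM /gden -expRD; congr (expR _)%:E; ring.
Qed.

End measure.
End gamma_density.

Section heat.
Context (R : realType).

Definition heat n (tau : R) (x : 'rV[R]_n) := expR (- (tau ^+ 2 * dot x x / 2)).

Lemma heat_ge0 n tau (x : 'rV[R]_n) : 0 <= heat tau x. Proof. exact: expR_ge0. Qed.

Lemma heat_le1 n tau (x : 'rV[R]_n) : heat tau x <= 1.
Proof. by rewrite -expR0 ler_expR oppr_le0 divr_ge0// mulr_ge0 ?sqr_ge0 ?dot_ge0. Qed.

Lemma heat_prod n tau (x : 'rV[R]_n) : \prod_i psi (tau * x ord0 i) = heat tau x.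
Proof.
rewrite /psi /heat -(big_morph expR (@expRD R) (@expR0 R)) sumrN; congr (expR (- _)).
rewrite /dot mulr_sumr mulr_suml; apply: eq_bigr => i _; by rewrite exprMn expr2.
Qed.

Lemma gmean_heat n tau (x : 'rV[R]_n) : gmean (fun u => cos (tau * dot u x)) = heat tau x.
Proof.
have := gmean_cos tau 0 x (lexx 0); rewrite cos0 mul1r mulr0 addr0 sqrtr1 invr1 => h.
rewrite -heat_prod; transitivity (\prod_i (1 * psi (tau * x ord0 i / 1))); last first.
  by apply: eq_bigr => i _; rewrite mul1r divr1.
rewrite invr1 in h *; rewrite -h; apply: eq_gmean => u; by rewrite mul0r oppr0 expR0 mul1r addr0.
Qed.

Lemma measurable_heat n tau d (T : measurableType d) (f : T -> 'rV[R]_n) :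
  measurable_fun [set: T] f -> measurable_fun [set: T] (fun t => heat tau (f t)).
Proof.
move=> mf; rewrite (_ : (fun t => _) = (fun t => expR (- (tau ^+ 2 / 2) * dot (f t) (f t)))); last first.
  by apply/funext => t; rewrite /heat; congr expR; ring.
apply: (measurableT_comp (@measurable_expR R)).
by apply: measurable_funM => //; exact: measurable_dot.
Qed.

Lemma heat_integral n tau : 0 < tau ->
  (\int[lebesgue_rV n]_x (heat tau x)%:E = ((Num.sqrt (2 * pi) / tau) ^+ n)%:E)%E.
Proof.
move=> t0; elim: n => [|n IH].
  rewrite /= integral_dirac//; last by apply/measurable_EFinP; exact: measurable_heat.
  by rewrite diracE mem_set// mul1e expr0 /heat /dot big_ord0 mulr0 mul0r oppr0 expR0.
have a0 : 0 < tau ^+ 2 / 2 by rewrite divr_gt0// exprn_gt0.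
rewrite ge0_integral_lebesgue_rVS; last 2 first.
- by apply/measurable_EFinP; exact: measurable_heat.
- by move=> x; rewrite lee_fin heat_ge0.
have E x : (\int[lebesgue_rV n]_v (heat tau (cons_rV (x, v)))%:E =
    ((Num.sqrt (2 * pi) / tau) ^+ n)%:E * (gauss (tau ^+ 2 / 2) x)%:E)%E.
  rewrite -IH muleC -ge0_integralZl//; last 3 first.
  - by apply/measurable_EFinP; exact: measurable_heat.
  - by move=> v _; rewrite lee_fin heat_ge0.
  - by rewrite lee_fin gauss_ge0.
  apply: eq_integral => v _; rewrite -EFinM /heat dot_cons_self /gauss -expRD; congr (expR _)%:E; ring.
under eq_integral do rewrite E.
rewrite ge0_integralZl//; last 3 first.
- by apply/measurable_EFinP; exact: measurable_gauss.
- by move=> v _; rewrite lee_fin gauss_ge0.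
- by rewrite lee_fin exprn_ge0// divr_ge0 ?sqrtr_ge0 ?(ltW t0).
have -> : (\int[lebesgue_measure]_x (gauss (tau ^+ 2 / 2) x)%:E = (Num.sqrt (2 * pi) / tau)%:E)%E.
  rewrite -[LHS]fineK; last by apply: integrable_fin_num => //; exact: integrable_gauss.
  rewrite -/(Rintegral _ _ _) Rintegral_gauss//; congr EFin.
  have -> : pi / (tau ^+ 2 / 2) = 2 * pi / tau ^+ 2 :> R by field; rewrite gt_eqF.
  by rewrite sqrtrM ?mulr_ge0 ?pi_ge0// sqrtrV ?sqr_ge0// sqrtr_sqr gtr0_norm.
by rewrite -EFinM exprSr.
Qed.

End heat.

Section signed_density.
Context (R : realType) (n : nat) (g : 'rV[R]_n -> \bar R).
Notation la := (@lebesgue_rV R n).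
Hypothesis intg : la.-integrable [set: 'rV[R]_n] g.

Definition ppart (y : 'rV[R]_n) := Num.max 0 (fine (g y)).
Definition npart (y : 'rV[R]_n) := Num.max 0 (- fine (g y)).

Lemma ppart_ge0 y : 0 <= ppart y. Proof. by rewrite /ppart le_max lexx. Qed.
Lemma npart_ge0 y : 0 <= npart y. Proof. by rewrite /npart le_max lexx. Qed.

Lemma ppartB y : ppart y - npart y = fine (g y).
Proof.
rewrite /ppart /npart; have [f0|f0] := leP 0 (fine (g y)).
  by rewrite (max_idPl _) ?subr0// oppr_le0.
by rewrite (max_idPr _) ?opprK ?add0r// oppr_ge0 ltW.
Qed.

Lemma ppartD y : ppart y + npart y = `|fine (g y)|.
Proof.
rewrite /ppart /npart; have [f0|f0] := leP 0 (fine (g y)).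
  by rewrite (max_idPl _) ?addr0 ?ger0_norm// oppr_le0.
by rewrite (max_idPr _) ?add0r ?ltr0_norm// oppr_ge0 ltW.
Qed.

Let mG : measurable_fun [set: 'rV[R]_n] (fun y => fine (g y)).
Proof. by apply: (measurableT_comp _ (measurable_int _ intg)); exact: fine_measurable. Qed.

Lemma measurable_ppart : measurable_fun [set: 'rV[R]_n] ppart.
Proof.
apply: (@measurable_maxr _ _ _ _ (cst 0) (fun y => fine (g y))) => //.
Qed.

Lemma measurable_npart : measurable_fun [set: 'rV[R]_n] npart.
Proof.
apply: (@measurable_maxr _ _ _ _ (cst 0) (fun y => - fine (g y))) => //.
by apply: measurable_funN.
Qed.

Lemma integrable_parts (f : 'rV[R]_n -> R) : measurable_fun [set: 'rV[R]_n] f ->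
  (forall y, `|f y| <= `|fine (g y)|) -> la.-integrable [set: 'rV[R]_n] (EFin \o f).
Proof.
move=> mf fg; apply: (le_integrable measurableT _ _ intg); first exact/measurable_EFinP.
move=> y _ /=; apply: (@le_trans _ _ (`|fine (g y)|)%:E); first by rewrite lee_fin.
by case: (g y) => [r| |] /=; rewrite ?normr0 ?lexx ?leey.
Qed.

Lemma integrable_ppart : la.-integrable [set: 'rV[R]_n] (EFin \o ppart).
Proof.
apply: integrable_parts => [|y]; first exact: measurable_ppart.
by rewrite -ppartD ger0_norm ?ppart_ge0// lerDl npart_ge0.
Qed.

Lemma integrable_npart : la.-integrable [set: 'rV[R]_n] (EFin \o npart).
Proof.
apply: integrable_parts => [|y]; first exact: measurable_npart.
by rewrite -ppartD ger0_norm ?npart_ge0// lerDr ppart_ge0.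
Qed.

Definition mup := @dens _ _ R la ppart ppart_ge0 integrable_ppart.
HB.instance Definition _ := Measure.on mup.
HB.instance Definition _ := FiniteMeasure.on mup.

Definition mun := @dens _ _ R la npart npart_ge0 integrable_npart.
HB.instance Definition _ := Measure.on mun.
HB.instance Definition _ := FiniteMeasure.on mun.

Lemma integral_mup (f : 'rV[R]_n -> \bar R) : measurable_fun [set: 'rV[R]_n] f ->
  (\int[mup]_y f y = \int[la]_y (f y * (ppart y)%:E))%E.
Proof.
by move=> mf; apply: (@integral_density _ _ R la mup ppart measurable_ppart ppart_ge0).
Qed.

Lemma integral_mun (f : 'rV[R]_n -> \bar R) : measurable_fun [set: 'rV[R]_n] f ->
  (\int[mun]_y f y = \int[la]_y (f y * (npart y)%:E))%E.
Proof.
by move=> mf; apply: (@integral_density _ _ R la mun npart measurable_npart npart_ge0).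
Qed.

(* The integral of f against the signed density g, which may be infinite on a null set. *)
Definition sint (f : 'rV[R]_n -> R) := \int[mup]_y f y - \int[mun]_y f y.

Lemma sintE (f : 'rV[R]_n -> R) (M : R) : measurable_fun [set: 'rV[R]_n] f -> (forall y, `|f y| <= M) ->
  sint f = fine (\int[la]_y ((f y)%:E * g y))%E.
Proof.
move=> mf fM; have M0 : 0 <= M by exact: le_trans (fM 0).
have i (h : 'rV[R]_n -> R) : measurable_fun [set: 'rV[R]_n] h -> (forall y, 0 <= h y) ->
    la.-integrable [set: 'rV[R]_n] (EFin \o h) ->
    la.-integrable [set: 'rV[R]_n] (fun y => ((f y)%:E * (h y)%:E)%E).
  move=> mh h0 ih; apply: (le_integrable measurableT _ _ (integrableZl measurableT M ih)).
    by apply: emeasurable_funM; exact/measurable_EFinP.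
  move=> y _; rewrite -[(EFin \o h) y]/((h y)%:E) -!EFinM !abse_EFin lee_fin !normrM ler_wpM2r//.
  by rewrite (ger0_norm M0).
have ip := i _ measurable_ppart ppart_ge0 integrable_ppart.
have im := i _ measurable_npart npart_ge0 integrable_npart.
rewrite /sint /Rintegral integral_mup; last exact/measurable_EFinP.
rewrite integral_mun; last exact/measurable_EFinP.
rewrite -fineB; [|by apply: integrable_fin_num|by apply: integrable_fin_num].
rewrite -integralB//; congr fine; apply: ae_eq_integral => //.
- by apply: emeasurable_funB; apply: (measurable_int la).
- by apply: emeasurable_funM; [exact/measurable_EFinP|exact: measurable_int intg].
have := integrable_ae measurableT intg; apply: filterS => y h _ /=.
by rewrite -!EFinM -EFinB -mulrBr ppartB EFinM fineK// h.
Qed.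

Lemma sint_lin (f h : 'rV[R]_n -> R) (a b M : R) :
  measurable_fun [set: 'rV[R]_n] f -> measurable_fun [set: 'rV[R]_n] h ->
  (forall y, `|f y| <= M) -> (forall y, `|h y| <= M) ->
  sint (fun y => a * f y + b * h y) = a * sint f + b * sint h.
Proof.
move=> mf mh fM hM.
have E (nu : {finite_measure set 'rV[R]_n -> \bar R}) :
    \int[nu]_y (a * f y + b * h y) = a * \int[nu]_y f y + b * \int[nu]_y h y.
  have i1 := bounded_integrable nu mf fM; have i2 := bounded_integrable nu mh hM.
  rewrite RintegralD//; last 2 first.
  - by apply: eq_integrable (integrableZl measurableT a i1).
  - by apply: eq_integrable (integrableZl measurableT b i2).
  by congr (_ + _); [exact: (@RintegralZl _ _ _ nu setT f a measurableT i1)|exact: (@RintegralZl _ _ _ nu setT h b measurableT i2)].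
have gen (p q r s : R) : a * p + b * q - (a * r + b * s) = a * (p - r) + b * (q - s) by ring.
by rewrite /sint !E; exact: gen.
Qed.

Lemma sint_gmean m (F : 'rV[R]_n * 'rV[R]_m -> R) (M : R) :
  measurable_fun [set: 'rV[R]_n * 'rV[R]_m] F -> (forall z, `|F z| <= M) ->
  sint (fun y => gmean (fun v => F (y, v))) = gmean (fun v => sint (fun y => F (y, v))).
Proof.
move=> mF FM; have M0 : 0 <= M by exact: le_trans (FM (0, 0)).
rewrite /sint (gmean_Fubini _ mF FM) (gmean_Fubini _ mF FM).
have mm (nu : {finite_measure set 'rV[R]_n -> \bar R}) :
    measurable_fun [set: 'rV[R]_m] (fun v => \int[nu]_y F (y, v)).
  exact: (@measurable_Rintegral1 _ _ _ _ R nu (@dirac _ 'rV[R]_m 0 R) _ M mF FM).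
have b (nu : {finite_measure set 'rV[R]_n -> \bar R}) v : `|\int[nu]_y F (y, v)| <= M * fine (nu setT).
  apply: normr_Rintegral_le => [|y]; last exact: FM.
  by apply: (measurableT_comp mF); exact: pair2_measurable.
rewrite -(@gmean_sub _ _ _ _ (M * fine (mup setT) + M * fine (mun setT)))// => v.
  by apply: (le_trans (b mup v)); rewrite lerDl mulr_ge0// fine_ge0.
by apply: (le_trans (b mun v)); rewrite lerDr mulr_ge0// fine_ge0.
Qed.

End signed_density.

Section bessel_heat.
Context (R : realType) (n : nat) (alpha : R) (g : 'rV[R]_n -> \bar R).
Notation la := (@lebesgue_rV R n).
Hypothesis a0 : 0 < alpha.
Hypothesis bg : is_bessel_kernel alpha g.
Hypothesis intg : la.-integrable [set: 'rV[R]_n] g.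

Let mcosdot (xi : 'rV[R]_n) : measurable_fun [set: 'rV[R]_n] (fun y : 'rV[R]_n => cos (dot y xi)).
Proof.
apply: measurableT_comp; first by apply: continuous_measurable_fun; exact: continuous_cos.
exact: measurable_dot.
Qed.

Let msindot (xi : 'rV[R]_n) : measurable_fun [set: 'rV[R]_n] (fun y : 'rV[R]_n => sin (dot y xi)).
Proof.
apply: measurableT_comp; first by apply: continuous_measurable_fun; exact: continuous_sin.
exact: measurable_dot.
Qed.

Let sint_cos xi : sint intg (fun y => cos (dot y xi)) = (1 + dot xi xi) `^ (- (alpha / 2)).
Proof.
rewrite (@sintE _ _ _ intg _ 1)//; last by move=> y; rewrite cos_max.
by have [_ _ /(_ xi)] := bg; rewrite /fourier enorm_sqr => -[].
Qed.

Let sint_sin xi : sint intg (fun y => sin (dot y xi)) = 0.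
Proof.
rewrite (@sintE _ _ _ intg _ 1)//; last by move=> y; rewrite sin_max.
by have [_ _ /(_ xi)] := bg; rewrite /fourier enorm_sqr => -[].
Qed.

Let c0 : 0 < alpha / 2. Proof. by rewrite divr_gt0. Qed.

Let gm := gmeas c0.

Definition rres (tau v : R) := (Num.sqrt (1 + 2 * (expR v * tau ^+ 2)))^-1.

Let rden_ge1 (tau v : R) : 1 <= 1 + 2 * (expR v * tau ^+ 2).
Proof. by rewrite lerDl mulr_ge0//; exact: (mulr_ge0 (expR_ge0 _) (sqr_ge0 _)). Qed.

Let rden_gt0 (tau v : R) : 0 < 1 + 2 * (expR v * tau ^+ 2).
Proof. exact: lt_le_trans (rden_ge1 _ _). Qed.

(* (1 + |xi|^2)^(-alpha/2) is the Laplace transform of a Gamma law in the variable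
   e^v, so the left-hand side is a mixture of Gaussian functions of z. *)
Lemma sint_heat tau (z : 'rV[R]_n) : sint intg (fun y => heat tau (z - y)) =
  (gmass (alpha / 2))^-1 * \int[gm]_v (rres tau v ^+ n * heat (tau * rres tau v) z).
Proof.
have J0 := gmass_gt0 c0; have Jn0 : gmass (alpha / 2) != 0 by rewrite gt_eqF.
transitivity (sint intg (fun y => gmean (fun u => cos (tau * dot u (z - y))))).
  by congr sint; apply/funext => y; rewrite gmean_heat.
have mF : measurable_fun [set: 'rV[R]_n * 'rV[R]_n] (fun p : 'rV[R]_n * 'rV[R]_n => cos (tau * dot p.2 (z - p.1))).
  apply: measurableT_comp; first by apply: continuous_measurable_fun; exact: continuous_cos.
  apply: measurable_funM => //; apply: measurable_dot => //; exact: measurable_rVB.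
rewrite (sint_gmean intg mF (M := 1)); last by move=> p; rewrite cos_max.
pose F (p : R * 'rV[R]_n) := expR (- (expR p.1 * (tau ^+ 2 * dot p.2 p.2))) * cos (tau * dot p.2 z + 0).
have mF2 : measurable_fun [set: R * 'rV[R]_n] F.
  apply: measurable_funM.
    apply: (measurableT_comp (@measurable_expR R)); apply: measurable_funN.
    apply: measurable_funM; first by apply: (measurableT_comp (@measurable_expR R)).
    by apply: measurable_funM => //; exact: measurable_dot.
  apply: measurableT_comp; first by apply: continuous_measurable_fun; exact: continuous_cos.
  by apply: measurable_funD => //; apply: measurable_funM => //; exact: measurable_dot.
have F1 p : `|F p| <= 1.
  rewrite normrM mulr_ile1 ?cos_max// ger0_norm ?expR_ge0//.
  by rewrite -expR0 ler_expR oppr_le0 (mulr_ge0 (expR_ge0 _) (mulr_ge0 (sqr_ge0 _) (dot_ge0 _))).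
transitivity (gmean (fun u => (gmass (alpha / 2))^-1 * \int[gm]_v F (v, u))).
  apply: eq_gmean => u /=.
  transitivity (sint intg (fun y => cos (tau * dot u z) * cos (dot y (tau *: u)) + sin (tau * dot u z) * sin (dot y (tau *: u)))).
    by congr sint; apply/funext => y; rewrite dotDr dotNr mulrDr mulrN cosB dotZr (dotC y).
  rewrite (@sint_lin _ _ _ intg _ _ _ _ 1)// => [|y|y]; [|exact: cos_max|exact: sin_max].
  rewrite sint_cos sint_sin mulr0 addr0 dotZl dotZr mulrA -expr2.
  rewrite /F /= (_ : (fun v : R => _) = (fun v : R => cos (tau * dot u z) * expR (- (expR v * (tau ^+ 2 * dot u u))))); last first.
    by apply/funext => v; rewrite addr0 mulrC.
  have ie : gm.-integrable [set: R] (EFin \o (fun v : R => expR (- (expR v * (tau ^+ 2 * dot u u))))).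
    apply: (@bounded_integrable _ _ _ gm _ 1); first exact: measurable_expRM.
    move=> v; rewrite ger0_norm ?expR_ge0//.
    by rewrite -expR0 ler_expR oppr_le0 (mulr_ge0 (expR_ge0 _) (mulr_ge0 (sqr_ge0 _) (dot_ge0 _))).
  rewrite (@RintegralZl _ _ _ gm setT _ (cos (tau * dot u z)) measurableT ie).
  rewrite gmeas_laplace; last exact: (mulr_ge0 (sqr_ge0 _) (dot_ge0 _)).
  by rewrite mulrCA (mulrC _ (gmass _)) mulKf.
have mI : measurable_fun [set: 'rV[R]_n] (fun u => \int[gm]_v F (v, u)).
  exact: (@measurable_Rintegral1 _ _ _ _ R gm (@dirac _ 'rV[R]_n 0 R) _ 1 mF2 F1).
rewrite (@gmean_scale _ _ (fun u => \int[gm]_v F (v, u)) _ (1 * fine (gm setT))) => [|//|u]; last first.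
  apply: normr_Rintegral_le => [|v]; last exact: F1.
  by apply: (measurableT_comp mF2); exact: pair2_measurable.
congr (_ * _); rewrite -(gmean_Fubini gm mF2 F1); apply: eq_Rintegral => v _.
have s0 : 0 <= expR v * tau ^+ 2 by exact: (mulr_ge0 (expR_ge0 _) (sqr_ge0 _)).
have := gmean_cos tau 0 z s0; rewrite cos0 mul1r -/(rres tau v).
rewrite big_split/= prodr_const card_ord => h.
transitivity (rres tau v ^+ n * \prod_(i < n) psi (tau * z ord0 i * rres tau v)).
  by rewrite -h; apply: eq_gmean => u; rewrite /F /= mulrA.
by congr (_ * _); rewrite -heat_prod; apply: eq_bigr => i _; congr psi; rewrite mulrAC.
Qed.

Lemma powR_psi_bound (th x : R) : 0 <= th <= n%:R -> 0 < x ->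
  x `^ th * psi x <= 1 + (2 * n%:R) ^+ n.
Proof.
move=> /andP[th0 thn] x0; have n0 : 0 <= (2 * n%:R : R) ^+ n by rewrite exprn_ge0// mulr_ge0.
have [x1|x1] := leP x 1.
  apply: (@le_trans _ _ 1); last by rewrite lerDl.
  rewrite mulr_ile1 ?powR_ge0 ?psi_ge0 ?psi_le1//.
  by rewrite -[leRHS](pow1R th); apply: ge0_ler_powR; rewrite ?nnegrE ?(ltW x0).
apply: (@le_trans _ _ ((2 * n%:R) ^+ n)); last by rewrite lerDr.
have y0 : 0 < x ^+ 2 / 2 by rewrite divr_gt0// exprn_gt0.
have := expR_neg_le n y0; rewrite -/(psi x) => h.
apply: (le_trans (ler_wpM2l (powR_ge0 _ _) h)).
apply: (@le_trans _ _ ((x ^+ 2) ^+ n * (n%:R / (x ^+ 2 / 2)) ^+ n)).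
  rewrite ler_wpM2r ?exprn_ge0 ?divr_ge0 ?(ltW y0) ?sqr_ge0//.
  apply: (@le_trans _ _ (x `^ n%:R)); first by apply: ler_powR; rewrite ?(ltW x1).
  rewrite powR_mulrn ?(ltW x0)// lerXn2r ?nnegrE ?exprn_ge0 ?(ltW x0)//.
  by rewrite expr2 ler_peMl ?(ltW x0) ?(ltW x1).
rewrite -exprMn (_ : x ^+ 2 * (n%:R / (x ^+ 2 / 2)) = 2 * n%:R)//.
by field; rewrite gt_eqF.
Qed.

Section bound.
Variable th : R.
Hypothesis th0 : 0 <= th <= n%:R.
Hypothesis tha : n%:R - alpha < th.

Let rres_gt0 tau v : 0 < rres tau v.
Proof. by rewrite invr_gt0 sqrtr_gt0. Qed.

Let rres_le tau v : 0 < tau -> tau * rres tau v <= expR (- (v / 2)).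
Proof.
move=> t0; rewrite -ler_sqr ?nnegrE ?expR_ge0 ?mulr_ge0 ?(ltW t0) ?(ltW (rres_gt0 _ _))//.
have D0 := rden_gt0 tau v.
rewrite exprMn exprVn sqr_sqrtr ?(ltW D0)// ler_pdivrMr// -expRM_natl.
rewrite (_ : 2 * - (v / 2) = - v); last by field.
rewrite expRN mulrDr mulr1 mulrCA mulKf ?gt_eqF ?expR_gt0//.
by rewrite mulr_natl mulr2n ler_wpDl ?invr_ge0 ?expR_ge0// lerDl sqr_ge0.
Qed.

Lemma rres_heat_le tau v (z : 'rV[R]_n) : 0 < tau -> z != 0 ->
  rres tau v ^+ n * heat (tau * rres tau v) z <=
  tau ^- n * enorm z `^ (- th) * (1 + (2 * n%:R) ^+ n) * expR (- ((n%:R - th) / 2 * v)).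
Proof.
move=> t0 z0; have e0 : 0 < enorm z by rewrite enorm_gt0.
have [rho rhoE] : exists r, tau * rres tau v = r by exists (tau * rres tau v).
have r0 : 0 < rho by rewrite -rhoE mulr_gt0// rres_gt0.
rewrite rhoE.
have /andP[th1 th2] := th0.
have -> : heat rho z = psi (rho * enorm z) by rewrite /heat /psi [(rho * _) ^+ 2]exprMn enorm_sqr.
have -> : rres tau v ^+ n = tau ^- n * rho `^ n%:R.
  by rewrite powR_mulrn ?(ltW r0)// -rhoE exprMn mulKf// expf_neq0// gt_eqF.
rewrite -!mulrA ler_wpM2l ?invr_ge0 ?exprn_ge0 ?(ltW t0)//.
have -> : rho `^ n%:R = (rho * enorm z) `^ th * enorm z `^ (- th) * rho `^ (n%:R - th).
  rewrite powRM ?(ltW r0) ?(ltW e0)// -mulrA -mulrA (mulrA (enorm z `^ th)) -powRD; last by rewrite (gt_eqF e0) implybT.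
  rewrite subrr powRr0 mul1r -powRD; last by rewrite (gt_eqF r0) implybT.
  by congr (_ `^ _); ring.
rewrite (_ : forall a b c e : R, a * b * c * e = b * (a * e * c))// => [|a b c e]; last by ring.
rewrite ler_wpM2l ?powR_ge0// ler_pM ?mulr_ge0 ?powR_ge0 ?psi_ge0//.
  by apply: powR_psi_bound => //; rewrite mulr_gt0.
apply: (@le_trans _ _ (expR (- (v / 2)) `^ (n%:R - th))).
  by apply: ge0_ler_powR; rewrite ?nnegrE ?expR_ge0 ?subr_ge0 ?(ltW r0)//; rewrite -rhoE; exact: rres_le.
rewrite /powR gt_eqF ?expR_gt0// expRK ler_expR le_eqVlt; apply/orP; left; apply/eqP.
by ring.
Qed.

Lemma sint_heat_bounds : exists2 K, 0 <= K & forall tau (z : 'rV[R]_n), 0 < tau -> z != 0 ->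
  0 <= sint intg (fun y => heat tau (z - y)) <= K * enorm z `^ (- th) * (Num.sqrt (2 * pi) / tau) ^+ n.
Proof.
have J0 := gmass_gt0 c0; have s0 : 0 < Num.sqrt (2 * pi) :> R by rewrite sqrtr_gt0 mulr_gt0// pi_gt0.
set e := (n%:R - th) / 2; have e0 : 0 < alpha / 2 - e.
  by rewrite /e -mulrBl divr_gt0// subr_gt0; move: tha; lra.
have J1 := gmass_gt0 e0; set K0 := 1 + (2 * n%:R) ^+ n : R.
have K00 : 0 <= K0 by rewrite addr_ge0// exprn_ge0// mulr_ge0.
exists ((gmass (alpha / 2))^-1 * (K0 * gmass (alpha / 2 - e) / Num.sqrt (2 * pi) ^+ n)).
  by rewrite !mulr_ge0 ?invr_ge0 ?exprn_ge0 ?(ltW J0) ?(ltW J1) ?(ltW s0).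
move=> tau z t0 z0; rewrite sint_heat; set I := \int[gm]_v _.
have m1 : measurable_fun [set: R] (fun v : R => rres tau v ^+ n * heat (tau * rres tau v) z).
  have mr : measurable_fun [set: R] (rres tau).
    have -> : rres tau = fun v => (1 + 2 * (expR v * tau ^+ 2)) `^ (- 2^-1).
      apply/funext => v; rewrite powRN powR12_sqrt//.
      exact: ltW.
    apply: (@measurableT_comp _ _ _ _ _ _ (fun x : R => x `^ (- 2^-1))); first exact: measurable_powR.
    by apply: measurable_funD => //; apply: measurable_funM => //; apply: measurable_funM.
  apply: measurable_funM; first exact: measurable_funX.
  apply: (measurableT_comp (@measurable_expR R)); apply: measurable_funN.
  by do 2 apply: measurable_funM => //; apply: measurable_funX; apply: measurable_funM.
have f0 v : 0 <= rres tau v ^+ n * heat (tau * rres tau v) z.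
  by rewrite mulr_ge0 ?heat_ge0// exprn_ge0// ltW.
have I0 : 0 <= I by exact: Rintegral_ge0.
rewrite mulr_ge0 ?invr_ge0 ?(ltW J0)//= -!mulrA ler_wpM2l ?invr_ge0 ?(ltW J0)//.
have b v : `|rres tau v ^+ n * heat (tau * rres tau v) z| <= 1.
  rewrite ger0_norm// mulr_ile1 ?heat_ge0 ?heat_le1 ?exprn_ge0 ?(ltW (rres_gt0 _ _))//.
  rewrite exprn_ile1 ?(ltW (rres_gt0 _ _))// invf_le1 ?sqrtr_gt0//.
  by rewrite -[leLHS]sqrtr1; apply: ler_wsqrtr.
rewrite -lee_fin /I -(integral_EFin_Rintegral gm m1 b).
set Q := tau ^- n * enorm z `^ (- th) * K0.
have Q0 : 0 <= Q by rewrite !mulr_ge0 ?invr_ge0 ?exprn_ge0 ?powR_ge0 ?(ltW t0).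
have me : measurable_fun [set: R] (fun v : R => (expR (- (e * v)))%:E).
  apply/measurable_EFinP; apply: (measurableT_comp (@measurable_expR R)); apply: measurable_funN.
  exact: measurable_funM.
apply: (@le_trans _ _ (\int[gm]_v (Q%:E * (expR (- (e * v)))%:E))%E).
  apply: ge0_le_integral => //.
  - by move=> v _; rewrite lee_fin f0.
  - exact/measurable_EFinP.
  - exact: emeasurable_funM.
  - by move=> v _; rewrite -EFinM lee_fin; exact: rres_heat_le.
rewrite ge0_integralZl//.
rewrite (@gmeas_moment R (alpha / 2) c0 e e0) -EFinM lee_fin /Q expr_div_n.
rewrite le_eqVlt; apply/orP; left; apply/eqP.
have sn : Num.sqrt (2 * pi) ^+ n != 0 :> R by rewrite expf_neq0// gt_eqF.
have tn : tau ^+ n != 0 by rewrite expf_neq0// gt_eqF.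
move: (gmass _) (Num.sqrt _ ^+ n) (tau ^+ n) (enorm z `^ _) sn tn => p q r s qn rn.
by field; rewrite qn rn.
Qed.

End bound.
End bessel_heat.

Section approximate_identity.
Context (R : realType) (n : nat).
Notation la := (@lebesgue_rV R n).

Lemma heat_integral_sub (z : 'rV[R]_n) tau : 0 < tau ->
  (\int[la]_y (heat tau (z - y))%:E = ((Num.sqrt (2 * pi) / tau) ^+ n)%:E)%E.
Proof.
move=> t0; rewrite -heat_integral// -[RHS](ge0_integral_rV_shift (- z)).
- by apply: eq_integral => y _; rewrite /heat -opprB dotNl dotNr opprK.
- by apply/measurable_EFinP; exact: measurable_heat.
- by move=> y; rewrite lee_fin heat_ge0.
Qed.

Lemma heat_halfE tau (x : 'rV[R]_n) :
  heat tau x = expR (- (3 * tau ^+ 2 * dot x x / 8)) * heat (tau / 2) x.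
Proof. by rewrite /heat -expRD; congr expR; field. Qed.

Lemma approximate_identity_le (g : 'rV[R]_n -> \bar R) (intg : la.-integrable [set: 'rV[R]_n] g)
    (M : R) (z : 'rV[R]_n) : continuous g -> 0 <= M ->
  (forall m : nat, sint intg (fun y => heat m.+1%:R (z - y)) <= M * (Num.sqrt (2 * pi) / m.+1%:R) ^+ n) ->
  (g z <= M%:E)%E.
Proof.
move=> cg M0 hM; rewrite leNgt; apply/negP => Mg.
have [M' MM' Mg'] : exists2 M' : R, M < M' & (M'%:E < g z)%E.
  case: (g z) Mg => [r| |]// Mr; last by exists (M + 1); rewrite ?ltrDl// ltry.
  by exists ((M + r) / 2); rewrite ?lte_fin ?midf_lt.
have M'0 : 0 <= M' by rewrite ltW// (le_lt_trans M0).
have hU : \forall y \near z, (M'%:E < g y)%E.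
  exact: (cg z _ (open_nbhs_nbhs (conj (@open_ereal_gt_ereal R M'%:E) Mg'))).
have [e /= e0 He] := (@nbhs_normP _ _ z _).1 hU.
pose dl := e / 2; have dl0 : 0 < dl by rewrite divr_gt0.
have near_z y : enorm (z - y) <= dl -> (M'%:E < g y)%E.
  move=> zy; apply: He; rewrite /= (le_lt_trans (norm_le_enorm _))// (le_lt_trans zy)//.
  by rewrite ltr_pdivrMr// ltr_pMr// ltr1n.
pose S := \int[la]_y (ppart g y + npart g y).
have iS : la.-integrable [set: 'rV[R]_n] (EFin \o (fun y => ppart g y + npart g y)).
  apply: eq_integrable (integrableD measurableT (integrable_ppart intg) (integrable_npart intg)) => //.
have SE : (\int[la]_y (ppart g y + npart g y)%:E)%E = S%:E.
  by rewrite /S /Rintegral fineK//; apply: integrable_fin_num.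
have S0 : 0 <= S by apply: Rintegral_ge0 => y _; rewrite addr_ge0 ?ppart_ge0 ?npart_ge0.
have mp := measurable_ppart intg; have mn := measurable_npart intg.
have mh tau : measurable_fun [set: 'rV[R]_n] (fun y => heat tau (z - y)).
  by apply: measurable_heat; exact: measurable_rVB.
have h1 tau y : `|heat tau (z - y)| <= 1 by rewrite ger0_norm ?heat_ge0 ?heat_le1.
pose c8 := 3 * dl ^+ 2 / 8; have c80 : 0 < c8 by rewrite divr_gt0// mulr_gt0// exprn_gt0.
have key (m : nat) : (M' - M) * (Num.sqrt (2 * pi) / m.+1%:R) ^+ n <=
    expR (- (c8 * m.+1%:R ^+ 2)) * (M' * (Num.sqrt (2 * pi) / (m.+1%:R / 2)) ^+ n + S).
  set tau : R := m.+1%:R; have t0 : 0 < tau by rewrite ltr0n.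
  have t20 : 0 < tau / 2 by rewrite divr_gt0.
  set ep := expR _; have ep0 : 0 <= ep by exact: expR_ge0.
  (* Away from z the kernel is at most ep times the one of twice the width. *)
  have pw y : g y \is a fin_num ->
      M' * heat tau (z - y) + heat tau (z - y) * npart g y <=
      heat tau (z - y) * ppart g y + ep * (M' * heat (tau / 2) (z - y) + (ppart g y + npart g y)).
    move=> gy; have p0 := ppart_ge0 g y; have n0 := npart_ge0 g y.
    have q0 := heat_ge0 tau (z - y); have q20 := heat_ge0 (tau / 2) (z - y).
    have [zy|zy] := leP (enorm (z - y)) dl.
      apply: (@le_trans _ _ (heat tau (z - y) * ppart g y)).
        rewrite mulrC -mulrDr ler_wpM2l// -lerBrDr ppartB ltW//.
        by rewrite -lte_fin fineK//; exact: near_z.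
      by rewrite lerDl mulr_ge0// addr_ge0 ?addr_ge0// mulr_ge0.
    have hle : heat tau (z - y) <= ep * heat (tau / 2) (z - y).
      rewrite heat_halfE ler_wpM2r// ler_expR lerN2 /c8 -enorm_sqr.
      have : dl ^+ 2 * tau ^+ 2 <= enorm (z - y) ^+ 2 * tau ^+ 2.
        by rewrite ler_wpM2r ?sqr_ge0// lerXn2r ?nnegrE ?enorm_ge0 ?(ltW dl0) ?(ltW zy).
      move: (dl ^+ 2) (tau ^+ 2) (enorm _ ^+ 2) => a b c abc.
      have -> : 3 * a / 8 * b = 3 / 8 * (a * b) by ring.
      have -> : 3 * b * c / 8 = 3 / 8 * (c * b) by ring.
      by rewrite ler_pM2l// divr_gt0.
    have hle' : heat tau (z - y) <= ep.
      by apply: (le_trans hle); rewrite ler_piMr// heat_le1.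
    have u1 : M' * heat tau (z - y) <= M' * (ep * heat (tau / 2) (z - y)) by rewrite ler_wpM2l.
    have u2 : heat tau (z - y) * npart g y <= ep * npart g y by rewrite ler_wpM2r.
    have u3 : 0 <= heat tau (z - y) * ppart g y by rewrite mulr_ge0.
    have u4 : 0 <= ep * ppart g y by rewrite mulr_ge0.
    clear -u1 u2 u3 u4; move: u1 u2 u3 u4.
    move: (heat tau (z - y)) (heat (tau / 2) (z - y)) (ppart g y) (npart g y) => a b p q; lra.
  have hi := ae_ge0_le_integral (mu := la) measurableT
    (f1 := fun y => (M'%:E * (heat tau (z - y))%:E + (heat tau (z - y))%:E * (npart g y)%:E)%E)
    (f2 := fun y => ((heat tau (z - y))%:E * (ppart g y)%:E +
       ep%:E * (M'%:E * (heat (tau / 2) (z - y))%:E + (ppart g y + npart g y)%:E))%E).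
  have m1 : measurable_fun [set: 'rV[R]_n] (fun y => (M'%:E * (heat tau (z - y))%:E)%E).
    by apply: emeasurable_funM => //; apply/measurable_EFinP.
  have m2 : measurable_fun [set: 'rV[R]_n] (fun y => ((heat tau (z - y))%:E * (npart g y)%:E)%E).
    by apply: emeasurable_funM => //; apply/measurable_EFinP.
  have m3 : measurable_fun [set: 'rV[R]_n] (fun y => ((heat tau (z - y))%:E * (ppart g y)%:E)%E).
    by apply: emeasurable_funM => //; apply/measurable_EFinP.
  have m4 : measurable_fun [set: 'rV[R]_n] (fun y => (M'%:E * (heat (tau / 2) (z - y))%:E)%E).
    by apply: emeasurable_funM => //; apply/measurable_EFinP.
  have m5 : measurable_fun [set: 'rV[R]_n] (fun y => (ppart g y + npart g y)%:E).
    by apply/measurable_EFinP; apply: measurable_funD.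
  have m6 : measurable_fun [set: 'rV[R]_n] (fun y => (M'%:E * (heat (tau / 2) (z - y))%:E + (ppart g y + npart g y)%:E)%E).
    exact: emeasurable_funD.
  have m7 : measurable_fun [set: 'rV[R]_n] (fun y => (ep%:E * (M'%:E * (heat (tau / 2) (z - y))%:E + (ppart g y + npart g y)%:E))%E).
    by apply: emeasurable_funM.
  have n1 y : (0 <= M'%:E * (heat tau (z - y))%:E)%E by rewrite mule_ge0 ?lee_fin ?heat_ge0.
  have n2 y : (0 <= (heat tau (z - y))%:E * (npart g y)%:E)%E by rewrite mule_ge0 ?lee_fin ?heat_ge0 ?npart_ge0.
  have n3 y : (0 <= (heat tau (z - y))%:E * (ppart g y)%:E)%E by rewrite mule_ge0 ?lee_fin ?heat_ge0 ?ppart_ge0.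
  have n4 y : (0 <= M'%:E * (heat (tau / 2) (z - y))%:E)%E by rewrite mule_ge0 ?lee_fin ?heat_ge0.
  have n5 y : (0 <= (ppart g y + npart g y)%:E)%E by rewrite lee_fin addr_ge0 ?ppart_ge0 ?npart_ge0.
  have n6 y : (0 <= M'%:E * (heat (tau / 2) (z - y))%:E + (ppart g y + npart g y)%:E)%E by rewrite adde_ge0.
  have epE : (0 <= ep%:E)%E by rewrite lee_fin.
  have {}hi := hi (fun y _ => adde_ge0 (n1 y) (n2 y)) (emeasurable_funD m1 m2)
    (fun y _ => adde_ge0 (n3 y) (mule_ge0 epE (n6 y))) (emeasurable_funD m3 m7).
  have {hi} : (\int[la]_y (M'%:E * (heat tau (z - y))%:E + (heat tau (z - y))%:E * (npart g y)%:E) <=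
     \int[la]_y ((heat tau (z - y))%:E * (ppart g y)%:E +
       ep%:E * (M'%:E * (heat (tau / 2) (z - y))%:E + (ppart g y + npart g y)%:E)))%E.
    apply: hi; have := integrable_ae measurableT intg; apply: filterS => y h _.
    change ((M' * heat tau (z - y) + heat tau (z - y) * npart g y)%:E <=
      (heat tau (z - y) * ppart g y + ep * (M' * heat (tau / 2) (z - y) + (ppart g y + npart g y)))%:E)%E.
    by rewrite lee_fin; apply: pw; exact: (h I).
  rewrite ge0_integralD// ge0_integralD//; last by move=> y _; rewrite mule_ge0.
  rewrite (ge0_integralZl _ measurableT m6)// ge0_integralD//.
  rewrite !ge0_integralZl//; try by [move=> y _; rewrite lee_fin heat_ge0|apply/measurable_EFinP].
  rewrite !heat_integral_sub// SE.
  rewrite -integral_mun; last by apply/measurable_EFinP.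
  rewrite -integral_mup; last by apply/measurable_EFinP.
  rewrite (integral_EFin_Rintegral (mun intg) (mh tau) (h1 tau)) (integral_EFin_Rintegral (mup intg) (mh tau) (h1 tau)).
  move=> hi'; have {hi'} hi : M' * (Num.sqrt (2 * pi) / tau) ^+ n + \int[mun intg]_y heat tau (z - y) <=
      \int[mup intg]_y heat tau (z - y) + ep * (M' * (Num.sqrt (2 * pi) / (tau / 2)) ^+ n + S).
    by rewrite -lee_fin; exact: hi'.
  have := hM m; rewrite -/tau /sint; move: hi.
  move: (\int[_]_y _) (\int[_]_y _) ((_ / tau) ^+ n) ((_ / (tau / 2)) ^+ n) => I1 I2 A B; lra.
have s1 : 1 <= Num.sqrt (2 * pi) :> R.
  rewrite -[leLHS]sqrtr1; apply: ler_wsqrtr.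
  by have := pi_ge2 R; move: (pi : R) => p; lra.
have s0 : 0 < Num.sqrt (2 * pi) :> R by exact: lt_le_trans s1.
pose D := (n.+1%:R / c8) ^+ n.+1 * (M' * 2 ^+ n + S).
have B0 : 0 <= M' * 2 ^+ n + S by rewrite addr_ge0// mulr_ge0// exprn_ge0.
have F0 : 0 <= (n.+1%:R / c8) ^+ n.+1 by rewrite exprn_ge0// divr_ge0// ltW.
have b (m : nat) : (M' - M) * m.+1%:R <= D.
  set tau : R := m.+1%:R; have t0 : 0 < tau by rewrite ltr0n.
  have t1 : 1 <= tau by rewrite ler1n.
  have := key m; rewrite -/tau.
  have -> : Num.sqrt (2 * pi) / (tau / 2) = 2 * (Num.sqrt (2 * pi) / tau) by field; rewrite gt_eqF.
  rewrite [X in M' * X]exprMn; set A := (_ / tau) ^+ n => h.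
  have A0 : 0 < A by rewrite exprn_gt0// divr_gt0.
  have Ai : 1 <= A * tau ^+ n.
    by rewrite /A expr_div_n mulfVK ?expf_neq0 ?gt_eqF// exprn_ege1.
  have tn0 : 0 < tau ^+ n by rewrite exprn_gt0.
  have {}h : M' - M <= expR (- (c8 * tau ^+ 2)) * (M' * 2 ^+ n + S) * tau ^+ n.
    rewrite -(ler_pM2r A0); apply: (le_trans h).
    rewrite -!mulrA ler_wpM2l ?expR_ge0// mulrDl.
    have : S <= S * (A * tau ^+ n) by rewrite ler_peMr.
    have : M' * 2 ^+ n * A <= M' * 2 ^+ n * (A * tau ^+ n).
      rewrite ler_wpM2l ?mulr_ge0 ?exprn_ge0// ler_peMr ?(ltW A0)// exprn_ege1//.
    by rewrite (mulrC (tau ^+ n) A) (mulrA M' (2 ^+ n) A) => u1 u2; exact: lerD.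
  have y0 : 0 < c8 * tau ^+ 2 by rewrite mulr_gt0// exprn_gt0.
  have he := expR_neg_le n.+1 y0.
  have : (M' - M) * tau <= (n.+1%:R / (c8 * tau ^+ 2)) ^+ n.+1 * (M' * 2 ^+ n + S) * tau ^+ n * tau.
    rewrite ler_wpM2r ?(ltW t0)//; apply: (le_trans h); rewrite ler_wpM2r ?(ltW tn0)//; exact: ler_wpM2r.
  move/le_trans; apply; rewrite (_ : n.+1%:R / (c8 * tau ^+ 2) = n.+1%:R / c8 * (tau ^+ 2)^-1); last by rewrite invfM mulrA.
  rewrite exprMn /D -mulrA -exprSr mulrAC ler_wpM2r// -mulrA ler_piMr//.
  rewrite -exprMn exprn_ile1//; first by rewrite mulr_ge0 ?invr_ge0 ?sqr_ge0 ?(ltW t0).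
  by rewrite mulrC expr2 invfM mulrA divff ?gt_eqF// mul1r invf_le1.
have := b (Num.truncn (D / (M' - M))); rewrite leNgt => /negP; apply.
rewrite mulrC -ltr_pdivrMr ?subr_gt0//.
by apply: truncnS_gt.
Qed.

End approximate_identity.

Lemma bessel_kernel_bound (R : realType) (n : nat) (alpha th : R) (g : 'rV[R]_n -> \bar R) :
  0 < alpha -> is_bessel_kernel alpha g -> 0 <= th <= n%:R -> n%:R - alpha < th ->
  exists2 K, 0 <= K & forall z, (`|g z| <= K%:E * rker th z)%E.
Proof.
move=> a0 bg th0 tha; have [intg cg _] := bg.
have [K K0 HK] := sint_heat_bounds a0 bg intg th0 tha.
exists (K + 1); first by rewrite addr_ge0.
move=> z; have [->|z0] := eqVneq z 0.
  by rewrite /rker eqxx gt0_muley ?leey// lte_fin ltr_wpDl.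
have g0 : (0 <= g z)%E.
  have intN : (lebesgue_rV n).-integrable [set: 'rV[R]_n] (fun y => - g y)%E by exact: integrableN.
  rewrite -oppe_le0; apply: (@approximate_identity_le R n _ intN 0 z) => //.
    by move=> y; apply: continuous_comp; [exact: cg|exact: oppe_continuous].
  move=> m; rewrite mul0r.
  have mh : measurable_fun [set: 'rV[R]_n] (fun y => heat m.+1%:R (z - y)).
    by apply: measurable_heat; exact: measurable_rVB.
  have h1 y : `|heat m.+1%:R (z - y)| <= 1 by rewrite ger0_norm ?heat_ge0 ?heat_le1.
  have /andP[h _] := HK m.+1%:R z (ltr0Sn _ _) z0; move: h.
  rewrite (sintE intg mh h1) (sintE intN mh h1).
  under [in X in _ -> X]eq_integral do rewrite muleN.
  have ig : (lebesgue_rV n).-integrable [set: 'rV[R]_n] (fun y => ((heat m.+1%:R (z - y))%:E * g y)%E).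
    apply: (le_integrable measurableT _ _ intg).
      by apply: emeasurable_funM; [exact/measurable_EFinP|exact: measurable_int intg].
    by move=> y _; rewrite abseM -[leRHS]mul1e lee_wpmul2r// abse_EFin lee_fin.
  rewrite integralN; last exact: integrable_add_def.
  by rewrite fineN oppr_le0.
rewrite gee0_abs// /rker (negbTE z0) -EFinM.
apply: (@approximate_identity_le R n _ intg _ z) => //.
  by rewrite mulr_ge0 ?powR_ge0// addr_ge0.
move=> m; have /andP[_ h] := HK m.+1%:R z (ltr0Sn _ _) z0; apply: (le_trans h).
rewrite ler_wpM2r ?exprn_ge0 ?divr_ge0 ?sqrtr_ge0//.
by rewrite ler_wpM2r ?powR_ge0// lerDl.
Qed.

(** * Potentials of the occupation measure *)

Section bounded_paths.
Context (R : realType) (k n : nat).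

Lemma holder0_bounded gam (X : 'rV[R]_k -> 'rV[R]_n) : 0 <= gam -> holder0 gam X ->
  exists C, forall t, cube t -> enorm (X t) <= C.
Proof.
move=> g0 [X0]; set S := ereal_sup _ => Soo.
exists (`|fine S| * (k%:R `^ gam)) => t ct.
have [->|t0] := eqVneq t 0; first by rewrite X0 enorm0 mulr_ge0// powR_ge0.
have h : ((enorm (X t - X 0) / enorm (t - 0) `^ gam)%:E <= S)%E.
  apply: ereal_sup_ubound; exists 0, t; split=> //; last by rewrite eq_sym.
  by move=> i; rewrite mxE lexx ler01.
have Sf : S \is a fin_num.
  by rewrite fin_numE (lt_eqF Soo) andbT gt_eqF// (lt_le_trans _ h)// ltNyr.
move: h; rewrite -(fineK Sf) lee_fin subr0 X0 subr0.
have tp : 0 < enorm t `^ gam by rewrite powR_gt0// enorm_gt0.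
rewrite ler_pdivrMr// => h; apply: (le_trans h).
apply: (@le_trans _ _ (`|fine S| * enorm t `^ gam)); first by rewrite ler_wpM2r ?powR_ge0 ?ler_norm.
rewrite ler_wpM2l//; apply: ge0_ler_powR; rewrite ?nnegrE ?enorm_ge0//.
exact: cube_enorm.
Qed.

End bounded_paths.

Section frostman.
Context d (T : measurableType d) (R : realType) (P : probability T R) (k n : nat) (H : R).
Context (B : 'rV[R]_k -> T -> 'rV[R]_n) (phi : 'rV[R]_k -> 'rV[R]_n).
Hypothesis k0 : (0 < k)%N.
Hypothesis H01 : 0 < H < 1.
Hypothesis fB : fbm_field P H B.
Hypothesis bphi : bounded_borel phi.
Local Notation Xp w := (fun t => pfield B phi (t, w)).

Lemma pfield_bounded gam w : 0 <= gam -> holder0 gam (B ^~ w) ->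
  exists M, forall t, cube t -> enorm (Xp w t) <= M.
Proof.
move=> g0 hB; have [C HC] := holder0_bounded g0 hB; have [_ [M HM]] := bphi.
exists (C + M) => t ct; rewrite pfield_cube//.
by rewrite (le_trans (enormD _ _))// lerD ?HC ?HM.
Qed.

Lemma ball_bump (x y : 'rV[R]_n) (c : 'I_n -> R) eta : 0 < eta ->
  (forall i, `|c i - x ord0 i| <= eta) -> enorm (x - y) <= eta -> expR (- 2 *+ n) <= bumps n eta c y.
Proof.
move=> e0 cx xy; rewrite /bumps.
have -> : expR (- 2 *+ n) = \prod_(i < n) expR (- 2) :> R.
  by rewrite prodr_const card_ord -expRM_natl mulr_natl.
apply: ler_prod => i _; rewrite expR_ge0/= theta_lt// /psi ler_expR lerN2.
have h : `|(y ord0 i - c i) / eta| <= 2.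
  rewrite normrM normfV (gtr0_norm e0) ler_pdivrMr//.
  have := coord_le_enorm (x - y) i; rewrite !mxE => h1; have h2 := cx i.
  rewrite -opprB normrN (_ : c i - y ord0 i = (c i - x ord0 i) + (x ord0 i - y ord0 i)); last by ring.
  rewrite (le_trans (ler_normD _ _))// mulr_natl mulr2n lerD//; exact: le_trans h1 xy.
by rewrite ler_pdivrMr// -real_normK ?num_real// (_ : 2 * 2 = 2 ^+ 2 :> R)// lerXn2r ?nnegrE.
Qed.

Lemma frostman_balls w (b M : R) : 0 <= b -> (forall t, cube t -> enorm (Xp w t) <= M) ->
  (exists J, forall j, (J <= j)%N -> forall g : sgrid n 1 j,
    `|\int[cubeM R k]_t bump_at B phi n (2^-1 ^+ j) (sgridpt R g) (t, w)| < (2^-1 ^+ j) `^ b) ->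
  exists2 C, 0 <= C & forall (x : 'rV[R]_n) j,
    (cubeM R k [set t | (enorm (x - Xp w t) <= 2^-1 ^+ j)%R] <= (C * (2^-1 ^+ j) `^ b)%:E)%E.
Proof.
move=> b0 XM [J HJ]; have mX := @measurable_pfield1 d T R P k n H B phi fB bphi w.
pose J' := maxn J (Num.truncn (M + 1)).+1.
have J'M : M + 1 < 2 ^+ J'.
  apply: (lt_le_trans (truncnS_gt _)); rewrite -natrX ler_nat.
  by apply: (leq_trans (leq_maxr J _)); apply: ltnW; exact: ltn_expl.
have mS (x : 'rV[R]_n) j : measurable [set t | (enorm (x - Xp w t) <= 2^-1 ^+ j)%R].
  by rewrite -[Y in measurable Y]setTI; apply: (mX measurableT (cball x (2^-1 ^+ j))); exact: measurable_cball.
exists (expR (2 *+ n) + (2^-1 ^+ J') `^ (- b)); first by rewrite addr_ge0 ?expR_ge0 ?powR_ge0.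
move=> x j; set eta : R := 2^-1 ^+ j; have eta0 : 0 < eta by exact: dy_gt0.
rewrite mulrDl EFinD; have [jJ|jJ] := ltnP j J'.
  apply: (@le_trans _ _ 1%E).
    by rewrite -(@cubeMT R k); apply: le_measure; rewrite ?inE//; exact: mS.
  rewrite -[leLHS]add0e leeD// ?lee_fin ?mulr_ge0 ?expR_ge0 ?powR_ge0//.
  rewrite powRN mulrC ler_pdivlMr ?powR_gt0 ?dy_gt0// mul1r.
  apply: ge0_ler_powR; rewrite ?nnegrE ?(ltW (dy_gt0 _ _))//.
  by apply: ler_wiXn2l; rewrite ?invr_ge0 ?invf_le1 ?ler1n// ltnW.
rewrite -[leLHS]adde0 leeD// ?lee_fin ?mulr_ge0 ?powR_ge0//.
have [xj|/existsNP[i /negP]] := pselect (forall i, `|x ord0 i| <= 2 ^+ j); last first.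
  rewrite -ltNge => xi; rewrite cubeME (_ : _ `&` _ = set0) ?measure0 ?lee_fin ?mulr_ge0 ?expR_ge0 ?powR_ge0//.
  apply/seteqP; split=> // t [ct /=]; apply/negP; rewrite -ltNge.
  move: (Xp w t) (XM t ct) => y yM.
  have := coord_le_enorm (x - y) i; apply: lt_le_trans; rewrite !mxE.
  apply: (le_lt_trans (dy_le1 R j)).
  have h1 : `|y ord0 i| <= M by apply: (le_trans (coord_le_enorm _ i)).
  have h2 : M + 1 < `|x ord0 i|.
    apply: (lt_le_trans J'M); apply: ltW; apply: (le_lt_trans _ xi).
    by apply: ler_weXn2l; rewrite ?ler1n.
  have := lerB_dist (x ord0 i) (y ord0 i); move: h1 h2.
  move: `|x ord0 i| `|y ord0 i| `|x ord0 i - y ord0 i| => p q r; lra.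
have [g Hg] := @sgrid_near R n 1 j x xj; rewrite muln1 in Hg.
have jJ0 : (J <= j)%N by apply: leq_trans jJ; exact: leq_maxl.
have hb := HJ j jJ0 g.
have mb : measurable_fun [set: 'rV[R]_k] (fun t => bump_at B phi n eta (sgridpt R g) (t, w)).
  by apply: (measurableT_comp (@measurable_bump_at d T R P k n H B phi fB bphi _ _ _)); exact: measurable_pair2.
set A := [set t | _]; set I := \int[cubeM R k]_t _ in hb.
have E : (\int[cubeM R k]_t (bump_at B phi n eta (sgridpt R g) (t, w))%:E = I%:E)%E.
  by rewrite (@integral_EFin_Rintegral _ _ _ (cubeM R k) _ 1 mb)// => t; exact: bump_at_le1.
have f0 t : 0 <= bump_at B phi n eta (sgridpt R g) (t, w).
  rewrite mulr_ge0//; apply: prodr_ge0 => i _; rewrite theta_lt//; exact: psi_ge0.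
have -> : cubeM R k A = cubeM R k (@cube R k `&` A) by rewrite !cubeME setIA setIid.
have mA : measurable (@cube R k `&` A) by apply: measurableI; [exact: measurable_cube|exact: mS].
have -> : cubeM R k (@cube R k `&` A) = (\int[cubeM R k]_t (\1_(@cube R k `&` A) t)%:E)%E.
  by rewrite integral_indic// setIT.
apply: (@le_trans _ _ (\int[cubeM R k]_t ((expR (2 *+ n))%:E * (bump_at B phi n eta (sgridpt R g) (t, w))%:E))%E).
  apply: ge0_le_integral => //.
  - by apply/measurable_EFinP; exact: measurable_indic.
  - by apply: emeasurable_funM => //; exact/measurable_EFinP.
  move=> t _; rewrite -EFinM lee_fin indicE; case: (boolP (_ \in _)) => [|_]; last by rewrite mulr_ge0 ?expR_ge0.
  rewrite inE => -[ct At]; rewrite /bump_at /= indicE mem_set// mul1r.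
  rewrite mulrC -ler_pdivrMr ?expR_gt0// mul1r -expRN -mulNrn.
  by apply: (ball_bump (x := x) eta0) => // i; exact: Hg.
rewrite ge0_integralZl ?lee_fin ?expR_ge0//; last 2 first.
- exact/measurable_EFinP.
- by move=> t _; rewrite lee_fin.
rewrite E -EFinM lee_fin ler_wpM2l ?expR_ge0//.
by apply: (le_trans (ler_norm _)); exact: ltW.
Qed.

Lemma potentials_almost (alpha gam : R) (g : 'rV[R]_n -> \bar R) :
  0 < alpha -> n%:R - k%:R / H < alpha < n%:R -> 0 < gam < H -> is_bessel_kernel alpha g ->
  almost P (fun w => [/\ holder0 gam (B ^~ w),
    finite_continuous (potential g (occupation_measure (fun t => B t w + phi t))),
    bounded_everywhere (potential g (occupation_measure (fun t => B t w + phi t))) &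
    bounded_everywhere (potential (riesz_kernel alpha) (occupation_measure (fun t => B t w + phi t)))]).
Proof.
move=> a0 /andP[an1 an2] gH bg; have [H0 H1] := andP H01; have [g0 _] := andP gH.
have hB : almost P (fun w => holder0 gam (B ^~ w)) by exact: (@field_holder d T R P k H H01).
pose u := n%:R - alpha; have u0 : 0 < u by rewrite subr_gt0.
have un : u < n%:R by rewrite gtrBl.
have uk : u < k%:R / H by rewrite /u; move: an1; lra.
pose beta := Num.min n%:R ((u + k%:R / H) / 2).
have bn : beta <= n%:R by rewrite ge_min lexx.
have ub : u < beta by rewrite lt_min un/= midf_lt.
have bk : H * beta < k%:R.
  rewrite mulrC -ltr_pdivlMr//; apply: (@le_lt_trans _ _ ((u + k%:R / H) / 2)); first by rewrite ge_min lexx orbT.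
  by rewrite (midf_lt uk).
have e0 : 0 < (beta - u) / 2 by rewrite divr_gt0// subr_gt0.
have [|Om [mO PO HO]] := @as_frostman d T R P k n H B phi k0 H01 fB bphi beta _ bk _ e0.
  by rewrite bn (lt_trans u0 ub).
pose b := beta - (beta - u) / 2.
have ub' : u < b by rewrite /b; move: ub; lra.
have bn' : b <= n%:R by rewrite /b; move: ub bn; lra.
pose th := (u + b) / 2; have uth : u < th by rewrite /th (midf_lt ub').
have thb : th < b by rewrite /th (midf_lt ub').
have th0 : 0 <= th by rewrite ltW// (lt_trans u0 uth).
have thn : th <= n%:R by apply: (le_trans (ltW thb)).
have [K K0 HK] := bessel_kernel_bound a0 bg (introT andP (conj th0 thn)) uth.
have [intg cg _] := bg; have mg := measurable_int _ intg.
have hF := almost_and hB (ex_intro _ Om (And3 mO PO HO)).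
have [Om2 [mO2 PO2 HO2]] := hF.
exists Om2; split=> // w /HO2[hw fw].
have [M XM] := pfield_bounded (ltW g0) hw.
have b0 : 0 <= b by rewrite ltW// (lt_trans u0).
have [C C0 HC] := frostman_balls b0 XM fw.
have mX := @measurable_pfield1 d T R P k n H B phi fB bphi w.
have cM : (cubeM R k setT <= 1%:E)%E by rewrite cubeMT.
have pot (h : 'rV[R]_n -> \bar R) : measurable_fun [set: 'rV[R]_n] h ->
    potential h (occupation_measure (fun t => B t w + phi t)) = fun x : 'rV[R]_n => (\int[cubeM R k]_t h (x - Xp w t)%R)%E.
  move=> mh; apply/funext => x; rewrite /potential occupation_pfield.
  rewrite (@integral_pushforward_all _ _ _ _ _ (cubeM R k) (Xp w) (fun y => h (x - y)))//.
  by apply: (measurableT_comp mh); exact: measurable_rVB.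
have rE : riesz_kernel alpha = rker u :> ('rV[R]_n -> \bar R).
  by apply/funext => z; rewrite /riesz_kernel /rker /u opprB.
rewrite rE !pot//; last first.
  have := @measurable_rker_sub R n u 0; rewrite (_ : (fun y : 'rV[R]_n => rker u (0 - y)) = rker u)//.
  by apply/funext => z; rewrite /rker sub0r oppr_eq0 enormN.
split=> //.
- exact: (@image_potential_continuous _ _ _ (cubeM R k) n (Xp w) mX b C 1 C0 cM HC g th K th0 thb K0 cg HK).
- exact: (@image_potential_bounded _ _ _ (cubeM R k) n (Xp w) mX b C 1 C0 cM HC g th K th0 thb K0 cg HK).
have [L L0 HL] := @rker_pot_bound _ _ _ (cubeM R k) n (Xp w) mX b C 1 C0 cM HC u (ltW u0) ub'.
exists L => x; rewrite gee0_abs//; apply: integral_ge0 => t _; exact: rker_ge0.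
Qed.

End frostman.

(** * Local times *)

Section bump_lipschitz.
Context (R : realType).

Lemma psi_lip (x y : R) : `|psi x - psi y| <= 2 * `|x - y|.
Proof.
wlog xy : x y / `|x| <= `|y|.
  move=> h; have [|/ltW] := leP `|x| `|y|; first exact: h.
  by rewrite distrC (distrC x); exact: h.
have psiE (z : R) : psi z = psi `|z| by rewrite /psi real_normK ?num_real.
rewrite (psiE x) (psiE y); set a := `|x|; set b := `|y|.
have a0 : 0 <= a by exact: normr_ge0.
have ab : b - a <= `|x - y| by rewrite distrC; exact: lerB_dist.
apply: (@le_trans _ _ (2 * (b - a))); last by rewrite ler_wpM2l.
have d0 : 0 <= b - a by rewrite subr_ge0.
have psi_ba : psi b <= psi a.
  by rewrite ler_expR lerN2 ler_pM2r// lerXn2r ?nnegrE ?normr_ge0.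
rewrite ger0_norm ?subr_ge0//; have [d1|d1] := leP 1 (b - a).
  by have := psi_le1 a; have := psi_ge0 b; lra.
have E : psi b = psi a * expR (- ((b - a) * (b + a) / 2)).
  by rewrite /psi -expRD; congr expR; field.
have h1 : psi a - psi b <= psi a * ((b - a) * (b + a) / 2).
  rewrite E -{1}[psi a]mulr1 -mulrBr ler_wpM2l ?psi_ge0//.
  by have := expR_ge1Dx (- ((b - a) * (b + a) / 2)); lra.
have h2 : a * psi a <= 1.
  rewrite /psi expRN ler_pdivrMr ?expR_gt0// mul1r.
  by have := expR_ge1Dx (a ^+ 2 / 2); have := sqr_ge0 (a - 1); rewrite !expr2; lra.
apply: (le_trans h1); rewrite (_ : psi a * _ = (b - a) * (a * psi a + psi a * ((b - a) / 2))); last by field.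
rewrite mulrC ler_wpM2r//.
have : psi a * ((b - a) / 2) <= 1 * (1 / 2).
  by rewrite ler_pM ?psi_ge0 ?psi_le1 ?divr_ge0 ?(ltW d1)// ler_pM2r// ltW.
by move: h2; lra.
Qed.

Lemma theta_lip l i (x y : R) : `|theta l i x - theta l i y| <= 3 * `|x - y|.
Proof.
have h := psi_lip x y; have h2 := psi_lip (x / 2) (y / 2).
have e : `|x / 2 - y / 2| = `|x - y| / 2 by rewrite -mulrBl normrM [`|2^-1|]ger0_norm.
rewrite e in h2; have := normr_ge0 (x - y).
have [il|li|->] := ltngtP i l; [rewrite theta_lt//|rewrite theta_gt//|rewrite theta_eq /dpsi].
- by move: h; lra.
- by rewrite -mulrBr normrM [`|2^-1|]ger0_norm//; move: h2; lra.
- rewrite (_ : _ - _ - _ = (psi x - psi y) - 2^-1 * (psi (x / 2) - psi (y / 2))); last by ring.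
  move=> n0; apply: (le_trans (ler_normB _ _)); rewrite normrM [`|2^-1|]ger0_norm//.
  by move: h h2 n0; lra.
Qed.

Lemma prod_dist n (a b : 'I_n -> R) : (forall i, `|a i| <= 1) -> (forall i, `|b i| <= 1) ->
  `|\prod_i a i - \prod_i b i| <= \sum_i `|a i - b i|.
Proof.
elim: n a b => [|n IH] a b a1 b1; first by rewrite !big_ord0 subrr normr0.
rewrite !big_ord_recl; set p := \prod_(i < n) a _; set q := \prod_(i < n) b _.
rewrite (_ : _ - _ = (a ord0 - b ord0) * p + b ord0 * (p - q)); last by ring.
apply: (le_trans (ler_normD _ _)); rewrite !normrM lerD//.
  rewrite ler_piMr// normr_prod; apply: prodr_ile1 => i _; by rewrite normr_ge0 a1.
apply: le_trans (IH _ _ _ _) => //; by rewrite ler_piMl.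
Qed.

Lemma bumps_lip n l eta (c c' : 'I_n -> R) (y : 'rV[R]_n) delta : 0 < eta ->
  (forall i, `|c i - c' i| <= delta) ->
  `|bumps l eta c y - bumps l eta c' y| <= 3 * n%:R * (delta / eta).
Proof.
move=> e0 cc; apply: le_trans (prod_dist _ _) _; [by move=> i; exact: theta_le1..|].
apply: (@le_trans _ _ (\sum_(i < n) 3 * (delta / eta))); last first.
  by rewrite sumr_const card_ord -[leLHS]mulr_natr mulrAC.
apply: ler_sum => i _; apply: (le_trans (theta_lip _ _ _ _)); rewrite ler_wpM2l//.
rewrite -mulrBl normrM normfV (gtr0_norm e0) ler_pM2r ?invr_gt0//.
by rewrite (_ : _ - _ = c' i - c i) ?(distrC (c' i))//; ring.
Qed.

Lemma prod_telescope n (u : 'I_n -> R) :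
  \prod_i psi (u i) - \prod_i (2^-1 * psi (u i / 2)) = \sum_(l < n) \prod_(i < n) theta l i (u i).
Proof.
pose Q l := \prod_(i < n) (if (i < l)%N then psi (u i) else 2^-1 * psi (u i / 2)).
transitivity (Q n - Q 0%N).
  by congr (_ - _); apply: eq_bigr => i _; rewrite ?ltn_ord.
rewrite -(@telescope_sumr _ 0 n Q)// big_mkord; apply: eq_bigr => l _.
rewrite /Q (bigD1 l)//= [in X in _ - X](bigD1 l)//= ltnSn ltnn.
rewrite [RHS](bigD1 l)//= theta_eq /dpsi mulrBl; congr (_ * _ - _ * _).
  apply: eq_bigr => i il; rewrite ltnS leq_eqVlt (negbTE (_ : val i != val l))//=.
  by rewrite /theta (negbTE (_ : val i != val l)).
apply: eq_bigr => i il; by rewrite /theta (negbTE (_ : val i != val l)).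
Qed.

End bump_lipschitz.

Section locally_uniform_limit.
Context (R : realType) (n : nat) (f : nat -> 'rV[R]_n -> R).
Hypothesis cf : forall j, continuous (f j).
Variables (J : nat) (K rho : R).
Hypothesis K0 : 0 <= K.
Hypothesis rho01 : 0 < rho < 1.
Hypothesis fK : forall j (x : 'rV[R]_n), (J <= j)%N -> (forall i, `|x ord0 i| <= 2 ^+ j) ->
  `|f j.+1 x - f j x| <= K * rho ^+ j.

Let rho1 : 0 < 1 - rho. Proof. by rewrite subr_gt0; case/andP: rho01. Qed.

Let f_dist j m (x : 'rV[R]_n) : (J <= j)%N -> (forall i, `|x ord0 i| <= 2 ^+ j) ->
  `|f (j + m)%N x - f j x| <= K / (1 - rho) * rho ^+ j.
Proof.
move=> Jj xj; have /andP[r0 r1] := rho01.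
apply: (@le_trans _ _ (K / (1 - rho) * rho ^+ j * (1 - rho ^+ m))); last first.
  rewrite ler_piMr// ?gerBl ?exprn_ge0 ?(ltW r0)//.
  by rewrite mulr_ge0 ?exprn_ge0 ?(ltW r0)// divr_ge0// ltW.
elim: m => [|m IH]; first by rewrite addn0 subrr normr0 expr0 subrr mulr0.
have h : `|f (j + m).+1 x - f (j + m)%N x| <= K * rho ^+ (j + m).
  apply: fK => [|i]; first by rewrite (leq_trans Jj)// leq_addr.
  by apply: (le_trans (xj i)); apply: ler_weXn2l; rewrite ?ler1n// leq_addr.
rewrite addnS -(subrK (f (j + m)%N x) (f _.+1 x)) -addrA.
apply: (le_trans (ler_normD _ _)); apply: (le_trans (lerD h IH)).
rewrite le_eqVlt; apply/orP; left; apply/eqP; rewrite exprD exprS.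
by move: (rho ^+ j) (rho ^+ m) => a b; field; rewrite gt_eqF.
Qed.

Let big_enough (x : 'rV[R]_n) : exists j0, forall y : 'rV[R]_n, (forall i, `|y ord0 i - x ord0 i| <= 1) ->
  forall j, (j0 <= j)%N -> forall i, `|y ord0 i| <= 2 ^+ j.
Proof.
exists (Num.truncn (enorm x + 1)).+1 => y yx j jj i.
apply: (@le_trans _ _ (enorm x + 1)).
  rewrite -(subrK (x ord0 i) (y ord0 i)) addrC; apply: (le_trans (ler_normD _ _)).
  by rewrite lerD// coord_le_enorm.
apply/ltW/(lt_le_trans (truncnS_gt _)); rewrite -natrX ler_nat.
by apply: (leq_trans jj); apply: ltnW; exact: ltn_expl.
Qed.

Let tail_small e : 0 < e -> exists j0, forall j, (j0 <= j)%N -> K / (1 - rho) * rho ^+ j < e.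
Proof.
move=> e0; have [q] := small_power (K / (1 - rho) / e) rho01.
rewrite mulrAC ltr_pdivrMr// mul1r => h; exists q => j qj; apply: le_lt_trans h.
rewrite ler_wpM2l ?divr_ge0 ?(ltW rho1)//; have /andP[r0 r1] := rho01.
by apply: ler_wiXn2l; rewrite ?(ltW r0) ?(ltW r1).
Qed.

Lemma locally_uniform_limit : exists L : 'rV[R]_n -> R, [/\ continuous L,
  forall x, f j x @[j --> \oo] --> L x &
  forall j (x : 'rV[R]_n), (J <= j)%N -> (forall i, `|x ord0 i| <= 2 ^+ j) ->
    `|L x - f j x| <= K / (1 - rho) * rho ^+ j].
Proof.
have cvgf (x : 'rV[R]_n) : cvg (f j x @[j --> \oo]).
  apply/cauchy_cvgP; apply: cauchy_exP => e e0 /=.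
  have [j1 Hj1] := big_enough x; have [j2 Hj2] := tail_small e0.
  pose j := maxn J (maxn j1 j2); exists (f j x); exists j => // m /= jm.
  rewrite -(subnKC jm) /ball/= distrC.
  apply: le_lt_trans (f_dist _ _ _) _; first exact: leq_maxl.
    apply: Hj1 => [i|]; first by rewrite subrr normr0.
    by rewrite /j !leq_max leqnn !orbT.
  by apply: Hj2; rewrite /j !leq_max leqnn !orbT.
pose L (x : 'rV[R]_n) := lim (f j x @[j --> \oo]).
have Lb j (x : 'rV[R]_n) : (J <= j)%N -> (forall i, `|x ord0 i| <= 2 ^+ j) -> `|L x - f j x| <= K / (1 - rho) * rho ^+ j.
  move=> Jj xj; have h : `|f m x - f j x| @[m --> \oo] --> `|L x - f j x|.
    by apply: cvg_norm; apply: cvgB; [exact: cvgf|exact: cvg_cst].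
  apply: (cvgr_to_le h).
  by exists j => // m /= jm; rewrite -(subnKC jm); exact: f_dist.
exists L; split=> // x; apply/(@cvgrPdist_le _ _ _ _ (nbhs_filter x)) => e e0.
have e3 : 0 < e / 3 by rewrite divr_gt0.
have [j1 Hj1] := big_enough x; have [j2 Hj2] := tail_small e3.
pose j := maxn J (maxn j1 j2); have Jj : (J <= j)%N by exact: leq_maxl.
have j1j : (j1 <= j)%N by rewrite /j !leq_max leqnn !orbT.
have sm : K / (1 - rho) * rho ^+ j < e / 3 by apply: Hj2; rewrite /j !leq_max leqnn !orbT.
have c1 := (@cvgrPdist_le _ _ _ _ (nbhs_filter x) _ _).1 (@cf j x) (e / 3) e3.
have c2 : \forall y \near x, `|x - y| <= 1.
  exact: (@cvgrPdist_le _ _ _ _ (nbhs_filter x) id x).1 (fun A hA => hA) _ ltr01.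
apply: filterS2 c1 c2 => y h1 h2.
have l1 : `|L x - f j x| <= K / (1 - rho) * rho ^+ j.
  by apply: Lb => //; apply: Hj1 => // i; rewrite subrr normr0.
have l2 : `|L y - f j y| <= K / (1 - rho) * rho ^+ j.
  apply: Lb => //; apply: Hj1 => // i.
  by have := coord_le_norm (x - y) i; rewrite !mxE distrC => h; exact: le_trans h h2.
rewrite (_ : L x - L y = (L x - f j x) + (f j x - f j y) - (L y - f j y)); last by ring.
apply: (le_trans (ler_normB _ _)); apply: (le_trans (lerD (ler_normD _ _) (lexx _))).
move: l1 l2 h1 sm; move: `|L x - _| `|L y - _| `|f j x - _| (K / _ * _) => p q r s; lra.
Qed.

End locally_uniform_limit.

Section gaussian_kernel.
Context (R : realType) (n : nat).
Notation la := (@lebesgue_rV R n).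
Notation Z := (Num.sqrt (2 * pi) : R).

Let Z0 : 0 < Z. Proof. by rewrite sqrtr_gt0 mulr_gt0// pi_gt0. Qed.

Definition gker j (z : 'rV[R]_n) : R := (2 ^+ j / Z) ^+ n * heat (2 ^+ j) z.

Let c0 j : 0 < (2 ^+ j / Z) ^+ n. Proof. by rewrite exprn_gt0// divr_gt0// exprn_gt0. Qed.

Lemma gker_ge0 j z : 0 <= gker j z.
Proof. by rewrite mulr_ge0 ?heat_ge0 ?(ltW (c0 j)). Qed.

Lemma gker_le j z : `|gker j z| <= (2 ^+ j / Z) ^+ n.
Proof. by rewrite ger0_norm ?gker_ge0// ler_piMr ?heat_le1 ?(ltW (c0 j)). Qed.

Lemma continuous_gker j : continuous (gker j).
Proof.
move=> z; rewrite (_ : gker j = fun z => (2 ^+ j / Z) ^+ n * gauss ((2 ^+ j) ^+ 2 / 2) (enorm z)); last first.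
  by apply/funext => y; rewrite /gker /heat /gauss enorm_sqr; congr (_ * expR (- _)); ring.
apply: (@cvgM R _ (nbhs z) (nbhs_filter z)); first exact: (@cvg_cst _ _ _ _ (nbhs_filter z)).
apply: (@continuous_comp _ _ _ (@enorm R n) (gauss ((2 ^+ j) ^+ 2 / 2))); first exact: continuous_enorm.
exact: continuous_gauss.
Qed.

Lemma measurable_gker j : measurable_fun [set: 'rV[R]_n] (gker j).
Proof. by apply: continuous_measurable_rV; exact: continuous_gker. Qed.

Lemma heatN tau (x : 'rV[R]_n) : heat tau (- x) = heat tau x.
Proof. by rewrite /heat dotNl dotNr opprK. Qed.

Lemma gker_integral j y : (\int[la]_x (gker j (x - y))%:E = 1)%E.
Proof.
have t0 : 0 < (2 : R) ^+ j by rewrite exprn_gt0.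
transitivity (\int[la]_x (((2 ^+ j / Z) ^+ n)%:E * (heat (2 ^+ j) (y - x))%:E))%E.
  by apply: eq_integral => x _; rewrite -EFinM /gker -(opprB y x) heatN.
rewrite ge0_integralZl ?lee_fin ?(ltW (c0 j))//; last 2 first.
- by apply/measurable_EFinP; apply: measurable_heat; exact: measurable_rVB.
- by move=> x _; rewrite lee_fin heat_ge0.
rewrite heat_integral_sub// -EFinM -exprMn; congr (_%:E).
by rewrite (_ : _ * _ = 1) ?expr1n//; field; rewrite !gt_eqF.
Qed.

Lemma gker_far j delta z : 0 < delta -> delta <= enorm z ->
  gker j.+1 z <= 2 ^+ n * (8 / (3 * delta ^+ 2)) * 2^-1 ^+ j * gker j z.
Proof.
move=> d0 dz; have t0 : 0 < (2 : R) ^+ j by rewrite exprn_gt0.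
rewrite /gker heat_halfE (_ : 2 ^+ j.+1 / 2 = 2 ^+ j :> R); last by rewrite exprS mulrC mulKf.
have -> : (2 ^+ j.+1 / Z) ^+ n = 2 ^+ n * (2 ^+ j / Z) ^+ n by rewrite -exprMn exprS mulrA.
have gen (a c E h k q : R) : 0 <= a -> 0 <= c -> 0 <= h -> E <= k * q -> a * c * (E * h) <= a * k * q * (c * h).
  move=> a0 cc0 h0 Ekq; rewrite (_ : a * c * (E * h) = a * c * h * E); last by ring.
  rewrite (_ : a * k * q * (c * h) = a * c * h * (k * q)); last by ring.
  by rewrite ler_wpM2l// mulr_ge0// mulr_ge0.
apply: gen; [exact: exprn_ge0|exact: ltW|exact: heat_ge0|].
have y0 : 0 < 3 * delta ^+ 2 / 8 * 2 ^+ j by rewrite mulr_gt0// divr_gt0// mulr_gt0// exprn_gt0.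
apply: (@le_trans _ _ (expR (- (3 * delta ^+ 2 / 8 * 2 ^+ j)))).
  rewrite ler_expR lerN2 -enorm_sqr.
  have h1 : delta ^+ 2 <= enorm z ^+ 2 by rewrite lerXn2r ?nnegrE ?enorm_ge0 ?(ltW d0).
  have h2 : (2 : R) ^+ j <= (2 ^+ j.+1) ^+ 2.
    have t1 : 1 <= (2 : R) ^+ j by rewrite exprn_ege1// ler1n.
    rewrite [2 ^+ j.+1]exprS; move: t1; move: (2 ^+ j : R) => t; rewrite expr2; nra.
  have h3 : delta ^+ 2 * 2 ^+ j <= enorm z ^+ 2 * (2 ^+ j.+1) ^+ 2.
    by apply: ler_pM; rewrite ?sqr_ge0 ?(ltW t0).
  move: h3; move: (delta ^+ 2) (enorm z ^+ 2) ((2 ^+ j.+1) ^+ 2) (2 ^+ j) => a b c e h.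
  rewrite (_ : 3 * a / 8 * e = 3 / 8 * (a * e)); last by ring.
  rewrite (_ : 3 * c * b / 8 = 3 / 8 * (b * c)); last by ring.
  by rewrite ler_wpM2l.
apply: (le_trans (expR_neg_le 1 y0)); rewrite expr1 le_eqVlt exprVn; apply/orP; left; apply/eqP.
by field; rewrite !gt_eqF ?exprn_gt0.
Qed.

Definition gmasses j (A : set 'rV[R]_n) (y : 'rV[R]_n) : \bar R :=
  (\int[la]_x (\1_A x * gker j (x - y))%R%:E)%E.

Let F0 j A x y : 0 <= \1_A x * gker j (x - y).
Proof. by rewrite mulr_ge0 ?gker_ge0. Qed.

Let mF j (A : set 'rV[R]_n) y : measurable A -> measurable_fun [set: 'rV[R]_n] (fun x => (\1_A x * gker j (x - y))%:E).
Proof.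
move=> mA; apply/measurable_EFinP; apply: measurable_funM; first exact: measurable_indic.
by apply: (measurableT_comp (measurable_gker j)); exact: measurable_rVB.
Qed.

Lemma gmasses_ge0 j A y : (0 <= gmasses j A y)%E.
Proof. by apply: integral_ge0 => x _; rewrite lee_fin. Qed.

Lemma gmasses_le1 j A y : measurable A -> (gmasses j A y <= 1)%E.
Proof.
move=> mA; rewrite -(gker_integral j y); apply: ge0_le_integral => //.
- by move=> x _; rewrite lee_fin F0.
- exact: (@mF j A y mA).
- apply/measurable_EFinP; apply: (measurableT_comp (measurable_gker j)); exact: measurable_rVB.
- by move=> x _; rewrite lee_fin ler_piMl ?gker_ge0// indicE; case: (_ \in _).
Qed.

Lemma gmasses_cvg (U : set 'rV[R]_n) y : open U -> U y -> gmasses j.+1 U y @[j --> \oo] --> 1%E.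
Proof.
move=> oU Uy; have [e /= e0 He] := (@nbhs_normP _ _ y _).1 (open_nbhs_nbhs (conj oU Uy)).
have mU := open_measurable_rV oU.
pose C : R := 2 ^+ n * (8 / (3 * e ^+ 2)).
have C0 : 0 <= C by rewrite mulr_ge0 ?exprn_ge0// divr_ge0// mulr_ge0// sqr_ge0.
have mUc : measurable (~` U) by exact: measurableC.
have lower j : ((1 - C * 2^-1 ^+ j)%:E <= gmasses j.+1 U y)%E.
  rewrite EFinB leeBlDr//.
  apply: (@le_trans _ _ (gmasses j.+1 U y + gmasses j.+1 (~` U) y)%E).
    rewrite /gmasses -ge0_integralD//; last 4 first.
    - by move=> x _; rewrite lee_fin F0.
    - exact: (@mF j.+1 U y mU).
    - by move=> x _; rewrite lee_fin F0.
    - exact: (@mF j.+1 (~` U) y mUc).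
    rewrite -(gker_integral j.+1 y) le_eqVlt; apply/orP; left; apply/eqP; apply: eq_integral => x _.
    rewrite -EFinD -mulrDl !indicE in_setC; by case: (_ \in _); rewrite ?addr0 ?add0r mul1r.
  rewrite leeD2l//; apply: (@le_trans _ _ (\int[la]_x ((C * 2^-1 ^+ j)%:E * (gker j (x - y))%:E))%E).
    apply: ge0_le_integral => //.
    - by move=> x _; rewrite lee_fin F0.
    - exact: (@mF j.+1 (~` U) y mUc).
    - apply: emeasurable_funM => //; apply/measurable_EFinP; apply: (measurableT_comp (measurable_gker j)); exact: measurable_rVB.
    move=> x _; rewrite -EFinM lee_fin indicE; case: (boolP (x \in _)) => [|_]; last first.
      by rewrite mul0r mulr_ge0 ?gker_ge0// mulr_ge0// exprn_ge0.
    rewrite inE mul1r => nU; apply: gker_far => //; rewrite leNgt; apply/negP => xe; apply: nU.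
    by apply: He; rewrite /= -opprB normrN (le_lt_trans (norm_le_enorm _)).
  rewrite ge0_integralZl//; first by rewrite gker_integral mule1.
  - apply/measurable_EFinP; apply: (measurableT_comp (measurable_gker j)); exact: measurable_rVB.
  - by move=> x _; rewrite lee_fin gker_ge0.
  - by rewrite lee_fin mulr_ge0// exprn_ge0.
apply: (@squeeze_cvge _ _ _ _ (fun j => (1 - C * 2^-1 ^+ j)%:E) _ (fun=> 1%E)).
- by apply: nearW => j; rewrite lower gmasses_le1.
- have h : (C * 2^-1 ^+ j) @[j --> \oo] --> (0 : R).
    rewrite -(mulr0 C); apply: cvgMr; apply: cvg_expr.
    by rewrite ger0_norm// invf_lt1// ltr1n.
  have h1 : (1 - C * 2^-1 ^+ j) @[j --> \oo] --> (1 - 0 : R) by apply: cvgB => //; exact: cvg_cst.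
  by rewrite subr0 in h1; apply: cvg_EFin => //; exact: nearW.
- exact: cvg_cst.
Qed.

Section smoothing.
Context d (T : measurableType d) (nu : {finite_measure set T -> \bar R}) (Y : T -> 'rV[R]_n).
Hypothesis mY : measurable_fun [set: T] Y.

Definition smooth j (x : 'rV[R]_n) : R := \int[nu]_t gker j (x - Y t).

Lemma continuous_smooth j : continuous (smooth j).
Proof. by apply: (continuous_Rintegral mY); [exact: continuous_gker|exact: gker_le]. Qed.

Lemma smooth_ge0 j x : 0 <= smooth j x.
Proof. by apply: Rintegral_ge0 => t _; exact: gker_ge0. Qed.

Let mF2 j (A : set 'rV[R]_n) : measurable A ->
  measurable_fun [set: 'rV[R]_n * T] (fun z : 'rV[R]_n * T => (\1_A z.1 * gker j (z.1 - Y z.2))%:E).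
Proof.
move=> mA; apply/measurable_EFinP; apply: measurable_funM.
  by apply: (measurableT_comp _ measurable_fst); exact: measurable_indic.
apply: (measurableT_comp (measurable_gker j)); apply: measurable_rVB => //.
exact: (measurableT_comp mY measurable_snd).
Qed.

Lemma smooth_mass j (A : set 'rV[R]_n) : measurable A ->
  (\int[la]_(x in A) (smooth j x)%:E = \int[nu]_t gmasses j A (Y t))%E.
Proof.
move=> mA; rewrite integral_mkcond.
pose F (z : 'rV[R]_n * T) : \bar R := (\1_A z.1 * gker j (z.1 - Y z.2))%:E.
transitivity (\int[la]_x \int[nu]_t F (x, t))%E; last first.
  by rewrite (@fubini_tonelli _ _ _ _ _ la nu F (@mF2 j A mA)) // => z; rewrite lee_fin F0.
apply: eq_integral => x _; rewrite patchE /F /= indicE; case: ifP => _.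
  under eq_integral do rewrite mul1r.
  rewrite (integral_EFin_Rintegral nu (M := (2 ^+ j / Z) ^+ n))// => [|t].
    by apply: (measurableT_comp (measurable_gker j)); exact: measurable_rVB.
  exact: gker_le.
by under eq_integral do rewrite mul0r; rewrite integral0.
Qed.

Lemma measurable_mass j (A : set 'rV[R]_n) : measurable A ->
  measurable_fun [set: T] (fun t => gmasses j A (Y t)).
Proof.
move=> mA; apply: (measurable_fun_fubini_tonelli_G (m1 := la) _ (@mF2 j A mA)) => z.
by rewrite lee_fin F0.
Qed.

Lemma smooth_total j : (\int[la]_x (smooth j x)%:E = nu setT)%E.
Proof.
rewrite smooth_mass//; under eq_integral => t _.
  rewrite (_ : gmasses j setT (Y t) = 1%E); first over.
  rewrite -(gker_integral j (Y t)); apply: eq_integral => x _.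
  by rewrite indicT mul1r.
by rewrite integral_cst// mul1e.
Qed.

Section local_time.
Variables (L : 'rV[R]_n -> R) (J : nat) (C rho : R).
Hypothesis cL : continuous L.
Hypothesis C0 : 0 <= C.
Hypothesis rho01 : 0 < rho < 1.
Hypothesis smL : forall x : 'rV[R]_n, smooth j x @[j --> \oo] --> L x.
Hypothesis smC : forall j (x : 'rV[R]_n), (J <= j)%N -> (forall i, `|x ord0 i| <= 2 ^+ j) ->
    `|L x - smooth j x| <= C * rho ^+ j.

Lemma limit_ge0 (x : 'rV[R]_n) : 0 <= L x.
Proof. 
have h := @smL x; rewrite -(cvg_lim _ h)//; apply: limr_ge; first by apply/cvg_ex; exists (L x).
by apply: nearW => j; exact: smooth_ge0. Qed.

Let mL : measurable_fun [set: 'rV[R]_n] L. Proof. exact: continuous_measurable_rV. Qed.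

Let total_le : (\int[la]_x (L x)%:E <= nu setT)%E.
Proof.
have := @fatou _ _ _ la setT measurableT (fun j x => (smooth j x)%:E) _ _.
have lx (x : 'rV[R]_n) : (limn_einf (fun j => (smooth j x)%:E) = (L x)%:E)%E.
  have h : (smooth j x)%:E @[j --> \oo] --> (L x)%:E by apply: cvg_EFin; [exact: nearW|exact: smL].
  exact: (cvg_limn_einf_sup h).1.
under eq_integral do rewrite lx.
under [X in limn_einf X]eq_fun do rewrite smooth_total.
have h : (nu setT : \bar R) @[j --> \oo] --> nu setT by exact: cvg_cst.
rewrite (cvg_limn_einf_sup h).1; apply.
- move=> j; apply/measurable_EFinP; apply: continuous_measurable_rV; exact: continuous_smooth.
- by move=> j x _; rewrite lee_fin smooth_ge0.
Qed.

Lemma integrable_limit : la.-integrable [set: 'rV[R]_n] (EFin \o L).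
Proof.
apply/integrableP; split; first exact/measurable_EFinP.
apply: (@le_lt_trans _ _ (\int[la]_x (L x)%:E)%E).
  by rewrite le_eqVlt; apply/orP; left; apply/eqP; apply: eq_integral => x _ /=; rewrite ger0_norm ?limit_ge0.
apply: (le_lt_trans total_le); rewrite -ge0_fin_numE//; exact: fin_num_measure.
Qed.

Let lam := @dens _ _ R la L limit_ge0 integrable_limit.
Let mu : {measure set 'rV[R]_n -> \bar R} :=
  measure_function_pushforward__canonical__measure_function_Measure nu mY.

Let open_bounded (U : set 'rV[R]_n) m : open U -> (forall x, U x -> forall i, `|x ord0 i| <= 2 ^+ m) ->
  (mu U <= lam U)%E.
Proof.
move=> oU Um; have mU := open_measurable_rV oU.
have mUY : measurable (Y @^-1` U) by rewrite -[S in measurable S]setTI; exact: mY.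
pose V : R := \prod_(i < n) (2 ^+ m - - 2 ^+ m).
have V0 : 0 <= V by apply: prodr_ge0 => i _; rewrite opprK addr_ge0// exprn_ge0.
have UV : (la U <= V%:E)%E.
  rewrite /V -(lebesgue_rV_box (a := fun=> - 2 ^+ m) (b := fun=> 2 ^+ m)); last first.
    by move=> i; rewrite -subr_ge0 opprK addr_ge0// exprn_ge0.
  apply: le_measure; rewrite ?inE//; first exact: measurable_box.
  by move=> x Ux i; rewrite -ler_norml; exact: Um.
have cv : (\int[nu]_t ((\1_U (Y t))%:E * gmasses j.+1 U (Y t)))%E @[j --> \oo] --> (\int[nu]_t (\1_U (Y t))%:E)%E.
  apply: (@dominated_cvg _ _ _ nu setT measurableT (fun j t => ((\1_U (Y t))%:E * gmasses j.+1 U (Y t))%E) _ (cst 1%E)).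
  - move=> j; apply: emeasurable_funM; last exact: measurable_mass.
    by apply/measurable_EFinP; apply: (measurableT_comp _ mY); exact: measurable_indic.
  - move=> t _; rewrite indicE; case: (boolP (Y t \in U)) => [|_]; last first.
      by under eq_fun do rewrite mul0e; exact: cvg_cst.
    rewrite inE => UY; under eq_fun do rewrite mul1e; exact: gmasses_cvg.
  - by [].
  - by apply: (@bounded_integrable _ _ _ nu (cst 1) 1) => // t; rewrite /= normr1.
  - move=> j t _; rewrite gee0_abs; last by rewrite mule_ge0 ?gmasses_ge0// lee_fin.
    rewrite indicE; case: (_ \in _); first by rewrite mul1e gmasses_le1.
    by rewrite mul0e.
have -> : mu U = (\int[nu]_t (\1_U (Y t))%:E)%E.
  rewrite (_ : (fun t => _) = (fun t => (\1_(Y @^-1` U) t)%:E)); last by apply/funext => t; rewrite !indicE.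
  by rewrite integral_indic// setIT.
apply/lee_addgt0Pr => e e0.
have [q Hq] := small_power (C * V / e) rho01.
apply: (cvge_le _ cv); exists (maxn q (maxn J m)) => // j /= jq.
have [jJ jm qj] : [/\ (J <= j.+1)%N, (m <= j.+1)%N & (q <= j.+1)%N].
  by move: jq; rewrite !geq_max => /and3P[h1 h2 h3]; split; apply: leqW.
apply: (@le_trans _ _ (\int[nu]_t gmasses j.+1 U (Y t))%E).
  apply: ge0_le_integral => //.
  - by move=> t _; rewrite mule_ge0 ?gmasses_ge0// lee_fin.
  - apply: emeasurable_funM; last exact: measurable_mass.
    by apply/measurable_EFinP; apply: (measurableT_comp _ mY); exact: measurable_indic.
  - exact: measurable_mass.
  - move=> t _; rewrite indicE; case: (_ \in _); first by rewrite mul1e.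
    by rewrite mul0e gmasses_ge0.
rewrite -smooth_mass//.
have Cr0 : 0 <= C * rho ^+ j.+1 by rewrite mulr_ge0// exprn_ge0// ltW//; case/andP: rho01.
apply: (@le_trans _ _ (\int[la]_(x in U) ((L x)%:E + (C * rho ^+ j.+1)%:E))%E).
  apply: ge0_le_integral => //.
  - by move=> x _; rewrite lee_fin smooth_ge0.
  - apply: measurable_funTS; apply/measurable_EFinP; apply: continuous_measurable_rV; exact: continuous_smooth.
  - by apply: measurable_funTS; apply: emeasurable_funD => //; exact/measurable_EFinP.
  move=> x Ux; rewrite -EFinD lee_fin.
  have := smC jJ (fun i => le_trans (Um x Ux i) (ler_weXn2l (ler1n R 2) jm)).
  by rewrite ler_norml => /andP[h _]; move: h; lra.
rewrite ge0_integralD//; last 2 first.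
- by move=> x _; rewrite lee_fin limit_ge0.
- by apply: measurable_funTS; exact/measurable_EFinP.
rewrite leeD2l// integral_cst//; apply: (@le_trans _ _ ((C * rho ^+ j.+1)%:E * V%:E)%E).
  by rewrite lee_wpmul2l.
rewrite -EFinM lee_fin; move: Hq; rewrite mulrAC ltr_pdivrMr// mul1r => Hq.
apply: le_trans (ltW Hq); rewrite mulrAC ler_wpM2l ?mulr_ge0//.
by have /andP[r0 r1] := rho01; apply: ler_wiXn2l; rewrite ?(ltW r0) ?(ltW r1).
Qed.

Let open_le (U : set 'rV[R]_n) : open U -> (mu U <= lam U)%E.
Proof.
move=> oU; pose V m := U `&` [set x : 'rV[R]_n | enorm x < 2 ^+ m].
have oV m : open (V m).
  apply: openI => //; apply: (@open_comp _ _ (@enorm R n) [set r | r < 2 ^+ m]); last exact: open_lt.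
  by move=> x _; exact: continuous_enorm.
have Vm m x : V m x -> forall i, `|x ord0 i| <= 2 ^+ m.
  by move=> [_ xm] i; apply: (le_trans (coord_le_enorm x i)); exact: ltW.
have UE : \bigcup_m V m = U.
  apply/seteqP; split=> [x [m _ []]//|x Ux]; exists (Num.truncn (enorm x)).+1 => //; split=> //=.
  apply: (lt_le_trans (truncnS_gt _)); rewrite -natrX ler_nat; apply: ltnW; exact: ltn_expl.
have h : (mu \o V) m @[m --> \oo] --> mu U.
  rewrite -[in X in _ --> X]UE; apply: nondecreasing_cvg_mu.
  - by move=> m; exact: open_measurable_rV.
  - by rewrite UE; exact: open_measurable_rV.
  move=> m p mp; apply/subsetPset => x [Ux xm]; split=> //=; apply: (lt_le_trans xm).
  by apply: ler_weXn2l; rewrite ?ler1n.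
apply: (cvge_le _ h); apply: nearW => m /=; apply: (le_trans (@open_bounded (V m) m (oV m) (@Vm m))).
apply: le_measure; rewrite ?inE; [exact: open_measurable_rV|exact: open_measurable_rV|].
by move=> x [].
Qed.

(* A closed set is the intersection of its open neighbourhoods. *)
Let closed_le (F : set 'rV[R]_n) : closed F -> (mu F <= lam F)%E.
Proof.
move=> clF; pose O m := \bigcup_(x in F) [set y : 'rV[R]_n | enorm (x - y) < 2^-1 ^+ m].
have oO m : open (O m).
  apply: bigcup_open => x _.
  apply: (@open_comp _ _ (fun y : 'rV[R]_n => enorm (x - y)) [set r : R | r < 2^-1 ^+ m]); last exact: open_lt.
  move=> y _; apply: (@continuous_comp _ _ _ (fun y : 'rV[R]_n => x - y) (@enorm R n)); last exact: continuous_enorm.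
  have c : continuous (fun z : 'rV[R]_n => x - z) by move=> z; apply: (@continuousB R 'rV[R]_n 'rV[R]_n (cst x) id z); [exact: cst_continuous|].
  exact: c.
have FE : \bigcap_m O m = F.
  apply/seteqP; split=> [y Oy|y Fy m _]; last by exists y => //=; rewrite subrr enorm0 dy_gt0.
  apply: clF => S /(@nbhs_normP _ _ y _)[e /= e0 He].
  have t01 : 0 < (2^-1 : R) < 1 by rewrite invr_gt0 invf_lt1 ?ltr1n// ltr0n.
  have [q] := small_power e^-1 t01; rewrite mulrC ltr_pdivrMr// mul1r => h.
  have [x Fx /= xy] := Oy q I; exists x; split=> //; apply: He => /=.
  by rewrite -opprB normrN (le_lt_trans (norm_le_enorm _))// (lt_trans xy).
have mF' : measurable F by rewrite -FE; apply: bigcap_measurable => // m _; exact: open_measurable_rV.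
have decr : {homo O : m p / (m <= p)%N >-> (p <= m)%O}.
  move=> m p mp; apply/subsetPset => y [x Fx /= xy]; exists x => //=; apply: (lt_le_trans xy).
  by apply: ler_wiXn2l; rewrite ?invr_ge0 ?invf_le1 ?ler1n.
have h : (lam \o O) m @[m --> \oo] --> lam F.
  rewrite -[in X in _ --> X]FE; apply: nonincreasing_cvg_mu => //.
  - by rewrite -ge0_fin_numE//; apply: fin_num_measure; exact: open_measurable_rV.
  - by move=> m; exact: open_measurable_rV.
  - by rewrite FE.
apply: (cvge_ge _ h); apply: nearW => m /=; apply: (le_trans _ (open_le (oO m))).
apply: le_measure; rewrite ?inE//; first exact: open_measurable_rV.
by move=> x Fx; exists x => //=; rewrite subrr enorm0 dy_gt0.
Qed.

Lemma pushforward_density (A : set 'rV[R]_n) : measurable A ->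
  pushforward nu Y A = (\int[la]_(x in A) (L x)%:E)%E.
Proof.
have totE : mu setT = lam setT.
  by apply/eqP; rewrite eq_le open_le ?total_le//; exact: openT.
have muf (S : set 'rV[R]_n) : measurable S -> mu S \is a fin_num.
  by move=> mS; apply: fin_num_measure; rewrite -[B in measurable B]setTI; exact: mY.
have lamf (S : set 'rV[R]_n) : measurable S -> lam S \is a fin_num by move=> mS; exact: fin_num_measure.
have gen (a a' b b' : \bar R) : a \is a fin_num -> a' \is a fin_num -> b \is a fin_num -> b' \is a fin_num ->
    (a + a' = b + b' -> a' <= b' -> b <= a)%E.
  move: a a' b b' => [a| |] [a'| |] [b| |] [b'| |] // _ _ _ _; rewrite -!EFinD => -[] h; rewrite !lee_fin; lra.
move=> mA; apply: (@measure_unique _ _ _ (@open 'rV[R]_n) (fun=> setT) _ _ _ _ mu lam) => //.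
- by move=> U V; exact: openI.
- by move=> _; exact: openT.
- by rewrite bigcup_const//; exists 0%N.
- move=> U oU; apply/eqP; rewrite eq_le; apply/andP; split; first exact: open_le.
  have mU := open_measurable_rV oU; have mUc := measurableC mU.
  have c := closed_le (open_closedC oU).
  have e1 : (mu U + mu (~` U) = mu setT)%E by rewrite -measureU ?setUCr ?setICr.
  have e2 : (lam U + lam (~` U) = lam setT)%E by rewrite -measureU ?setUCr ?setICr.
  rewrite -totE -e1 in e2; exact: (gen _ _ _ _ (muf _ mU) (muf _ mUc) (lamf _ mU) (lamf _ mUc) (esym e2) c).
- by move=> _; rewrite -ge0_fin_numE//; exact: muf.
Qed.

End local_time.
End smoothing.
End gaussian_kernel.

Section smooth_increments.
Context (R : realType) (n : nat) d (T : measurableType d) (nu : {finite_measure set T -> \bar R}).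
Variable Y : T -> 'rV[R]_n.
Hypothesis mY : measurable_fun [set: T] Y.
Notation Z := (Num.sqrt (2 * pi) : R).
Local Notation crd x := (fun i => (x : 'rV[R]_n) ord0 i).

Lemma gker_increment j (x y : 'rV[R]_n) : gker j.+1 (x - y) - gker j (x - y) =
  (2 ^+ j.+1 / Z) ^+ n * \sum_(l < n) bumps l (2^-1 ^+ j.+1) (crd x) y.
Proof.
have E m : heat (2 ^+ m) (x - y) = \prod_(i < n) psi (2 ^+ m * (y ord0 i - x ord0 i)).
  by rewrite -(opprB y x) heatN -heat_prod; apply: eq_bigr => i _; rewrite !mxE.
have t0 m : (2 : R) ^+ m != 0 by rewrite expf_neq0.
have := prod_telescope (fun i => (y ord0 i - x ord0 i) / 2^-1 ^+ j.+1) => <-.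
rewrite /gker mulrBr !E; congr (_ * _ - _).
  by apply: eq_bigr => i _; rewrite exprVn invrK mulrC.
rewrite big_split/= prodr_const card_ord mulrA -exprMn; congr (_ ^+ _ * _).
  by rewrite exprS; field; rewrite gt_eqF// sqrtr_gt0 mulr_gt0// pi_gt0.
by apply: eq_bigr => i _; rewrite exprVn invrK exprS; congr psi; field.
Qed.

Let mb l eta (c : 'I_n -> R) : measurable_fun [set: T] (fun t => bumps l eta c (Y t)).
Proof. exact: (measurableT_comp (measurable_bumps _ _ _) mY). Qed.

Lemma smooth_increment eps J : 0 < eps ->
  (forall j, (J <= j)%N -> forall (l : 'I_n) (g : sgrid n n.+2 j),
    `|\int[nu]_t bumps l (2^-1 ^+ j) (crd (sgridpt R g)) (Y t)| <= (2^-1 ^+ j) `^ (n%:R + eps)) ->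
  exists K rho, [/\ 0 <= K, 0 < rho < 1 &
   forall j (x : 'rV[R]_n), (J <= j)%N -> (forall i, `|x ord0 i| <= 2 ^+ j) ->
    `|smooth nu Y j.+1 x - smooth nu Y j x| <= K * rho ^+ j].
Proof.
move=> eps0 HJ; pose M := fine (nu setT); have M0 : 0 <= M by exact: fine_ge0.
pose rho : R := Num.max (2^-1 `^ eps) 2^-1.
have rho0 : 0 < rho by rewrite lt_max powR_gt0.
have rho1 : rho < 1.
  rewrite gt_max invf_lt1 ?ltr1n// andbT -[ltRHS](pow1R eps).
  by apply: gt0_ltr_powR; rewrite ?nnegrE// invf_lt1 ?ltr1n.
exists (n%:R * (1 + 3 * n%:R * M)), rho; split; rewrite ?rho0//.
  by rewrite mulr_ge0// addr_ge0// mulr_ge0.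
move=> j x Jj xj; set eta : R := 2^-1 ^+ j.+1; have eta0 : 0 < eta by exact: dy_gt0.
have [g Hg] : exists g : sgrid n n.+2 j.+1, forall i, `|sgridpt R g ord0 i - x ord0 i| <= 2^-1 ^+ (j.+1 * n.+2).
  by apply: sgrid_near => i; apply: (le_trans (xj i)); apply: ler_weXn2l; rewrite ?ler1n.
have bI l (c : 'I_n -> R) := bounded_integrable nu (mb l eta c) (fun t => bumps_le1 l eta c (Y t)).
have D (l : 'I_n) : `|\int[nu]_t bumps l eta (crd x) (Y t)| <= eta `^ (n%:R + eps) + 3 * n%:R * M * eta ^+ n.+1.
  rewrite -(subrK (\int[nu]_t bumps l eta (crd (sgridpt R g)) (Y t)) (\int[nu]_t bumps l eta (crd x) (Y t))) addrC.
  apply: (le_trans (ler_normD _ _)); rewrite lerD//; first by apply: HJ; exact: leqW.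
  rewrite -RintegralB//.
  apply: (@le_trans _ _ (3 * n%:R * eta ^+ n.+1 * M)); last by rewrite mulrAC.
  apply: normr_Rintegral_le => [|t]; first exact: measurable_funB.
  rewrite (_ : eta ^+ n.+1 = 2^-1 ^+ (j.+1 * n.+2) / eta); last by rewrite exprM -/eta [eta ^+ n.+2]exprSr mulfK// gt_eqF.
  by apply: bumps_lip => // i; rewrite distrC; exact: Hg.
have kb m : nu.-integrable [set: T] (EFin \o (fun t => gker m (x - Y t))).
  apply: (@bounded_integrable _ _ _ nu _ ((2 ^+ m / Z) ^+ n)) => [|t]; last exact: gker_le.
  by apply: (measurable_shifted mY); exact: measurable_gker.
rewrite /smooth -RintegralB//.
set c := (2 ^+ j.+1 / Z) ^+ n.
have -> : \int[nu]_t (gker j.+1 (x - Y t) - gker j (x - Y t)) =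
    c * \sum_(l < n) \int[nu]_t bumps l eta (crd x) (Y t).
  rewrite -(@Rintegral_sum_seq _ _ _ nu _ (index_enum 'I_n) (fun l t => bumps (l : 'I_n) eta (crd x) (Y t))); last by move=> l; exact: bI.
  rewrite -RintegralZl//; first by apply: eq_Rintegral => t _; exact: gker_increment.
  apply: integrable_sum_seq => l; exact: bI.
have s1 : 1 <= Z.
  rewrite -[leLHS]sqrtr1; apply: ler_wsqrtr.
  by have := pi_ge2 R; move: (pi : R) => p; lra.
have c0 : 0 <= c by rewrite exprn_ge0// divr_ge0 ?exprn_ge0// sqrtr_ge0.
have cle : c <= eta ^- n.
  have -> : eta ^- n = (2 ^+ j.+1) ^+ n by rewrite -exprVn /eta -exprVn invrK.
  rewrite /c; apply: lerXn2r; rewrite ?nnegrE ?divr_ge0 ?exprn_ge0 ?sqrtr_ge0//.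
  by rewrite ler_pdivrMr ?(lt_le_trans _ s1)// ler_peMr ?exprn_ge0.
rewrite normrM (ger0_norm c0).
apply: (@le_trans _ _ (eta ^- n * (n%:R * (eta `^ (n%:R + eps) + 3 * n%:R * M * eta ^+ n.+1)))).
  apply: ler_pM => //; apply: (le_trans (ler_norm_sum _ _ _)).
  apply: (@le_trans _ _ (\sum_(l < n) (eta `^ (n%:R + eps) + 3 * n%:R * M * eta ^+ n.+1))).
    by apply: ler_sum => l _; exact: D.
  by rewrite sumr_const card_ord -[leLHS]mulr_natl.
have en0 : eta ^+ n != 0 by rewrite expf_neq0// gt_eqF.
rewrite powRD; last by rewrite (gt_eqF eta0) implybT.
rewrite powR_mulrn ?(ltW eta0)// (_ : eta ^- n * _ = n%:R * (eta `^ eps + 3 * n%:R * M * eta)); last first.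
  rewrite exprSr; move: (eta ^+ n) (eta `^ eps) en0 => a b a0; by field.
rewrite -(mulrA n%:R _ (rho ^+ j)) ler_wpM2l//.
have r1 : eta `^ eps <= rho ^+ j.
  rewrite /eta dy_powR; apply: (@le_trans _ _ (rho ^+ j.+1)).
    by apply: lerXn2r; rewrite ?nnegrE ?powR_ge0 ?(ltW rho0)// le_max lexx.
  by rewrite exprS ler_piMl ?exprn_ge0 ?(ltW rho0) ?(ltW rho1).
have r2 : eta <= rho ^+ j.
  rewrite /eta; apply: (@le_trans _ _ (rho ^+ j.+1)).
    by apply: lerXn2r; rewrite ?nnegrE ?invr_ge0 ?(ltW rho0)// le_max lexx orbT.
  by rewrite exprS ler_piMl ?exprn_ge0 ?(ltW rho0) ?(ltW rho1).
by rewrite (mulrDl 1 _ (rho ^+ j)) mul1r lerD// ler_wpM2l// !mulr_ge0.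
Qed.

End smooth_increments.

Section local_time.
Context d (T : measurableType d) (R : realType) (P : probability T R) (k n : nat) (H : R).
Context (B : 'rV[R]_k -> T -> 'rV[R]_n) (phi : 'rV[R]_k -> 'rV[R]_n).
Hypothesis k0 : (0 < k)%N.
Hypothesis H01 : 0 < H < 1.
Hypothesis fB : fbm_field P H B.
Hypothesis bphi : bounded_borel phi.

Lemma Rintegral_cubeM (f : 'rV[R]_k -> R) : measurable_fun [set: 'rV[R]_k] f ->
  \int[cubeM R k]_t (\1_(@cube R k) t * f t) = \int[cubeM R k]_t f t.
Proof.
move=> mf; rewrite /Rintegral; congr fine; apply: ae_eq_integral => //.
- apply/measurable_EFinP; apply: measurable_funM => //; apply: measurable_indic; exact: measurable_cube.
- exact/measurable_EFinP.
exists (~` @cube R k); split; first by apply: measurableC; exact: measurable_cube.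
  by have := @cubeME R k (~` @cube R k); rewrite setICr measure0.
move=> t /= nt ct; apply: nt => _; by rewrite indicE mem_set// mul1r.
Qed.

Lemma local_time_almost (gam : R) : n%:R < k%:R / H -> 0 < gam < H ->
  almost P (fun w => holder0 gam (B ^~ w) /\ exists L : 'rV[R]_n -> R,
    is_local_time (fun t => B t w + phi t) L /\ continuous L).
Proof.
move=> nk gH; have [H0 H1] := andP H01.
have hB : almost P (fun w => holder0 gam (B ^~ w)) by exact: (@field_holder d T R P k H H01).
have Hnk : H * n%:R < k%:R by rewrite mulrC -ltr_pdivlMr.
have [eps eps0 hI] := @as_increment d T R P k n H B phi k0 H01 fB bphi Hnk.
have [Om [mO PO HO]] := almost_and hB hI.
exists Om; split=> // w /HO[hw [J HJ]]; split=> //.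
have mX := @measurable_pfield1 d T R P k n H B phi fB bphi w.
have [|K [rho [K0 rho01 HK]]] := @smooth_increment R n _ _ (cubeM R k) _ mX eps J eps0.
  move=> j Jj l g; rewrite -Rintegral_cubeM; first by apply/ltW; exact: HJ.
  exact: (measurableT_comp (measurable_bumps _ _ _) mX).
have [L [cL smL smC]] := locally_uniform_limit (@continuous_smooth R n _ _ (cubeM R k) _ mX) K0 rho01 HK.
have /andP[r0 r1] := rho01.
have C0 : 0 <= K / (1 - rho) by rewrite divr_ge0// subr_ge0 ltW.
have dL := pushforward_density mX cL C0 rho01 smL smC.
exists L; split=> //; split.
- apply/null_content_dominatesP => A mA A0; rewrite occupation_pfield [LHS](dL A mA).
  by apply: null_set_integral => //; apply/measurable_EFinP; apply: measurable_funTS; exact: continuous_measurable_rV.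
- exact: continuous_measurable_rV.
- exact: limit_ge0 smL.
- by move=> A mA; rewrite occupation_pfield; exact: dL.
Qed.

End local_time.

Theorem lemma5p10 (R : realType) (d : measure_display) (T : measurableType d)
    (P : probability T R) (k n : nat) (H : R)
    (B : 'rV[R]_k -> T -> 'rV[R]_n) (phi : 'rV[R]_k -> 'rV[R]_n) :
  (1 <= k)%N -> (1 <= n)%N -> 0 < H < 1 ->
  fbm_field P H B -> bounded_borel phi ->
  (forall (alpha gamma : R) (g : 'rV[R]_n -> \bar R),
    0 < alpha -> n%:R - k%:R / H < alpha < n%:R -> 0 < gamma < H ->
    is_bessel_kernel alpha g ->
    exists Omega1 : set T, [/\ measurable Omega1, P Omega1 = 1%E,
      forall w, Omega1 w ->
        holder0 gamma (B ^~ w) /\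
        finite_continuous
          (potential g (occupation_measure (fun t => B t w + phi t))) &
      forall w, Omega1 w ->
        bounded_everywhere
          (potential g (occupation_measure (fun t => B t w + phi t))) /\
        bounded_everywhere
          (potential (riesz_kernel alpha)
            (occupation_measure (fun t => B t w + phi t)))]) /\
  (n%:R < k%:R / H ->
    forall gamma : R, 0 < gamma < H ->
    exists Omega1 : set T, [/\ measurable Omega1, P Omega1 = 1%E &
      forall w, Omega1 w ->
        holder0 gamma (B ^~ w) /\
        exists L : 'rV[R]_n -> R,
          [/\ is_local_time (fun t => B t w + phi t) L, continuous L &
              forall x : 'rV[R]_n, exists M : R, \forall y \near x, `|L y| <= M]]).
Proof.
move=> k0 _ H01 fB bphi; split=> [alpha gam g a0 an gH bg|nk gam gH].
  have [Om [mO PO HO]] := potentials_almost k0 H01 fB bphi a0 an gH bg.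
  by exists Om; split=> // w /HO[].
have [Om [mO PO HO]] := local_time_almost k0 H01 fB bphi nk gH.
exists Om; split=> // w /HO[hw [L [lL cL]]]; split=> //; exists L; split=> // x.
exists (`|L x| + 1).
have := (@cvgrPdist_le _ _ _ _ (nbhs_filter x) _ _).1 (cL x) 1 ltr01.
apply: filterS => y h; rewrite -(subrK (L x) (L y)) addrC.
by apply: (le_trans (ler_normD _ _)); rewrite lerD2l distrC.
Qed.
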